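(* Let $A^*,B^*,d^*,D^*,U^*,u^*$ be the unique real numbers such that the function $g=g_{A^*,B^*}$ has a local minimum at a point $x_1<a$ and a local maximum at a point $x_2>a$ with $d^*<x_1<D^*<U^*<x_2<u^*$, and $$\int_{d^*}^{D^*}[g(x)+k]\,dx=-K,\quad \int_{U^*}^{u^*}[g(x)-\ell]\,dx=L,\quad g(d^* )=g(D^* )=-k,\quad g(U^* )=g(u^* )=\ell$$ (such numbers exist and are unique). Then the control band policy $\varphi^*=\{d^*,D^*,U^*,u^*\}$ is optimal among all non-anticipating (feasible) policies; that is, $\mathrm{DC}(x,\varphi^* )\le \mathrm{DC}(x,\varphi)$ for every initial inventory level $x\in\mathbb{R}$ and every feasible policy $\varphi$.
   Context: Fix constants $\mu\in\mathbb{R}$, $\sigma>0$, $\beta>0$, $K>0$, $L>0$, $k>0$, $\ell>0$, and put $\lambda_1=\bigl[(\mu^2+2\beta\sigma^2)^{1/2}-\mu\bigr]/\sigma^2>0$, $\lambda_2=\bigl[(\mu^2+2\beta\sigma^2)^{1/2}+\mu\bigr]/\sigma^2>0$. Assumption on $h:\mathbb{R}\to[0,\infty)$: (a) $h$ is continuous and convex; (b) there is a point $a\in\mathbb{R}$ such that $h$ is $C^2$ on $\mathbb{R}\setminus\{a\}$ and $h(a)=0$; (c) $h'(x)\le 0$ for $x<a$ and $h'(x)\ge 0$ for $x>a$; (d) $\lim_{x\uparrow\infty}h'(x)>\ell\beta$ and $\lim_{x\downarrow-\infty}h'(x)<-k\beta$; (e) $\lim_{x\uparrow\infty}h''(x)/e^{\lambda_1x}=0$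 and $\int_a^{\infty}e^{-\lambda_1y}h''(y)\,dy<\infty$; (f) $\lim_{x\downarrow-\infty}h''(x)/e^{-\lambda_2x}=0$ and $\int_{-\infty}^ae^{\lambda_2y}h''(y)\,dy<\infty$. For $A,B\in\mathbb{R}$ define $g_{A,B}:\mathbb{R}\to\mathbb{R}$ by $$g_{A,B}(x)=\frac{2}{\sigma^2}\frac{1}{\lambda_1+\lambda_2}\Bigl[\frac{1}{\lambda_1}\Bigl(A-\lambda_1\int_a^xe^{-\lambda_1(y-a)}h'(y)\,dy\Bigr)e^{\lambda_1(x-a)}+\frac{1}{\lambda_2}\Bigl(B+\lambda_2\int_a^xe^{\lambda_2(y-a)}h'(y)\,dy\Bigr)e^{-\lambda_2(x-a)}\Bigr].$$ Control problem. Let $(\Omega,\mathcal{F},\{\mathcal{F}_t\},\mathbb{P})$ be a filtered probability space carrying a standard Brownian motion $W$ with $W(0)=0$ that is an $\{\mathcal{F}_t\}$-martingale. A policy $\varphi=(Y_1,Y_2)$ is a pair of $\{\mathcal{F}_t\}$-adapted processes whose paths are nondecreasing, right continuous on $[0,\infty)$ with left limits on $(0,\infty)$, and piecewise constant with finitely many jumps in each bounded interval; with the convention $Y_i(0-)=0$, $Y_i(t)$ is the sum of its jumps $\Delta Y_i(s)=Y_i(s)-Y_i(s-)$ over $s\in[0,t]$ (a jump at time $0$ is allowed). $Y_1$ and $Y_2$ are the cumulative upward and downward adjustments. The adjustments are listed as a sequence $(T_n,\xi_n)_{n\ge0}$ with $T_0=0$, where $T_n$ is the $n$th adjustment time and $\xi_n$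 the signed amount ($\xi_n>0$ upward, $\xi_n<0$ downward, $\xi_0=0$ if there is no adjustment at time $0$); $T_n$ is a stopping time and $\xi_n$ is $\mathcal{F}_{T_n-}$-measurable. With initial level $Z(0-)=x$, the inventory level is $Z(t)=x+\mu t+\sigma W(t)+Y_1(t)-Y_2(t)$, $t\ge 0$. The policy is feasible if $\mathbb{E}_x\bigl[\sum_{n\ge0}e^{-\beta T_n}(1+|\xi_n|)\bigr]<\infty$. The expected total discounted cost is $$\mathrm{DC}(x,\varphi)=\mathbb{E}_x\Bigl[\int_0^\infty e^{-\beta t}h(Z(t))\,dt+\sum_{s\ge0}e^{-\beta s}\bigl((K+k\,\Delta Y_1(s))1_{\{\Delta Y_1(s)>0\}}+(L+\ell\,\Delta Y_2(s))1_{\{\Delta Y_2(s)>0\}}\bigr)\Bigr],$$ where $\mathbb{E}_x$ is expectation given $Z(0-)=x$. Control band policy $\{d,D,U,u\}$ with $d<D<U<u$: at time $0$ the adjustment is $\xi_0=D-x$ if $x\le d$, $\xi_0=0$ if $d<x<u$, and $\xi_0=U-x$ if $x\ge u$; thereafter, each time the inventory level reaches $d$ (i.e. $Z(t-)=d$) it is immediately adjusted upward to $D$, and each time it reaches $u$ (i.e. $Z(t-)=u$) it is immediately adjusted downward to $U$; no other adjustments are made. *)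

(* Defs.v *)
From HB Require Import structures.
From mathcomp Require Import all_boot all_order all_algebra.
From mathcomp Require Import all_classical all_reals all_analysis.

Set Implicit Arguments.
Unset Strict Implicit.
Unset Printing Implicit Defensive.

Import Order.TTheory GRing.Theory Num.Theory.
Import numFieldNormedType.Exports.

Local Open Scope classical_set_scope.
Local Open Scope ring_scope.

Section free_boundary.
Context {R : realType}.
Local Notation leb := (@lebesgue_measure R).

Definition lambda1 (mu sigma beta : R) : R :=
  (Num.sqrt (mu ^+ 2 + 2 * beta * sigma ^+ 2) - mu) / sigma ^+ 2.

Definition lambda2 (mu sigma beta : R) : R :=
  (Num.sqrt (mu ^+ 2 + 2 * beta * sigma ^+ 2) + mu) / sigma ^+ 2.

(* In the limit conditions the limit of h' may be infinite, hence [l : \bar R].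
   The derivatives of h at the kink a are never used. *)
Record holding_cost (mu sigma beta k ell : R) (h : R -> R) (a : R) : Prop :=
  HoldingCost {
    holding_ge0 : forall x, 0 <= h x;
    holding_continuous : continuous h;
    holding_convex : convex_function (setT : set (convex_lmodType R^o)) h;
    holding_derivable : forall x, x != a -> derivable h x 1;
    holding_derivable2 : forall x, x != a -> derivable h^`()%classic x 1;
    holding_continuous2 : forall x, x != a -> {for x, continuous h^`(2)%classic};
    holding_min : h a = 0;
    holding_decreasing : forall x, x < a -> h^`()%classic x <= 0;
    holding_increasing : forall x, a < x -> 0 <= h^`()%classic x;
    holding_slope_pinfty : exists l : \bar R,
      (h^`()%classic x)%:E @[x --> +oo] --> l /\ ((ell * beta)%:E < l)%E;
    holding_slope_ninfty : exists l : \bar R,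
      (h^`()%classic x)%:E @[x --> -oo] --> l /\ (l < (- (k * beta))%:E)%E;
    holding_growth_pinfty :
      h^`(2)%classic x / expR (lambda1 mu sigma beta * x) @[x --> +oo] --> 0;
    holding_integral_pinfty :
      (\int[leb]_(y in `]a, +oo[)
         (expR (- lambda1 mu sigma beta * y) * h^`(2)%classic y)%:E < +oo)%E;
    holding_growth_ninfty :
      h^`(2)%classic x / expR (- lambda2 mu sigma beta * x) @[x --> -oo] --> 0;
    holding_integral_ninfty :
      (\int[leb]_(y in `]-oo, a[)
         (expR (lambda2 mu sigma beta * y) * h^`(2)%classic y)%:E < +oo)%E }.

(* The oriented integral of f from a to x. *)
Definition oriented_integral (a x : R) (f : R -> R) : R :=
  if a <= x then \int[leb]_(y in `]a, x[) f y
  else - \int[leb]_(y in `]x, a[) f y.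

Definition gAB (mu sigma beta : R) (h : R -> R) (a A B x : R) : R :=
  let l1 := lambda1 mu sigma beta in
  let l2 := lambda2 mu sigma beta in
  2 / sigma ^+ 2 * (l1 + l2)^-1 *
  (l1^-1 * (A - l1 * oriented_integral a x
                       (fun y => expR (- l1 * (y - a)) * h^`()%classic y))
         * expR (l1 * (x - a)) +
   l2^-1 * (B + l2 * oriented_integral a x
                       (fun y => expR (l2 * (y - a)) * h^`()%classic y))
         * expR (- l2 * (x - a))).

Definition local_minimum (f : R -> R) (x : R) : Prop :=
  \forall y \near x, f x <= f y.

Definition local_maximum (f : R -> R) (x : R) : Prop :=
  \forall y \near x, f y <= f x.

Definition free_boundary (mu sigma beta K L k ell : R) (h : R -> R)
    (a A B d D U u : R) : Prop :=
  let g := gAB mu sigma beta h a A B in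
  [/\ exists x1 x2 : R,
        [/\ x1 < a, local_minimum g x1, a < x2, local_maximum g x2 &
            [/\ d < x1, x1 < D, D < U, U < x2 & x2 < u]],
      \int[leb]_(x in `[d, D]) (g x + k) = - K,
      \int[leb]_(x in `[U, u]) (g x - ell) = L,
      g d = - k /\ g D = - k &
      g U = ell /\ g u = ell].

End free_boundary.

(* Processes are functions [R -> Omega -> R]; only times t >= 0 matter. *)
Section filtered_space.
Context {R : realType} {dsp : measure_display} {Omega : measurableType dsp}.
Variables (P : probability Omega R) (F : R -> set (set Omega)).

Definition filtration : Prop :=
  [/\ forall t : R, 0 <= t -> sigma_algebra setT (F t),
      forall t : R, 0 <= t -> F t `<=` measurable &
      forall s t : R, 0 <= s -> s <= t -> F s `<=` F t].

Definition measurable_wrt (G : set (set Omega)) (X : Omega -> R) : Prop :=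
  forall B, measurable B -> G (X @^-1` B).

Definition adapted (X : R -> Omega -> R) : Prop :=
  forall t : R, 0 <= t -> measurable_wrt (F t) (X t).

Definition martingale (X : R -> Omega -> R) : Prop :=
  [/\ adapted X,
      forall t : R, 0 <= t -> P.-integrable setT (EFin \o X t) &
      forall (s t : R) (A : set Omega), 0 <= s -> s <= t -> F s A ->
        (\int[P]_(w in A) (X t w)%:E = \int[P]_(w in A) (X s w)%:E)%E].

Definition independent_increments (X : R -> Omega -> R) : Prop :=
  forall (n : nat) (t : nat -> R) (B : nat -> set R),
    0 <= t 0%N -> {homo t : i j / (i <= j)%N >-> i <= j} ->
    (forall i, measurable (B i)) ->
    (P (\bigcap_(i < n) (X (t i.+1) \- X (t i))%R @^-1` B i) =
     \prod_(i < n) P ((X (t i.+1) \- X (t i))%R @^-1` B i))%E.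

(* Here continuity and the value at 0 are required of every path, not only of
   almost every one. *)
Definition standard_brownian (X : R -> Omega -> R) : Prop :=
  [/\ forall t : R, 0 <= t -> measurable_fun setT (X t),
      forall w, X 0 w = 0,
      forall w, {within `[0, +oo[, continuous (X ^~ w)},
      independent_increments X &
      forall (s t : R) (B : set R), 0 <= s -> s < t -> measurable B ->
        P ((X t \- X s) @^-1` B) = normal_prob 0 (Num.sqrt (t - s)) B].

Definition stopping_time (T : Omega -> \bar R) : Prop :=
  forall t : R, 0 <= t -> F t [set w | (T w <= t%:E)%E].

(* The sigma-algebra F_{T-} of events strictly prior to T. *)
Definition strict_past (T : Omega -> \bar R) : set (set Omega) :=
  <<s [set E | F 0 E \/ exists (t : R) (A : set Omega),
        [/\ 0 <= t, F t A & E = A `&` [set w | (t%:E < T w)%E]]] >>.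

End filtered_space.

Section paths.
Context {R : realType}.

(* f(t-), with the convention f(0-) = f0. *)
Definition before (f0 : R) (f : R -> R) (t : R) : R :=
  if t <= 0 then f0 else lim (f s @[s --> t^'-]).

(* Jump of a cumulative adjustment y, with y(0-) = 0. *)
Definition jump (y : R -> R) (t : R) : R := y t - before 0 y t.

(* The last two fields make the path piecewise constant. *)
Record pure_jump_path (y : R -> R) : Prop := PureJumpPath {
  path_ge0 : 0 <= y 0;
  path_nondecreasing : forall s t : R, 0 <= s -> s <= t -> y s <= y t;
  path_right_continuous : forall t : R, 0 <= t -> y s @[s --> t^'+] --> y t;
  path_left_limit : forall t : R, 0 < t -> cvg (y s @[s --> t^'-]);
  path_finite_jumps : forall t : R,
    finite_set [set s | 0 <= s /\ s <= t /\ jump y s != 0];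
  path_sum_jumps : forall t : R, 0 <= t ->
    ((y t)%:E = \esum_(s in `[0%R, t]) (jump y s)%:E)%E }.

End paths.

Section policies.
Context {R : realType} {dsp : measure_display} {Omega : measurableType dsp}.

Record policy := Policy { upward : R -> Omega -> R;
                          downward : R -> Omega -> R }.

Definition dY1 (phi : policy) (t : R) (w : Omega) : R :=
  jump (upward phi ^~ w) t.

Definition dY2 (phi : policy) (t : R) (w : Omega) : R :=
  jump (downward phi ^~ w) t.

(* T_0 = 0 and T_(n+1) is the first adjustment after T_n, or +oo if there is
   none (the infimum of the empty set). *)
Fixpoint adj_time (phi : policy) (n : nat) (w : Omega) : \bar R :=
  if n is m.+1 then
    ereal_inf [set t%:E | t in
      [set t : R | (adj_time phi m w < t%:E)%E /\
                   (dY1 phi t w != 0 \/ dY2 phi t w != 0)]]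
  else 0%E.

(* The signed amount xi_n, set to 0 when there is no nth adjustment. *)
Definition adj_amount (phi : policy) (n : nat) (w : Omega) : R :=
  if adj_time phi n w is t%:E then dY1 phi t w - dY2 phi t w else 0.

Definition pure_jump_policy (phi : policy) : Prop :=
  forall w, pure_jump_path (upward phi ^~ w) /\
            pure_jump_path (downward phi ^~ w).

Definition inventory (mu sigma : R) (W : R -> Omega -> R) (x : R)
    (phi : policy) (t : R) (w : Omega) : R :=
  x + mu * t + sigma * W t w + upward phi t w - downward phi t w.

Record admissible (F : R -> set (set Omega)) (phi : policy) : Prop :=
  Admissible {
    admissible_upward : adapted F (upward phi);
    admissible_downward : adapted F (downward phi);
    admissible_paths : pure_jump_policy phi;
    admissible_time : forall n, stopping_time F (adj_time phi n);
    admissible_amount : forall n,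
      measurable_wrt (strict_past F (adj_time phi n)) (adj_amount phi n) }.

Definition feasible (P : probability Omega R) (F : R -> set (set Omega))
    (beta : R) (phi : policy) : Prop :=
  admissible F phi /\
  (\int[P]_w (\sum_(0 <= n <oo) (expeR (- (beta%:E * adj_time phi n w)) *
                                (1 + `|adj_amount phi n w|)%:E)) < +oo)%E.

Definition discounted_cost (P : probability Omega R) (W : R -> Omega -> R)
    (mu sigma beta K L k ell : R) (h : R -> R) (x : R) (phi : policy) : \bar R :=
  (\int[P]_w
     (\int[lebesgue_measure]_(t in `[0%R, +oo[)
        (expR (- beta * t) * h (inventory mu sigma W x phi t w))%:E +
      \esum_(s in `[0%R, +oo[)
        (expR (- beta * s) *
         ((if 0 < dY1 phi s w then K + k * dY1 phi s w else 0) +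
          (if 0 < dY2 phi s w then L + ell * dY2 phi s w else 0)))%:E))%E.

(* Signed adjustments prescribed by the band {d, D, U, u}: at time 0 from the
   initial level z, and afterwards from the level z = Z(t-). *)
Definition band_initial (d D U u z : R) : R :=
  if z <= d then D - z else if u <= z then U - z else 0.

Definition band_reset (d D U u z : R) : R :=
  if z == d then D - d else if z == u then U - u else 0.

Definition control_band (mu sigma : R) (W : R -> Omega -> R)
    (x d D U u : R) (phi : policy) : Prop :=
  pure_jump_policy phi /\
  forall (t : R) (w : Omega), 0 <= t ->
    let xi := if t == 0 then band_initial d D U u x
              else band_reset d D U u
                     (before x (inventory mu sigma W x phi ^~ w) t) in
    dY1 phi t w = Num.max xi 0 /\ dY2 phi t w = Num.max (- xi) 0.

Definition optimal (P : probability Omega R) (F : R -> set (set Omega))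
    (W : R -> Omega -> R) (mu sigma beta K L k ell : R) (h : R -> R) (x : R)
    (phi : policy) : Prop :=
  feasible P F beta phi /\
  forall psi, feasible P F beta psi ->
    (discounted_cost P W mu sigma beta K L k ell h x phi <=
     discounted_cost P W mu sigma beta K L k ell h x psi)%E.

End policies.

Arguments policy R {dsp} Omega.

(* Main.v *)
(* The function [g] solves the differentiated equation of the uncontrolled
   problem; its primitive [v] solves [sigma^2/2 v'' + mu v' - beta v + h = 0].
   A free boundary is obtained by maximising the sum of the two constants of
   integration over the compact set of bands whose integrals are at least [K]
   and [L]: at a maximiser both integral conditions are equalities and the slope
   conditions are the first order conditions.

   Let [V] be [v] on [[d, u]], extended with slope [-k] to the left and [ell] to
   the right.  Convexity of [h] makes [V] a solution of the quasi-variational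
   inequality: no adjustment gains more than it costs, and
   [sigma^2/2 V'' + mu V' - beta V + h >= 0].  Symmetric means of [V] are smooth
   and satisfy both up to [e], so Dynkin's formula bounds the cost of every
   feasible policy from below by [V x].  Dynkin's formula itself comes from
   Taylor expansions on a time grid, jumps being delayed to the next grid point.

   The band policy keeps the inventory in [[d, u]], where [v] turns both
   inequalities into equalities, so its cost is at most [V x]; it is feasible
   because a bounded function of the inventory drops by a fixed amount at every
   adjustment.  Thus [V] is the optimal cost function, the same for all free
   boundaries, and the free boundary can be read off [V]. *)

From HB Require Import structures.
Require Import Defs.
From mathcomp Require Import all_boot all_order all_algebra.
From mathcomp Require Import all_classical all_reals all_analysis.
From mathcomp Require Import measurable_realfun ring lra.

Set Implicit Arguments.
Unset Strict Implicit.
Unset Printing Implicit Defensive.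

Import Order.TTheory GRing.Theory Num.Theory.
Import numFieldNormedType.Exports.

Local Open Scope classical_set_scope.
Local Open Scope ring_scope.

(** * Calculus and expectations *)

Section calculus.
Context {R : realType}.
Local Notation leb := (@lebesgue_measure R).
Implicit Types (f g : R -> R) (x a b : R).

(** Two gaps between the hypotheses and the usual argument shape the proof. The increments of [W]
    are independent of one another, but only the martingale property relates them to [F s]; so the
    second order term of Taylor's formula needs a proof that [dW s t ^+ 2 - (t - s)] is orthogonal
    to [F s]. And the expansion asks for bounded derivatives and a Lipschitz second derivative,
    while [V''] jumps at [d] and [u]. The lower bound therefore smooths [V]; for the band policy [v]
    is replaced beyond [[d, u]], where the inventory never goes, by a function with these bounds.
    The constants that are maximised are the amounts of the two exponentials subtracted from the
    resolvent of [h]: they steepen the descent at both ends, which confines the barriers.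
    Feasibility of the band policy cannot be presupposed when Dynkin's formula is applied to prove
    it, so the adjustments are first cut off after a fixed number. Since every free boundary comes
    with a band policy on the given probability space, uniqueness is a consequence of the control
    problem. *)

Lemma der_eq f x (df dg : R) : is_derive x 1 f df -> df = dg -> is_derive x 1 f dg.
Proof. by move=> + <-. Qed.

(** Rules for functions written as explicit lambda terms: a derivative is assembled as a term and
    its value adjusted afterwards by [der_eq]. *)
Lemma derD f g x (df dg : R) : is_derive x 1 f df -> is_derive x 1 g dg ->
  is_derive x 1 (fun y => f y + g y) (df + dg).
Proof. by move=> ? ?; exact: is_deriveD. Qed.

Lemma derB f g x (df dg : R) : is_derive x 1 f df -> is_derive x 1 g dg ->
  is_derive x 1 (fun y => f y - g y) (df - dg).
Proof. by move=> ? ?; exact: is_deriveB. Qed.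

Lemma derN f x (df : R) : is_derive x 1 f df -> is_derive x 1 (fun y => - f y) (- df).
Proof. by move=> ?; exact: is_deriveN. Qed.

Lemma derZ c f x (df : R) : is_derive x 1 f df ->
  is_derive x 1 (fun y => c * f y) (c * df).
Proof. by move=> ?; exact: (@is_deriveZ _ _ _ f c x 1 df). Qed.

Lemma derM f g x (df dg : R) : is_derive x 1 f df -> is_derive x 1 g dg ->
  is_derive x 1 (fun y => f y * g y) (f x * dg + df * g x).
Proof.
move=> df' dg'; have dfg := is_deriveM df' dg'; apply: (@der_eq (f * g) _ _ _ dfg).
by rewrite /GRing.scale/= (mulrC (g x)).
Qed.

Lemma der_comp f g x (df dg : R) : is_derive (g x) 1 f df -> is_derive x 1 g dg ->
  is_derive x 1 (fun y => f (g y)) (df * dg).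
Proof. by move=> ? ?; exact: is_derive1_comp. Qed.

Lemma der_id x : is_derive x 1 (fun y : R => y) 1.
Proof. exact: is_derive_id. Qed.

Lemma der_cst (c : R) x : is_derive x 1 (fun=> c) 0.
Proof. exact: is_derive_cst. Qed.

Lemma der_affine m n x : is_derive x 1 (fun y => m * y + n) m.
Proof.
by apply: (der_eq (derD (derZ m (der_id x)) (der_cst n x))); rewrite addr0 mulr1.
Qed.

Lemma der_shift n x : is_derive x 1 (fun y => y + n) 1.
Proof. by apply: (der_eq (derD (der_id x) (der_cst n x))); rewrite addr0. Qed.

Lemma der_shift_comp f n x (df : R) : is_derive (x + n) 1 f df ->
  is_derive x 1 (fun y => f (y + n)) df.
Proof.
by move=> dx; apply: (der_eq (@der_comp f (fun y => y + n) x df 1 dx (der_shift n x))); rewrite mulr1.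
Qed.

Lemma der_expR m n x : is_derive x 1 (fun y => expR (m * (y - n))) (m * expR (m * (x - n))).
Proof.
apply: (der_eq (@der_comp expR (fun y => m * (y - n)) x _ _ (is_derive_expR _) (derZ m (der_shift (- n) x)))).
by rewrite mulr1 mulrC.
Qed.

Lemma der_expRM m x : is_derive x 1 (fun y => expR (m * y)) (m * expR (m * x)).
Proof.
apply: (der_eq (@der_comp expR (fun y => m * y) x _ _ (is_derive_expR _) (derZ m (der_id x)))).
by rewrite mulr1 mulrC.
Qed.

Lemma der_cont f x (df : R) : is_derive x 1 f df -> {for x, continuous f}.
Proof. by move=> [dx _]; exact/differentiable_continuous/derivable1_diffP. Qed.

Lemma contD f g : continuous f -> continuous g -> continuous (fun x => f x + g x).
Proof. by move=> cf cg x; exact: (cvgD (cf x) (cg x)). Qed.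

Lemma contB f g : continuous f -> continuous g -> continuous (fun x => f x - g x).
Proof. by move=> cf cg x; exact: (cvgB (cf x) (cg x)). Qed.

Lemma contM f g : continuous f -> continuous g -> continuous (fun x => f x * g x).
Proof. by move=> cf cg x; exact: (cvgM (cf x) (cg x)). Qed.

Lemma contZ c f : continuous f -> continuous (fun x => c * f x).
Proof. by move=> cf x; exact: (cvgM (@cvg_cst _ _ _ _ _) (cf x)). Qed.

Lemma der_continuous f (df : R -> R) : (forall x : R, is_derive x 1 f (df x)) ->
  continuous f.
Proof. by move=> dfx x; exact: der_cont (dfx x). Qed.

Lemma der_MVT f (df : R -> R) a b : a < b -> continuous f ->
  (forall x : R, a < x -> x < b -> is_derive x 1 f (df x)) ->
  exists c, [/\ a < c, c < b & f b - f a = df c * (b - a)].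
Proof.
move=> ab cf dfx; have [||c /[!in_itv]/= /andP[ac cb] E] := @MVT R f df a b ab.
- by move=> x /[!in_itv]/= /andP[ax xb]; exact: dfx.
- exact: continuous_subspaceT.
- by exists c.
Qed.

Lemma der_ge0_le f (df : R -> R) a b : a <= b -> continuous f ->
  (forall x : R, a < x -> x < b -> is_derive x 1 f (df x)) ->
  (forall x : R, a < x -> x < b -> 0 <= df x) -> f a <= f b.
Proof.
rewrite le_eqVlt => /predU1P[->//|ab] cf dfx df0.
have [c [ac cb E]] := der_MVT ab cf dfx.
by rewrite -subr_ge0 E mulr_ge0 ?subr_ge0 ?df0// ltW.
Qed.

Lemma der_le0_ge f (df : R -> R) a b : a <= b -> continuous f ->
  (forall x : R, a < x -> x < b -> is_derive x 1 f (df x)) ->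
  (forall x : R, a < x -> x < b -> df x <= 0) -> f b <= f a.
Proof.
rewrite le_eqVlt => /predU1P[->//|ab] cf dfx df0.
have [c [ac cb E]] := der_MVT ab cf dfx.
by rewrite -subr_le0 E mulr_le0_ge0 ?subr_ge0 ?df0// ltW.
Qed.

Lemma der_gt0_lt f (df : R -> R) a b : a < b -> continuous f ->
  (forall x : R, a < x -> x < b -> is_derive x 1 f (df x)) ->
  (forall x : R, a < x -> x < b -> 0 < df x) -> f a < f b.
Proof.
move=> ab cf dfx df0; have [c [ac cb E]] := der_MVT ab cf dfx.
by rewrite -subr_gt0 E mulr_gt0 ?subr_gt0 ?df0.
Qed.

Lemma der_lt0_gt f (df : R -> R) a b : a < b -> continuous f ->
  (forall x : R, a < x -> x < b -> is_derive x 1 f (df x)) ->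
  (forall x : R, a < x -> x < b -> df x < 0) -> f b < f a.
Proof.
move=> ab cf dfx df0; have [c [ac cb E]] := der_MVT ab cf dfx.
by rewrite -subr_lt0 E nmulr_rlt0 ?subr_gt0 ?df0.
Qed.

(** A bound on the difference quotients of one side passes to their limit. The four one-sided forms
    serve the first order conditions at a constrained maximiser, where variations may be allowed in
    one direction only. *)
Lemma der_right_le f x (df : R) c e : is_derive x 1 f df -> 0 < e ->
  (forall t, 0 < t -> t < e -> f (x + t) - f x <= c * t) -> df <= c.
Proof.
move=> [dx <-] e0 fc.
apply: (cvgr_to_le (cvg_dnbhs_at_right dx)).
near=> t; rewrite /GRing.scale/= mulr1 ler_pdivrMl ?(addrC t)//.
by rewrite mulrC fc.
Unshelve. all: by end_near. Qed.

Lemma der_left_ge f x (df : R) c e : is_derive x 1 f df -> 0 < e ->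
  (forall t, 0 < t -> t < e -> f x - f (x - t) >= c * t) -> c <= df.
Proof.
move=> dx e0 fc; rewrite -lerN2; apply: (@der_right_le (fun y => f (- y)) (- x) _ _ e) => //.
  have dx' : is_derive (- - x) 1 f df by rewrite opprK.
  exact: (der_eq (@der_comp f (fun y => - y) (- x) df (- 1) dx'
    (derN (der_id (- x)))) (mulrN1 df)).
by move=> t t0 te; rewrite opprK opprD opprK mulNr -lerN2 opprK opprB fc.
Qed.

Lemma der_right_ge f x (df : R) c e : is_derive x 1 f df -> 0 < e ->
  (forall t, 0 < t -> t < e -> c * t <= f (x + t) - f x) -> c <= df.
Proof.
move=> dx e0 fc; rewrite -lerN2; apply: (der_right_le (derN dx) e0) => t t0 te.
by rewrite mulNr opprK addrC lerNr opprB fc.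
Qed.

Lemma der_left_le f x (df : R) c e : is_derive x 1 f df -> 0 < e ->
  (forall t, 0 < t -> t < e -> f x - f (x - t) <= c * t) -> df <= c.
Proof.
move=> dx e0 fc; rewrite -lerN2; apply: (der_left_ge (derN dx) e0) => t t0 te.
by rewrite mulNr opprK addrC lerNl opprB fc.
Qed.

Lemma Rintegral_derive f (F : R -> R) a b : a <= b ->
  (forall x : R, is_derive x 1 F (f x)) -> continuous f ->
  \int[leb]_(x in `[a, b]) f x = F b - F a.
Proof.
move=> ab dF cf; move: ab; rewrite le_eqVlt => /predU1P[->|ab].
  by rewrite set_itv1 Rintegral_set1 subrr.
have dF1 x : derivable F x 1 by have := dF x; case.
rewrite /Rintegral (@continuous_FTC2 _ f F)//.
- exact: continuous_subspaceT.
- have cF x : {for x, continuous F} by exact: der_cont (dF x).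
  split=> //; first exact: cvg_at_right_filter (cF a).
  exact: cvg_at_left_filter (cF b).
- by move=> x _; rewrite derive1E; apply: derive_val.
Qed.

Lemma continuous_integrable f a b : continuous f ->
  leb.-integrable `[a, b] (EFin \o f).
Proof.
move=> cf; apply: continuous_compact_integrable; first exact: segment_compact.
exact: continuous_subspaceT.
Qed.

(* The primitive is that of the integral from a point left of all arguments,
   so that no case distinction on the orientation is needed. *)
Lemma oriented_integralE f a b x : continuous f -> b < a -> b < x ->
  oriented_integral a x f =
  \int[leb]_(y in `[b, x]) f y - \int[leb]_(y in `[b, a]) f y.
Proof.
move=> cf ba bx; rewrite /oriented_integral; case: leP => [ax|xa].
  rewrite Rintegral_itv_bndo_bndc; last first.
    apply: integrableS (continuous_integrable a x cf) => //.
    exact: subset_itv_oo_cc.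
  rewrite Rintegral_itvB ?bnd_simp//; first exact: continuous_integrable.
  exact: ltW.
rewrite Rintegral_itv_bndo_bndc; last first.
  apply: integrableS (continuous_integrable x a cf) => //.
  exact: subset_itv_oo_cc.
rewrite -(@Rintegral_itvB _ f (BLeft b)) ?bnd_simp ?opprB ?ltW//.
exact: continuous_integrable.
Qed.

Lemma oriented_integral_refl f a : oriented_integral a a f = 0.
Proof. by rewrite /oriented_integral lexx set_itvoo0 Rintegral_set0. Qed.

Lemma der_oriented_integral f a x : continuous f ->
  is_derive x 1 (fun y => oriented_integral a y f) (f x).
Proof.
move=> cf; pose b := Num.min a x - 1.
have ba : b < a by rewrite /b ltrBlDr gt_min ltrDl ltr01.
have bx : b < x by rewrite /b ltrBlDr gt_min ltrDl ltr01 orbT.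
have [dF F'] := @continuous_FTC1_closed R f b x (x + 1) (ltr_pwDr ltr01 (lexx x))
  (continuous_integrable b (x + 1) cf) bx (cf x).
apply: (@near_eq_is_derive _ _ _
  (fun y => \int[leb]_(z in `[b, y]) f z - \int[leb]_(z in `[b, a]) f z)).
  near=> y; rewrite (@oriented_integralE f a b y)//; near: y.
  by apply: (cvgr_gt x) => //; exact: cvg_id.
rewrite derive1E in F'; apply: (der_eq (derB (DeriveDef dF F') (der_cst _ x))).
by rewrite subr0.
Unshelve. all: by end_near. Qed.

End calculus.

(** * Expectations of real random variables *)

Section expectation.
Context {R : realType} {dsp : measure_display} {Omega : measurableType dsp}.
Variable P : probability Omega R.
Implicit Types X Y Z H : Omega -> R.

Definition intg X := P.-integrable setT (EFin \o X).

Definition Ex X : R := \int[P]_w X w.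

Lemma intg_mf X : intg X -> measurable_fun setT X.
Proof. by move=> /measurable_int/measurable_EFinP. Qed.

Lemma intg_le Y X : measurable_fun setT X -> (forall w, `|X w| <= Y w) ->
  intg Y -> intg X.
Proof.
move=> mX XY; apply: le_integrable => //; first exact/measurable_EFinP.
by move=> w _ /=; rewrite lee_fin (le_trans (XY w))// ler_norm.
Qed.

Lemma intgD X Y : intg X -> intg Y -> intg (fun w => X w + Y w).
Proof. by move=> iX iY; exact: (integrableD measurableT iX iY). Qed.

Lemma intgN X : intg X -> intg (fun w => - X w).
Proof. by move=> iX; exact: (integrableN iX). Qed.

Lemma intgB X Y : intg X -> intg Y -> intg (fun w => X w - Y w).
Proof. by move=> iX iY; exact: intgD iX (intgN iY). Qed.

Lemma intgZ c X : intg X -> intg (fun w => c * X w).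
Proof. by move=> iX; exact: (integrableZl measurableT c iX). Qed.

Lemma intg_cst c : intg (fun=> c).
Proof. exact: finite_measure_integrable_cst. Qed.

Lemma intg_abs X : intg X -> intg (fun w => `|X w|).
Proof. by move=> iX; exact: integrable_norm. Qed.

Lemma intg_bnd M X : measurable_fun setT X -> (forall w, `|X w| <= M) -> intg X.
Proof. by move=> mX XM; exact: (@intg_le (fun=> M)) (intg_cst M). Qed.

Lemma intgMl M H X : measurable_fun setT H -> (forall w, `|H w| <= M) ->
  intg X -> intg (fun w => H w * X w).
Proof.
move=> mH HM iX; apply: (@intg_le (fun w => M * `|X w|)).
- exact: measurable_funM mH (intg_mf iX).
- by move=> w; rewrite normrM ler_wpM2r.
- exact/intgZ/intg_abs.
Qed.

Lemma intg_sum I (s : seq I) (X : I -> Omega -> R) :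
  (forall i, intg (X i)) -> intg (fun w => \sum_(i <- s) X i w).
Proof.
move=> iX; elim: s => [|i s IHs].
  by under eq_fun do rewrite big_nil; exact: intg_cst.
by under eq_fun do rewrite big_cons; exact: intgD.
Qed.

Lemma intg_indic A : measurable A -> intg \1_A.
Proof.
move=> mA; apply: (@intg_bnd 1); first exact: measurable_indic.
by move=> w; rewrite indicE; case: (w \in A); rewrite ?normr1 ?normr0.
Qed.

Lemma integral_Ex X : intg X -> (\int[P]_w (X w)%:E = (Ex X)%:E)%E.
Proof. by move=> iX; rewrite /Ex /Rintegral fineK// integrable_fin_num. Qed.

Lemma eq_Ex X Y : X =1 Y -> Ex X = Ex Y.
Proof. by move=> XY; rewrite /Ex; congr Rintegral; apply/funext. Qed.

Lemma ExD X Y : intg X -> intg Y -> Ex (fun w => X w + Y w) = Ex X + Ex Y.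
Proof. exact: RintegralD. Qed.

Lemma ExB X Y : intg X -> intg Y -> Ex (fun w => X w - Y w) = Ex X - Ex Y.
Proof. exact: RintegralB. Qed.

Lemma ExZ c X : intg X -> Ex (fun w => c * X w) = c * Ex X.
Proof. by move=> iX; exact: (RintegralZl c measurableT iX). Qed.

Lemma ExN X : intg X -> Ex (fun w => - X w) = - Ex X.
Proof.
by move=> iX; rewrite -mulN1r -ExZ//; apply: eq_Ex => w; rewrite mulN1r.
Qed.

Lemma Ex_cst c : Ex (fun=> c) = c.
Proof.
by rewrite /Ex Rintegral_cst//= -[X in _ * fine X]/(P setT) probability_setT mulr1.
Qed.

Lemma Ex_sum I (s : seq I) (X : I -> Omega -> R) : (forall i, intg (X i)) ->
  Ex (fun w => \sum_(i <- s) X i w) = \sum_(i <- s) Ex (X i).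
Proof.
move=> iX; elim: s => [|i s IHs].
  by rewrite big_nil -[RHS]Ex_cst; apply: eq_Ex => w; rewrite big_nil.
rewrite big_cons -IHs -ExD//; last exact: intg_sum.
by apply: eq_Ex => w; rewrite big_cons.
Qed.

Lemma Ex_le X Y : intg X -> intg Y -> (forall w, X w <= Y w) -> Ex X <= Ex Y.
Proof. by move=> iX iY XY; exact: le_Rintegral. Qed.

Lemma Ex_ge0 X : (forall w, 0 <= X w) -> 0 <= Ex X.
Proof. by move=> X0; exact: Rintegral_ge0. Qed.

Lemma Ex_norm X : intg X -> `|Ex X| <= Ex (fun w => `|X w|).
Proof. by move=> iX; exact: le_normr_Rintegral. Qed.

Lemma Ex_norm_le X Y : intg X -> intg Y -> (forall w, `|X w| <= Y w) ->
  `|Ex X| <= Ex Y.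
Proof.
by move=> iX iY XY; rewrite (le_trans (Ex_norm iX))// Ex_le//; exact: intg_abs.
Qed.

Lemma Ex_indic A : measurable A -> Ex \1_A = fine (P A).
Proof. by move=> mA; rewrite /Ex /Rintegral integral_indic// setIT. Qed.

Lemma Ex_dominated (X : nat -> Omega -> R) X0 Y :
  (forall n, measurable_fun setT (X n)) ->
  (forall w, X ^~ w @ \oo --> X0 w) ->
  (forall n w, `|X n w| <= Y w) -> intg Y ->
  intg X0 /\ Ex (X n) @[n --> \oo] --> Ex X0.
Proof.
move=> mX XX0 XY iY.
have mX0 : measurable_fun setT X0.
  by apply: (@measurable_fun_cvg _ _ _ _ X) => // w _; exact: XX0.
have ecvg w : (EFin \o X n) w @[n --> \oo] --> (EFin \o X0) w.
  by apply: cvg_EFin; [exact: nearW|exact: XX0].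
have [i0 _ cvgE] := @dominated_convergence _ _ _ P setT measurableT
  (fun n => EFin \o X n) (EFin \o X0) (EFin \o Y)
  (fun n => (measurable_EFinP _ _).2 (mX n)) ((measurable_EFinP _ _).2 mX0)
  (aeW _ (fun w _ => ecvg w)) iY (aeW _ (fun w n _ => XY n w)).
split=> //; apply: fine_cvg; rewrite -/(Ex X0) -integral_Ex//.
Qed.

End expectation.

(** * The cost function and the differential equation *)

(* The part of the hypotheses on [h] that the analysis needs: a supporting line
   at every point, and the sign and size of [h']. *)
Section holding_cost_facts.
Context {R : realType}.
Variables (mu sigma beta k ell : R) (h : R -> R) (a : R).
Hypothesis hh : holding_cost mu sigma beta k ell h a.
Local Notation h' := h^`()%classic.
Local Notation h'' := h^`(2)%classic.

Lemma cost_der (x : R) : x != a -> is_derive x 1 h (h' x).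
Proof. by move=> xa; rewrite derive1E; apply: DeriveDef => //; exact: holding_derivable hh _ xa. Qed.

Lemma cost_der2 (x : R) : x != a -> is_derive x 1 h' (h'' x).
Proof.
move=> xa; rewrite [h'' x](derive1E h').
by apply: DeriveDef => //; exact: holding_derivable2 hh _ xa.
Qed.

Lemma cost_convex (x y t : R) : 0 <= t -> t <= 1 ->
  h (x + t * (y - x)) <= (1 - t) * h x + t * h y.
Proof.
move=> t0 t1.
have t01 : 0 <= t <= 1 by rewrite t0.
have H := holding_convex hh (Itv01 t0 t1).
have {H} := H y x (mem_set I) (mem_set I).
have -> : x + t * (y - x) = t * y + (1 - t) * x by ring.
by rewrite [leRHS]addrC; apply.
Qed.

(** By convexity the difference quotients along the segment from [x] to [y] are at most [h y - h x],
    and so is their limit at [x]. *)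
Lemma cost_tangent (x y : R) : x != a -> h x + h' x * (y - x) <= h y.
Proof.
move=> xa; rewrite -lerBrDl.
pose f t : R := h (t * (y - x) + x).
have df : is_derive (0 : R) 1 f (h' x * (y - x)).
  have dx : is_derive (0 * (y - x) + x) 1 h (h' x).
    by rewrite mul0r add0r; exact: cost_der.
  apply: (der_eq (@der_comp _ h (fun t => t * (y - x) + x) 0 _ _ dx
    (derD (derM (der_id 0) (der_cst (y - x) 0)) (der_cst x 0)))).
  by rewrite mul0r add0r mul1r addr0.
apply: (der_right_le df ltr01) => t t0 t1.
rewrite /f !add0r mul0r add0r [t * _ + x]addrC.
have := cost_convex x y (ltW t0) (ltW t1).
by rewrite mulrBl mul1r -mulrC; move: (h _) => Q; lra.
Qed.

Lemma cost_subgradient (x : R) : exists m, forall y, h x + m * (y - x) <= h y.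
Proof.
(* At the kink, where [h] attains its minimum 0, the slope 0 serves. *)
have [->|xa] := eqVneq x a; last by exists (h' x) => y; exact: cost_tangent.
by exists 0 => y; rewrite mul0r addr0 (holding_min hh) (holding_ge0 hh).
Qed.

Lemma cost_slope_le (x y : R) : x != a -> y != a -> x <= y -> h' x <= h' y.
Proof.
move=> xa ya; rewrite le_eqVlt => /predU1P[->//|xy].
have := cost_tangent y xa; have := cost_tangent x ya; nra.
Qed.

Lemma cost_der2_ge0 (x : R) : x != a -> 0 <= h'' x.
Proof.
(* Slopes can be compared only off the kink, so the increments to the right of [x] must be short
   enough to avoid [a]. *)
move=> xa; have [e e0 xe] : exists2 e, 0 < e & forall t, 0 < t -> t < e -> x + t != a.
  have [ax|xa'] := leP a x; first by exists 1 => // t t0 _; lra.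
  by exists (a - x) => [|t t0 te]; lra.
apply: (@der_left_ge _ (fun y => - h' (- y)) (- x) _ _ e) => //.
- have dx : is_derive (- - x) 1 h' (h'' x) by rewrite opprK; exact: cost_der2.
  apply: (der_eq (derN (@der_comp _ h' (fun y => - y) (- x) _ (- 1) dx (derN (der_id (- x)))))).
  by rewrite mulrN1 opprK.
- move=> t t0 te; rewrite mul0r opprB !opprK (addrC (- _)) (addrC t) subr_ge0.
  by apply: cost_slope_le; rewrite ?xe// lerDl ltW.
Qed.

Lemma cost_slope_right : exists z, a < z /\ ell * beta < h' z.
Proof.
have [l [hl ll]] := holding_slope_pinfty hh.
have near_l : \forall x \near +oo, ((ell * beta)%:E < (h' x)%:E)%E.
  exact: hl _ (open_ereal_gt' ll).
near (pinfty_nbhs R) => z.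
exists z; split; first by near: z; exact: nbhs_pinfty_gt (num_real a).
by rewrite -lte_fin; near: z; exact: near_l.
Unshelve. all: by end_near. Qed.

Lemma cost_slope_left : exists z, z < a /\ h' z < - (k * beta).
Proof.
have [l [hl ll]] := holding_slope_ninfty hh.
have near_l : \forall x \near -oo, ((h' x)%:E < (- (k * beta))%:E)%E.
  exact: hl _ (open_ereal_lt' ll).
near (ninfty_nbhs R) => z.
exists z; split; first by near: z; exact: nbhs_ninfty_lt (num_real a).
by rewrite -lte_fin; near: z; exact: near_l.
Unshelve. all: by end_near. Qed.

End holding_cost_facts.

(** For [t >= 0], [expR t] is the square of [expR (t / 2)], hence at least [(1 + t / 2) ^+ 2], while
    the affine function is at most [C * (1 + t / 2)]. *)
Lemma expR_affine_small {R : realType} (p q e : R) : 0 < e ->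
  exists T, forall t, T <= t -> expR (- t) * (p * t + q) <= e.
Proof.
move=> e0; pose C := 2 * `|p| + `|q|.
have C0 : 0 <= C by rewrite addr_ge0// mulr_ge0.
exists (2 * C / e) => t tT.
have t0 : 0 <= t by rewrite (le_trans _ tT)// divr_ge0 ?mulr_ge0// ltW.
have tC : C <= e * (1 + t / 2).
  have := tT; rewrite ler_pdivrMr// => H.
  rewrite mulrDr mulr1; nra.
have pq : p * t + q <= C * (1 + t / 2).
  have := ler_norm p; have := ler_norm q; have := normr_ge0 p; have := normr_ge0 q.
  by rewrite /C => ? ? ? ?; nra.
rewrite expRN mulrC ler_pdivrMr ?expR_gt0// (le_trans pq)//.
have -> : expR t = expR (t / 2) ^+ 2 by rewrite -expRM_natl; congr expR; field.
have h1 : 1 + t / 2 <= expR (t / 2) by exact: expR_ge1Dx.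
have h2 : (1 + t / 2) ^+ 2 <= expR (t / 2) ^+ 2.
  by rewrite lerXn2r ?nnegrE ?expR_ge0// addr_ge0// divr_ge0.
apply: le_trans (ler_wpM2l (ltW e0) h2).
by rewrite expr2 mulrA ler_wpM2r// addr_ge0// divr_ge0.
Qed.

(** * Solutions of the differential equation *)

Section free_boundary_ode.
Context {R : realType}.
Variables (mu sigma beta k ell : R) (h : R -> R) (a : R).
Hypotheses (sigma0 : 0 < sigma) (beta0 : 0 < beta).
Hypothesis hh : holding_cost mu sigma beta k ell h a.
Local Notation h' := h^`()%classic.
Local Notation l1 := (lambda1 mu sigma beta).
Local Notation l2 := (lambda2 mu sigma beta).
Local Notation rt := (Num.sqrt (mu ^+ 2 + 2 * beta * sigma ^+ 2)).

Let ch : continuous h := holding_continuous hh.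

Let rt2 : rt ^+ 2 = mu ^+ 2 + 2 * beta * sigma ^+ 2.
Proof. by rewrite sqr_sqrtr// addr_ge0 ?sqr_ge0// mulr_ge0 ?sqr_ge0// mulr_ge0// ltW. Qed.

Let rt_gt : `|mu| < rt.
Proof.
rewrite -ltr_sqr ?nnegrE// ?sqrtr_ge0// rt2 real_normK ?num_real// ltrDl.
by rewrite mulr_gt0 ?exprn_gt0// mulr_gt0.
Qed.

Lemma lambda1_gt0 : 0 < l1.
Proof.
by rewrite /lambda1 divr_gt0 ?exprn_gt0// subr_gt0 (le_lt_trans (ler_norm _) rt_gt).
Qed.

Lemma lambda2_gt0 : 0 < l2.
Proof.
rewrite /lambda2 divr_gt0 ?exprn_gt0//.
by have := rt_gt; have := ler_norm (- mu); rewrite normrN; lra.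
Qed.

Let s0 : sigma != 0. Proof. exact: lt0r_neq0. Qed.
Let l1n0 : l1 != 0. Proof. exact/lt0r_neq0/lambda1_gt0. Qed.
Let l2n0 : l2 != 0. Proof. exact/lt0r_neq0/lambda2_gt0. Qed.
Let l12 : 0 < l1 + l2. Proof. exact: addr_gt0 lambda1_gt0 lambda2_gt0. Qed.

(** [l1] and [- l2] are the two roots of the characteristic equation. *)
Lemma lambda1_root : sigma ^+ 2 / 2 * l1 ^+ 2 + mu * l1 = beta.
Proof.
have H : sigma ^+ 2 * l1 = rt - mu by rewrite /lambda1 mulrCA divff ?mulr1// expf_neq0.
have H2 : sigma ^+ 2 * (sigma ^+ 2 / 2 * l1 ^+ 2 + mu * l1 - beta) = 0.
  have -> : sigma ^+ 2 * (sigma ^+ 2 / 2 * l1 ^+ 2 + mu * l1 - beta) =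
     (sigma ^+ 2 * l1) ^+ 2 / 2 + mu * (sigma ^+ 2 * l1) - beta * sigma ^+ 2 by field.
  by rewrite H sqrrB rt2; field.
by move/eqP: H2; rewrite mulf_eq0 expf_eq0/= (negbTE s0)/= subr_eq0 => /eqP.
Qed.

Lemma lambda2_root : sigma ^+ 2 / 2 * l2 ^+ 2 - mu * l2 = beta.
Proof.
have H : sigma ^+ 2 * l2 = rt + mu by rewrite /lambda2 mulrCA divff ?mulr1// expf_neq0.
have H2 : sigma ^+ 2 * (sigma ^+ 2 / 2 * l2 ^+ 2 - mu * l2 - beta) = 0.
  have -> : sigma ^+ 2 * (sigma ^+ 2 / 2 * l2 ^+ 2 - mu * l2 - beta) =
     (sigma ^+ 2 * l2) ^+ 2 / 2 - mu * (sigma ^+ 2 * l2) - beta * sigma ^+ 2 by field.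
  by rewrite H sqrrD rt2; field.
by move/eqP: H2; rewrite mulf_eq0 expf_eq0/= (negbTE s0)/= subr_eq0 => /eqP.
Qed.

Implicit Types (x y A B : R).

(** The factor of variation of constants: [l1 + l2] comes from the Wronskian of the two
    exponentials, [2 / sigma ^+ 2] from the leading coefficient. *)
Definition cc : R := 2 / sigma ^+ 2 * (l1 + l2)^-1.

Lemma cc_gt0 : 0 < cc.
Proof. by rewrite /cc mulr_gt0 ?invr_gt0// divr_gt0// exprn_gt0. Qed.

Lemma ccE : sigma ^+ 2 / 2 * cc * (l1 + l2) = 1.
Proof. by have sn0 := lt0r_neq0 l12; rewrite /cc; field; apply/andP. Qed.

(** Vieta's formula for the product of the roots: [l1 * l2] is [2 * beta / sigma ^+ 2]. *)
Lemma cc_beta : cc * beta * (l1 + l2) = l1 * l2.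
Proof.
have E : l1 * beta + l2 * beta = sigma ^+ 2 / 2 * l1 * l2 * (l1 + l2).
  transitivity (l1 * (sigma ^+ 2 / 2 * l2 ^+ 2 - mu * l2) +
    l2 * (sigma ^+ 2 / 2 * l1 ^+ 2 + mu * l1)); last by ring.
  by rewrite lambda2_root lambda1_root.
rewrite -mulrA [beta * _]mulrC mulrDl E.
by rewrite -[RHS]mulr1 -[in RHS]ccE; ring.
Qed.

Definition E1 x : R := expR (l1 * (x - a)).
Definition E2 x : R := expR (- l2 * (x - a)).
Definition e1 x : R := expR (- l1 * (x - a)).
Definition e2 x : R := expR (l2 * (x - a)).

Lemma e1E x : e1 x = (E1 x)^-1. Proof. by rewrite /e1 /E1 mulNr expRN. Qed.
Lemma e2E x : e2 x = (E2 x)^-1. Proof. by rewrite /e2 /E2 mulNr expRN invrK. Qed.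
Lemma E1_gt0 x : 0 < E1 x. Proof. exact: expR_gt0. Qed.
Lemma E2_gt0 x : 0 < E2 x. Proof. exact: expR_gt0. Qed.
Lemma e1_gt0 x : 0 < e1 x. Proof. exact: expR_gt0. Qed.
Lemma e2_gt0 x : 0 < e2 x. Proof. exact: expR_gt0. Qed.
Let E1n0 x : E1 x != 0. Proof. exact/lt0r_neq0/E1_gt0. Qed.
Let E2n0 x : E2 x != 0. Proof. exact/lt0r_neq0/E2_gt0. Qed.

Lemma der_E1 x : is_derive x 1 E1 (l1 * E1 x). Proof. exact: der_expR. Qed.
Lemma der_E2 x : is_derive x 1 E2 (- l2 * E2 x). Proof. exact: der_expR. Qed.
Lemma der_e1 x : is_derive x 1 e1 (- l1 * e1 x). Proof. exact: der_expR. Qed.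
Lemma der_e2 x : is_derive x 1 e2 (l2 * e2 x). Proof. exact: der_expR. Qed.

Definition N1 x : R := oriented_integral a x (fun y => e1 y * h y).
Definition N2 x : R := oriented_integral a x (fun y => e2 y * h y).

Lemma der_N1 x : is_derive x 1 N1 (e1 x * h x).
Proof.
apply: (@der_oriented_integral _ (fun y => e1 y * h y)).
exact: (contM (der_continuous der_e1) ch).
Qed.

Lemma der_N2 x : is_derive x 1 N2 (e2 x * h x).
Proof.
apply: (@der_oriented_integral _ (fun y => e2 y * h y)).
exact: (contM (der_continuous der_e2) ch).
Qed.

Lemma N1_a : N1 a = 0. Proof. exact: oriented_integral_refl. Qed.
Lemma N2_a : N2 a = 0. Proof. exact: oriented_integral_refl. Qed.

(** The varying coefficients of the two exponentials in [gfun], up to the factor [cc]. *)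
Definition K1 A x : R := A / l1 - l1 * N1 x.
Definition K2 B x : R := B / l2 - l2 * N2 x.

Lemma der_K1 A x : is_derive x 1 (K1 A) (- l1 * (e1 x * h x)).
Proof. by apply: (der_eq (derB (der_cst (A / l1) x) (derZ l1 (der_N1 x)))); rewrite sub0r mulNr. Qed.

Lemma der_K2 B x : is_derive x 1 (K2 B) (- l2 * (e2 x * h x)).
Proof. by apply: (der_eq (derB (der_cst (B / l2) x) (derZ l2 (der_N2 x)))); rewrite sub0r mulNr. Qed.

(* [vfun] is the solution of the inhomogeneous equation whose derivative is [gfun],
   which agrees with [gAB]; integrating by parts has replaced [h'] by [h]. *)
Definition vfun A B x : R := cc * (K1 A x * E1 x / l1 - K2 B x * E2 x / l2).
Definition gfun A B x : R := cc * (K1 A x * E1 x + K2 B x * E2 x).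
Definition gder A B x : R :=
  cc * (l1 * (K1 A x * E1 x) - l2 * (K2 B x * E2 x) - (l1 + l2) * h x).

Lemma der_K1E1 A x : is_derive x 1 (fun y => K1 A y * E1 y) (l1 * (K1 A x * E1 x) - l1 * h x).
Proof.
apply: (der_eq (derM (der_K1 A x) (der_E1 x))).
by rewrite e1E; field; rewrite E1n0.
Qed.

Lemma der_K2E2 B x : is_derive x 1 (fun y => K2 B y * E2 y) (- l2 * (K2 B x * E2 x) - l2 * h x).
Proof.
apply: (der_eq (derM (der_K2 B x) (der_E2 x))).
by rewrite e2E; field; rewrite E2n0.
Qed.

Lemma der_vfun A B x : is_derive x 1 (vfun A B) (gfun A B x).
Proof.
apply: (der_eq (derZ cc (derB (derM (der_K1E1 A x) (der_cst l1^-1 x))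
  (derM (der_K2E2 B x) (der_cst l2^-1 x))))).
by rewrite /gfun; field; rewrite l1n0 l2n0.
Qed.

Lemma der_gfun A B x : is_derive x 1 (gfun A B) (gder A B x).
Proof.
apply: (der_eq (derZ cc (derD (der_K1E1 A x) (der_K2E2 B x)))).
by rewrite /gder; ring.
Qed.

(** With [p] and [q] for the two exponential terms, those in [p] cancel by the equation of the root
    [l1], those in [q] by that of [l2], and the cost by [ccE]. *)
Lemma vfun_ode A B x :
  sigma ^+ 2 / 2 * gder A B x + mu * gfun A B x - beta * vfun A B x + h x = 0.
Proof.
suff alg (p q hx : R) : sigma ^+ 2 / 2 * (cc * (l1 * p - l2 * q - (l1 + l2) * hx)) +
    mu * (cc * (p + q)) - beta * (cc * (p / l1 - q / l2)) + hx = 0 by exact: alg.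
have -> : sigma ^+ 2 / 2 * (cc * (l1 * p - l2 * q - (l1 + l2) * hx)) =
   cc * (sigma ^+ 2 / 2 * l1 * p - sigma ^+ 2 / 2 * l2 * q) - (sigma ^+ 2 / 2 * cc * (l1 + l2)) * hx by ring.
rewrite ccE; apply/eqP; rewrite mul1r.
have b1 : beta / l1 = sigma ^+ 2 / 2 * l1 + mu by apply: (mulIf l1n0); rewrite divfK// -[LHS]lambda1_root; ring.
have b2 : beta / l2 = sigma ^+ 2 / 2 * l2 - mu by apply: (mulIf l2n0); rewrite divfK// -[LHS]lambda2_root; ring.
have -> : beta * (cc * (p / l1 - q / l2)) = cc * (beta / l1 * p - beta / l2 * q).
  by field; rewrite l1n0 l2n0.
by rewrite b1 b2; apply/eqP; ring.
Qed.

Lemma gder_continuous A B : continuous (gder A B).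
Proof.
apply/contZ/contB/contZ/ch.
by apply: contB; apply: contZ; [exact: der_continuous (der_K1E1 A)|exact: der_continuous (der_K2E2 B)].
Qed.

End free_boundary_ode.

(** * Functions differentiable off one point *)

Section derivative_off_a_point.
Context {R : realType}.
Local Notation leb := (@lebesgue_measure R).
Implicit Types (f F : R -> R) (x p : R).

Lemma der_off_le f (df : R -> R) p a b : a <= b -> continuous f ->
  (forall x : R, x != p -> is_derive x 1 f (df x)) ->
  (forall x : R, a < x -> x < b -> x != p -> 0 <= df x) -> f a <= f b.
Proof.
move=> ab cf dfx df0.
have [pa|ap] := leP p a.
  by apply: (der_ge0_le ab cf) => x ax xb; [apply: dfx|apply: df0] => //; rewrite gt_eqF// (le_lt_trans pa).
have [bp|pb] := leP b p.
  by apply: (der_ge0_le ab cf) => x ax xb; [apply: dfx|apply: df0] => //; rewrite lt_eqF// (lt_le_trans xb).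
apply: (@le_trans _ _ (f p)).
  by apply: (der_ge0_le (ltW ap) cf) => x ax xp; [apply: dfx|apply: df0] => //;
    rewrite ?(lt_trans xp)// lt_eqF.
by apply: (der_ge0_le (ltW pb) cf) => x px xb; [apply: dfx|apply: df0] => //;
  rewrite ?(lt_trans ap)// gt_eqF.
Qed.

Lemma der_off_lt f (df : R -> R) p a b : a < b -> continuous f ->
  (forall x : R, x != p -> is_derive x 1 f (df x)) ->
  (forall x : R, a < x -> x < b -> x != p -> 0 < df x) -> f a < f b.
Proof.
move=> ab cf dfx df0.
have [pa|ap] := leP p a.
  by apply: (der_gt0_lt ab cf) => x ax xb; [apply: dfx|apply: df0] => //; rewrite gt_eqF// (le_lt_trans pa).
(* The strict increase is gained before [p]; beyond it the weak version suffices. *)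
apply: (@lt_le_trans _ _ (f (Num.min p b))).
  have ab' : a < Num.min p b by rewrite lt_min ap.
  apply: (der_gt0_lt ab' cf) => x ax; rewrite lt_min => /andP[xp xb]; [apply: dfx|apply: df0] => //.
    by rewrite lt_eqF.
  by rewrite lt_eqF.
have mb : Num.min p b <= b by rewrite ge_min lexx orbT.
apply: (der_off_le mb cf dfx) => x mx xb xp; apply/ltW/df0 => //.
by rewrite (lt_trans _ mx)// lt_min ap.
Qed.

Lemma der_off_ge f (df : R -> R) p a b : a <= b -> continuous f ->
  (forall x : R, x != p -> is_derive x 1 f (df x)) ->
  (forall x : R, a < x -> x < b -> x != p -> df x <= 0) -> f b <= f a.
Proof.
move=> ab cf dfx df0; rewrite -lerN2.
apply: (@der_off_le (fun x => - f x) (fun x => - df x) p) => //.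
- by move=> x; apply: cvgN; exact: cf.
- by move=> x xp; exact: derN (dfx x xp).
- by move=> x ax xb xp; rewrite oppr_ge0 df0.
Qed.

Lemma der_off_gt f (df : R -> R) p a b : a < b -> continuous f ->
  (forall x : R, x != p -> is_derive x 1 f (df x)) ->
  (forall x : R, a < x -> x < b -> x != p -> df x < 0) -> f b < f a.
Proof.
move=> ab cf dfx df0; rewrite -ltrN2.
apply: (@der_off_lt (fun x => - f x) (fun x => - df x) p) => //.
- by move=> x; apply: cvgN; exact: cf.
- by move=> x xp; exact: derN (dfx x xp).
- by move=> x ax xb xp; rewrite oppr_gt0 df0.
Qed.

(** Nothing is assumed of [f] at the end points, one of which will be the kink. The interval is
    exhausted by closed ones, and [0 <= f] lets monotone convergence pass to the limit. *)
Lemma Rintegral_derive_oo f F a b : a < b -> continuous F ->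
  (forall x : R, a < x -> x < b -> is_derive x 1 F (f x)) ->
  (forall x : R, a < x -> x < b -> {for x, continuous f}) ->
  (forall x : R, a < x -> x < b -> 0 <= f x) ->
  \int[leb]_(x in `]a, b[) f x = F b - F a.
Proof.
move=> ab cF dF cf f0.
(* The third keeps [a + e n] below [b - e n] already for [n = 0]. *)
pose e n : R := (b - a) / 3 * (n.+1%:R)^-1.
have e0 n : 0 < e n by rewrite mulr_gt0 ?invr_gt0// divr_gt0// subr_gt0.
have ab3 : 0 <= (b - a) / 3 by rewrite divr_ge0// subr_ge0 ltW.
have eb n : e n <= (b - a) / 3.
  by apply: ler_piMr => //; rewrite invf_le1 ?ltr0n// ler1n.
have emono m n : (m <= n)%N -> e n <= e m.
  by move=> mn; apply: ler_wpM2l => //; rewrite lef_pV2 ?posrE ?ltr0n// ler_nat.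
have cvge : e n @[n --> \oo] --> (0 : R).
  by rewrite -(mulr0 ((b - a) / 3)); apply: cvgM; [exact: cvg_cst|exact: cvg_harmonic].
pose S n : set R := `[a + e n, b - e n]%classic.
have Sin n x : S n x -> a < x /\ x < b.
  rewrite /S/= in_itv/= => /andP[ax xb]; have := e0 n; split; lra.
have SU : \bigcup_n S n = `]a, b[%classic.
  apply/seteqP; split=> [x [n _ /Sin[ax xb]]|x]; first by rewrite /= in_itv/= ax.
  rewrite /= in_itv/= => /andP[ax xb].
  have [N _ HN] := cvgr_lt 0 cvge (Num.min (x - a) (b - x)) ltac:(by rewrite lt_min !subr_gt0 ax).
  exists N => //; have := HN N (leqnn N); rewrite lt_min => /andP[? ?].
  by rewrite /S/= in_itv/=; apply/andP; split; lra.
have H := @ge0_nondecreasing_set_cvg_integral _ (measurableTypeR R) R S (EFin \o f) leb.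
have mf n : measurable_fun (S n) (EFin \o f).
  apply/measurable_EFinP; apply: (@measurable_funS _ _ _ _ `]a, b[) => //.
    by move=> x /Sin[ax xb]; rewrite /= in_itv/= ax.
  apply: open_continuous_measurable_fun; first exact: interval_open.
  by move=> x; rewrite inE/= in_itv/= => /andP[ax xb]; exact: cf.
have {}H := H _ _ mf _; rewrite SU in H.
have FS n : (\int[leb]_(x in S n) (EFin \o f) x = (F (b - e n) - F (a + e n))%:E)%E.
  have abn : a + e n < b - e n.
    by have := eb n; move: ab; set q := e n; move=> *; lra.
  rewrite /S (@continuous_FTC2 _ f F) ?EFinB//.
  - apply: continuous_in_subspaceT => x; rewrite inE => /Sin[ax xb]; exact: cf.
  - split; first by move=> x /[!in_itv]/= /andP[ax xb]; have [] := dF x ltac:(have := e0 n; lra) ltac:(have := e0 n; lra).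
      exact: cvg_at_right_filter (cF _).
    exact: cvg_at_left_filter (cF _).
  - move=> x /[!in_itv]/= /andP[ax xb]; rewrite derive1E.
    by have [_ <-] := dF x ltac:(have := e0 n; lra) ltac:(have := e0 n; lra).
have cb : b - e n @[n --> \oo] --> b by rewrite -{2}(subr0 b); apply: cvgB => //; exact: cvg_cst.
have ca : a + e n @[n --> \oo] --> a by rewrite -{2}(addr0 a); apply: cvgD => //; exact: cvg_cst.
have cFb : F (b - e n) @[n --> \oo] --> F b := cvg_comp _ _ cb (cF b).
have cFa : F (a + e n) @[n --> \oo] --> F a := cvg_comp _ _ ca (cF a).
have L : (F (b - e n) - F (a + e n))%:E @[n --> \oo] --> (F b - F a)%:E.
  by apply: cvg_EFin; [exact: nearW|exact: (cvgB cFb cFa)].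
rewrite /Rintegral; suff -> : (\int[leb]_(x in `]a, b[) (f x)%:E = (F b - F a)%:E)%E by [].
have {}H : (\int[leb]_(x in S n) (EFin \o f) x)%E @[n --> \oo] -->
    (\int[leb]_(x in `]a, b[) (f x)%:E)%E.
  apply: H.
  - move=> m n mn; apply/subsetPset => x; rewrite /S/= !in_itv/= => /andP[ax xb].
    by have emn := emono _ _ mn; apply/andP; split; lra.
  - by move=> n; exact: measurable_itv.
  - by move=> n x /Sin[ax xb]; rewrite lee_fin f0.
rewrite -(cvg_lim _ H)//; under eq_fun do rewrite FS.
exact: cvg_lim L.
Qed.

End derivative_off_a_point.

(** * Shape of the derivative of a solution *)

Section free_boundary_shape.
Context {R : realType}.
Local Notation leb := (@lebesgue_measure R).
Variables (mu sigma beta k ell : R) (h : R -> R) (a : R).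
Hypotheses (sigma0 : 0 < sigma) (beta0 : 0 < beta).
Hypothesis hh : holding_cost mu sigma beta k ell h a.
Local Notation h' := h^`()%classic.
Local Notation l1 := (lambda1 mu sigma beta).
Local Notation l2 := (lambda2 mu sigma beta).
Local Notation cc := (cc mu sigma beta).
Local Notation E1 := (E1 mu sigma beta a).
Local Notation E2 := (E2 mu sigma beta a).
Local Notation e1 := (e1 mu sigma beta a).
Local Notation e2 := (e2 mu sigma beta a).
Local Notation K1 := (K1 mu sigma beta h a).
Local Notation K2 := (K2 mu sigma beta h a).
Local Notation gfun := (gfun mu sigma beta h a).
Local Notation gder := (gder mu sigma beta h a).
Implicit Types (A B x y z : R).

Let ch : continuous h := holding_continuous hh.
Let l1_gt0 : 0 < l1. Proof. exact: lambda1_gt0. Qed.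
Let l2_gt0 : 0 < l2. Proof. exact: lambda2_gt0. Qed.
Let l1n0 : l1 != 0. Proof. exact: lt0r_neq0. Qed.
Let l2n0 : l2 != 0. Proof. exact: lt0r_neq0. Qed.
Let cc0 : 0 < cc. Proof. exact: cc_gt0. Qed.
Let ce1 : continuous e1. Proof. exact: der_continuous (der_e1 _ _ _ _). Qed.
Let ce2 : continuous e2. Proof. exact: der_continuous (der_e2 _ _ _ _). Qed.

Lemma continuous_cost_slope x : x != a -> {for x, continuous h'}.
Proof. by move=> xa; exact: der_cont (cost_der2 hh xa). Qed.

(** Integration by parts: off the kink [e y * h y - r * N y] is a primitive of the integrand, and it
    vanishes at [a] because [h] does. The two sides are treated apart since [h'] changes sign at
    [a]. *)
Lemma oriented_integral_slope (e : R -> R) (r : R) (N : R -> R) x :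
  (forall y, is_derive y 1 e (r * e y)) -> (forall y, 0 < e y) ->
  (forall y, is_derive y 1 N (e y * h y)) -> N a = 0 ->
  oriented_integral a x (fun y => e y * h' y) = e x * h x - r * N x.
Proof.
move=> de e0 dN Na.
have ce : continuous e by exact: der_continuous de.
pose F y := e y * h y - r * N y.
have Fa : F a = 0 by rewrite /F (holding_min hh) Na !mulr0 subrr.
have cF : continuous F.
  by apply: contB; [exact: contM|exact/contZ/(der_continuous dN)].
have dF y : y != a -> is_derive y 1 F (e y * h' y).
  move=> ya; apply: (der_eq (derB (derM (de y) (cost_der hh ya)) (derZ r (dN y)))); ring.
have cf y : y != a -> {for y, continuous (fun y => e y * h' y)}.
  by move=> ya; apply: (@cvgM _ _ _ _ e h'); [exact: ce|exact: continuous_cost_slope].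
rewrite /oriented_integral; case: leP => [|xa].
  rewrite le_eqVlt => /predU1P[<-|ax].
    by rewrite set_itvoo0 Rintegral_set0 -/(F a) Fa.
  rewrite -[RHS]subr0 -[in RHS]Fa; apply: (Rintegral_derive_oo ax cF) => y ay yx.
  - by apply: dF; rewrite gt_eqF.
  - by apply: cf; rewrite gt_eqF.
  - by rewrite mulr_ge0 ?(ltW (e0 y))// (holding_increasing hh).
have cF' : continuous (fun y => - F y) by move=> y; apply: cvgN; exact: cF.
have E : \int[leb]_(y in `]x, a[) (- (e y * h' y)) = - F a - - F x.
  apply: (Rintegral_derive_oo xa cF') => y xy ya.
  - by apply/derN/dF; rewrite lt_eqF.
  - by apply: cvgN; apply: cf; rewrite lt_eqF.
  - by rewrite oppr_ge0 mulr_ge0_le0 ?(ltW (e0 y))// (holding_decreasing hh).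
rewrite Fa oppr0 sub0r opprK in E; rewrite -/(F x) -E.
have H : (\int[leb]_(y in `]x, a[) (e y * h' y)%:E =
    - \int[leb]_(y in `]x, a[) (- (e y * h' y))%:E)%E.
  rewrite -integral_ge0N; first by apply: eq_integral => y _; rewrite EFinN oppeK.
  move=> y /=; rewrite in_itv/= => /andP[_ ya]; rewrite lee_fin oppr_ge0.
  by rewrite mulr_ge0_le0 ?(ltW (e0 y))// (holding_decreasing hh).
by rewrite /Rintegral H fineN opprK.
Qed.

Lemma gAB_gfun A B : gAB mu sigma beta h a A B = gfun A B.
Proof.
apply/funext => x; rewrite /gAB /gfun -/cc.
rewrite (oriented_integral_slope x (der_e1 _ _ _ _) (e1_gt0 _ _ _ _) (der_N1 hh) (N1_a _ _ _ _ _)).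
rewrite (oriented_integral_slope x (der_e2 _ _ _ _) (e2_gt0 _ _ _ _) (der_N2 hh) (N2_a _ _ _ _ _)).
rewrite -/(E1 x) -/(E2 x) /K1 /K2 e1E e2E.
have := lt0r_neq0 (E1_gt0 mu sigma beta a x); have := lt0r_neq0 (E2_gt0 mu sigma beta a x).
move=> E2n0 E1n0; congr (_ * _).
by field; rewrite E1n0 E2n0 l1n0 l2n0.
Qed.

(** The other exponential is eliminated between [gfun] and [gder]; [cc_beta] turns the remaining
    factor into [l1 * l2]. *)
Lemma gder1 A B x :
  l1 * l2 * (K1 A x * E1 x - h x) = beta * (l2 * gfun A B x + gder A B x).
Proof. rewrite -(cc_beta mu sigma0 beta0) /gfun /gder; ring. Qed.

Lemma gder2 A B x :
  l1 * l2 * (K2 B x * E2 x + h x) = beta * (l1 * gfun A B x - gder A B x).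
Proof. rewrite -(cc_beta mu sigma0 beta0) /gfun /gder; ring. Qed.

(* Up to positive factors these are the derivatives of [gder / E2] and
   [gder / E1]; divided by [E1], resp. [E2], they are nonincreasing, because
   [h'] is nondecreasing, so that [gder / E2] and [gder / E1] are unimodal. *)
Definition slope1 A B x : R := beta * gfun A B x + beta / l2 * gder A B x - h' x.
Definition slope2 A B x : R := beta * gfun A B x - beta / l1 * gder A B x - h' x.

Let slope1E A B x : slope1 A B x = l1 * (K1 A x * E1 x) - l1 * h x - h' x.
Proof.
rewrite /slope1; congr (_ - _); apply: (mulfI l2n0).
transitivity (beta * (l2 * gfun A B x + gder A B x)); first by field; rewrite l2n0.
by rewrite -gder1; ring.
Qed.

Let slope2E A B x : slope2 A B x = l2 * (K2 B x * E2 x) + l2 * h x - h' x.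
Proof.
rewrite /slope2; congr (_ - _); apply: (mulfI l1n0).
transitivity (beta * (l1 * gfun A B x - gder A B x)); first by field; rewrite l1n0.
by rewrite -gder2; ring.
Qed.

Definition ratio2 A B x : R := gder A B x * e2 x.
Definition ratio1 A B x : R := gder A B x * e1 x.

Lemma ratio2_continuous A B : continuous (ratio2 A B).
Proof. apply: contM ce2; exact: gder_continuous hh _ _. Qed.

Lemma ratio1_continuous A B : continuous (ratio1 A B).
Proof. apply: contM ce1; exact: gder_continuous hh _ _. Qed.

Lemma der_gder A B x : x != a -> is_derive x 1 (gder A B)
  (cc * (l1 * (l1 * (K1 A x * E1 x) - l1 * h x) - l2 * (- l2 * (K2 B x * E2 x) - l2 * h x)
   - (l1 + l2) * h' x)).
Proof.
move=> xa; exact: (derZ cc (derB (derB (derZ l1 (der_K1E1 hh A x))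
  (derZ l2 (der_K2E2 hh B x))) (derZ (l1 + l2) (cost_der hh xa)))).
Qed.

Lemma der_ratio2 A B x : x != a ->
  is_derive x 1 (ratio2 A B) (cc * (l1 + l2) * e2 x * slope1 A B x).
Proof.
move=> xa; apply: (der_eq (derM (der_gder A B xa) (der_e2 mu sigma beta a x))).
by rewrite slope1E /gder; ring.
Qed.

Lemma der_ratio1 A B x : x != a ->
  is_derive x 1 (ratio1 A B) (cc * (l1 + l2) * e1 x * slope2 A B x).
Proof.
move=> xa; apply: (der_eq (derM (der_gder A B xa) (der_e1 mu sigma beta a x))).
by rewrite slope2E /gder; ring.
Qed.

(** [h'] may jump at the kink, so it is frozen at its value [m] at [x]. The function [f] so obtained
    is continuous, its derivative [l1 * e1 z * (m - h' z)] is nonpositive beyond [x], and at [y] the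
    true slope only lowers the value further. *)
Lemma slope1_decr A B x y : x != a -> y != a -> x <= y ->
  e1 y * slope1 A B y <= e1 x * slope1 A B x.
Proof.
move=> xa ya xy; pose m := h' x.
pose f z := l1 * K1 A z - l1 * (e1 z * h z) - m * e1 z.
have eE z : e1 z * slope1 A B z = l1 * K1 A z - l1 * (e1 z * h z) - h' z * e1 z.
  by rewrite slope1E e1E; field; exact: lt0r_neq0 (E1_gt0 _ _ _ _ _).
have fyx : f y <= f x.
  refine (@der_off_ge _ f (fun z => l1 * e1 z * (m - h' z)) a x y xy _ _ _).
  - refine (contB (contB (contZ _) (contZ _)) (contZ ce1)); last exact: contM ce1 ch.
    exact: der_continuous (der_K1 hh A).
  - move=> z za; apply: (der_eq (derB (derB (derZ l1 (der_K1 hh A z))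
      (derZ l1 (derM (der_e1 mu sigma beta a z) (cost_der hh za)))) (derZ m (der_e1 mu sigma beta a z)))).
    ring.
  - move=> z xz zy za; apply: mulr_ge0_le0; rewrite ?subr_le0; first by rewrite mulr_ge0 ?expR_ge0 ?ltW.
    by apply: (cost_slope_le hh xa za); exact: ltW.
rewrite !eE; apply: (@le_trans _ _ (f y)); last exact: fyx.
rewrite lerD2l lerN2 ler_wpM2r ?expR_ge0//.
exact: (cost_slope_le hh xa ya xy).
Qed.

Lemma slope2_decr A B x y : x != a -> y != a -> x <= y ->
  e2 y * slope2 A B y <= e2 x * slope2 A B x.
Proof.
(* Here the slope is frozen at the right end, as the derivative of [f] is now
   [l2 * e2 z * (h' z - m)]. *)
move=> xa ya xy; pose m := h' y.
pose f z := l2 * K2 B z + l2 * (e2 z * h z) - m * e2 z.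
have eE z : e2 z * slope2 A B z = l2 * K2 B z + l2 * (e2 z * h z) - h' z * e2 z.
  by rewrite slope2E e2E; field; exact: lt0r_neq0 (E2_gt0 _ _ _ _ _).
have fyx : f y <= f x.
  refine (@der_off_ge _ f (fun z => l2 * e2 z * (h' z - m)) a x y xy _ _ _).
  - refine (contB (contD (contZ _) (contZ _)) (contZ ce2)); last exact: contM ce2 ch.
    exact: der_continuous (der_K2 hh B).
  - move=> z za; apply: (der_eq (derB (derD (derZ l2 (der_K2 hh B z))
      (derZ l2 (derM (der_e2 mu sigma beta a z) (cost_der hh za)))) (derZ m (der_e2 mu sigma beta a z)))).
    ring.
  - move=> z xz zy za; apply: mulr_ge0_le0; rewrite ?subr_le0; first by rewrite mulr_ge0 ?expR_ge0 ?ltW.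
    by apply: (cost_slope_le hh za ya); exact: ltW.
rewrite !eE; apply: (@le_trans _ _ (f x)); first exact: fyx.
rewrite lerD2l lerN2 ler_wpM2r ?expR_ge0//.
exact: (cost_slope_le hh xa ya xy).
Qed.

Lemma slope1_lt0 A B x y : x != a -> y != a -> x <= y -> slope1 A B x < 0 -> slope1 A B y < 0.
Proof.
move=> xa ya xy s0; have := slope1_decr A B xa ya xy.
rewrite -(pmulr_rlt0 _ (e1_gt0 mu sigma beta a y)) => /le_lt_trans; apply.
by rewrite pmulr_rlt0 ?e1_gt0.
Qed.

Lemma slope1_gt0 A B x y : x != a -> y != a -> x <= y -> 0 < slope1 A B y -> 0 < slope1 A B x.
Proof.
move=> xa ya xy s0; have := slope1_decr A B xa ya xy.
rewrite -(pmulr_rgt0 _ (e1_gt0 mu sigma beta a x)); apply: lt_le_trans.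
by rewrite pmulr_rgt0 ?e1_gt0.
Qed.

Lemma slope2_gt0 A B x y : x != a -> y != a -> x <= y -> 0 < slope2 A B y -> 0 < slope2 A B x.
Proof.
move=> xa ya xy s0; have := slope2_decr A B xa ya xy.
rewrite -(pmulr_rgt0 _ (e2_gt0 mu sigma beta a x)); apply: lt_le_trans.
by rewrite pmulr_rgt0 ?e2_gt0.
Qed.

Let cf0 x : 0 < cc * (l1 + l2) * e2 x.
Proof. by rewrite mulr_gt0 ?expR_gt0// mulr_gt0// addr_gt0. Qed.

Let cf1 x : 0 < cc * (l1 + l2) * e1 x.
Proof. by rewrite mulr_gt0 ?expR_gt0// mulr_gt0// addr_gt0. Qed.

Lemma ratio2_decreasing A B x y t : t != a -> slope1 A B t < 0 -> t <= x -> x < y ->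
  ratio2 A B y < ratio2 A B x.
Proof.
move=> ta st tx xy; refine (der_off_gt xy (@ratio2_continuous A B) (@der_ratio2 A B) _).
move=> z xz zy za; rewrite pmulr_rlt0//; apply: slope1_lt0 st => //.
by rewrite (le_trans tx)// ltW.
Qed.

Lemma ratio2_increasing A B x y t : t != a -> 0 < slope1 A B t -> y <= t -> x < y ->
  ratio2 A B x < ratio2 A B y.
Proof.
move=> ta st yt xy; refine (der_off_lt xy (@ratio2_continuous A B) (@der_ratio2 A B) _).
move=> z xz zy za; rewrite pmulr_rgt0//; apply: slope1_gt0 st => //.
by rewrite (le_trans _ yt)// ltW.
Qed.

Lemma ratio1_increasing A B x y t : t != a -> 0 < slope2 A B t -> y <= t -> x < y ->
  ratio1 A B x < ratio1 A B y.
Proof.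
move=> ta st yt xy; refine (der_off_lt xy (@ratio1_continuous A B) (@der_ratio1 A B) _).
move=> z xz zy za; rewrite pmulr_rgt0//; apply: slope2_gt0 st => //.
by rewrite (le_trans _ yt)// ltW.
Qed.

Lemma ratio2_drop A B x y : x < y -> ratio2 A B y < ratio2 A B x ->
  exists t, [/\ x < t, t < y, t != a & slope1 A B t < 0].
Proof.
move=> xy; apply: contraPP => H; apply/negP; rewrite -leNgt.
refine (der_off_le (ltW xy) (@ratio2_continuous A B) (@der_ratio2 A B) _) => z xz zy za.
by rewrite pmulr_rge0// leNgt; apply/negP => s0; apply: H; exists z.
Qed.

Lemma ratio2_rise A B x y : x < y -> ratio2 A B x < ratio2 A B y ->
  exists t, [/\ x < t, t < y, t != a & 0 < slope1 A B t].
Proof.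
move=> xy; apply: contraPP => H; apply/negP; rewrite -leNgt.
refine (der_off_ge (ltW xy) (@ratio2_continuous A B) (@der_ratio2 A B) _) => z xz zy za.
by rewrite pmulr_rle0// leNgt; apply/negP => s0; apply: H; exists z.
Qed.

Let ratio2_sgn A B x : [/\ (0 <= ratio2 A B x) = (0 <= gder A B x),
  (ratio2 A B x <= 0) = (gder A B x <= 0) & (gder A B x = 0 -> ratio2 A B x = 0)].
Proof.
by rewrite /ratio2 pmulr_lge0 ?expR_gt0// pmulr_lle0 ?expR_gt0//; split=> // ->; rewrite mul0r.
Qed.

(** [ratio2] has the sign of [gder] and is unimodal, and a unimodal function with two zeros is
    nonnegative between them and nonpositive outside. *)
Lemma gder_shape A B x1 x2 : x1 < x2 -> gder A B x1 = 0 -> gder A B x2 = 0 ->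
  [/\ forall x, x <= x1 -> gder A B x <= 0,
      forall x, x1 <= x -> x <= x2 -> 0 <= gder A B x &
      forall x, x2 <= x -> gder A B x <= 0].
Proof.
move=> x12 g1 g2; have [_ _ /(_ g1) r1] := ratio2_sgn A B x1.
have [_ _ /(_ g2) r2] := ratio2_sgn A B x2.
split=> x.
- rewrite le_eqVlt => /predU1P[->|xx1]; first by rewrite g1.
  have [_ <- _] := ratio2_sgn A B x; rewrite leNgt; apply/negP => rx.
  have [|t [xt tx1 ta st]] := @ratio2_drop A B x x1 xx1; first by rewrite r1.
  by have := ratio2_decreasing ta st (ltW tx1) x12; rewrite r1 r2 ltxx.
- rewrite le_eqVlt => /predU1P[<-|xx1]; first by rewrite g1.
  rewrite le_eqVlt => /predU1P[->|xx2]; first by rewrite g2.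
  have [<- _ _] := ratio2_sgn A B x; rewrite leNgt; apply/negP => rx.
  have [|t [xt tx1 ta st]] := @ratio2_drop A B x1 x xx1; first by rewrite r1.
  have [|s [xs sx2 sa ss]] := @ratio2_rise A B x x2 xx2; first by rewrite r2.
  have := slope1_lt0 ta sa (ltW (lt_trans tx1 xs)) st.
  by rewrite ltNge ltW.
- rewrite le_eqVlt => /predU1P[<-|xx1]; first by rewrite g2.
  have [_ <- _] := ratio2_sgn A B x; rewrite leNgt; apply/negP => rx.
  have [|t [xt tx1 ta st]] := @ratio2_rise A B x2 x xx1; first by rewrite r2.
  by have := ratio2_increasing ta st (ltW xt) x12; rewrite r1 r2 ltxx.
Qed.

(** A unimodal function that is constant on an interval takes its largest value there. *)
Lemma gder_flat A B x y : x < y -> (forall z, x <= z -> z <= y -> gder A B z = 0) ->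
  forall z, gder A B z <= 0.
Proof.
move=> xy H z; have [_ _ /(_ (H x (lexx _) (ltW xy))) rx] := ratio2_sgn A B x.
have [_ _ /(_ (H y (ltW xy) (lexx _))) ry] := ratio2_sgn A B y.
have [_ <- _] := ratio2_sgn A B z; rewrite leNgt; apply/negP => rz.
have [zx|xz] := ltP z x.
  have [|t [zt tx ta st]] := @ratio2_drop A B z x zx; first by rewrite rx.
  by have := ratio2_decreasing ta st (ltW tx) xy; rewrite rx ry ltxx.
have [yz|zy] := ltP y z.
  have [|t [yt tz ta st]] := @ratio2_rise A B y z yz; first by rewrite ry.
  by have := ratio2_increasing ta st (ltW yt) xy; rewrite rx ry ltxx.
by have [_ _ H0] := ratio2_sgn A B z; move: rz; rewrite H0 ?ltxx// H.
Qed.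

(** A negative [slope1] at [d] would make [ratio2] decrease from a nonpositive value down to [x1],
    where it vanishes. The resulting bound makes the generator inequality hold to the left of the
    band; the next lemma is its mirror image, with [ratio1]. *)
Lemma slope_left_bound A B d x1 : d != a -> d < x1 -> gder A B d <= 0 -> gder A B x1 = 0 ->
  h' d <= beta * gfun A B d.
Proof.
move=> da dx gd g1; have [_ _ /(_ g1) r1] := ratio2_sgn A B x1.
have s0 : 0 <= slope1 A B d.
  rewrite leNgt; apply/negP => s0; have := ratio2_decreasing da s0 (lexx _) dx.
  by rewrite r1 ltNge; have [_ -> _] := ratio2_sgn A B d; rewrite gd.
move: s0; rewrite /slope1 subr_ge0 => /le_trans; apply.
by rewrite gerDl mulr_ge0_le0// divr_ge0// ltW.
Qed.

Lemma slope_right_bound A B u x2 : u != a -> x2 < u -> gder A B u <= 0 -> gder A B x2 = 0 ->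
  beta * gfun A B u <= h' u.
Proof.
move=> ua xu gu g2.
have s0 : slope2 A B u <= 0.
  rewrite leNgt; apply/negP => s0; have := ratio1_increasing ua s0 (lexx _) xu.
  by rewrite /ratio1 g2 mul0r pmulr_lgt0 ?expR_gt0// ltNge gu.
move: s0; rewrite /slope2 subr_le0; apply: le_trans.
by rewrite lerDl oppr_ge0 mulr_ge0_le0// divr_ge0// ltW.
Qed.

Let cg A B : continuous (gfun A B).
Proof. exact: der_continuous (der_gfun hh A B). Qed.

(** If [x1] were at or beyond the kink, [h'] would be nonnegative after it while
    [beta * g + beta / l2 * g'] is negative near it. Then [ratio2] falls from 0, [gder] is negative,
    and [gfun] drops below its minimum. *)
Lemma min_left_of_kink A B x1 D : x1 < D -> gfun A B x1 < 0 -> gder A B x1 = 0 ->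
  (forall x, x1 <= x -> x <= D -> gfun A B x1 <= gfun A B x) -> x1 < a.
Proof.
move=> xD gneg g1 gmin; rewrite ltNge; apply/negP => ax.
pose s z := beta * gfun A B z + beta / l2 * gder A B z.
have cs : continuous s by apply: contD; apply: contZ => //; exact: gder_continuous hh _ _.
have s0 : s x1 < 0 by rewrite /s g1 mulr0 addr0 pmulr_rlt0.
have [e e0 He] : exists2 e, 0 < e & forall z, x1 <= z -> z < x1 + e -> s z < 0.
  have [e /= e0 He] := cvgr_lt (s x1) (cs x1) 0 s0.
  exists e => // z xz ze; apply: He => /=; rewrite ler0_norm ?subr_le0//; lra.
pose y := Num.min D (x1 + e / 2).
have xy : x1 < y by rewrite /y lt_min xD/= ltrDl divr_gt0.
have ye : y < x1 + e by rewrite /y gt_min ltrD2l gtr_pMr// invf_lt1// ltr1n orbT.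
have gx z : x1 < z -> z <= y -> gder A B z < 0.
  move=> xz zy; have : ratio2 A B z < ratio2 A B x1.
    refine (der_off_gt xz (@ratio2_continuous A B) (@der_ratio2 A B) _) => t xt tz ta.
    rewrite pmulr_rlt0// /slope1 -/(s t) subr_lt0.
    apply: (@lt_le_trans _ _ 0); first by apply: He; [exact: ltW|rewrite (lt_trans _ ye)// (lt_le_trans tz)].
    by apply: (holding_increasing hh); rewrite (le_lt_trans ax).
  by rewrite /ratio2 g1 mul0r pmulr_llt0 ?expR_gt0.
have : gfun A B y < gfun A B x1.
  apply: (der_lt0_gt xy (@cg A B) (fun z _ _ => der_gfun hh A B z)) => z xz zy.
  by apply: gx => //; exact: ltW.
by rewrite ltNge gmin ?(ltW xy)// /y ge_min lexx.
Qed.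

Lemma max_right_of_kink A B U x2 : U < x2 -> 0 < gfun A B x2 -> gder A B x2 = 0 ->
  (forall x, U <= x -> x <= x2 -> gfun A B x <= gfun A B x2) -> a < x2.
Proof.
move=> Ux gpos g2 gmax; rewrite ltNge; apply/negP => xa.
pose s z := beta * gfun A B z - beta / l1 * gder A B z.
have cs : continuous s by apply: contB; apply: contZ => //; exact: gder_continuous hh _ _.
have s0 : 0 < s x2 by rewrite /s g2 mulr0 subr0 mulr_gt0.
have [e e0 He] : exists2 e, 0 < e & forall z, z <= x2 -> x2 - e < z -> 0 < s z.
  have [e /= e0 He] := cvgr_gt (s x2) (cs x2) 0 s0.
  exists e => // z xz ze; apply: He => /=; rewrite ger0_norm ?subr_ge0//; lra.
pose y := Num.max U (x2 - e / 2).
have yx : y < x2 by rewrite /y gt_max Ux/= gtrDl oppr_lt0 divr_gt0.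
have ye : x2 - e < y by rewrite /y lt_max ltrD2l ltrN2 gtr_pMr// invf_lt1// ltr1n orbT.
have gx z : z < x2 -> y <= z -> gder A B z < 0.
  move=> zx yz; have : ratio1 A B z < ratio1 A B x2.
    refine (der_off_lt zx (@ratio1_continuous A B) (@der_ratio1 A B) _) => t zt tx ta.
    rewrite pmulr_rgt0// /slope2 -/(s t) subr_gt0.
    apply: (@le_lt_trans _ _ 0); last by apply: He; [exact: ltW|rewrite (lt_trans ye)// (le_lt_trans yz)].
    by apply: (holding_decreasing hh); rewrite (lt_le_trans tx).
  by rewrite /ratio1 g2 mul0r pmulr_llt0 ?expR_gt0.
have : gfun A B x2 < gfun A B y.
  apply: (der_lt0_gt yx (@cg A B) (fun z _ _ => der_gfun hh A B z)) => z xz zy.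
  by apply: gx => //; exact: ltW.
by rewrite ltNge gmax ?(ltW yx)// /y le_max lexx.
Qed.

End free_boundary_shape.

(** * Growth of the holding cost *)

Section free_boundary_growth.
Context {R : realType}.
Local Notation leb := (@lebesgue_measure R).
Variables (mu sigma beta k ell : R) (h : R -> R) (a : R).
Hypotheses (sigma0 : 0 < sigma) (beta0 : 0 < beta).
Hypothesis hh : holding_cost mu sigma beta k ell h a.
Local Notation h' := h^`()%classic.
Local Notation h'' := h^`(2)%classic.
Local Notation l1 := (lambda1 mu sigma beta).
Local Notation l2 := (lambda2 mu sigma beta).
Local Notation e1 := (e1 mu sigma beta a).
Local Notation e2 := (e2 mu sigma beta a).
Local Notation N1 := (N1 mu sigma beta h a).
Local Notation N2 := (N2 mu sigma beta h a).
Implicit Types (A B x y z : R).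

Let l1_gt0 : 0 < l1. Proof. exact: lambda1_gt0. Qed.
Let l2_gt0 : 0 < l2. Proof. exact: lambda2_gt0. Qed.
Let l1n0 : l1 != 0. Proof. exact: lt0r_neq0. Qed.
Let l2n0 : l2 != 0. Proof. exact: lt0r_neq0. Qed.
Let h0 x : 0 <= h x. Proof. exact: (holding_ge0 hh). Qed.

Lemma N1_le x y : x <= y -> N1 x <= N1 y.
Proof.
move=> xy; apply: (der_ge0_le xy (der_continuous (der_N1 hh)) (fun z _ _ => der_N1 hh z)).
by move=> z _ _; rewrite mulr_ge0// ltW ?expR_gt0.
Qed.

Lemma N2_le x y : x <= y -> N2 x <= N2 y.
Proof.
move=> xy; apply: (der_ge0_le xy (der_continuous (der_N2 hh)) (fun z _ _ => der_N2 hh z)).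
by move=> z _ _; rewrite mulr_ge0// ltW ?expR_gt0.
Qed.

(* Integrating the given bound on the weighted integral of [h''] twice. *)
Let weighted_bound (r : R) (F : R -> R) (D : set R) b c : measurable D -> D `<=` ~` [set a] ->
  b < c -> `[b, c]%classic `<=` D -> open D ->
  (forall y, y != a -> is_derive y 1 F (expR (r * y) * h'' y)) ->
  (\int[leb]_(y in D) (expR (r * y) * h'' y)%:E < +oo)%E ->
  F c - F b <= fine (\int[leb]_(y in D) (expR (r * y) * h'' y)%:E).
Proof.
move=> mD Da bc bcD oD dF fin.
pose f y := expR (r * y) * h'' y.
have f0 y : D y -> 0 <= f y.
  by move=> Dy; rewrite mulr_ge0 ?expR_ge0// (cost_der2_ge0 hh)//; apply/eqP; exact: Da.
have cf y : D y -> {for y, continuous f}.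
  move=> Dy; apply: (@cvgM _ _ _ _ (fun y => expR (r * y)) h'').
    exact: der_cont (der_expRM r y).
  by apply: (holding_continuous2 hh); apply/eqP; exact: Da.
have H : (\int[leb]_(y in `[b, c]) (f y)%:E <= \int[leb]_(y in D) (f y)%:E)%E.
  apply: ge0_subset_integral => //.
  - have mf : measurable_fun D f.
      by apply: open_continuous_measurable_fun => // y; rewrite inE; exact: cf.
    exact/measurable_EFinP.
have E : (\int[leb]_(y in `[b, c]) (f y)%:E = (F c - F b)%:E)%E.
  have dFy y : `[b, c]%classic y -> is_derive y 1 F (f y).
    by move=> /bcD Dy; apply: dF; apply/eqP; exact: Da.
  rewrite (@continuous_FTC2 _ f F) ?EFinB//.
  - by apply: continuous_in_subspaceT => y; rewrite inE => /bcD; exact: cf.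
  - have cFb : {for b, continuous F} by apply: (der_cont (dFy b _)); rewrite /= in_itv/= lexx ltW.
    have cFc : {for c, continuous F} by apply: (der_cont (dFy c _)); rewrite /= in_itv/= lexx ltW.
    split; last 2 first.
    + exact: cvg_at_right_filter cFb.
    + exact: cvg_at_left_filter cFc.
    + move=> y /[!in_itv]/= /andP[by' yc].
      by have [] : is_derive y 1 F (f y) by apply: dFy; rewrite /= in_itv/= !ltW.
  - move=> y /[!in_itv]/= /andP[by' yc]; rewrite derive1E.
    by have [_ <-] : is_derive y 1 F (f y) by apply: dFy; rewrite /= in_itv/= !ltW.
rewrite -lee_fin -E (le_trans H)// fineK// ge0_fin_numE// integral_ge0//.
Qed.

Lemma N1_bounded : has_ubound (range N1).
Proof.
(* Two integrations by parts: off the kink [G] is a primitive of the integrand of the hypothesis,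
   and [expR (- l1 * a)] converts its weight to [e1]. Right of [a] the other terms of [G] are
   nonnegative, so a bound on [G] bounds [N1]. *)
pose G y := expR (- l1 * y) * (h' y + l1 * h y) + l1 ^+ 2 * expR (- l1 * a) * N1 y.
have dG y : y != a -> is_derive y 1 G (expR (- l1 * y) * h'' y).
  move=> ya; have de := der_expRM (- l1) y.
  apply: (der_eq (derD (derM de (derD (cost_der2 hh ya) (derZ l1 (cost_der hh ya))))
    (derZ (l1 ^+ 2 * expR (- l1 * a)) (der_N1 hh y)))).
  have -> : expR (- l1 * y) = expR (- l1 * a) * e1 y by rewrite -expRD; congr expR; ring.
  ring.
pose I := fine (\int[leb]_(y in `]a, +oo[) (expR (- l1 * y) * h'' y)%:E).
have c0 : 0 < l1 ^+ 2 * expR (- l1 * a) by rewrite mulr_gt0 ?exprn_gt0 ?expR_gt0.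
(* The estimate starts one unit beyond the kink, where [G] is differentiable; up to there the
   monotonicity of [N1] suffices. *)
exists (Num.max (N1 (a + 1)) ((G (a + 1) + I) / (l1 ^+ 2 * expR (- l1 * a)))) => _ [x _ <-].
rewrite le_max; have [xa|ax] := leP x (a + 1); first by rewrite N1_le.
apply/orP; right; rewrite ler_pdivlMr//.
have Da : `]a, +oo[%classic `<=` ~` [set a].
  by move=> y /=; rewrite in_itv/= andbT => ay ya; rewrite ya ltxx in ay.
have bxD : `[a + 1, x]%classic `<=` `]a, +oo[%classic.
  by move=> y /=; rewrite !in_itv/= => /andP[+ _]; rewrite andbT; apply: lt_le_trans; rewrite ltrDl.
have := weighted_bound (measurable_itv _) Da ax bxD (interval_open _ _) dG
  (holding_integral_pinfty hh).
rewrite -/I lerBlDl => /(_ isT isT) HI; apply: le_trans HI.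
rewrite /G mulrC lerDr; apply: mulr_ge0; first exact: expR_ge0.
apply: addr_ge0; last exact: mulr_ge0 (ltW l1_gt0) (h0 x).
by apply: (holding_increasing hh); rewrite (lt_trans _ ax)// ltrDl.
Qed.

Lemma N2_bounded : has_lbound (range N2).
Proof.
pose G y := expR (l2 * y) * (h' y - l2 * h y) + l2 ^+ 2 * expR (l2 * a) * N2 y.
have dG y : y != a -> is_derive y 1 G (expR (l2 * y) * h'' y).
  move=> ya; have de := der_expRM l2 y.
  apply: (der_eq (derD (derM de (derB (cost_der2 hh ya) (derZ l2 (cost_der hh ya))))
    (derZ (l2 ^+ 2 * expR (l2 * a)) (der_N2 hh y)))).
  have -> : expR (l2 * y) = expR (l2 * a) * e2 y by rewrite -expRD; congr expR; ring.
  ring.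
pose I := fine (\int[leb]_(y in `]-oo, a[) (expR (l2 * y) * h'' y)%:E).
have c0 : 0 < l2 ^+ 2 * expR (l2 * a) by rewrite mulr_gt0 ?exprn_gt0 ?expR_gt0.
exists (Num.min (N2 (a - 1)) ((G (a - 1) - I) / (l2 ^+ 2 * expR (l2 * a)))) => _ [x _ <-].
rewrite ge_min; have [xa|ax] := leP (a - 1) x; first by rewrite N2_le.
apply/orP; right; rewrite ler_pdivrMr//.
have Da : `]-oo, a[%classic `<=` ~` [set a].
  by move=> y /=; rewrite in_itv/= => ay ya; rewrite ya ltxx in ay.
have bxD : `[x, a - 1]%classic `<=` `]-oo, a[%classic.
  move=> y /=; rewrite !in_itv/= => /andP[_ +]; move/le_lt_trans; apply.
  by rewrite gtrDl oppr_lt0.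
have := weighted_bound (measurable_itv _) Da ax bxD (interval_open _ _) dG
  (holding_integral_ninfty hh).
rewrite -/I lerBlDl -lerBlDr => /(_ isT isT) HI; apply: (le_trans HI).
rewrite /G [leRHS]mulrC gerDr mulr_ge0_le0 ?expR_ge0// subr_le0.
apply: (@le_trans _ _ 0); last exact: mulr_ge0 (ltW l2_gt0) (h0 x).
by apply: (holding_decreasing hh); rewrite (lt_trans ax)// gtrDl oppr_lt0.
Qed.

(** The limits of the monotone functions [N1] at plus infinity and [N2] at minus infinity. *)
Definition n1 : R := sup (range N1).
Definition n2 : R := inf (range N2).

Lemma N1_n1 x : N1 x <= n1.
Proof. by apply: ub_le_sup; [exact: N1_bounded|exists x]. Qed.

Lemma n2_N2 x : n2 <= N2 x.
Proof. by apply: ge_inf; [exact: N2_bounded|exists x]. Qed.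

Lemma N1_near e : 0 < e -> exists x, forall y, x <= y -> n1 - e < N1 y.
Proof.
move=> e0; have [|_ [x _ <-] H] := @sup_adherent _ (range N1) e e0.
  by split; [exists (N1 0), 0|exact: N1_bounded].
by exists x => y xy; apply: lt_le_trans H _; exact: N1_le.
Qed.

Lemma N2_near e : 0 < e -> exists x, forall y, y <= x -> N2 y < n2 + e.
Proof.
move=> e0; have [|_ [x _ <-] H] := @inf_adherent _ (range N2) e e0.
  by split; [exists (N2 0), 0|exact: N2_bounded].
by exists x => y xy; apply: le_lt_trans H; exact: N2_le.
Qed.

(** The left side is the integral of [e1 y * (m * y + n)] over all [y] beyond [x]. The sum [f] is
    nondecreasing, and far out its second term is below any [e]. *)
Lemma N1_affine m n x : (forall y, m * y + n <= h y) ->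
  e1 x * ((m * x + n + m / l1) / l1) <= n1 - N1 x.
Proof.
move=> mn; rewrite lerBrDl; pose f y := N1 y + e1 y * ((m * y + n + m / l1) / l1).
have df y : is_derive y 1 f (e1 y * (h y - (m * y + n))).
  apply: (der_eq (derD (der_N1 hh y) (derM (der_e1 mu sigma beta a y)
    (derM (derD (der_affine m n y) (der_cst (m / l1) y)) (der_cst l1^-1 y))))).
  by field; rewrite l1n0.
have fle y : x <= y -> f x <= f y.
  move=> xy; apply: (der_ge0_le xy (der_continuous df) (fun z _ _ => df z)) => z _ _.
  by rewrite mulr_ge0 ?expR_ge0// subr_ge0.
rewrite -/(f x); apply/ler_addgt0Pr => e e0.
have [T HT] := @expR_affine_small _ (m / l1 / l1) ((m * a + n + m / l1) / l1) e e0.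
pose y := Num.max x (a + T / l1).
have xy : x <= y by rewrite /y le_max lexx.
have Ty : T <= l1 * (y - a).
  have : a + T / l1 <= y by rewrite /y le_max lexx orbT.
  by rewrite -lerBrDl ler_pdivrMr// mulrC.
apply: (le_trans (fle y xy)); rewrite /f lerD ?N1_n1//.
have := HT _ Ty; rewrite /e1 -mulNr; congr (_ * _ <= _).
by field; rewrite l1n0.
Qed.

Lemma N2_affine m n x : (forall y, m * y + n <= h y) ->
  e2 x * ((m * x + n - m / l2) / l2) <= N2 x - n2.
Proof.
move=> mn; rewrite lerBrDl -lerBrDr; pose f y := N2 y - e2 y * ((m * y + n - m / l2) / l2).
have df y : is_derive y 1 f (e2 y * (h y - (m * y + n))).
  apply: (der_eq (derB (der_N2 hh y) (derM (der_e2 mu sigma beta a y)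
    (derM (derB (der_affine m n y) (der_cst (m / l2) y)) (der_cst l2^-1 y))))).
  by field; rewrite l2n0.
have fle y : y <= x -> f y <= f x.
  move=> xy; apply: (der_ge0_le xy (der_continuous df) (fun z _ _ => df z)) => z _ _.
  by rewrite mulr_ge0 ?expR_ge0// subr_ge0.
rewrite -/(f x); apply/ler_addgt0Pr => e e0.
have [T HT] := @expR_affine_small _ (- (m / l2 / l2)) ((m * a + n - m / l2) / l2) e e0.
pose y := Num.min x (a - T / l2).
have xy : y <= x by rewrite /y ge_min lexx.
have Ty : T <= l2 * (a - y).
  have : y <= a - T / l2 by rewrite /y ge_min lexx orbT.
  by rewrite lerBrDl -lerBrDr ler_pdivrMr// mulrC.
rewrite -lerBlDr; apply: le_trans (fle y xy); rewrite /f lerB ?n2_N2//.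
have := HT _ Ty; rewrite /e2 -mulrN opprB; congr (_ * _ <= _).
by field; rewrite l2n0.
Qed.

End free_boundary_growth.

(** * The resolvent of the holding cost *)

Section free_boundary_existence.
Context {R : realType}.
Variables (mu sigma beta k ell : R) (h : R -> R) (a : R).
Hypotheses (sigma0 : 0 < sigma) (beta0 : 0 < beta).
Hypothesis hh : holding_cost mu sigma beta k ell h a.
Local Notation h' := h^`()%classic.
Local Notation l1 := (lambda1 mu sigma beta).
Local Notation l2 := (lambda2 mu sigma beta).
Local Notation cc := (cc mu sigma beta).
Local Notation E1 := (E1 mu sigma beta a).
Local Notation E2 := (E2 mu sigma beta a).
Local Notation e1 := (e1 mu sigma beta a).
Local Notation e2 := (e2 mu sigma beta a).
Local Notation N1 := (N1 mu sigma beta h a).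
Local Notation N2 := (N2 mu sigma beta h a).
Local Notation n1 := (n1 mu sigma beta h a).
Local Notation n2 := (n2 mu sigma beta h a).
Local Notation vfun := (vfun mu sigma beta h a).
Local Notation gfun := (gfun mu sigma beta h a).
Local Notation gder := (gder mu sigma beta h a).
Implicit Types (A B x y z al ga : R).

Let ch : continuous h := holding_continuous hh.
Let l1_gt0 : 0 < l1. Proof. exact: lambda1_gt0. Qed.
Let l2_gt0 : 0 < l2. Proof. exact: lambda2_gt0. Qed.
Let l1n0 : l1 != 0. Proof. exact: lt0r_neq0. Qed.
Let l2n0 : l2 != 0. Proof. exact: lt0r_neq0. Qed.
Let cc0 : 0 < cc. Proof. exact: cc_gt0. Qed.
Let h0 x : 0 <= h x. Proof. exact: (holding_ge0 hh). Qed.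

(* For [al = ga = 0] this is the resolvent of [h], i.e. the cost of never
   adjusting; it is the only solution without exponential growth. *)
Definition rval al ga : R -> R := vfun (l1 ^+ 2 * n1 - al) (l2 ^+ 2 * n2 + ga).
Definition rfun al ga : R -> R := gfun (l1 ^+ 2 * n1 - al) (l2 ^+ 2 * n2 + ga).
Definition rder al ga : R -> R := gder (l1 ^+ 2 * n1 - al) (l2 ^+ 2 * n2 + ga).

Lemma rvalE al ga x :
  rval al ga x = rval 0 0 x - al * (cc / l1 ^+ 2 * E1 x) - ga * (cc / l2 ^+ 2 * E2 x).
Proof. by rewrite /rval /vfun /K1 /K2; field; rewrite l1n0 l2n0. Qed.

Lemma rfunE al ga x :
  rfun al ga x = rfun 0 0 x - al * (cc / l1 * E1 x) + ga * (cc / l2 * E2 x).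
Proof. by rewrite /rfun /gfun /K1 /K2; field; rewrite l1n0 l2n0. Qed.

Lemma rderE al ga x :
  rder al ga x = cc * ((l1 ^+ 2 * (n1 - N1 x) - al) * E1 x +
    (l2 ^+ 2 * (N2 x - n2) - ga) * E2 x - (l1 + l2) * h x).
Proof. by rewrite /rder /gder /K1 /K2; field; rewrite l1n0 l2n0. Qed.

Lemma der_rval al ga x : is_derive x 1 (rval al ga) (rfun al ga x).
Proof. exact: (der_vfun sigma0 beta0 hh). Qed.

Lemma der_rfun al ga x : is_derive x 1 (rfun al ga) (rder al ga x).
Proof. exact: (der_gfun hh). Qed.

(** The left side is the resolvent of the affine minorant: its second term is the drift correction
    [mu * m / beta ^+ 2], expressed by the roots. *)
Lemma rval_affine m n x : (forall y, m * y + n <= h y) ->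
  (m * x + n) / beta + cc * m * (l1 ^- 2 - l2 ^- 2) <= rval 0 0 x.
Proof.
move=> mn; have H1 := N1_affine sigma0 beta0 hh x mn; have H2 := N2_affine sigma0 beta0 hh x mn.
have -> : rval 0 0 x = cc * ((n1 - N1 x) * E1 x + (N2 x - n2) * E2 x).
  by rewrite /rval /vfun /K1 /K2; field; rewrite l1n0 l2n0.
have bE : beta^-1 = cc * (l1^-1 + l2^-1).
  apply: (mulfI (lt0r_neq0 beta0)); rewrite divff ?lt0r_neq0//.
  transitivity (cc * beta * (l1 + l2) / (l1 * l2)); last by field; rewrite l1n0 l2n0.
  by rewrite cc_beta// divff// mulf_neq0.
have G1 : (m * x + n + m / l1) / l1 <= (n1 - N1 x) * E1 x.
  by rewrite -ler_pdivrMr ?expR_gt0// mulrC -e1E.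
have G2 : (m * x + n - m / l2) / l2 <= (N2 x - n2) * E2 x.
  by rewrite -ler_pdivrMr ?expR_gt0// mulrC -e2E.
apply: le_trans (ler_wpM2l (ltW cc0) (lerD G1 G2)).
rewrite le_eqVlt; apply/orP; left; apply/eqP.
by rewrite bE; field; rewrite l1n0 l2n0.
Qed.

(** The resolvent inherits convexity: if [h] is replaced by its supporting line at [x] in both
    tails, the right side of [rderE] becomes exactly zero. *)
Lemma rder_ge0 x : 0 <= rder 0 0 x.
Proof.
have [m mx] := cost_subgradient hh x.
have mn y : m * y + (h x - m * x) <= h y.
  by rewrite (le_trans _ (mx y))// le_eqVlt; apply/orP; left; apply/eqP; ring.
have H1 := N1_affine sigma0 beta0 hh x mn; have H2 := N2_affine sigma0 beta0 hh x mn.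
rewrite rderE !subr0; apply: mulr_ge0; first exact: ltW.
have G1 : (h x + m / l1) / l1 <= (n1 - N1 x) * E1 x.
  rewrite -ler_pdivrMr ?expR_gt0// mulrC -e1E.
  by move: H1; congr (_ * (_ / _) <= _); ring.
have G2 : (h x - m / l2) / l2 <= (N2 x - n2) * E2 x.
  rewrite -ler_pdivrMr ?expR_gt0// mulrC -e2E.
  by move: H2; congr (_ * (_ / _) <= _); ring.
have l12 : 0 <= l1 ^+ 2 by exact: sqr_ge0.
have l22 : 0 <= l2 ^+ 2 by exact: sqr_ge0.
have -> : (l1 + l2) * h x = l1 ^+ 2 * ((h x + m / l1) / l1) + l2 ^+ 2 * ((h x - m / l2) / l2).
  by field; rewrite l1n0 l2n0.
rewrite subr_ge0 -[l1 ^+ 2 * _ * _]mulrA -[l2 ^+ 2 * _ * _]mulrA.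
by apply: lerD; exact: ler_wpM2l.
Qed.

Lemma rfun_le x y : x <= y -> rfun 0 0 x <= rfun 0 0 y.
Proof.
move=> xy; apply: (der_ge0_le xy (der_continuous (der_rfun 0 0)) (fun z _ _ => der_rfun 0 0 z)).
by move=> z _ _; exact: rder_ge0.
Qed.

Lemma rval_chord_left x y : x <= y -> rfun 0 0 x * (y - x) <= rval 0 0 y - rval 0 0 x.
Proof.
rewrite le_eqVlt => /predU1P[->|xy]; first by rewrite !subrr mulr0.
have [c [xc cy ->]] := der_MVT xy (der_continuous (der_rval 0 0)) (fun z _ _ => der_rval 0 0 z).
by rewrite ler_wpM2r ?subr_ge0 ?rfun_le// ltW.
Qed.

Lemma rval_chord_right x y : x <= y -> rval 0 0 y - rval 0 0 x <= rfun 0 0 y * (y - x).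
Proof.
rewrite le_eqVlt => /predU1P[->|xy]; first by rewrite !subrr mulr0.
have [c [xc cy ->]] := der_MVT xy (der_continuous (der_rval 0 0)) (fun z _ _ => der_rval 0 0 z).
by rewrite ler_wpM2r ?subr_ge0 ?rfun_le// ltW.
Qed.

(** The resolvent lies above that of a supporting line of slope [m < - (k * beta)], hence above a
    line of slope [m / beta]. By convexity its derivative at [x] is at most the slope of the chord
    to 0. *)
Lemma rfun_left : exists x0 e, 0 < e /\ forall x, x <= x0 -> rfun 0 0 x <= - k - e.
Proof.
have [z [za hz]] := cost_slope_left hh.
pose m := h' z; pose dl := - k - m / beta.
have dl0 : 0 < dl by rewrite /dl subr_gt0 ltr_pdivrMr// mulNr.
pose n := h z - m * z.
have mn y : m * y + n <= h y.
  rewrite (le_trans _ (cost_tangent hh y (negbT (lt_eqF za))))// /n -/m.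
  by rewrite le_eqVlt; apply/orP; left; apply/eqP; ring.
pose C := rval 0 0 0 - (n / beta + cc * m * (l1 ^- 2 - l2 ^- 2)).
(* Beyond this point half of the slack [dl] absorbs the constant [C]. *)
exists (- (2 * `|C| / dl + 1)), (dl / 2); split; first by rewrite divr_gt0.
move=> x xx0; have Cn := normr_ge0 C.
have q0 : 0 <= 2 * `|C| / dl by rewrite divr_ge0 ?mulr_ge0// ltW.
have x0 : x < 0 by lra.
have := rval_chord_left (ltW x0); rewrite sub0r => H.
have H2 := rval_affine x mn.
have H3 : rfun 0 0 x * - x <= C - m / beta * x.
  apply: (le_trans H); rewrite /C.
  have -> : m / beta * x = (m * x + n) / beta - n / beta by rewrite mulrDl; ring.
  by move: H2; set q := (_ + n) / beta; lra.
have H4 : C <= dl / 2 * - x.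
  rewrite (le_trans (ler_norm C))//.
  have : 2 * `|C| / dl <= - x by lra.
  by rewrite ler_pdivrMr//; nra.
rewrite -(ler_pM2r (_ : 0 < - x)) ?oppr_gt0// (le_trans H3)//.
have -> : (- k - dl / 2) * - x = dl / 2 * - x - m / beta * x by rewrite /dl; field; exact: lt0r_neq0.
by rewrite lerD2r.
Qed.

Lemma rfun_right : exists x0 e, 0 < e /\ forall x, x0 <= x -> ell + e <= rfun 0 0 x.
Proof.
have [z [az hz]] := cost_slope_right hh.
pose m := h' z; pose dl := m / beta - ell.
have dl0 : 0 < dl by rewrite /dl subr_gt0 ltr_pdivlMr.
pose n := h z - m * z.
have mn y : m * y + n <= h y.
  rewrite (le_trans _ (cost_tangent hh y (negbT (gt_eqF az))))// /n -/m.
  by rewrite le_eqVlt; apply/orP; left; apply/eqP; ring.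
pose C := (n / beta + cc * m * (l1 ^- 2 - l2 ^- 2)) - rval 0 0 0.
exists (2 * `|C| / dl + 1), (dl / 2); split; first by rewrite divr_gt0.
move=> x xx0; have Cn := normr_ge0 C.
have q0 : 0 <= 2 * `|C| / dl by rewrite divr_ge0 ?mulr_ge0// ltW.
have x0 : 0 < x by lra.
have := rval_chord_right (ltW x0); rewrite subr0 => H.
have H2 := rval_affine x mn.
have H3 : C + m / beta * x <= rfun 0 0 x * x.
  apply: le_trans H; rewrite /C.
  have -> : m / beta * x = (m * x + n) / beta - n / beta by rewrite mulrDl; ring.
  by move: H2; set q := (_ + n) / beta; lra.
have H4 : - C <= dl / 2 * x.
  rewrite (le_trans (ler_norm (- C)))// normrN.
  have : 2 * `|C| / dl <= x by lra.
  by rewrite ler_pdivrMr//; nra.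
rewrite -(ler_pM2r x0) (le_trans _ H3)//.
have -> : (ell + dl / 2) * x = - (dl / 2 * x) + m / beta * x by rewrite /dl; field; exact: lt0r_neq0.
by rewrite lerD2r lerNl.
Qed.

Lemma E1_le1 x : x <= a -> E1 x <= 1.
Proof. by move=> xa; rewrite -[leRHS]expR0 ler_expR mulr_ge0_le0 ?subr_le0// ltW. Qed.

Lemma E2_le1 x : a <= x -> E2 x <= 1.
Proof. by move=> ax; rewrite -[leRHS]expR0 ler_expR mulr_le0_ge0 ?subr_ge0// oppr_le0 ltW. Qed.

(** Right of [a] the cost is nondecreasing, so it dominates the discounted mean of its past. This
    absorbs the decreasing exponential where the increasing one has to decide the sign of [rder]. *)
Lemma N2_le_cost x : a <= x -> l2 * N2 x * E2 x <= h x.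
Proof.
move=> ax; pose f y := e2 y * h y - l2 * N2 y.
have df y : y != a -> is_derive y 1 f (e2 y * h' y).
  move=> ya; apply: (der_eq (derB (derM (der_e2 mu sigma beta a y) (cost_der hh ya))
    (derZ l2 (der_N2 hh y)))); ring.
have cf : continuous f.
  by apply: contB; [apply: contM ch; exact: der_continuous (der_e2 _ _ _ _)|
    apply: contZ; exact: der_continuous (der_N2 hh)].
have : f a <= f x.
  refine (der_off_le ax cf df _) => y ay yx ya.
  by rewrite mulr_ge0 ?expR_ge0// (holding_increasing hh).
rewrite /f (holding_min hh) N2_a !mulr0 subr0 subr_ge0.
by rewrite e2E [leRHS]mulrC ler_pdivlMr ?expR_gt0.
Qed.

Lemma N1_ge_cost x : x <= a -> - (l1 * N1 x * E1 x) <= h x.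
Proof.
move=> xa; pose f y := e1 y * h y + l1 * N1 y.
have df y : y != a -> is_derive y 1 f (e1 y * h' y).
  move=> ya; apply: (der_eq (derD (derM (der_e1 mu sigma beta a y) (cost_der hh ya))
    (derZ l1 (der_N1 hh y)))); ring.
have cf : continuous f.
  by apply: contD; [apply: contM ch; exact: der_continuous (der_e1 _ _ _ _)|
    apply: contZ; exact: der_continuous (der_N1 hh)].
have : f a <= f x.
  refine (der_off_ge xa cf df _) => y xy ya yna.
  by rewrite mulr_ge0_le0 ?expR_ge0// (holding_decreasing hh).
rewrite /f (holding_min hh) N1_a !mulr0 addr0 -lerBlDr sub0r.
by rewrite e1E [leRHS]mulrC ler_pdivlMr ?expR_gt0// mulNr.
Qed.

(** Far to the right the tail [n1 - N1 z] no longer compensates [al], so the increasing exponential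
    has a coefficient of at most [- (al / 2)]. The remaining terms are absorbed by [h] or bounded by
    [C - 1]. *)
Lemma rfun_steep_right al ga : 0 < al -> 0 <= ga ->
  exists x0, forall x y, x0 <= x -> x <= y -> rfun al ga y <= rfun al ga x - cc * (y - x).
Proof.
move=> al0 ga0.
have [|x1 Hx1] := N1_near sigma0 beta0 hh (e := al / 2 / l1 ^+ 2).
  by rewrite !divr_gt0// exprn_gt0.
pose C := l2 ^+ 2 * `|n2| + 1; have C0 : 0 <= C by rewrite addr_ge0// mulr_ge0// sqr_ge0.
pose x2 := a + 2 * C / al / l1.
exists (Num.max x1 (Num.max a x2)) => x y.
rewrite !ge_max => /andP[xx1 /andP[xa xx2]] xy.
have rneg z : x <= z -> rder al ga z <= - cc.
  move=> xz; rewrite rderE -[leRHS]mulrN1 ler_wpM2l ?(ltW cc0)//.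
  have az := le_trans xa xz; have h1 := N2_le_cost az; have h2 := E2_le1 az.
  have p1 : l1 ^+ 2 * (n1 - N1 z) - al <= - (al / 2).
    have := Hx1 z (le_trans xx1 xz); rewrite ltrBlDr -ltrBlDl ltr_pdivlMr ?exprn_gt0//.
    by rewrite mulrC; move: (_ * (n1 - _)) => *; lra.
  have p2 : C <= al / 2 * E1 z.
    have e1z : 1 + l1 * (z - a) <= E1 z by exact: expR_ge1Dx.
    have : 2 * C / al <= l1 * (z - a).
      have := le_trans xx2 xz; rewrite /x2 -lerBrDl ler_pdivrMr// [_ * l1]mulrC; exact.
    by rewrite ler_pdivrMr// => H; nra.
  have e2z := E2_gt0 mu sigma beta a z; have e1z := E1_gt0 mu sigma beta a z.
  have q1 : (l1 ^+ 2 * (n1 - N1 z) - al) * E1 z <= - C.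
    by apply: (le_trans (ler_wpM2r (ltW e1z) p1)); rewrite mulNr lerN2.
  have q2 : l2 ^+ 2 * N2 z * E2 z <= l2 * h z.
    have -> : l2 ^+ 2 * N2 z * E2 z = l2 * (l2 * N2 z * E2 z) by ring.
    by apply: ler_wpM2l => //; exact: ltW.
  have q3 : - (l2 ^+ 2 * n2 * E2 z) <= l2 ^+ 2 * `|n2|.
    rewrite -mulrN -mulrA ler_wpM2l ?sqr_ge0//.
    apply: (@le_trans _ _ (`|n2| * E2 z)); first by rewrite mulrN -mulNr ler_wpM2r ?(ltW e2z)// -normrN ler_norm.
    by rewrite ler_piMr.
  have q4 : 0 <= ga * E2 z by rewrite mulr_ge0// ltW.
  have q5 : 0 <= l1 * h z by rewrite mulr_ge0// ltW.
  rewrite mulrBl mulrBr mulrBl mulrDl.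
  by move: q1; rewrite /C; lra.
move: xy; rewrite le_eqVlt => /predU1P[->|xy]; first by rewrite subrr mulr0 subr0.
have [c [xc cy E]] := der_MVT xy (der_continuous (der_rfun al ga)) (fun z _ _ => der_rfun al ga z).
rewrite -lerBlDl E -mulNr ler_wpM2r ?subr_ge0 ?(ltW xy)//.
by rewrite rneg// ltW.
Qed.

Lemma rfun_steep_left al ga : 0 <= al -> 0 < ga ->
  exists x0, forall x y, y <= x0 -> x <= y -> rfun al ga y <= rfun al ga x - cc * (y - x).
Proof.
move=> al0 ga0.
have [|x1 Hx1] := N2_near sigma0 beta0 hh (e := ga / 2 / l2 ^+ 2).
  by rewrite !divr_gt0// exprn_gt0.
pose C := l1 ^+ 2 * `|n1| + 1; have C0 : 0 <= C by rewrite addr_ge0// mulr_ge0// sqr_ge0.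
pose x2 := a - 2 * C / ga / l2.
exists (Num.min x1 (Num.min a x2)) => x y.
rewrite !le_min => /andP[xx1 /andP[xa xx2]] xy.
have rneg z : z <= y -> rder al ga z <= - cc.
  move=> xz; rewrite rderE -[leRHS]mulrN1 ler_wpM2l ?(ltW cc0)//.
  have az := le_trans xz xa; have h1 := N1_ge_cost az; have h2 := E1_le1 az.
  have p1 : l2 ^+ 2 * (N2 z - n2) - ga <= - (ga / 2).
    have := Hx1 z (le_trans xz xx1); rewrite -ltrBlDl ltr_pdivlMr ?exprn_gt0//.
    by rewrite mulrC; move: (_ * (_ - n2)) => *; lra.
  have p2 : C <= ga / 2 * E2 z.
    have e2z : 1 + - l2 * (z - a) <= E2 z by exact: expR_ge1Dx.
    have : 2 * C / ga <= - l2 * (z - a).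
      have := le_trans xz xx2; rewrite /x2 lerBrDl -lerBrDr ler_pdivrMr// => H.
      by have -> : - l2 * (z - a) = (a - z) * l2 by ring.
    by rewrite ler_pdivrMr// => H; nra.
  have e2z := E2_gt0 mu sigma beta a z; have e1z := E1_gt0 mu sigma beta a z.
  have q1 : (l2 ^+ 2 * (N2 z - n2) - ga) * E2 z <= - C.
    by apply: (le_trans (ler_wpM2r (ltW e2z) p1)); rewrite mulNr lerN2.
  have q2 : - (l1 ^+ 2 * N1 z * E1 z) <= l1 * h z.
    have -> : - (l1 ^+ 2 * N1 z * E1 z) = l1 * - (l1 * N1 z * E1 z) by ring.
    by apply: ler_wpM2l => //; exact: ltW.
  have q3 : l1 ^+ 2 * n1 * E1 z <= l1 ^+ 2 * `|n1|.
    rewrite -mulrA ler_wpM2l ?sqr_ge0//.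
    apply: (@le_trans _ _ (`|n1| * E1 z)); first by rewrite ler_wpM2r ?(ltW e1z)// ler_norm.
    by rewrite ler_piMr.
  have q4 : 0 <= al * E1 z by rewrite mulr_ge0// ltW.
  have q5 : 0 <= l2 * h z by rewrite mulr_ge0// ltW.
  rewrite [in X in X + _ - _]mulrBl mulrBr mulrBl [(l1 + l2) * _]mulrDl.
  by move: q1; rewrite /C; lra.
move: xy; rewrite le_eqVlt => /predU1P[->|xy]; first by rewrite subrr mulr0 subr0.
have [c [xc cy E]] := der_MVT xy (der_continuous (der_rfun al ga)) (fun z _ _ => der_rfun al ga z).
rewrite -lerBlDl E -mulNr ler_wpM2r ?subr_ge0 ?(ltW xy)//.
by rewrite rneg// ltW.
Qed.

(** Outside a bounded interval [rfun] descends at rate at least [cc], so no rise takes place there,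
    and a rise whose end point sticks out by more than [S] would have to overcome more than the
    oscillation of [rfun] on the middle part. This bound will confine the barriers of a
    maximiser. *)
Lemma rfun_rise_bounded al ga : 0 < al -> 0 < ga ->
  exists M, forall x y, x < y -> rfun al ga x < rfun al ga y -> - M <= x /\ y <= M.
Proof.
move=> al0 ga0; have [r1 Hr] := rfun_steep_right al0 (ltW ga0).
have [r0 Hl] := rfun_steep_left (ltW al0) ga0.
pose m0 := Num.min r0 r1; have m01 : m0 <= r1 by rewrite /m0 ge_min lexx orbT.
have m0r : m0 <= r0 by rewrite /m0 ge_min lexx.
have cr : {within `[m0, r1], continuous rfun al ga}.
  exact/continuous_subspaceT/(der_continuous (der_rfun al ga)).
have [cu _ Hu] := EVT_max m01 cr; have [cl _ Hlw] := EVT_min m01 cr.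
set g := rfun al ga in Hr Hl Hu Hlw *.
have ub y : m0 <= y -> g y <= g cu.
  move=> my; have [yr|ry] := leP y r1; first by apply: Hu; rewrite in_itv/= my.
  apply: (le_trans (Hr _ _ (lexx r1) (ltW ry))).
  rewrite (le_trans _ (Hu r1 _)) ?in_itv/= ?lexx ?m01//.
  by rewrite gerBl mulr_ge0// ?subr_ge0 ltW.
have lb y : y <= r1 -> g cl <= g y.
  move=> my; have [yr|ry] := leP m0 y; first by apply: Hlw; rewrite in_itv/= my yr.
  apply: le_trans (_ : g m0 <= _); first by apply: Hlw; rewrite in_itv/= lexx m01.
  by apply: (le_trans (Hl y m0 m0r (ltW ry))); rewrite gerBl mulr_ge0// ?subr_ge0 ltW.
pose S := (g cu - g cl) / cc.
exists (Num.max (S - m0) (S + r1)) => x y xy gxy.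
rewrite lerNl !le_max; split; apply/orP; [left|right].
  have [m0x|xm0] := leP m0 x.
    have : 0 <= S by rewrite /S divr_ge0 ?(ltW cc0)// subr_ge0 (le_trans (lb m0 m01))// ub.
    lra.
  have m0y : m0 < y.
    rewrite ltNge; apply/negP => ym; have := Hl x y (le_trans ym m0r) (ltW xy).
    rewrite leNgt => /negP; apply; apply: le_lt_trans gxy.
    by rewrite gerBl mulr_ge0// ?subr_ge0 ltW.
  have := Hl x m0 m0r (ltW xm0); have := ub y (ltW m0y); have := lb m0 m01.
  move=> H1 H2 H3; have : cc * (m0 - x) <= g cu - g cl by lra.
  by rewrite mulrC -ler_pdivlMr// -/S; lra.
have [yr|ry] := leP y r1.
  have : 0 <= S by rewrite /S divr_ge0 ?(ltW cc0)// subr_ge0 (le_trans (lb m0 m01))// ub.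
  lra.
have xr : x < r1.
  rewrite ltNge; apply/negP => rx; have := Hr x y rx (ltW xy).
  rewrite leNgt => /negP; apply; apply: le_lt_trans gxy.
  by rewrite gerBl mulr_ge0// ?subr_ge0 ltW.
have := Hr r1 y (lexx _) (ltW ry); have := ub r1 m01; have := lb x (ltW xr).
move=> H1 H2 H3; have : cc * (y - r1) <= g cu - g cl by lra.
by rewrite mulrC -ler_pdivlMr// -/S; lra.
Qed.

End free_boundary_existence.

(** * Existence of the free boundary *)

Section slides.
Context {R : numDomainType}.
Implicit Types p q t : R.

Lemma slide_right p t : 0 < t -> p <= p + t. Proof. by move/ltW; rewrite lerDl. Qed.
Lemma slide_left p t : 0 < t -> p - t <= p. Proof. by move/ltW; rewrite gerBl. Qed.
Lemma slide_below p q t : t < q - p -> p + t <= q. Proof. by rewrite ltrBrDl => /ltW. Qed.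
Lemma slide_above p q t : t < q - p -> p <= q - t.
Proof. by rewrite ltrBrDr lerBrDl => /ltW; rewrite addrC. Qed.

End slides.

Section free_boundary_maximiser.
Context {R : realType}.
Variables (mu sigma beta K L k ell : R) (h : R -> R) (a : R).
Hypotheses (sigma0 : 0 < sigma) (beta0 : 0 < beta).
Hypotheses (K0 : 0 < K) (L0 : 0 < L) (k0 : 0 < k) (ell0 : 0 < ell).
Hypothesis hh : holding_cost mu sigma beta k ell h a.
Local Notation l1 := (lambda1 mu sigma beta).
Local Notation l2 := (lambda2 mu sigma beta).
Local Notation cc := (cc mu sigma beta).
Local Notation E1 := (E1 mu sigma beta a).
Local Notation E2 := (E2 mu sigma beta a).
Local Notation N1 := (N1 mu sigma beta h a).
Local Notation N2 := (N2 mu sigma beta h a).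
Local Notation n1 := (n1 mu sigma beta h a).
Local Notation n2 := (n2 mu sigma beta h a).
Local Notation vfun := (vfun mu sigma beta h a).
Local Notation gfun := (gfun mu sigma beta h a).
Local Notation rval := (rval mu sigma beta h a).
Local Notation rfun := (rfun mu sigma beta h a).
Local Notation rder := (rder mu sigma beta h a).
Implicit Types (A B x y z al ga : R).

Let ch : continuous h := holding_continuous hh.
Let l1_gt0 : 0 < l1. Proof. exact: lambda1_gt0. Qed.
Let l2_gt0 : 0 < l2. Proof. exact: lambda2_gt0. Qed.
Let l1n0 : l1 != 0. Proof. exact: lt0r_neq0. Qed.
Let l2n0 : l2 != 0. Proof. exact: lt0r_neq0. Qed.
Let cc0 : 0 < cc. Proof. exact: cc_gt0. Qed.
Let h0 x : 0 <= h x. Proof. exact: (holding_ge0 hh). Qed.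
Let E1n0 x : E1 x != 0. Proof. exact/lt0r_neq0/E1_gt0. Qed.
Let E2n0 x : E2 x != 0. Proof. exact/lt0r_neq0/E2_gt0. Qed.
Let N1n1 x : N1 x <= n1. Proof. exact: (N1_n1 sigma0 beta0 hh). Qed.
Let n2N2 x : n2 <= N2 x. Proof. exact: (n2_N2 sigma0 beta0 hh). Qed.

Let c1 : R := cc / l1 ^+ 2.
Let c2 : R := cc / l2 ^+ 2.
Let c10 : 0 < c1. Proof. by rewrite divr_gt0// exprn_gt0. Qed.
Let c20 : 0 < c2. Proof. by rewrite divr_gt0// exprn_gt0. Qed.
Let dval al ga x : is_derive x 1 (rval al ga) (rfun al ga x).
Proof. exact: (der_rval sigma0 beta0 hh). Qed.
Let dfun al ga x : is_derive x 1 (rfun al ga) (rder al ga x).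
Proof. exact: (der_rfun hh). Qed.
Let rvalC al ga x : rval al ga x = rval 0 0 x - al * (c1 * E1 x) - ga * (c2 * E2 x).
Proof. exact: rvalE. Qed.

Let rderC al ga x : rder al ga x = cc * ((l1 ^+ 2 * (n1 - N1 x) - al) * E1 x +
    (l2 ^+ 2 * (N2 x - n2) - ga) * E2 x - (l1 + l2) * h x).
Proof. exact: rderE. Qed.
Let rfunC al ga x :
  rfun al ga x = rfun 0 0 x - al * (cc / l1 * E1 x) + ga * (cc / l2 * E2 x).
Proof. exact: rfunE. Qed.

Lemma E1_le x y : x <= y -> E1 x <= E1 y.
Proof. by move=> xy; rewrite ler_expR ler_wpM2l ?(ltW l1_gt0)// lerD2r. Qed.

Lemma E2_ge x y : x <= y -> E2 y <= E2 x.
Proof. by move=> xy; rewrite ler_expR !mulNr lerN2 ler_wpM2l ?(ltW l2_gt0)// lerD2r. Qed.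

(* The conditions on the two integrals, in terms of the primitive of [gfun]. *)
Definition well al ga d D : R := rval al ga d - rval al ga D - k * (D - d).
Definition hump al ga U u : R := rval al ga u - rval al ga U - ell * (u - U).

Lemma wellC al ga d D :
  well al ga d D = well 0 0 d D - al * (c1 * (E1 d - E1 D)) - ga * (c2 * (E2 d - E2 D)).
Proof. by rewrite /well !(rvalC al ga); ring. Qed.

Lemma humpC al ga U u :
  hump al ga U u = hump 0 0 U u - al * (c1 * (E1 u - E1 U)) - ga * (c2 * (E2 u - E2 U)).
Proof. by rewrite /hump !(rvalC al ga); ring. Qed.

(** Far out the slope of the resolvent beats [- k] and [ell] by fixed margins, so wide enough
    intervals satisfy both constraints for [al = 0], with one unit to spare; that unit pays for a
    small positive [al]. *)
Lemma base_point : exists al, 0 < al /\ exists d D U u,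
  [/\ d <= D, D <= U, U <= u, K <= well al al d D & L <= hump al al U u].
Proof.
have [x0 [e [e0 He]]] := rfun_left sigma0 beta0 hh.
have [x1 [e' [e'0 He']]] := rfun_right sigma0 beta0 hh.
pose D := x0; pose d := x0 - (K + 1) / e; pose U := Num.max x0 x1; pose u := U + (L + 1) / e'.
have dD : d <= D by rewrite /d gerBl divr_ge0 ?addr_ge0// ltW.
have Uu : U <= u by rewrite /u lerDl divr_ge0 ?addr_ge0// ltW.
have DU : D <= U by rewrite /U le_max lexx.
have x1U : x1 <= U by rewrite /U le_max lexx orbT.
have W1 : K + 1 <= well 0 0 d D.
  have H1 := rval_chord_right sigma0 beta0 hh dD; have H2 := He D (lexx _).
  have DdE : (D - d) * e = K + 1 by rewrite /d /D opprB addrC subrK divfK// lt0r_neq0.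
  have Dd0 : 0 <= D - d by rewrite subr_ge0.
  by rewrite /well -DdE; have := ler_wpM2r Dd0 H2; nra.
have W2 : L + 1 <= hump 0 0 U u.
  have H1 := rval_chord_left sigma0 beta0 hh Uu; have H2 := He' U x1U.
  have DdE : (u - U) * e' = L + 1 by rewrite /u addrAC subrr add0r divfK// lt0r_neq0.
  have Dd0 : 0 <= u - U by rewrite subr_ge0.
  by rewrite /hump -DdE; have := ler_wpM2r Dd0 H2; nra.
pose W x := c1 * E1 x + c2 * E2 x.
have W0 x : 0 < W x by rewrite addr_gt0// mulr_gt0// expR_gt0.
(* With this value the loss at either outer end point is at most 1. *)
pose al := (W d + W u)^-1; have al0 : 0 < al by rewrite invr_gt0 addr_gt0.
have alW : al * (W d + W u) = 1 by rewrite mulVf// lt0r_neq0// addr_gt0.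
have ald : al * W d <= 1 by rewrite -alW ler_wpM2l ?(ltW al0)// lerDl ltW.
have alu : al * W u <= 1 by rewrite -alW ler_wpM2l ?(ltW al0)// lerDr ltW.
exists al; split=> //; exists d, D, U, u; split=> //.
  rewrite wellC; have : 0 <= al * W D by rewrite mulr_ge0 ?ltW.
  by move: ald W1; rewrite /W; lra.
rewrite humpC; have : 0 <= al * W U by rewrite mulr_ge0 ?ltW.
by move: alu W2; rewrite /W; lra.
Qed.

Lemma well_point al ga d D : d <= D -> K <= well al ga d D ->
  exists x, [/\ d < x, x < D & rfun al ga x < - k].
Proof.
rewrite le_eqVlt => /predU1P[->|dD].
  by rewrite /well !subrr mulr0 subr0 leNgt K0.
move=> Kw; have [c [dc cD E]] := der_MVT dD (der_continuous (dval al ga)) (fun z _ _ => dval al ga z).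
exists c; split=> //; have Dd : 0 < D - d by rewrite subr_gt0.
rewrite -(ltr_pM2r Dd) -E; move: Kw; rewrite /well; have := K0; lra.
Qed.

Lemma hump_point al ga U u : U <= u -> L <= hump al ga U u ->
  exists x, [/\ U < x, x < u & ell < rfun al ga x].
Proof.
rewrite le_eqVlt => /predU1P[->|Uu].
  by rewrite /hump !subrr mulr0 subr0 leNgt L0.
move=> Kw; have [c [dc cD E]] := der_MVT Uu (der_continuous (dval al ga)) (fun z _ _ => dval al ga z).
exists c; split=> //; have Dd : 0 < u - U by rewrite subr_gt0.
rewrite -(ltr_pM2r Dd) -E; move: Kw; rewrite /hump; have := L0; lra.
Qed.

(** The coordinates are [((al, ga), (d, D), (U, u))]. The common lower bound [al0] makes one bound
    of [rfun_rise_bounded] valid for all candidates; upper bounds on [al] and [ga] follow from the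
    two integral constraints. *)
Definition candidate al0 M (t : (R * R) * (R * R) * (R * R)) : Prop :=
  [/\ [/\ al0 <= t.1.1.1 & al0 <= t.1.1.2],
      [/\ - M <= t.1.2.1, t.1.2.1 <= t.1.2.2, t.1.2.2 <= t.2.1, t.2.1 <= t.2.2 & t.2.2 <= M],
      K <= well t.1.1.1 t.1.1.2 t.1.2.1 t.1.2.2 &
      L <= hump t.1.1.1 t.1.1.2 t.2.1 t.2.2].

Let T : topologicalType := ((R * R) * (R * R) * (R * R))%type.

Let contTB (f g : T -> R) : continuous f -> continuous g -> continuous (fun t => f t - g t).
Proof. by move=> cf cg x; exact: (cvgB (cf x) (cg x)). Qed.
Let cfst (S1 S2 : topologicalType) : continuous (fst : S1 * S2 -> S1).
Proof. by move=> x; exact: cvg_fst. Qed.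
Let csnd (S1 S2 : topologicalType) : continuous (snd : S1 * S2 -> S2).
Proof. by move=> x; exact: cvg_snd. Qed.
Let p11 : continuous (fun t : T => t.1.1).
Proof. by move=> x; exact: (continuous_comp (@cfst _ _ _) (@cfst _ _ _)). Qed.
Let p12 : continuous (fun t : T => t.1.2).
Proof. by move=> x; exact: (continuous_comp (@cfst _ _ _) (@csnd _ _ _)). Qed.
Let pal : continuous (fun t : T => t.1.1.1).
Proof. by move=> x; exact: (continuous_comp (@p11 x) (@cfst _ _ _)). Qed.
Let pga : continuous (fun t : T => t.1.1.2).
Proof. by move=> x; exact: (continuous_comp (@p11 x) (@csnd _ _ _)). Qed.
Let pd : continuous (fun t : T => t.1.2.1).
Proof. by move=> x; exact: (continuous_comp (@p12 x) (@cfst _ _ _)). Qed.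
Let pD : continuous (fun t : T => t.1.2.2).
Proof. by move=> x; exact: (continuous_comp (@p12 x) (@csnd _ _ _)). Qed.
Let pU : continuous (fun t : T => t.2.1).
Proof. by move=> x; exact: (continuous_comp (@csnd _ _ _) (@cfst _ _ _)). Qed.
Let pu : continuous (fun t : T => t.2.2).
Proof. by move=> x; exact: (continuous_comp (@csnd _ _ _) (@csnd _ _ _)). Qed.

Let closed_le (f g : T -> R) : continuous f -> continuous g -> closed [set t | f t <= g t].
Proof.
move=> cf cg; rewrite (_ : [set t | f t <= g t] = (fun t => g t - f t) @^-1` [set x | 0 <= x]).
  by apply: preimage_closed; [move=> x _; exact: contTB|exact: closed_ge].
by apply/seteqP; split=> t /=; rewrite subr_ge0.
Qed.

Let cE1 : continuous E1. Proof. exact: der_continuous (der_E1 _ _ _ _). Qed.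
Let cE2 : continuous E2. Proof. exact: der_continuous (der_E2 _ _ _ _). Qed.

Lemma candidate_closed al0 M : closed (candidate al0 M : set T).
Proof.
have cw : continuous (fun t : T => well t.1.1.1 t.1.1.2 t.1.2.1 t.1.2.2).
  rewrite (_ : (fun _ => _) = fun t : T => rval 0 0 t.1.2.1 - rval 0 0 t.1.2.2
      - k * (t.1.2.2 - t.1.2.1) - t.1.1.1 * (c1 * (E1 t.1.2.1 - E1 t.1.2.2))
      - t.1.1.2 * (c2 * (E2 t.1.2.1 - E2 t.1.2.2))); last first.
    by apply/funext => t; rewrite wellC.
  have cv := der_continuous (dval 0 0).
  move=> t; have hal : (fun s : T => s.1.1.1) @ t --> t.1.1.1 by exact: pal.
  have hga : (fun s : T => s.1.1.2) @ t --> t.1.1.2 by exact: pga.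
  have hp : (fun s : T => s.1.2.1) @ t --> t.1.2.1 by exact: pd.
  have hq : (fun s : T => s.1.2.2) @ t --> t.1.2.2 by exact: pD.
  have vp := cvg_comp _ _ hp (cv t.1.2.1); have vq := cvg_comp _ _ hq (cv t.1.2.2).
  have ep := cvg_comp _ _ hp (@cE1 t.1.2.1); have eq := cvg_comp _ _ hq (@cE1 t.1.2.2).
  have fp := cvg_comp _ _ hp (@cE2 t.1.2.1); have fq := cvg_comp _ _ hq (@cE2 t.1.2.2).
  have cst (c : R) : (fun=> c) @ t --> c by exact: cvg_cst.
  exact: (cvgB (cvgB (cvgB (cvgB vp vq) (cvgM (cst k) (cvgB hq hp)))
    (cvgM hal (cvgM (cst c1) (cvgB ep eq)))) (cvgM hga (cvgM (cst c2) (cvgB fp fq)))).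
have cj : continuous (fun t : T => hump t.1.1.1 t.1.1.2 t.2.1 t.2.2).
  rewrite (_ : (fun _ => _) = fun t : T => rval 0 0 t.2.2 - rval 0 0 t.2.1
      - ell * (t.2.2 - t.2.1) - t.1.1.1 * (c1 * (E1 t.2.2 - E1 t.2.1))
      - t.1.1.2 * (c2 * (E2 t.2.2 - E2 t.2.1))); last first.
    by apply/funext => t; rewrite humpC.
  have cv := der_continuous (dval 0 0).
  move=> t; have hal : (fun s : T => s.1.1.1) @ t --> t.1.1.1 by exact: pal.
  have hga : (fun s : T => s.1.1.2) @ t --> t.1.1.2 by exact: pga.
  have hp : (fun s : T => s.2.2) @ t --> t.2.2 by exact: pu.
  have hq : (fun s : T => s.2.1) @ t --> t.2.1 by exact: pU.
  have vp := cvg_comp _ _ hp (cv t.2.2); have vq := cvg_comp _ _ hq (cv t.2.1).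
  have ep := cvg_comp _ _ hp (@cE1 t.2.2); have eq := cvg_comp _ _ hq (@cE1 t.2.1).
  have fp := cvg_comp _ _ hp (@cE2 t.2.2); have fq := cvg_comp _ _ hq (@cE2 t.2.1).
  have cst (c : R) : (fun=> c) @ t --> c by exact: cvg_cst.
  exact: (cvgB (cvgB (cvgB (cvgB vp vq) (cvgM (cst ell) (cvgB hp hq)))
    (cvgM hal (cvgM (cst c1) (cvgB ep eq)))) (cvgM hga (cvgM (cst c2) (cvgB fp fq)))).
rewrite (_ : candidate al0 M = [set t : T | al0 <= t.1.1.1] `&` [set t : T | al0 <= t.1.1.2] `&`
  ([set t : T | - M <= t.1.2.1] `&` [set t : T | t.1.2.1 <= t.1.2.2] `&`
   [set t : T | t.1.2.2 <= t.2.1] `&` [set t : T | t.2.1 <= t.2.2] `&` [set t : T | t.2.2 <= M]) `&`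
  [set t : T | K <= well t.1.1.1 t.1.1.2 t.1.2.1 t.1.2.2] `&`
  [set t : T | L <= hump t.1.1.1 t.1.1.2 t.2.1 t.2.2]); last first.
  apply/seteqP; split=> t /=; first by move=> [[? ?] [? ? ? ? ?] ? ?].
  by move=> [[[[? ?] [[[[? ?] ?] ?] ?]] ?] ?].
have cst (c : R) : continuous (fun _ : T => c) by move=> t; exact: cvg_cst.
have le f g := @closed_le f g.
apply: closedI; first apply: closedI; first apply: closedI; first apply: closedI.
- exact: (le (fun=> al0) _ (cst _) pal).
- exact: (le (fun=> al0) _ (cst _) pga).
- apply: closedI; first apply: closedI; first apply: closedI; first apply: closedI.
  + exact: (le (fun=> - M) _ (cst _) pd).
  + exact: (le _ _ pd pD).
  + exact: (le _ _ pD pU).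
  + exact: (le _ _ pU pu).
  + exact: (le _ (fun=> M) pu (cst _)).
- exact: (le (fun=> K) _ (cst _) cw).
- exact: (le (fun=> L) _ (cst _) cj).
Qed.

(** Between a point of the well and one of the hump [rfun] rises from below [- k] to above [ell], so
    [rder] is positive somewhere in [[- M, M]]. There the second derivative of the resolvent is at
    most [C], and [al] and [ga] each lower it by a positive multiple of themselves; this bounds
    both. *)
Lemma candidate_compact al0 M : 0 <= al0 -> compact (candidate al0 M : set T).
Proof.
move=> al00; have [M0|M0] := ltP M 0.
  have -> : candidate al0 M = set0 :> set T; last exact: compact0.
  by apply/seteqP; split=> // t [_ [? ? ? ? ?] _ _]; exfalso; lra.
have MM : - M <= M by rewrite ge0_cp.
have [cm _ Hm] := EVT_max MM (continuous_subspaceT (gder_continuous hh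
  (A := l1 ^+ 2 * n1 - 0) (B := l2 ^+ 2 * n2 + 0))).
pose C := rder 0 0 cm.
pose Ca := C / (cc * E1 (- M)); pose Cg := C / (cc * E2 M).
pose box : set T := ((`[al0, Ca]%classic `*` `[al0, Cg]%classic) `*`
  (`[- M, M]%classic `*` `[- M, M]%classic)) `*` (`[- M, M]%classic `*` `[- M, M]%classic).
apply: (@subclosed_compact _ _ box); first exact: candidate_closed.
  by do ![apply: compact_setX]; exact: segment_compact.
move=> [[[al ga] [d D]] [U u]] [/= [a1 a2] [m1 m2 m3 m4 m5] w1 w2].
have [x [dx xD gx]] := well_point m2 w1.
have [y [Uy yu gy]] := hump_point m4 w2.
have xy : x < y by rewrite (lt_trans xD)// (le_lt_trans m3).
have [z [xz zy E]] := der_MVT xy (der_continuous (dfun al ga)) (fun z _ _ => dfun al ga z).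
have gz : 0 < rder al ga z.
  rewrite -(pmulr_lgt0 (rder al ga z) (_ : 0 < y - x)) ?subr_gt0// -E.
  by have := k0; have := ell0; lra.
have zM : - M <= z <= M by apply/andP; split; lra.
have Cz : rder 0 0 z <= C by apply: Hm; rewrite in_itv/=.
have rE : rder al ga z = rder 0 0 z - cc * (al * E1 z + ga * E2 z).
  by rewrite (rderC al ga) (rderC 0 0); ring.
have al00' : 0 <= al by rewrite (le_trans al00). have ga00 : 0 <= ga by rewrite (le_trans al00).
have e1M : E1 (- M) <= E1 z by apply: E1_le; case/andP: zM.
have e2M : E2 M <= E2 z by apply: E2_ge; case/andP: zM.
have p1 : al * E1 (- M) <= al * E1 z by rewrite ler_wpM2l.
have p2 : ga * E2 M <= ga * E2 z by rewrite ler_wpM2l.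
have p3 : 0 <= al * E1 z by rewrite mulr_ge0 ?expR_ge0.
have p4 : 0 <= ga * E2 z by rewrite mulr_ge0 ?expR_ge0.
have q : cc * (al * E1 z + ga * E2 z) <= C by rewrite rE in gz; lra.
have q1 : al <= Ca.
  have pc : 0 < cc * E1 (- M) by rewrite mulr_gt0 ?expR_gt0.
  rewrite /Ca ler_pdivlMr//; apply: le_trans q; rewrite mulrCA; apply: ler_wpM2l; first exact: ltW.
  lra.
have q2 : ga <= Cg.
  have pc : 0 < cc * E2 M by rewrite mulr_gt0 ?expR_gt0.
  rewrite /Cg ler_pdivlMr//; apply: le_trans q; rewrite mulrCA; apply: ler_wpM2l; first exact: ltW.
  lra.
have D1 := le_trans m1 m2; have U1 := le_trans D1 m3; have u1 := le_trans U1 m4.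
have U2 := le_trans m4 m5; have D2 := le_trans m3 U2; have d2 := le_trans m2 D2.
by rewrite /box /=; do !split; rewrite /= in_itv/=; apply/andP.
Qed.

(* At a maximiser of [al + ga] both integral conditions are equalities and the
   end points are critical, since [well] decreases and [hump] increases with
   [ga], and the other way round with [al]. *)
Lemma free_boundary_solution : exists A B d D U u : R,
  [/\ [/\ d < D, D < U & U < u],
      vfun A B d - vfun A B D - k * (D - d) = K,
      vfun A B u - vfun A B U - ell * (u - U) = L,
      gfun A B d = - k /\ gfun A B D = - k &
      gfun A B U = ell /\ gfun A B u = ell].
Proof.
have [al0 [al00 [db [Db [Ub [ub [m1 m2 m3 wb hb]]]]]]] := base_point.
have [M0 HM0] := rfun_rise_bounded sigma0 beta0 hh al00 al00.
(* The margin above [M0] is the room for moving the outer barriers outwards. *)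
pose M := Num.max (Num.max (- db) ub) (M0 + 1).
have M1 : - M <= db by rewrite lerNl !le_max lexx.
have M2 : ub <= M by rewrite !le_max lexx orbT.
have M3 : M0 < M by rewrite lt_max ltrDl ltr01 orbT.
have [||] := @compact_EVT_max T R (fun t => t.1.1.1 + t.1.1.2) (candidate al0 M) _
   (candidate_compact (M := M) (ltW al00)).
- by exists ((al0, al0), (db, Db), (Ub, ub)); split=> //=; split=> //; lra.
- apply: continuous_subspaceT => t; exact: (cvgD (@pal t) (@pga t)).
move=> [[[al ga] [d D]] [U u]]; rewrite inE => -[/= [a1 a2] [d1 d2 d3 d4 d5] w1 h1] Hmax.
have ga_up e : 0 <= e -> forall d' D' U' u',
    [/\ - M <= d', d' <= D', D' <= U', U' <= u' & u' <= M] ->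
    K <= well al (ga + e) d' D' -> L <= hump al (ga + e) U' u' -> e <= 0.
  move=> e0 d' D' U' u' [? ? ? ? ?] w h2.
  have := Hmax ((al, ga + e), (d', D'), (U', u')); rewrite inE /= => /(_ _).
  rewrite -[leRHS]addr0 addrA lerD2l; apply; split=> //=; split=> //; lra.
have al_up e : 0 <= e -> forall d' D' U' u',
    [/\ - M <= d', d' <= D', D' <= U', U' <= u' & u' <= M] ->
    K <= well (al + e) ga d' D' -> L <= hump (al + e) ga U' u' -> e <= 0.
  move=> e0 d' D' U' u' [? ? ? ? ?] w h2.
  have := Hmax ((al + e, ga), (d', D'), (U', u')); rewrite inE /= => /(_ _).
  rewrite -[leRHS]addr0 addrAC lerD2l; apply; split=> //=; split=> //; lra.
(* Were the well over [[d', D']] deeper than [K], [ga] could be raised by [e]: this costs the well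
   at most its excess and only raises the hump. *)
have wle d' D' : - M <= d' -> d' <= D' -> D' <= U -> well al ga d' D' <= K.
  move=> p1 p2 p3; rewrite leNgt; apply/negP => w.
  pose e := (well al ga d' D' - K) / (c2 * E2 d').
  have q0 : 0 < c2 * E2 d' by rewrite mulr_gt0 ?expR_gt0.
  have e0 : 0 < e by rewrite divr_gt0// subr_gt0.
  have eE : e * (c2 * E2 d') = well al ga d' D' - K by rewrite divfK// lt0r_neq0.
  have q1 : 0 <= e * (c2 * E2 D') by rewrite mulr_ge0 ?ltW// mulr_gt0// expR_gt0.
  have q2 : 0 <= e * (c2 * (E2 U - E2 u)).
    by rewrite mulr_ge0 ?(ltW e0)// mulr_ge0 ?(ltW c20)// subr_ge0 E2_ge.
  suff : e <= 0 by rewrite leNgt e0.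
  apply: (ga_up e (ltW e0) d' D' U u) => //.
    by move: eE q1; rewrite (wellC al (ga + e)) (wellC al ga); lra.
  by move: h1 q2; rewrite (humpC al (ga + e)) (humpC al ga); lra.
have hle U' u' : D <= U' -> U' <= u' -> u' <= M -> hump al ga U' u' <= L.
  move=> p1 p2 p3; rewrite leNgt; apply/negP => w.
  pose e := (hump al ga U' u' - L) / (c1 * E1 u').
  have q0 : 0 < c1 * E1 u' by rewrite mulr_gt0 ?expR_gt0.
  have e0 : 0 < e by rewrite divr_gt0// subr_gt0.
  have eE : e * (c1 * E1 u') = hump al ga U' u' - L by rewrite divfK// lt0r_neq0.
  have q1 : 0 <= e * (c1 * E1 U') by rewrite mulr_ge0 ?ltW// mulr_gt0// expR_gt0.
  have q2 : 0 <= e * (c1 * (E1 D - E1 d)).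
    by rewrite mulr_ge0 ?(ltW e0)// mulr_ge0 ?(ltW c10)// subr_ge0 E1_le.
  suff : e <= 0 by rewrite leNgt e0.
  apply: (al_up e (ltW e0) d D U' u') => //.
    by move: w1 q2; rewrite (wellC (al + e)) (wellC al ga); lra.
  by move: eE q1; rewrite (humpC (al + e)) (humpC al ga); lra.
have wK : well al ga d D = K by apply/eqP; rewrite eq_le w1 wle.
have hL : hump al ga U u = L by apply/eqP; rewrite eq_le h1 hle.
have [x [dx xD gx]] := well_point d2 w1; have [y [Uy yu gy]] := hump_point d4 h1.
have dD : d < D by exact: lt_trans xD. have Uu : U < u by exact: lt_trans yu.
have Dd0 : 0 < D - d by rewrite subr_gt0. have uU0 : 0 < u - U by rewrite subr_gt0.
have dv z := dval al ga z.
(* By [wle] and [hle] the intervals [[d, D]] and [[U, u]] are extremal; shrinking them is always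
   permitted and yields one half of each slope condition. *)
have gd : rfun al ga d <= - k.
  apply: (der_right_le (dv d) Dd0) => t t0 tD.
  have := wle (d + t) D; rewrite -wK /well => H.
    have {}H := H (le_trans d1 (slide_right d t0)) (slide_below tD) d3.
  rewrite -subr_ge0 in H; rewrite -subr_ge0 (le_trans H)// le_eqVlt.
  by apply/orP; left; apply/eqP; ring.
have gu : ell <= rfun al ga u.
  apply: (der_left_ge (dv u) uU0) => t t0 tD.
  have := hle U (u - t); rewrite -hL /hump => H.
    have {}H := H d3 (slide_above tD) (le_trans (slide_left u t0) d5).
  rewrite -subr_ge0 in H; rewrite -subr_ge0 (le_trans H)// le_eqVlt.
  by apply/orP; left; apply/eqP; ring.
have gD : rfun al ga D <= - k.
  apply: (der_left_le (dv D) Dd0) => t t0 tD.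
  have := wle d (D - t); rewrite -wK /well => H.
    have {}H := H d1 (slide_above tD) (le_trans (slide_left D t0) d3).
  rewrite -subr_ge0 in H; rewrite -subr_ge0 (le_trans H)// le_eqVlt.
  by apply/orP; left; apply/eqP; ring.
have gU : ell <= rfun al ga U.
  apply: (der_right_ge (dv U) uU0) => t t0 tD.
  have := hle (U + t) u; rewrite -hL /hump => H.
    have {}H := H (le_trans d3 (slide_right U t0)) (slide_below tD) d5.
  rewrite -subr_ge0 in H; rewrite -subr_ge0 (le_trans H)// le_eqVlt.
  by apply/orP; left; apply/eqP; ring.
(* The half conditions already separate [D] from [U], which makes room for moving both into the
   gap. *)
have DU : D < U.
  rewrite lt_neqAle d3 andbT; apply/eqP => DU; move: gD gU; rewrite DU.
  by have := k0; have := ell0; lra.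
(* Compared with [al0], larger constants only reduce the increments of [rfun], so the bound [M0]
   applies. Hence [d] and [u] are interior to [[- M, M]]. *)
have rise x' y' : x' < y' -> rfun al ga x' < rfun al ga y' -> - M0 <= x' /\ y' <= M0.
  move=> xy' H; apply: HM0 => //; move: H.
  rewrite !(rfunC al ga) !(rfunC al0 al0).
  have q1 : 0 <= (al - al0) * (cc / l1 * (E1 y' - E1 x')).
    rewrite mulr_ge0 ?subr_ge0// mulr_ge0 ?subr_ge0 ?E1_le ?(ltW xy')//.
    by rewrite divr_ge0 ?(ltW cc0) ?(ltW l1_gt0).
  have q2 : 0 <= (ga - al0) * (cc / l2 * (E2 x' - E2 y')).
    rewrite mulr_ge0 ?subr_ge0// mulr_ge0 ?subr_ge0 ?E2_ge ?(ltW xy')//.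
    by rewrite divr_ge0 ?(ltW cc0) ?(ltW l2_gt0).
  by lra.
have dMl : - M0 <= d.
  have [//|] := rise d y ltac:(lra); last by [].
  by have := k0; have := ell0; lra.
have uMr : u <= M0.
  have [//|] := rise x u ltac:(lra); last by [].
  by have := k0; have := ell0; lra.
have gd' : - k <= rfun al ga d.
  have dM0 : 0 < d - - M by lra.
  apply: (der_left_ge (dv d) dM0) => t t0 tD.
  have := wle (d - t) D; rewrite -wK /well => H.
    have {}H := H (slide_above tD) (le_trans (slide_left d t0) d2) d3.
  rewrite -subr_ge0 in H; rewrite -subr_ge0 (le_trans H)// le_eqVlt.
  by apply/orP; left; apply/eqP; ring.
have gu' : rfun al ga u <= ell.
  have dM0 : 0 < M - u by lra.
  apply: (der_right_le (dv u) dM0) => t t0 tD.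
  have := hle U (u + t); rewrite -hL /hump => H.
    have {}H := H d3 (le_trans d4 (slide_right u t0)) (slide_below tD).
  rewrite -subr_ge0 in H; rewrite -subr_ge0 (le_trans H)// le_eqVlt.
  by apply/orP; left; apply/eqP; ring.
have UD0 : 0 < U - D by rewrite subr_gt0.
have gD' : - k <= rfun al ga D.
  apply: (der_right_ge (dv D) UD0) => t t0 tD.
  have := wle d (D + t); rewrite -wK /well => H.
    have {}H := H d1 (le_trans d2 (slide_right D t0)) (slide_below tD).
  rewrite -subr_ge0 in H; rewrite -subr_ge0 (le_trans H)// le_eqVlt.
  by apply/orP; left; apply/eqP; ring.
have gU' : rfun al ga U <= ell.
  apply: (der_left_le (dv U) UD0) => t t0 tD.
  have := hle (U - t) u; rewrite -hL /hump => H.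
    have {}H := H (slide_above tD) (le_trans (slide_left U t0) d4) d5.
  rewrite -subr_ge0 in H; rewrite -subr_ge0 (le_trans H)// le_eqVlt.
  by apply/orP; left; apply/eqP; ring.
exists (l1 ^+ 2 * n1 - al), (l2 ^+ 2 * n2 + ga), d, D, U, u.
split=> //; first by split; apply/eqP; rewrite eq_le; apply/andP; split.
by split; apply/eqP; rewrite eq_le; apply/andP; split.
Qed.

End free_boundary_maximiser.

(** * Consequences of the free boundary conditions *)

Section free_boundary_facts.
Context {R : realType}.
Local Notation leb := (@lebesgue_measure R).
Variables (mu sigma beta K L k ell : R) (h : R -> R) (a : R).
Hypotheses (sigma0 : 0 < sigma) (beta0 : 0 < beta).
Hypotheses (K0 : 0 < K) (L0 : 0 < L) (k0 : 0 < k) (ell0 : 0 < ell).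
Hypothesis hh : holding_cost mu sigma beta k ell h a.
Local Notation h' := h^`()%classic.
Local Notation vfun := (vfun mu sigma beta h a).
Local Notation gfun := (gfun mu sigma beta h a).
Local Notation gder := (gder mu sigma beta h a).
Implicit Types (A B x y z al ga : R).

Lemma local_minimum_der f (x df : R) : is_derive x 1 f df -> local_minimum f x -> df = 0.
Proof.
move=> dx [e /= e0 He]; apply/eqP; rewrite eq_le; apply/andP; split.
  apply: (der_left_le dx e0) => t t0 te; rewrite mul0r subr_le0; apply: He => /=.
  by rewrite opprB addrC subrK ger0_norm// ltW.
apply: (der_right_ge dx e0) => t t0 te; rewrite mul0r subr_ge0; apply: He => /=.
by rewrite opprD addrA subrr sub0r normrN ger0_norm// ltW.
Qed.

Lemma local_maximum_der f (x df : R) : is_derive x 1 f df -> local_maximum f x -> df = 0.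
Proof.
move=> dx [e /= e0 He]; apply/eqP; rewrite eq_le; apply/andP; split.
  apply: (der_right_le dx e0) => t t0 te; rewrite mul0r subr_le0; apply: He => /=.
  by rewrite opprD addrA subrr sub0r normrN ger0_norm// ltW.
apply: (der_left_ge dx e0) => t t0 te; rewrite mul0r subr_ge0; apply: He => /=.
by rewrite opprB addrC subrK ger0_norm// ltW.
Qed.

Lemma integral_gfun A B c x y : x <= y ->
  \int[leb]_(z in `[x, y]) (gfun A B z + c) = vfun A B y - vfun A B x + c * (y - x).
Proof.
move=> xy; pose F z := vfun A B z + c * z.
have dF z : is_derive z 1 F (gfun A B z + c).
  apply: (der_eq (derD (der_vfun sigma0 beta0 hh A B z) (derZ c (der_id z)))).
  by rewrite mulr1.
have cg : continuous (fun z => gfun A B z + c).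
  by apply: contD; [exact: (der_continuous (der_gfun hh A B))|move=> z; exact: cvg_cst].
by rewrite (Rintegral_derive xy dF cg) /F; ring.
Qed.

(** What remains is to find the extrema. By the mean value theorem [gfun] goes below [- k] inside
    [[d, D]] and above [ell] inside [[U, u]], so its extrema there are interior; the kink lemmas
    place them on the two sides of [a]. *)
Lemma free_boundary_exists : exists A B d D U u : R,
  free_boundary mu sigma beta K L k ell h a A B d D U u.
Proof.
have [A [B [d [D [U [u [[dD DU Uu] vK vL [gd gD] [gU gu]]]]]]]] :=
  free_boundary_solution sigma0 beta0 K0 L0 k0 ell0 hh.
exists A, B, d, D, U, u; rewrite /free_boundary (gAB_gfun sigma0 beta0 hh).
have cg : continuous (gfun A B) by exact: der_continuous (der_gfun hh A B).
split=> //; last 2 first.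
- by rewrite integral_gfun ?ltW//; move: vK; lra.
- by rewrite (integral_gfun A B (- ell)) ?ltW//; move: vL; lra.
have [c1 + Hc1] := EVT_min (ltW dD) (continuous_subspaceT cg).
rewrite in_itv/= => /andP[dc1 c1D].
have [c2 + Hc2] := EVT_max (ltW Uu) (continuous_subspaceT cg).
rewrite in_itv/= => /andP[Uc2 c2u].
have [x [dx xD gx]] : exists x, [/\ d < x, x < D & gfun A B x < - k].
  have [x [dx xD E]] := der_MVT dD (der_continuous (der_vfun sigma0 beta0 hh A B)) (fun z _ _ => der_vfun sigma0 beta0 hh A B z).
  exists x; split=> //; rewrite -(ltr_pM2r (_ : 0 < D - d)) ?subr_gt0// -E.
  by move: vK; have := K0; lra.
have [y [Uy yu gy]] : exists y, [/\ U < y, y < u & ell < gfun A B y].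
  have [y [dy yD E]] := der_MVT Uu (der_continuous (der_vfun sigma0 beta0 hh A B)) (fun z _ _ => der_vfun sigma0 beta0 hh A B z).
  exists y; split=> //; rewrite -(ltr_pM2r (_ : 0 < u - U)) ?subr_gt0// -E.
  by move: vL; have := L0; lra.
have g1 : gfun A B c1 < - k by rewrite (le_lt_trans (Hc1 x _))// in_itv/= !ltW.
have g2 : ell < gfun A B c2 by rewrite (lt_le_trans gy)// Hc2// in_itv/= !ltW.
have dc1' : d < c1 by rewrite lt_neqAle dc1 andbT; apply/eqP => E; move: g1; rewrite -E gd ltxx.
have c1D' : c1 < D by rewrite lt_neqAle c1D andbT; apply/eqP => E; move: g1; rewrite E gD ltxx.
have Uc2' : U < c2 by rewrite lt_neqAle Uc2 andbT; apply/eqP => E; move: g2; rewrite -E gU ltxx.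
have c2u' : c2 < u by rewrite lt_neqAle c2u andbT; apply/eqP => E; move: g2; rewrite E gu ltxx.
have lmin : local_minimum (gfun A B) c1.
  have e0 : 0 < Num.min (c1 - d) (D - c1) by rewrite lt_min !subr_gt0 dc1'.
  exists (Num.min (c1 - d) (D - c1)) => //= z; rewrite /= lt_min => /andP[t1 t2].
  have q1 := ler_norm (c1 - z); have := ler_norm (z - c1); rewrite distrC => q2.
  by apply: Hc1; rewrite in_itv/=; apply/andP; split; lra.
have lmax : local_maximum (gfun A B) c2.
  have e0 : 0 < Num.min (c2 - U) (u - c2) by rewrite lt_min !subr_gt0 Uc2'.
  exists (Num.min (c2 - U) (u - c2)) => //= z; rewrite /= lt_min => /andP[t1 t2].
  have q1 := ler_norm (c2 - z); have := ler_norm (z - c2); rewrite distrC => q2.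
  by apply: Hc2; rewrite in_itv/=; apply/andP; split; lra.
have G1 : gder A B c1 = 0 by exact: local_minimum_der (der_gfun hh A B c1) lmin.
have G2 : gder A B c2 = 0 by exact: local_maximum_der (der_gfun hh A B c2) lmax.
exists c1, c2; split=> //.
- apply: (min_left_of_kink sigma0 beta0 hh c1D' _ G1) => [|z cz zD].
    by rewrite (lt_trans g1)// oppr_lt0.
  by apply: Hc1; rewrite in_itv/= (le_trans dc1).
- apply: (max_right_of_kink sigma0 beta0 hh Uc2' _ G2) => [|z cz zD].
    exact: lt_trans g2.
  by apply: Hc2; rewrite in_itv/= cz (le_trans zD).
Qed.

Section given_free_boundary.
Variables (A B d D U u : R).
Hypothesis fb : free_boundary mu sigma beta K L k ell h a A B d D U u.
Local Notation v := (vfun A B).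
Local Notation g := (gfun A B).
Local Notation g' := (gder A B).

Lemma fb_order : [/\ d < D, D < U & U < u].
Proof.
have [[x1 [x2 [_ _ _ _ [? ? ? ? ?]]]] _ _ _ _] := fb.
by split=> //; [apply: lt_trans|apply: (@lt_trans _ _ x2)]; first by eassumption.
Qed.

Lemma fb_values : [/\ g d = - k, g D = - k, g U = ell & g u = ell].
Proof. by have [_ _ _ [? ?] [? ?]] := fb; rewrite -(gAB_gfun sigma0 beta0 hh). Qed.

Lemma fb_integrals :
  v d - v D = K + k * (D - d) /\ v u - v U = L + ell * (u - U).
Proof.
have [dD DU Uu] := fb_order.
have [_ + + _ _] := fb; rewrite (gAB_gfun sigma0 beta0 hh).
rewrite integral_gfun ?(ltW dD)// (integral_gfun A B (- ell)) ?(ltW Uu)//.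
by move=> H1 H2; split; lra.
Qed.

Lemma fb_shape : exists x1 x2, [/\ [/\ x1 < a, a < x2, d < x1, x1 < D & U < x2 /\ x2 < u],
  g' x1 = 0, g' x2 = 0 &
  [/\ forall x, x <= x1 -> g' x <= 0, forall x, x1 <= x -> x <= x2 -> 0 <= g' x &
      forall x, x2 <= x -> g' x <= 0]].
Proof.
have [[x1 [x2 [xa m1 ax m2 [? ? DU ? ?]]]] _ _ _ _] := fb.
rewrite (gAB_gfun sigma0 beta0 hh) in m1 m2.
have G1 : g' x1 = 0 by exact: local_minimum_der (der_gfun hh A B x1) m1.
have G2 : g' x2 = 0 by exact: local_maximum_der (der_gfun hh A B x2) m2.
exists x1, x2; split=> //.
by apply: (gder_shape sigma0 beta0 hh _ G1 G2); exact: lt_trans ax.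
Qed.

Let g_noninc x y : x <= y -> (forall z, x <= z -> z <= y -> g' z <= 0) -> g y <= g x.
Proof.
move=> xy H; apply: (der_le0_ge xy (der_continuous (der_gfun hh A B)) (fun z _ _ => der_gfun hh A B z)).
by move=> z xz zy; apply: H; exact: ltW.
Qed.

Let g_nondec x y : x <= y -> (forall z, x <= z -> z <= y -> 0 <= g' z) -> g x <= g y.
Proof.
move=> xy H; apply: (der_ge0_le xy (der_continuous (der_gfun hh A B)) (fun z _ _ => der_gfun hh A B z)).
by move=> z xz zy; apply: H; exact: ltW.
Qed.

Lemma fb_bands : [/\ forall x, d <= x -> x <= D -> g x <= - k,
  forall x, D <= x -> x <= u -> - k <= g x,
  forall x, d <= x -> x <= U -> g x <= ell &
  forall x, U <= x -> x <= u -> ell <= g x].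
Proof.
have [x1 [x2 [[x1a ax2 dx1 x1D [Ux2 x2u]] _ _ [s1 s2 s3]]]] := fb_shape.
have [gd gD gU gu] := fb_values; have [dD DU Uu] := fb_order.
have x12 : x1 < x2 by exact: lt_trans ax2.
have kell : - k <= ell by have := k0; have := ell0; lra.
have Q1 x : d <= x -> x <= D -> g x <= - k.
  move=> dx xD; have [xx1|x1x] := leP x x1.
    by rewrite -gd; apply: g_noninc => // z _ zx; apply: s1; exact: le_trans xx1.
  rewrite -gD; apply: g_nondec => // z xz zD; apply: s2; first by rewrite (le_trans (ltW x1x)).
  by rewrite (le_trans zD)// ltW// (lt_trans DU).
have Q4 x : U <= x -> x <= u -> ell <= g x.
  move=> Ux xu; have [xx2|x2x] := leP x x2.
    rewrite -gU; apply: g_nondec => // z Uz zx; apply: s2; last exact: le_trans xx2.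
    by rewrite (le_trans _ Uz)// ltW// (lt_trans x1D).
  by rewrite -gu; apply: g_noninc => // z xz _; apply: s3; rewrite (le_trans (ltW x2x)).
split=> // x xl xr.
  have [xU|Ux] := leP x U; last by rewrite (le_trans kell)// Q4// ltW.
  rewrite -gD; apply: g_nondec => // z xz zD; apply: s2; first by rewrite (le_trans (ltW x1D)).
  by rewrite (le_trans zD)// (le_trans xU)// ltW.
have [xD|Dx] := leP x D; first by rewrite (le_trans (Q1 _ _ _)).
rewrite -gU; apply: g_nondec => // z xz zD; last first.
  by apply: s2; [rewrite (le_trans _ xz)// ltW// (lt_trans x1D)|rewrite (le_trans zD)// ltW].
Qed.

Lemma fb_slopes : [/\ d < a, a < u, g' d <= 0 & g' u <= 0] /\
  (h' d <= - (k * beta) /\ ell * beta <= h' u).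
Proof.
have [x1 [x2 [[x1a ax2 dx1 x1D [Ux2 x2u]] G1 G2 [s1 s2 s3]]]] := fb_shape.
have [gd gD gU gu] := fb_values.
have da : d < a by exact: lt_trans x1a.
have au : a < u by exact: lt_trans x2u.
have gd0 : g' d <= 0 by apply: s1; exact: ltW.
have gu0 : g' u <= 0 by apply: s3; exact: ltW.
split; split=> //.
  have := slope_left_bound sigma0 beta0 hh (negbT (lt_eqF da)) dx1 gd0 G1.
  by rewrite gd mulrN mulrC.
have := slope_right_bound sigma0 beta0 hh (negbT (gt_eqF au)) x2u gu0 G2.
by rewrite gu mulrC.
Qed.

(** A constant piece would make [gder] nonpositive everywhere by [gder_flat], hence [g U <= g D],
    against [- k < ell]. This is what allows the barriers to be read off the value function. *)
Lemma fb_nonconstant x y : x < y -> (forall z, x <= z -> z <= y -> g z = g x) -> False.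
Proof.
move=> xy gc; have [gd gD gU gu] := fb_values; have [dD DU Uu] := fb_order.
(* Points of the middle third have a neighbourhood on which [g] is constant. *)
pose x' := x + (y - x) / 3; pose y' := x + 2 * (y - x) / 3.
have xy0 : 0 < y - x by rewrite subr_gt0.
have xx' : x < x' by rewrite /x' ltrDl divr_gt0.
have x'y' : x' < y' by rewrite /x' /y' ltrD2l ltr_pM2r ?invr_gt0//; lra.
have y'y : y' < y by rewrite /y'; lra.
have flat z : x' <= z -> z <= y' -> g' z = 0.
  move=> xz zy; apply: (local_minimum_der (der_gfun hh A B z)).
  have e0 : 0 < Num.min (z - x) (y - z) by rewrite lt_min; apply/andP; split; lra.
  exists (Num.min (z - x) (y - z)) => //= t; rewrite /= lt_min => /andP[t1 t2].
  have := ler_norm (z - t); have := ler_norm (t - z); rewrite distrC => n1' n2'.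
  by rewrite (gc z) ?(gc t)//; lra.
have G := gder_flat sigma0 beta0 hh x'y' flat.
have : g U <= g D by apply: g_noninc => //; exact: ltW.
by rewrite gD gU; have := k0; have := ell0; lra.
Qed.

End given_free_boundary.

End free_boundary_facts.

(** * The value function *)

Section lipschitz.
Context {R : realType}.
Implicit Types (f g df : R -> R) (c x y d u : R).

Definition lip c f : Prop := forall x y, `|f x - f y| <= c * `|x - y|.

Lemma lip_continuous c f : lip c f -> continuous f.
Proof.
move=> fc x; apply/cvgrPdist_le => e e0.
have c0 : 0 < `|c| + 1 by rewrite ltr_wpDl.
exists (e / (`|c| + 1)) => /=; first by rewrite divr_gt0.
move=> y /=; rewrite ltr_pdivlMr// => H; apply: (le_trans (fc x y)).
have := ler_norm c; have := normr_ge0 (x - y); nra.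
Qed.

Lemma lip_le c c' f : c <= c' -> lip c f -> lip c' f.
Proof. by move=> cc' fc x y; rewrite (le_trans (fc x y))// ler_wpM2r. Qed.

Lemma lip_der c f df : (forall x, is_derive x 1 f (df x)) -> (forall x, `|df x| <= c) -> lip c f.
Proof.
move=> dfx dfc.
have H x y : x < y -> `|f x - f y| <= c * `|x - y|.
  move=> xy; have [z [_ _ E]] := der_MVT xy (der_continuous dfx) (fun z _ _ => dfx z).
  by rewrite distrC E normrM [`|x - y|]distrC ler_wpM2r.
move=> x y; have [xy|yx|->] := ltgtP x y; first exact: H.
  by rewrite distrC [`|x - y|]distrC H.
by rewrite !subrr normr0 mulr0.
Qed.

Lemma lipD c c' f g : lip c f -> lip c' g -> lip (c + c') (fun x => f x + g x).
Proof.
move=> fc gc x y; rewrite opprD addrACA mulrDl.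
by rewrite (le_trans (ler_normD _ _))// lerD.
Qed.

Lemma lipZ c a f : lip c f -> lip (`|a| * c) (fun x => a * f x).
Proof. by move=> fc x y; rewrite -mulrBr normrM -mulrA ler_wpM2l. Qed.

Lemma lipM c c' M f g : lip c f -> lip c' g -> (forall x, `|f x| <= M) ->
  (forall x, `|g x| <= M) -> lip (M * (c + c')) (fun x => f x * g x).
Proof.
move=> fc gc fM gM x y.
have -> : f x * g x - f y * g y = f x * (g x - g y) + g y * (f x - f y) by ring.
rewrite (le_trans (ler_normD _ _))// !normrM mulrDr mulrDl addrC -!mulrA.
by apply: lerD; apply: ler_pM.
Qed.

Definition clamp d u x : R := Num.max d (Num.min x u).

Lemma clamp_id d u x : d <= x -> x <= u -> clamp d u x = x.
Proof. by move=> dx xu; rewrite /clamp min_l// max_r. Qed.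

Lemma clamp_l d u x : d <= u -> x <= d -> clamp d u x = d.
Proof. by move=> du xd; rewrite /clamp min_l ?max_l// (le_trans xd). Qed.

Lemma clamp_r d u x : d <= u -> u <= x -> clamp d u x = u.
Proof. by move=> du ux; rewrite /clamp min_r// max_r. Qed.

Lemma clamp_in d u x : d <= u -> d <= clamp d u x /\ clamp d u x <= u.
Proof. by move=> du; rewrite /clamp le_max lexx ge_max du ge_min lexx orbT. Qed.

Lemma lip_clamp d u : lip 1 (clamp d u).
Proof.
move=> x y; rewrite mul1r; wlog xy : x y / x <= y.
  move=> H; have [/H//|/ltW/H] := leP x y; by rewrite distrC [`|y - x|]distrC.
rewrite [leLHS]distrC [leRHS]distrC [leRHS]ger0_norm ?subr_ge0// ger0_norm ?subr_ge0.
  rewrite /clamp; case: (leP x u) => xu; case: (leP y u) => yu;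
    [case: (leP d x) => dx; case: (leP d y) => dy
    |case: (leP d x) => dx; case: (leP d u) => dy
    |case: (leP d u) => dx; case: (leP d y) => dy
    |case: (leP d u) => dx]; lra.
by rewrite /clamp ge_max !le_max lexx/=; apply/orP; right; rewrite le_min !ge_min lexx xy/= orbT.
Qed.

Lemma lip_comp_clamp c f d u : d <= u -> 0 <= c ->
  (forall x y, d <= x -> x <= u -> d <= y -> y <= u -> `|f x - f y| <= c * `|x - y|) ->
  lip c (fun x => f (clamp d u x)).
Proof.
move=> du c0 H x y; have [? ?] := clamp_in x du; have [? ?] := clamp_in y du.
by rewrite (le_trans (H _ _ _ _ _ _))// ler_wpM2l// -[leRHS]mul1r lip_clamp.
Qed.

Lemma continuous_bounded f d u : d <= u -> continuous f ->
  exists c, 0 <= c /\ forall x, d <= x -> x <= u -> `|f x| <= c.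
Proof.
move=> du cf; have cn : continuous (fun x => `|f x|).
  by move=> x; apply: cvg_norm; exact: cf.
have [c _ H] := EVT_max du (continuous_subspaceT cn).
by exists `|f c|; split=> // x dx xu; apply: H; rewrite in_itv/= dx.
Qed.

Lemma lip_der_on f df d u : d <= u -> (forall x, is_derive x 1 f (df x)) -> continuous df ->
  exists c, 0 <= c /\ lip c (fun x => f (clamp d u x)).
Proof.
move=> du dfx cdf; have [c [c0 Hc]] := continuous_bounded du cdf.
exists c; split=> //; apply: lip_comp_clamp => //.
have H x y : d <= x -> x < y -> y <= u -> `|f x - f y| <= c * `|x - y|.
  move=> dx xy yu; have [z [xz zy E]] := der_MVT xy (der_continuous dfx) (fun z _ _ => dfx z).
  rewrite distrC E normrM [`|x - y|]distrC ler_wpM2r// Hc//; lra.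
move=> x y dx xu dy yu; have [xy|yx|->] := ltgtP x y; first exact: H.
  by rewrite distrC [`|x - y|]distrC H.
by rewrite !subrr normr0 mulr0.
Qed.

End lipschitz.

Section value_function.
Context {R : realType}.
Variables (mu sigma beta K L k ell : R) (h : R -> R) (a : R).
Hypotheses (sigma0 : 0 < sigma) (beta0 : 0 < beta).
Hypotheses (K0 : 0 < K) (L0 : 0 < L) (k0 : 0 < k) (ell0 : 0 < ell).
Hypothesis hh : holding_cost mu sigma beta k ell h a.
Local Notation vfun := (vfun mu sigma beta h a).
Local Notation gfun := (gfun mu sigma beta h a).
Local Notation gder := (gder mu sigma beta h a).
Implicit Types (A B x y z al ga : R).

Let h0 x : 0 <= h x. Proof. exact: (holding_ge0 hh). Qed.

Let dv A B x : is_derive x 1 (vfun A B) (gfun A B x).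
Proof. exact: (der_vfun sigma0 beta0 hh). Qed.
Let dg A B x : is_derive x 1 (gfun A B) (gder A B x).
Proof. exact: (der_gfun hh). Qed.

(** The slope of a supporting line at a point of [[p, q]] is controlled by the values of [h] one
    unit outside, because [h] is nonnegative. *)
Lemma cost_lipschitz p q : exists c, 0 <= c /\
  forall x y, p <= x -> x <= q -> p <= y -> y <= q -> `|h x - h y| <= c * `|x - y|.
Proof.
pose c := Num.max (h (q + 1)) (h (p - 1)); have c0 : 0 <= c by rewrite le_max h0.
have hq : h (q + 1) <= c by rewrite le_max lexx.
have hp : h (p - 1) <= c by rewrite le_max lexx orbT.
exists c; split=> //.
have H x y : p <= x -> x <= q -> h x - h y <= c * `|x - y|.
  move=> px xq; have [m Hm] := cost_subgradient hh x.
  have m1 : m <= c.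
    by have := Hm (q + 1); have := h0 x; rewrite -subr_ge0 in xq; nra.
  have m2 : - m <= c.
    by have := Hm (p - 1); have := h0 x; rewrite -subr_ge0 in px; nra.
  have mc : `|m| <= c by rewrite ler_norml lerNl m2.
  have H1 : h x - h y <= m * (x - y) by have := Hm y; lra.
  by rewrite (le_trans H1)// (le_trans (ler_norm _))// normrM ler_wpM2r.
move=> x y px xq py yq; have H1 := H x y px xq; have H2 := H y x py yq.
by rewrite distrC in H2; rewrite ler_norml H1 andbT; lra.
Qed.

Section band_value.
Variables (A B d D U u : R).
Hypothesis fb : free_boundary mu sigma beta K L k ell h a A B d D U u.
Local Notation v := (vfun A B).
Local Notation g := (gfun A B).
Local Notation g' := (gder A B).

Let du : d <= u.
Proof.
have [dD DU Uu] := fb_order fb.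
by apply: ltW; rewrite (lt_trans dD)// (lt_trans DU).
Qed.

Definition Vder x : R := g (clamp d u x).
Definition Vfun x : R := v d + oriented_integral d x Vder.

Lemma Vder_lip : exists c, 0 <= c /\ lip c Vder.
Proof. exact: lip_der_on du (@dg A B) (@gder_continuous _ _ _ _ _ _ _ _ hh A B). Qed.

Lemma Vder_bounded : exists c, 0 <= c /\ forall x, `|Vder x| <= c.
Proof.
have [c [c0 Hc]] := continuous_bounded du (der_continuous (@dg A B)).
by exists c; split=> // x; have [? ?] := clamp_in x du; exact: Hc.
Qed.

Lemma Vder_continuous : continuous Vder.
Proof. by have [c [_ /lip_continuous]] := Vder_lip. Qed.

Lemma der_Vfun x : is_derive x 1 Vfun (Vder x).
Proof.
apply: (der_eq (derD (der_cst (v d) x) (der_oriented_integral d x Vder_continuous))).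
by rewrite add0r.
Qed.

Lemma Vfun_eq (F f : R -> R) x y : x <= y -> (forall z, is_derive z 1 F (f z)) ->
  (forall z, x < z -> z < y -> Vder z = f z) -> Vfun y - F y = Vfun x - F x.
Proof.
move=> xy dF E; apply/eqP; rewrite eq_le.
have dVF z : is_derive z 1 (fun z => Vfun z - F z) (Vder z - f z).
  exact: derB (der_Vfun z) (dF z).
apply/andP; split.
  apply: (der_le0_ge xy (der_continuous dVF) (fun z _ _ => dVF z)) => z xz zy.
  by rewrite E// subrr.
apply: (der_ge0_le xy (der_continuous dVF) (fun z _ _ => dVF z)) => z xz zy.
by rewrite E// subrr.
Qed.

Let Vd : Vfun d = v d.
Proof. by rewrite /Vfun oriented_integral_refl addr0. Qed.

Lemma Vder_left x : x <= d -> Vder x = - k.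
Proof.
have [gd _ _ _] := fb_values sigma0 beta0 hh fb.
by move=> xd; rewrite /Vder clamp_l.
Qed.

Lemma Vder_right x : u <= x -> Vder x = ell.
Proof.
have [_ _ _ gu] := fb_values sigma0 beta0 hh fb.
by move=> xu; rewrite /Vder clamp_r.
Qed.

Lemma Vder_in x : d <= x -> x <= u -> Vder x = g x.
Proof. by move=> dx xu; rewrite /Vder clamp_id. Qed.

Lemma Vfun_in x : d <= x -> x <= u -> Vfun x = v x.
Proof.
move=> dx xu; have := Vfun_eq dx (@dv A B); rewrite Vd subrr.
move=> /(_ _)/eqP; rewrite subr_eq0 => H; apply/eqP/H => z dz zx.
by rewrite Vder_in ?ltW// (lt_le_trans zx).
Qed.

Lemma Vfun_left x : x <= d -> Vfun x = v d + k * (d - x).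
Proof.
move=> xd; have := @Vfun_eq (fun z => - k * z + 0) (fun=> - k) x d xd (der_affine _ _).
by rewrite Vd => H; have := H (fun z _ zd => Vder_left (ltW zd)); lra.
Qed.

Lemma Vfun_right x : u <= x -> Vfun x = v u + ell * (x - u).
Proof.
move=> ux; have := @Vfun_eq (fun z => ell * z + 0) (fun=> ell) u x ux (der_affine _ _).
by rewrite (Vfun_in du (lexx u)) => H; have := H (fun z uz _ => Vder_right (ltW uz)); lra.
Qed.

Let dFk c x : is_derive x 1 (fun z => Vfun z + c * z) (Vder x + c).
Proof. by apply: (der_eq (derD (der_Vfun x) (derZ c (der_id x)))); rewrite mulr1. Qed.

Let Fk_le c x y : x <= y -> (forall z, x < z -> z < y -> 0 <= Vder z + c) ->
  Vfun x + c * x <= Vfun y + c * y.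
Proof. by move=> xy; exact: (der_ge0_le xy (der_continuous (@dFk c)) (fun z _ _ => dFk c z)). Qed.

Let Fk_ge c x y : x <= y -> (forall z, x < z -> z < y -> Vder z + c <= 0) ->
  Vfun y + c * y <= Vfun x + c * x.
Proof. by move=> xy; exact: (der_le0_ge xy (der_continuous (@dFk c)) (fun z _ _ => dFk c z)). Qed.

(** [Vfun + k * x] is constant up to [d], falls from [d] to [D] and does not fall afterwards, so its
    largest drop from left to right is the one from [d] to [D], which is exactly [K]. *)
Lemma Vfun_jump_up x y : x <= y -> Vfun x <= Vfun y + K + k * (y - x).
Proof.
move=> xy; have [dD DU Uu] := fb_order fb.
have [q1 q2 q3 q4] := fb_bands sigma0 beta0 k0 ell0 hh fb.
have [E _] := fb_integrals sigma0 beta0 hh fb.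
have Du : D <= u by rewrite ltW// (lt_trans DU).
have neg z : z <= D -> Vder z + k <= 0.
  move=> zD; have [dz|zd] := leP d z; last by rewrite (Vder_left (ltW zd)) addrC subrr.
  by rewrite (Vder_in dz (le_trans zD Du)); have := q1 z dz zD; lra.
have pos z : D <= z -> 0 <= Vder z + k.
  move=> Dz; have [zu|uz] := leP z u; last by rewrite (Vder_right (ltW uz)); have := k0; have := ell0; lra.
  by rewrite (Vder_in (le_trans (ltW dD) Dz) zu); have := q2 z Dz zu; lra.
have [Dx|xD] := leP D x.
  have := @Fk_le k x y xy (fun z xz _ => pos z (le_trans Dx (ltW xz))); have := K0; lra.
have Fx : Vfun x + k * x <= Vfun d + k * d.
  have [dx|xd] := leP d x; last by rewrite (Vfun_left (ltW xd)) Vd; lra.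
  exact: (@Fk_ge k d x dx (fun z _ zx => neg z (ltW (lt_trans zx xD)))).
have Fy : Vfun D + k * D <= Vfun y + k * y.
  have [Dy|yD] := leP D y; first exact: (@Fk_le k D y Dy (fun z Dz _ => pos z (ltW Dz))).
  exact: (@Fk_ge k y D (ltW yD) (fun z _ zD => neg z (ltW zD))).
by move: Fx Fy; rewrite Vd (Vfun_in (ltW dD) Du); lra.
Qed.

Lemma Vfun_jump_down x y : x <= y -> Vfun y <= Vfun x + L + ell * (y - x).
Proof.
move=> xy; have [dD DU Uu] := fb_order fb.
have [q1 q2 q3 q4] := fb_bands sigma0 beta0 k0 ell0 hh fb.
have [_ E] := fb_integrals sigma0 beta0 hh fb.
have dU : d <= U by rewrite ltW// (lt_trans dD).
have neg z : z <= U -> Vder z + - ell <= 0.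
  move=> zU; have [dz|zd] := leP d z; last by rewrite (Vder_left (ltW zd)); have := k0; have := ell0; lra.
  by rewrite (Vder_in dz (le_trans zU (ltW Uu))); have := q3 z dz zU; lra.
have pos z : U <= z -> 0 <= Vder z + - ell.
  move=> Uz; have [zu|uz] := leP z u; last by rewrite (Vder_right (ltW uz)) subrr.
  by rewrite (Vder_in (le_trans dU Uz) zu); have := q4 z Uz zu; lra.
have [yU|Uy] := leP y U.
  have := @Fk_ge (- ell) x y xy (fun z _ zy => neg z (le_trans (ltW zy) yU)); have := L0; lra.
have Fx : Vfun y + - ell * y <= Vfun u + - ell * u.
  have [yu|uy] := leP y u; last by rewrite (Vfun_right (ltW uy)) (Vfun_in du (lexx u)); lra.
  exact: (@Fk_le (- ell) y u yu (fun z yz _ => pos z (ltW (lt_trans Uy yz)))).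
have Fy : Vfun U + - ell * U <= Vfun x + - ell * x.
  have [Dy|yD] := leP U x; first exact: (@Fk_le (- ell) U x Dy (fun z Dz _ => pos z (ltW Dz))).
  exact: (@Fk_ge (- ell) x U (ltW yD) (fun z _ zD => neg z (ltW zD))).
by move: Fx Fy; rewrite (Vfun_in du (lexx u)) (Vfun_in dU (ltW Uu)); lra.
Qed.

(** At [d] the equation together with [g' d <= 0] gives the inequality. Further left [beta * V]
    grows at the rate [k * beta], and [h] at least as fast, as its slope at [d] is at most
    [- (k * beta)]. *)
Lemma Vfun_generator_left x : x <= d -> 0 <= - mu * k - beta * Vfun x + h x.
Proof.
move=> xd; rewrite Vfun_left//.
have [[da au gd0 gu0] [sd su]] := fb_slopes sigma0 beta0 hh fb.
have [gd _ _ _] := fb_values sigma0 beta0 hh fb.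
have := vfun_ode mu h a sigma0 beta0 A B d; rewrite gd => ode.
have s20 : 0 <= sigma ^+ 2 / 2 by rewrite divr_ge0// sqr_ge0.
have := mulr_ge0_le0 s20 gd0.
have := cost_tangent hh x (negbT (lt_eqF da)).
have := ler_wpM2r (_ : 0 <= d - x) sd; rewrite subr_ge0 => /(_ xd); lra.
Qed.

Lemma Vfun_generator_right x : u <= x -> 0 <= mu * ell - beta * Vfun x + h x.
Proof.
move=> xd; rewrite Vfun_right//.
have [[da au gd0 gu0] [sd su]] := fb_slopes sigma0 beta0 hh fb.
have [_ _ _ gd] := fb_values sigma0 beta0 hh fb.
have := vfun_ode mu h a sigma0 beta0 A B u; rewrite gd => ode.
have s20 : 0 <= sigma ^+ 2 / 2 by rewrite divr_ge0// sqr_ge0.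
have := mulr_ge0_le0 s20 gu0.
have := cost_tangent hh x (negbT (gt_eqF au)).
have := ler_wpM2r (_ : 0 <= x - u) su; rewrite subr_ge0 => /(_ xd); lra.
Qed.

(* The inequality [sigma^2/2 V'' + mu V' - beta V + h >= 0], integrated because
   [V''] jumps at [d] and [u]. *)
Lemma Vfun_generator (Q H : R -> R) : (forall x, is_derive x 1 Q (Vfun x)) ->
  (forall x, is_derive x 1 H (h x)) -> forall x y, x <= y ->
  sigma ^+ 2 / 2 * Vder x + mu * Vfun x - beta * Q x + H x <=
  sigma ^+ 2 / 2 * Vder y + mu * Vfun y - beta * Q y + H y.
Proof.
move=> dQ dH; pose F z := sigma ^+ 2 / 2 * Vder z + mu * Vfun z - beta * Q z + H z.
have cF : continuous F.
  apply: contD; last exact: der_continuous dH.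
  apply: contB; last by apply: contZ; exact: der_continuous dQ.
  by apply: contD; apply: contZ; [exact: Vder_continuous|exact: der_continuous der_Vfun].
have dF z r : is_derive z 1 Vder r -> is_derive z 1 F (sigma ^+ 2 / 2 * r + mu * Vder z - beta * Vfun z + h z).
  move=> dz; exact: (derD (derB (derD (derZ _ dz) (derZ mu (der_Vfun z))) (derZ beta (dQ z))) (dH z)).
have cst c z : (\forall t \near z, Vder t = c) -> is_derive z 1 Vder 0.
  by move=> E; apply: near_eq_is_derive (der_cst c z); apply: filterS E => t ->.
have F1 x y : x <= y -> y <= d -> F x <= F y.
  move=> xy yd; refine (der_ge0_le xy cF (fun z _ zy => dF z 0 _) _).
    apply: (cst (- k)); near=> t; apply: Vder_left; apply: ltW; near: t.
    by apply: (cvgr_lt z) => //; exact: lt_le_trans yd.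
  move=> z xz zy; have zd : z <= d by rewrite (le_trans (ltW zy)).
  by rewrite Vder_left// mulr0 add0r; have := Vfun_generator_left zd; lra.
have F3 x y : x <= y -> u <= x -> F x <= F y.
  move=> xy yd; refine (der_ge0_le xy cF (fun z xz _ => dF z 0 _) _).
    apply: (cst ell); near=> t; apply: Vder_right; apply: ltW; near: t.
    by apply: (cvgr_gt z) => //; exact: le_lt_trans yd xz.
  move=> z xz zy; have zd : u <= z by rewrite (le_trans yd)// ltW.
  by rewrite Vder_right// mulr0 add0r; have := Vfun_generator_right zd; lra.
have F2 x y : x <= y -> d <= x -> y <= u -> F x <= F y.
  move=> xy dx yu; refine (der_ge0_le xy cF (fun z xz zy => dF z (g' z) _) _).
    have E : \forall t \near z, g t = Vder t.
      near=> t; rewrite Vder_in//; apply: ltW; near: t.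
        by apply: (cvgr_gt z) => //; exact: le_lt_trans dx xz.
      by apply: (cvgr_lt z) => //; exact: lt_le_trans zy yu.
    exact: near_eq_is_derive E (dg A B z).
  move=> z xz zy; have dz : d <= z by rewrite (le_trans dx)// ltW.
  have zu : z <= u by rewrite (le_trans (ltW zy)).
  by rewrite Vder_in// Vfun_in// vfun_ode.
move=> x y xy; rewrite -!/(F _).
(* The interval [[x, y]] is cut at [d] and [u]; [Num.min] and [Num.max] make pieces degenerate when
   [x] or [y] lies beyond a cut. *)
have q1 : F x <= F (Num.min y (Num.max x d)).
  have /orP[dx|xd] := le_total d x; first by rewrite max_l// min_r.
  rewrite max_r//; apply: F1; first by rewrite le_min xy.
  by rewrite ge_min lexx orbT.
have q2 : F (Num.min y (Num.max x d)) <= F (Num.min y (Num.max x u)).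
  have /orP[xu|ux] := le_total u x.
    by rewrite !max_l// (le_trans du).
  have /orP[yd|dy] := le_total y (Num.max x d).
    by rewrite !min_l// (le_trans yd)// ge_max le_max lexx le_max du orbT.
  rewrite (max_r ux) (min_r dy); apply: F2.
  - by rewrite le_min dy/= ge_max ux.
  - by rewrite le_max lexx orbT.
  - by rewrite ge_min lexx orbT.
apply: (le_trans q1); apply: (le_trans q2).
have /orP[yu|uy] := le_total y (Num.max x u); first by rewrite min_l.
by rewrite min_r//; apply: F3 => //; rewrite le_max lexx orbT.
Unshelve. all: by end_near. Qed.

End band_value.

End value_function.

(** * Brownian increments *)

Section gaussian_law.
Context {R : realType} {dsp : measure_display} {Omega : measurableType dsp}.
Local Notation leb := (@lebesgue_measure R).
Variables (P : probability Omega R) (s : R) (X : Omega -> R).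
Hypotheses (s0 : 0 < s) (mX : measurable_fun setT X).
Hypothesis lawX : forall B, measurable B -> P (X @^-1` B) = normal_prob 0 s B.
Local Notation q := (normal_pdf 0 s).
Implicit Types (x : R) (f F g : R -> R).

Let s_neq0 : s != 0. Proof. exact: lt0r_neq0. Qed.

Lemma normal_pdf_exp x : q x = normal_peak s * expR (- (s ^+ 2 * 2)^-1 * (x * x)).
Proof.
rewrite normal_pdfE// /normal_fun subr0; congr (_ * expR _).
by rewrite -expr2 mulr_natr mulNr [in RHS]mulNr [in RHS]mulrC.
Qed.

Lemma der_normal_pdf x : is_derive x 1 q (- x / s ^+ 2 * q x).
Proof.
have -> : q = fun y => normal_peak s * expR (- (s ^+ 2 * 2)^-1 * (y * y)).
  by apply/funext => y; rewrite normal_pdf_exp.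
apply: (der_eq (derZ _ (@der_comp _ expR (fun y => - (s ^+ 2 * 2)^-1 * (y * y)) x _ _
  (is_derive_expR _) (derZ _ (derM (der_id x) (der_id x)))))).
by field.
Qed.

Let cq : continuous q := der_continuous der_normal_pdf.

(** On a compact interval a continuous function is bounded, hence integrable for the law, and the
    Radon-Nikodym derivative agrees almost everywhere with the density. *)
Lemma integral_normal_prob (f : R -> R) (a b : R) : continuous f ->
  (\int[normal_prob 0 s]_(x in `[a, b]) (f x)%:E =
   \int[leb]_(x in `[a, b]) (f x * q x)%:E)%E.
Proof.
move=> cf; have mab : measurable `[a, b]%classic by exact: measurable_itv.
have mf : measurable_fun `[a, b]%classic (EFin \o f).
  by apply/measurable_EFinP/measurable_funTS; exact: continuous_measurable_fun.
have nif : (normal_prob 0 s).-integrable `[a, b]%classic (EFin \o f).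
  apply: measurable_bounded_integrable => //.
  - by rewrite (le_lt_trans (probability_le1 _ _))// ltry.
  - by apply: measurable_funTS; exact: continuous_measurable_fun.
  - have [M [_ HM]] := compact_bounded (continuous_compact
      (continuous_subspaceT cf) (@segment_compact _ a b)).
    by exists M; split; rewrite ?num_real// => y My x xab; apply: HM => //; exists x.
have dom := @normal_prob_dominates R 0 s.
rewrite -(Radon_Nikodym_change_of_variables dom)//=.
apply: ae_eq_integral => //.
- apply: emeasurable_funM => //; apply: (measurable_int leb).
  apply: (integrableS _ _ (@subsetT _ _)) => //=.
  exact: Radon_Nikodym_integrable.
- apply/measurable_EFinP; apply: measurable_funTS; apply: continuous_measurable_fun.
  exact: contM.
- rewrite [X in ae_eq _ _ _ X](_ : _ = (EFin \o f) \* (EFin \o q))%E//.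
  apply: ae_eqe_mul2l; apply: integral_ae_eq => //=.
  + by apply: (integrableS measurableT) => //; exact: Radon_Nikodym_integrable.
  + by apply/measurable_EFinP; apply: measurable_funTS; exact: continuous_measurable_fun.
  + by move=> E _ mE; rewrite -Radon_Nikodym_integral.
Qed.

Let Bn (n : nat) : set R := `[- n%:R, n%:R]%classic.
Let In (f : R -> R) (n : nat) : R := \int[leb]_(x in Bn n) (f x * q x).

(** Moments are computed on [[- n, n]], where all integrands are continuous, and recovered by
    monotone convergence. *)
Lemma law_cvg (f : R -> R) : continuous f -> (forall x, 0 <= f x) ->
  (In f n)%:E @[n --> \oo] --> (\int[P]_w (f (X w))%:E)%E.
Proof.
move=> cf f0.
have mf : measurable_fun setT f by exact: continuous_measurable_fun.
have E n : (In f n)%:E = (\int[P]_(w in X @^-1` Bn n) (f (X w))%:E)%E.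
  have mB : measurable (Bn n) by exact: measurable_itv.
  pose X' : Omega -> measurableTypeR R := X.
  have mX' : measurable_fun setT X' := mX.
  transitivity (\int[pushforward P X']_(x in Bn n) (f x)%:E)%E; last first.
    rewrite (ge0_integral_pushforward mX') //=.
    - by apply/measurable_EFinP/measurable_funTS.
    - by move=> x _; rewrite lee_fin.
  transitivity (\int[normal_prob 0 s]_(x in Bn n) (f x)%:E)%E; last first.
    pose Xp : {mfun _ >-> _} := HB.pack X' (isMeasurableFun.Build _ _ _ _ _ mX').
    apply: (@eq_measure_integral _ _ _ _ (pushforward P Xp) (normal_prob 0 s)).
    by move=> A mA _; rewrite /= -lawX.
  rewrite integral_normal_prob// /In /Rintegral fineK//.
  apply: integrable_fin_num => //.
  exact: (@continuous_integrable _ (fun x => f x * q x)) (contM cf cq).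
under eq_fun do rewrite E.
have -> : [set: Omega] = \bigcup_n (X @^-1` Bn n).
  apply/seteqP; split=> // w _; exists (Num.bound `|X w|) => //=.
  by rewrite /Bn /= in_itv/= -ler_norml; exact/ltW/archi_boundP/normr_ge0.
apply: ge0_nondecreasing_set_cvg_integral.
- move=> m n mn; apply/subsetPset => w; rewrite /Bn/= !in_itv/= => /andP[H1 H2].
  have := mn; rewrite -(ler_nat R) => mnR.
  by rewrite (le_trans _ H1) ?lerN2//= (le_trans H2).
- move=> n; rewrite -[_ @^-1` _]setTI; apply: (mX measurableT).
  exact: measurable_itv.
- move=> n; apply: (@measurable_funTS _ _ _ _ _ _) => //.
  by apply/measurable_EFinP; exact: (measurableT_comp mf mX).
- by move=> n w _; rewrite lee_fin.
Qed.

Let pw k : continuous (fun x : R => x ^+ k).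
Proof. by move=> x; exact: exprn_continuous. Qed.

Let I_der (f F : R -> R) (n : nat) : (forall x, is_derive x 1 F (f x * q x)) ->
  continuous f -> In f n = F n%:R - F (- n%:R).
Proof.
move=> dF cf; apply: Rintegral_derive => //; last exact: contM.
by rewrite (le_trans (_ : _ <= 0))// oppr_le0.
Qed.

Let qN x : q (- x) = q x.
Proof. by rewrite !normal_pdf_exp mulrNN. Qed.

Let q0 x : 0 <= q x. Proof. exact: normal_pdf_ge0. Qed.

Let InB (f g : R -> R) c n : continuous f -> continuous g ->
  In (fun x => f x - c * g x) n = In f n - c * In g n.
Proof.
move=> cf cg; rewrite /In.
have If : leb.-integrable (Bn n) (EFin \o (fun x => f x * q x)).
  by apply: continuous_integrable; exact: contM.
have Ig : leb.-integrable (Bn n) (EFin \o (fun x => g x * q x)).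
  by apply: continuous_integrable; exact: contM.
have Icg : leb.-integrable (Bn n) (EFin \o (fun x => c * (g x * q x))).
  apply: (@continuous_integrable _ (fun x => c * (g x * q x))).
  by apply: contZ; exact: contM.
have mB : measurable (Bn n) by exact: measurable_itv.
transitivity (\int[leb]_(x in Bn n) (f x * q x - c * (g x * q x))).
  by congr Rintegral; apply/funext => x; ring.
by rewrite RintegralB//; congr (_ - _); exact: RintegralZl.
Qed.

(** Integration by parts with the primitive [y * q y]; the boundary terms at [n] and [- n] coincide
    by symmetry of the density. *)
Lemma normal_second n : In (fun x => x ^+ 2) n =
  s ^+ 2 * (In (fun=> 1) n - 2 * n%:R * q n%:R).
Proof.
have c1 : continuous (fun _ : R => 1 : R) by move=> x; exact: cvg_cst.
have dF x : is_derive x 1 (fun y => y * q y) ((1 - (s ^+ 2)^-1 * x ^+ 2) * q x).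
  by apply: (der_eq (derM (der_id x) (der_normal_pdf x))); ring.
have := I_der n dF; rewrite qN InB// => H.
have := H (@contB _ _ _ c1 (@contZ _ _ _ (@pw 2))) => E.
have -> : 2 * n%:R * q n%:R = In (fun=> 1) n - (s ^+ 2)^-1 * In (fun x => x ^+ 2) n.
  by rewrite E; ring.
by field.
Qed.

(** The same with [y * y * y * q y]; the boundary term has a sign and is dropped. *)
Lemma normal_fourth n : In (fun x => x ^+ 4) n <= s ^+ 2 * (3 * In (fun x => x ^+ 2) n).
Proof.
have c3 : continuous (fun x : R => 3 * x ^+ 2) by exact: contZ.
have dF x : is_derive x 1 (fun y => y * y * y * q y)
    ((3 * x ^+ 2 - (s ^+ 2)^-1 * x ^+ 4) * q x).
  apply: (der_eq (derM (derM (derM (der_id x) (der_id x)) (der_id x)) (der_normal_pdf x))).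
  by ring.
have := I_der n dF; rewrite qN InB// => H.
have := H (@contB _ _ _ c3 (@contZ _ _ _ (@pw 4))) => E.
have E3 : In (fun x => 3 * x ^+ 2) n = 3 * In (fun x => x ^+ 2) n.
  have := @InB (fun=> 0) (fun x => x ^+ 2) (- 3) n (fun x => cvg_cst _) (@pw 2).
  have -> : (fun x : R => 0 - (- 3) * x ^+ 2) = (fun x => 3 * x ^+ 2).
    by apply/funext => x; ring.
  have -> : In (fun=> 0) n = 0.
    rewrite /In; under eq_Rintegral do rewrite mul0r.
    by rewrite /Rintegral integral0.
  by move=> ->; ring.
rewrite E3 in E.
have n0 : 0 <= n%:R * n%:R * n%:R * q n%:R by rewrite !mulr_ge0.
have E4 : (s ^+ 2)^-1 * In (fun x => x ^+ 4) n =
  3 * In (fun x => x ^+ 2) n - 2 * (n%:R * n%:R * n%:R * q n%:R) by lra.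
rewrite -[leLHS](@mulVKf _ (s ^+ 2)) ?sqrf_eq0// E4.
by rewrite ler_wpM2l ?sqr_ge0//; lra.
Qed.

Lemma normal_tail : n%:R * q n%:R @[n --> \oo] --> (0 : R).
Proof.
pose c := normal_peak s * (s ^+ 2 * 2).
have c0 : 0 <= c by rewrite mulr_ge0 ?normal_peak_ge0// mulr_ge0// sqr_ge0.
have : c * n%:R^-1 @[n --> \oo] --> (0 : R).
  by rewrite -(mulr0 c); apply: cvgMl_tmp; apply/gtr0_cvgV0; [exists 1%N => // n /=; rewrite ltr0n|exact: cvgr_idn].
apply: squeeze_cvgr (cvg_cst 0); near=> n.
have n0 : (0 : R) < n%:R by rewrite ltr0n; near: n; exists 1%N.
apply/andP; split; first by rewrite mulr_ge0.
rewrite normal_pdf_exp /c mulrCA -!mulrA ler_wpM2l ?normal_peak_ge0//.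
have s2 : 0 < s * (s * 2) by rewrite !mulr_gt0.
rewrite mulNr expRN; set y := (_^-1 * _).
have y0 : 0 < y by rewrite /y mulr_gt0 ?invr_gt0 ?mulr_gt0.
have ey : y <= expR y by have := expR_ge1Dx y; lra.
have -> : s * (s * (2 / n%:R)) = n%:R * y^-1.
  by rewrite /y; field; rewrite (lt0r_neq0 n0) s_neq0.
by rewrite ler_wpM2l ?(ltW n0)// lef_pV2 ?posrE ?expR_gt0.
Unshelve. all: by end_near. Qed.

Lemma normal_moments :
  [/\ intg P (fun w => X w ^+ 2), Ex P (fun w => X w ^+ 2) = s ^+ 2,
      intg P (fun w => X w ^+ 4) & Ex P (fun w => X w ^+ 4) <= 3 * s ^+ 4].
Proof.
have mXk k : measurable_fun setT (fun w => X w ^+ k) by exact: measurable_funX.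
have c1 : continuous (fun _ : R => 1 : R) by move=> x; exact: cvg_cst.
have J0 : In (fun=> 1) n @[n --> \oo] --> (1 : R).
  have := @law_cvg (fun=> 1) c1 (fun=> ler01).
  have -> : (\int[P]__ 1)%E = 1%E.
    by rewrite integral_cst// mul1e; exact: probability_setT.
  by move/fine_cvg.
have J2 : In (fun x => x ^+ 2) n @[n --> \oo] --> s ^+ 2.
  rewrite (_ : In _ = fun n => s ^+ 2 * (In (fun=> 1) n - 2 * n%:R * q n%:R)); last first.
    by apply/funext => n; exact: normal_second.
  rewrite -[X in _ --> X](mulr1 (s ^+ 2)); apply: cvgMl_tmp.
  rewrite -[X in _ --> X]subr0; apply: cvgB => //.
  have H : 2 * (n%:R * q n%:R) @[n --> \oo] --> (2 * 0 : R).
    by apply: cvgMl_tmp; exact: normal_tail.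
  rewrite mulr0 in H; rewrite (_ : (fun n => _) = (fun n => 2 * (n%:R * q n%:R)))//.
  by apply/funext => n; rewrite mulrA.
have E2 : (\int[P]_w (X w ^+ 2)%:E)%E = (s ^+ 2)%:E.
  have := @law_cvg (fun x => x ^+ 2) (@pw 2) (fun x => sqr_ge0 x).
  move=> H; apply: (cvg_unique _ H) => //.
  by apply: cvg_EFin => //; exact: nearW.
have E4 : (\int[P]_w (X w ^+ 4)%:E <= (3 * s ^+ 4)%:E)%E.
  have e4 x : 0 <= x ^+ 4 :> R by rewrite (_ : 4 = 2 * 2)%N// exprM sqr_ge0.
  have H := @law_cvg (fun x => x ^+ 4) (@pw 4) e4.
  have H' : (s ^+ 2 * (3 * In (fun x => x ^+ 2) n))%:E @[n --> \oo] --> (3 * s ^+ 4)%:E.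
    apply: cvg_EFin; first exact: nearW.
    rewrite (_ : 3 * s ^+ 4 = s ^+ 2 * (3 * s ^+ 2)); last by ring.
    by do 2 apply: cvgMl_tmp.
  rewrite -(cvg_lim _ H)// -(cvg_lim _ H')//; apply: lee_lim.
  - by apply/cvg_ex; eexists; exact: H.
  - by apply/cvg_ex; eexists; exact: H'.
  apply: nearW => n.
  by rewrite lee_fin normal_fourth.
have i2 : intg P (fun w => X w ^+ 2).
  apply/integrableP; split; first exact/measurable_EFinP.
  under eq_integral do rewrite /= ger0_norm ?sqr_ge0//.
  by rewrite E2 ltry.
have i4 : intg P (fun w => X w ^+ 4).
  apply/integrableP; split; first exact/measurable_EFinP.
  under eq_integral do rewrite /= ger0_norm ?(exprn_even_ge0 _ (n := 4))//.
  by rewrite (le_lt_trans E4)// ltry.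
split=> //.
  by have := integral_Ex i2; rewrite E2 => -[].
by have := integral_Ex i4; rewrite -lee_fin => <-.
Qed.

End gaussian_law.

(** * Orthogonality to a sigma-algebra, and independence *)

Section strict_expectation.
Context {R : realType} {dsp : measure_display} {Omega : measurableType dsp}.
Variables (P : probability Omega R).
Local Notation intg := (intg P).
Local Notation Ex := (Ex P).
Implicit Types (X Y : Omega -> R) (G : set (set Omega)).

Lemma measurable_wrtP G X : sigma_algebra setT G ->
  measurable_wrt G X <-> measurable_fun setT (X : g_sigma_algebraType G -> R).
Proof.
move=> sG; have E : @measurable _ (g_sigma_algebraType G) = G.
  exact: sigma_algebra_id.
split=> [mX _ B mB|mX B mB]; first by rewrite setTI E; exact: mX.
by have := mX measurableT B mB; rewrite setTI E.
Qed.

Lemma measurable_wrt_mf G X : G `<=` measurable -> measurable_wrt G X ->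
  measurable_fun setT X.
Proof. by move=> Gm mX _ B mB; rewrite setTI; exact/Gm/mX. Qed.

Lemma measurable_wrt_sub G G' X : G `<=` G' -> measurable_wrt G X -> measurable_wrt G' X.
Proof. by move=> GG' mX B mB; exact/GG'/mX. Qed.

(* Rounding down to a multiple of [1/n] on [[-n, n[]. *)
Definition grid (n i : nat) : R := i%:R / n.+1%:R - n.+1%:R.
Definition in_cell (n i : nat) (x : R) : bool := grid n i <= x < grid n i.+1.
Definition rounding (n : nat) (x : R) : R :=
  \sum_(i < 2 * n.+1 * n.+1) grid n i * (in_cell n i x)%:R.

Lemma gridS n i : grid n i.+1 = grid n i + n.+1%:R^-1.
Proof. by rewrite /grid -natr1 mulrDl mul1r addrAC. Qed.

Lemma in_cellP n i x : in_cell n i x = (0 <= (x + n.+1%:R) * n.+1%:R) && (Num.truncn ((x + n.+1%:R) * n.+1%:R) == i).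
Proof.
have n0 : (0 : R) < n.+1%:R by rewrite ltr0n.
rewrite /in_cell /grid lerBlDr ltrBrDr ler_pdivrMr// ltr_pdivlMr//.
set y := _ * _; apply/idP/idP => [/andP[iy yi]|/andP[y0 /eqP <-]]; last exact: truncn_itv.
have y0 : 0 <= y by rewrite (le_trans _ iy).
by rewrite y0/=; apply/eqP/truncn_def; rewrite iy.
Qed.

Lemma rounding_eq n i x : (i < 2 * n.+1 * n.+1)%N -> in_cell n i x -> rounding n x = grid n i.
Proof.
move=> iN ix; rewrite /rounding (bigD1 (Ordinal iN))//= ix mulr1 big1 ?addr0// => j ji.
move: ix; rewrite in_cellP => /andP[_ /eqP ix].
rewrite in_cellP ix; case: eqP => [ij|]; last by rewrite andbF mulr0.
by move: ji; rewrite -val_eqE/= ij eqxx.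
Qed.

Lemma rounding_near n x : `|x| < n.+1%:R -> `|rounding n x - x| <= n.+1%:R^-1.
Proof.
have n0 : (0 : R) < n.+1%:R by rewrite ltr0n.
rewrite ltr_norml => /andP[nx xn].
set y := (x + n.+1%:R) * n.+1%:R.
have y0 : 0 <= y by rewrite mulr_ge0// -lerBlDr sub0r ltW.
have iN : (Num.truncn y < 2 * n.+1 * n.+1)%N.
  rewrite -(ltr_nat R); have /andP[ty _] := truncn_itv y0.
  rewrite (le_lt_trans ty)// !natrM /y ltr_pM2r//; lra.
have ix : in_cell n (Num.truncn y) x by rewrite in_cellP y0 eqxx.
rewrite (rounding_eq iN ix); move: ix => /andP[H1 H2].
by rewrite distrC ger0_norm ?subr_ge0// lerBlDl -gridS ltW.
Qed.

Lemma rounding_bound n x : `|rounding n x| <= `|x| + 1.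
Proof.
have n0 : (0 : R) < n.+1%:R by rewrite ltr0n.
have [[i ix]|nix] := pselect (exists i : 'I_(2 * n.+1 * n.+1), in_cell n i x).
  rewrite (rounding_eq (ltn_ord i) ix); move: ix => /andP[H1 H2].
  have n1 : n.+1%:R^-1 <= 1 :> R by rewrite invf_le1// ler1n.
  rewrite gridS in H2; move: (n.+1%:R^-1) n1 H2 => b b1 H2.
  by have := ler_norm x; have := ler_norm (- x); rewrite normrN ler_norml; lra.
rewrite /rounding big1 ?normr0 ?addr_ge0// => i _.
by case: (boolP (in_cell n i x)) => [ix|_]; [case: nix; exists i|rewrite mulr0].
Qed.

Lemma rounding_cvg x : rounding n x @[n --> \oo] --> x.
Proof.
apply/cvgrPdist_le => e e0; near=> n.
have nx : `|x| < n.+1%:R by rewrite (lt_trans (_ : _ < n%:R)) ?ltr_nat//; near: n; exact: nbhs_infty_gtr.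
rewrite distrC (le_trans (rounding_near nx))//.
by apply: ltW; near: n; exact: (near_infty_natSinv_lt (PosNum e0)).
Unshelve. all: by end_near. Qed.

(** Orthogonality passes from events to [G]-measurable factors: the roundings of [X] are
    combinations of indicators of events of [G], and their products with [Y] are dominated because a
    rounding exceeds [X] by at most 1 in absolute value. *)
Lemma Ex_mul_eq0 G X Y : G `<=` measurable -> measurable_wrt G X ->
  intg Y -> intg (fun w => X w * Y w) ->
  (forall A, G A -> Ex (fun w => \1_A w * Y w) = 0) -> Ex (fun w => X w * Y w) = 0.
Proof.
move=> Gm GX iY iXY GY.
have cellG n i : G (X @^-1` [set x | in_cell n i x]).
  apply: GX; rewrite (_ : [set _ | _] = `[grid n i, grid n i.+1[%classic).
    exact: measurable_itv.
  by apply/seteqP; split=> x /=; rewrite in_itv.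
have iCell n i : intg (fun w => \1_(X @^-1` [set x | in_cell n i x]) w * Y w).
  apply: (@intgMl _ _ _ _ 1) => //; first exact/measurable_indic/Gm.
  by move=> w; rewrite indicE; case: (w \in _); rewrite ?normr1 ?normr0.
have E n w : rounding n (X w) * Y w = \sum_(i < 2 * n.+1 * n.+1)
    grid n i * (\1_(X @^-1` [set x | in_cell n i x]) w * Y w).
  rewrite /rounding mulr_suml; apply: eq_bigr => i _; rewrite -mulrA indicE.
  by congr (_ * (_%:R * _)); congr nat_of_bool; apply/idP/idP; rewrite inE.
have iR n : intg (fun w => rounding n (X w) * Y w).
  under eq_fun do rewrite E.
  by apply: intg_sum => i; exact: intgZ.
have zero n : Ex (fun w => rounding n (X w) * Y w) = 0.
  rewrite (eq_Ex P (E n)) Ex_sum => [|i]; last exact: intgZ.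
  by rewrite big1// => i _; rewrite ExZ// GY ?mulr0.
have [] := @Ex_dominated _ _ _ P (fun n w => rounding n (X w) * Y w)
  (fun w => X w * Y w) (fun w => `|X w * Y w| + `|Y w|).
- by move=> n; exact: intg_mf.
- by move=> w; apply: cvgMr_tmp; exact: rounding_cvg.
- move=> n w; rewrite !normrM -[X in _ <= _ + X]mul1r -mulrDl.
  by rewrite ler_wpM2r// rounding_bound.
- by apply: intgD; exact: intg_abs.
move=> _ H; apply: (cvg_unique _ H) => //.
rewrite (_ : (fun n => _) = fun=> 0); first exact: cvg_cst.
by apply/funext => n; exact: zero.
Qed.

Lemma Ex_indic_mul A X : measurable A -> intg X ->
  (\int[P]_(w in A) (X w)%:E = (Ex (fun w => \1_A w * X w))%:E)%E.
Proof.
move=> mA iX; rewrite integral_mkcond -integral_Ex; last first.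
  apply: (@intgMl _ _ _ _ 1) => // w.
  by rewrite indicE; case: (w \in _); rewrite ?normr1 ?normr0.
apply: eq_integral => w _; rewrite patchE indicE.
by case: (w \in A); rewrite ?mul1r ?mul0r.
Qed.

(* First with an indicator in place of [f X], then with [f]. *)
Lemma Ex_independent X Y (f g : R -> R) : measurable_fun setT X -> measurable_fun setT Y ->
  measurable_fun setT f -> measurable_fun setT g ->
  (forall A B, measurable A -> measurable B ->
    P (X @^-1` A `&` Y @^-1` B) = (P (X @^-1` A) * P (Y @^-1` B))%E) ->
  intg (f \o X) -> intg (g \o Y) -> intg (fun w => f (X w) * g (Y w)) ->
  Ex (fun w => f (X w) * g (Y w)) = Ex (f \o X) * Ex (g \o Y).
Proof.
move=> mX mY mf mg XY ifX igY ifg.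
have pre (Z : Omega -> R) (B : set R) : measurable_fun setT Z -> measurable B -> measurable (Z @^-1` B).
  by move=> mZ mB; rewrite -[_ @^-1` _]setTI; exact: (mZ measurableT).
have bnd1 (A : set Omega) w : `|\1_A w| <= 1 :> R.
  by rewrite indicE; case: (w \in _); rewrite ?normr1 ?normr0.
pose GX := [set X @^-1` B | B in @measurable _ R].
pose GY := [set Y @^-1` B | B in @measurable _ R].
have mGX : GX `<=` measurable by move=> _ [B mB <-]; exact: pre.
have mGY : GY `<=` measurable by move=> _ [B mB <-]; exact: pre.
have H1 A : GX A -> Ex (fun w => g (Y w) * (\1_A w - fine (P A))) = 0.
  move=> GA; have mA := mGX _ GA; have iA := intg_indic P mA.
  apply: (@Ex_mul_eq0 GY) => //.
  - by move=> B mB; exists (g @^-1` B) => //; rewrite -[_ @^-1` _]setTI; exact: mg.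
  - exact: intgB iA (intg_cst _ _).
  - rewrite (_ : (fun w => _) = fun w => (\1_A w - fine (P A)) * g (Y w)); last first.
      by apply/funext => w; rewrite mulrC.
    apply: (@intgMl _ _ _ _ (1 + `|fine (P A)|)) => //.
      by apply: measurable_funB => //; exact: measurable_indic.
    by move=> w; rewrite (le_trans (ler_normB _ _))// lerD.
  move=> B GB; have mB := mGY _ GB; have iB := intg_indic P mB.
  rewrite (eq_Ex P (Y := fun w => \1_(A `&` B) w - fine (P A) * \1_B w)); last first.
    by move=> w; rewrite indicI mulrBr [RHS]/= mulrC [X in _ - X]mulrC.
  have mAB := measurableI _ _ mA mB; have iAB := intg_indic P mAB.
  rewrite ExB ?ExZ ?Ex_indic//; last exact: intgZ.
  move: GA GB => [A' mA' <-] [B' mB' <-].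
  by rewrite XY// fineM ?fin_num_measure//; [rewrite subrr|exact: pre|exact: pre].
have H2 : Ex (fun w => f (X w) * (g (Y w) - Ex (g \o Y))) = 0.
  apply: (@Ex_mul_eq0 GX) => //.
  - by move=> B mB; exists (f @^-1` B) => //; rewrite -[_ @^-1` _]setTI; exact: mf.
  - exact: intgB igY (intg_cst _ _).
  - rewrite (_ : (fun w => _) = fun w => f (X w) * g (Y w) - Ex (g \o Y) * f (X w)); last first.
      by apply/funext => w; rewrite mulrBr [X in _ - X]mulrC.
    by apply: intgB => //; exact: intgZ.
  move=> A GA; have mA := mGX _ GA; have iA := intg_indic P mA.
  have iAg : intg (fun w => \1_A w * g (Y w)).
    by apply: (@intgMl _ _ _ _ 1) => //; exact: measurable_indic.
  rewrite (eq_Ex P (Y := fun w => \1_A w * g (Y w) - Ex (g \o Y) * \1_A w)); last first.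
    by move=> w; rewrite mulrBr [X in _ - X]mulrC.
  rewrite ExB ?ExZ//; last exact: intgZ.
  have := H1 A GA.
  rewrite (eq_Ex P (Y := fun w => \1_A w * g (Y w) - fine (P A) * g (Y w))); last first.
    by move=> w; rewrite mulrBr mulrC [X in _ - X]mulrC.
  by rewrite ExB ?ExZ ?Ex_indic//; [rewrite [X in _ - X]mulrC|exact: intgZ].
move: H2; rewrite (eq_Ex P (Y := fun w => f (X w) * g (Y w) - Ex (g \o Y) * f (X w))); last first.
  by move=> w; rewrite mulrBr [X in _ - X]mulrC.
rewrite ExB ?ExZ//; last exact: intgZ.
by move/eqP; rewrite subr_eq0 => /eqP ->; rewrite mulrC.
Qed.

End strict_expectation.

(** * Brownian increments under the filtration *)

Section brownian.
Context {R : realType} {dsp : measure_display} {Omega : measurableType dsp}.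
Variables (P : probability Omega R) (F : R -> set (set Omega)) (W : R -> Omega -> R).
Hypotheses (Ff : filtration F) (bm : standard_brownian P W) (mart : martingale P F W).
Local Notation intg := (intg P).
Local Notation Ex := (Ex P).
Implicit Types (s t : R) (G X Y : Omega -> R).

Let Fsig t : 0 <= t -> sigma_algebra setT (F t).
Proof. by case: Ff => H _ _; exact: H. Qed.
Lemma filtration_mf t : 0 <= t -> F t `<=` measurable.
Proof. by case: Ff => _ H _; exact: H. Qed.
Lemma filtration_le s t : 0 <= s -> s <= t -> F s `<=` F t.
Proof. by case: Ff => _ _ H; exact: H. Qed.

Lemma wrt_comp2 t X Y (f : R * R -> R) : 0 <= t -> measurable_fun setT f ->
  measurable_wrt (F t) X -> measurable_wrt (F t) Y ->
  measurable_wrt (F t) (fun w => f (X w, Y w)).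
Proof.
move=> t0 mf /(measurable_wrtP _ (Fsig t0)) mX /(measurable_wrtP _ (Fsig t0)) mY.
apply/(measurable_wrtP _ (Fsig t0)).
by apply: (measurableT_comp mf); exact: measurable_fun_pair.
Qed.

Lemma wrtD t X Y : 0 <= t -> measurable_wrt (F t) X -> measurable_wrt (F t) Y ->
  measurable_wrt (F t) (fun w => X w + Y w).
Proof.
move=> t0 mX mY; apply: (@wrt_comp2 t X Y (fun z => z.1 + z.2)) => //.
exact: measurable_funD.
Qed.

Lemma wrtB t X Y : 0 <= t -> measurable_wrt (F t) X -> measurable_wrt (F t) Y ->
  measurable_wrt (F t) (fun w => X w - Y w).
Proof.
move=> t0 mX mY; apply: (@wrt_comp2 t X Y (fun z => z.1 - z.2)) => //.
exact: measurable_funB.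
Qed.

Lemma wrtM t X Y : 0 <= t -> measurable_wrt (F t) X -> measurable_wrt (F t) Y ->
  measurable_wrt (F t) (fun w => X w * Y w).
Proof.
move=> t0 mX mY; apply: (@wrt_comp2 t X Y (fun z => z.1 * z.2)) => //.
exact: measurable_funM.
Qed.

Lemma wrt_comp t X (f : R -> R) : measurable_fun setT f ->
  measurable_wrt (F t) X -> measurable_wrt (F t) (fun w => f (X w)).
Proof.
move=> mf mX B mB; apply: (mX (f @^-1` B)).
by rewrite -[_ @^-1` _]setTI; exact: (mf measurableT).
Qed.

Lemma wrt_cst t (c : R) : 0 <= t -> measurable_wrt (F t) (fun=> c).
Proof. by move=> t0; apply/(measurable_wrtP _ (Fsig t0)); exact: measurable_cst. Qed.

Lemma wrt_indic t A : 0 <= t -> F t A -> measurable_wrt (F t) (\1_A : Omega -> R).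
Proof.
move=> t0 FA; apply/(measurable_wrtP _ (Fsig t0)); apply: measurable_indic.
by rewrite /measurable/= sigma_algebra_id//; exact: Fsig.
Qed.

Lemma wrt_le s t X : 0 <= s -> s <= t -> measurable_wrt (F s) X -> measurable_wrt (F t) X.
Proof. by move=> s0 st; apply: measurable_wrt_sub; exact: filtration_le. Qed.

Lemma wrt_mf t X : 0 <= t -> measurable_wrt (F t) X -> measurable_fun setT X.
Proof. by move=> t0; apply: measurable_wrt_mf; exact: filtration_mf. Qed.

Lemma brownian_adapted t : 0 <= t -> measurable_wrt (F t) (W t).
Proof. by case: mart => H _ _; exact: H. Qed.

Lemma brownian_intg t : 0 <= t -> intg (W t).
Proof. by case: mart => _ H _; exact: H. Qed.

Definition dW s t (w : Omega) : R := W t w - W s w.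

Lemma increment_mf s t : 0 <= s -> s <= t -> measurable_fun setT (dW s t).
Proof.
move=> s0 st; have t0 := le_trans s0 st.
by apply: measurable_funB; apply: intg_mf (P) _ _; exact: brownian_intg.
Qed.

Lemma increment_wrt s t : 0 <= s -> s <= t -> measurable_wrt (F t) (dW s t).
Proof.
move=> s0 st; have t0 := le_trans s0 st; apply: wrtB => //; first exact: brownian_adapted.
exact: wrt_le (brownian_adapted s0).
Qed.

Lemma increment_intg s t : 0 <= s -> s <= t -> intg (dW s t).
Proof. by move=> s0 st; apply: intgB; exact: brownian_intg (le_trans s0 _). Qed.

Lemma increment_moments s t : 0 <= s -> s < t ->
  [/\ intg (fun w => dW s t w ^+ 2), Ex (fun w => dW s t w ^+ 2) = t - s,
      intg (fun w => dW s t w ^+ 4) & Ex (fun w => dW s t w ^+ 4) <= 3 * (t - s) ^+ 2].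
Proof.
move=> s0 st; have ts : 0 < t - s by rewrite subr_gt0.
have r0 : 0 < Num.sqrt (t - s) by rewrite sqrtr_gt0.
case: bm => _ _ _ _ law.
have [] := normal_moments r0 (increment_mf s0 (ltW st)) (fun B mB => law s t B s0 st mB).
rewrite sqr_sqrtr ?(ltW ts)// (_ : Num.sqrt (t - s) ^+ 4 = (t - s) ^+ 2); first by [].
by rewrite -[in RHS](sqr_sqrtr (ltW ts)) -exprM.
Qed.

Lemma increments_independent s t s' t' A B : 0 <= s -> s <= t -> t <= s' -> s' <= t' ->
  measurable A -> measurable B ->
  P (dW s t @^-1` A `&` dW s' t' @^-1` B) = (P (dW s t @^-1` A) * P (dW s' t' @^-1` B))%E.
Proof.
move=> s0 st ts st' mA mB; case: bm => _ _ _ ind _.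
(* Four nodes whose middle increment is left unconstrained; the default value of [nth] continues the
   sequence by the constant [t']. *)
pose T i := nth t' [:: s; t; s'] i.
pose D (i : nat) : set R := if i is 0%N then A else if i is 2%N then B else setT.
have T0 : 0 <= T 0%N by [].
have mono : {homo T : i j / (i <= j)%N >-> i <= j}.
  move=> [|[|[|i]]] [|[|[|j]]]//=; rewrite /T/= ?nth_nil ?lexx// => _;
    by rewrite ?(le_trans st')// ?(le_trans ts)// ?(le_trans st)// ?(le_trans ts).
have mD i : measurable (D i) by case: i => [|[|[|i]]] //=.
have := ind 3%N T D T0 mono mD.
rewrite !big_ord_recl big_ord0/= /bump/= !preimage_setT probability_setT mule1 mul1e.
rewrite (_ : \bigcap_(i < 3) _ = dW s t @^-1` A `&` dW s' t' @^-1` B); first by [].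
apply/seteqP; split=> w /=.
  by move=> H; split; [have := H 0%N erefl|have := H 2%N erefl].
by move=> [HA HB] [|[|[|i]]] //= _.
Qed.

Lemma martingale_mul s t G : 0 <= s -> s <= t -> measurable_wrt (F s) G ->
  intg (fun w => G w * dW s t w) -> Ex (fun w => G w * dW s t w) = 0.
Proof.
move=> s0 st mG iG; have t0 := le_trans s0 st.
apply: (@Ex_mul_eq0 _ _ _ P (F s)) => //; first exact: filtration_mf.
  exact: increment_intg.
move=> A FA; have mA := filtration_mf s0 FA.
case: mart => _ _ /(_ s t A s0 st FA).
rewrite !Ex_indic_mul//; [|exact: brownian_intg|exact: brownian_intg].
move=> [E].
have i1 r : 0 <= r -> intg (fun w => \1_A w * W r w).
  move=> r0; apply: (@intgMl _ _ _ _ 1) => //; last exact: brownian_intg.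
  by move=> w; rewrite indicE; case: (w \in _); rewrite ?normr1 ?normr0.
rewrite (eq_Ex P (Y := fun w => \1_A w * W t w - \1_A w * W s w)); last first.
  by move=> w; rewrite -mulrBr.
by rewrite ExB ?E ?subrr//; exact: i1.
Qed.

Lemma intg_mul X Y : measurable_fun setT X -> measurable_fun setT Y ->
  intg (fun w => X w ^+ 2) -> intg (fun w => Y w ^+ 2) -> intg (fun w => X w * Y w).
Proof.
move=> mX mY iX iY; apply: (intg_le _ _ (intgD iX iY)); first exact: measurable_funM.
move=> w; rewrite ler_norml; have := sqr_ge0 (X w + Y w); have := sqr_ge0 (X w - Y w).
have := sqr_ge0 (X w); have := sqr_ge0 (Y w).
by rewrite !expr2; nra.
Qed.

Section quadratic_variation.
Variables (s dt : R).
Hypotheses (s0 : 0 <= s) (dt0 : 0 < dt).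
Let T (i : nat) : R := s + i%:R * dt.
Let e (i : nat) (w : Omega) : R := dW (T i) (T i.+1) w ^+ 2 - dt.

Let T0 i : 0 <= T i. Proof. by rewrite addr_ge0// mulr_ge0// ltW. Qed.
Let TS i : T i.+1 - T i = dt. Proof. by rewrite /T -natr1; ring. Qed.
Let Tlt i : T i < T i.+1. Proof. by rewrite -subr_gt0 TS. Qed.
Let Tle i j : (i <= j)%N -> T i <= T j.
Proof. by move=> ij; rewrite lerD2l ler_pM2r// ler_nat. Qed.

Let moments i : [/\ intg (e i), intg (fun w => e i w ^+ 2) & Ex (fun w => e i w ^+ 2) <= 2 * dt ^+ 2].
Proof.
have [i2 E2 i4 E4] := increment_moments (T0 i) (Tlt i).
have E w : e i w ^+ 2 = dW (T i) (T i.+1) w ^+ 4 - 2 * dt * dW (T i) (T i.+1) w ^+ 2 + dt ^+ 2.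
  by rewrite /e; ring.
have iE : intg (fun w => e i w ^+ 2).
  under eq_fun do rewrite E.
  by apply: intgD; [apply: intgB => //; exact: intgZ|exact: intg_cst].
split=> //; first by apply: intgB => //; exact: intg_cst.
have ia : intg (fun w => 2 * dt * dW (T i) (T i.+1) w ^+ 2) by exact: intgZ.
have ib := intgB i4 ia; have ic := intg_cst P (dt ^+ 2).
rewrite (eq_Ex P E) ExD// ExB// ExZ// Ex_cst.
by rewrite E2; move: E4; rewrite TS; lra.
Qed.

Let em i : measurable_fun setT (e i).
Proof. by have [/intg_mf] := moments i. Qed.

(** Increments over disjoint cells are independent, so the centred squares [e i] are pairwise
    orthogonal and the second moments of their sums add up. *)
Let orth i j : (i < j)%N -> intg (fun w => e i w * e j w) /\ Ex (fun w => e i w * e j w) = 0.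
Proof.
move=> ij; have [ii ii2 _] := moments i; have [ij1 ij2 _] := moments j.
have iij : intg (fun w => e i w * e j w) by exact: intg_mul.
have mean0 l : Ex (e l) = 0.
  have [i2 E2 _ _] := increment_moments (T0 l) (Tlt l).
  by rewrite ExB ?Ex_cst ?E2 ?TS ?subrr//; exact: intg_cst.
split=> //.
have mf : measurable_fun setT (fun x : R => x ^+ 2 - dt).
  by apply: measurable_funB => //; exact: measurable_funX.
have := @Ex_independent _ _ _ P (dW (T i) (T i.+1)) (dW (T j) (T j.+1)) (fun x => x ^+ 2 - dt) (fun x => x ^+ 2 - dt).
move=> ->//; first by rewrite [X in X * _](mean0 i) mul0r.
- by apply: increment_mf => //; exact: Tle.
- by apply: increment_mf => //; exact: Tle.
- by move=> A B mA mB; apply: increments_independent => //; apply: Tle.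
Qed.

Let S (k : nat) (w : Omega) : R := \sum_(i < k) e i w.

Let Sorth k j : (k <= j)%N -> intg (fun w => S k w * e j w) /\ Ex (fun w => S k w * e j w) = 0.
Proof.
move=> kj.
have E w : S k w * e j w = \sum_(i < k) e i w * e j w by rewrite /S mulr_suml.
have ii (i : 'I_k) : intg (fun w => e i w * e j w).
  by have [] := orth (leq_trans (ltn_ord i) kj).
split; first by under eq_fun do rewrite E; exact: intg_sum.
rewrite (eq_Ex P E) Ex_sum// big1// => i _.
by have [] := orth (leq_trans (ltn_ord i) kj).
Qed.

Let Smoments k : intg (fun w => S k w ^+ 2) /\ Ex (fun w => S k w ^+ 2) <= k%:R * (2 * dt ^+ 2).
Proof.
elim: k => [|k [IH1 IH2]].
  have E w : S 0 w ^+ 2 = 0 by rewrite /S big_ord0 expr0n.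
  rewrite (eq_Ex P E) Ex_cst mul0r lexx; split=> //.
  by under eq_fun do rewrite E; exact: intg_cst.
have [i1 E1] := Sorth (leqnn k); have [_ i2 E2] := moments k.
have E w : S k.+1 w ^+ 2 = S k w ^+ 2 + 2 * (S k w * e k w) + e k w ^+ 2.
  by rewrite /S big_ord_recr/=; ring.
have i3 : intg (fun w => S k w ^+ 2 + 2 * (S k w * e k w)).
  by apply: intgD => //; exact: intgZ.
split; first by under eq_fun do rewrite E; exact: intgD.
rewrite (eq_Ex P E) ExD// ExD//; last exact: intgZ.
by rewrite ExZ// E1 -natr1 mulrDl mul1r; lra.
Qed.

Let increment_sum k w : dW s (T k) w ^+ 2 - k%:R * dt =
  S k w + 2 * \sum_(i < k) dW s (T i) w * dW (T i) (T i.+1) w.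
Proof.
elim: k => [|k IH].
  by rewrite /S !big_ord0 /T mul0r addr0 /dW subrr; ring.
rewrite /S !big_ord_recr/= mulrDr addrACA -/(S k w) -IH /e -natr1.
have -> : dW s (T k.+1) w = dW s (T k) w + dW (T k) (T k.+1) w by rewrite /dW; ring.
by ring.
Qed.

(** The cross terms vanish because the indicator of [A] times [dW s (T i)] is known at time [T i];
    the sum [S k] of the centred squares is estimated by its second moment. *)
Lemma quadratic_variation_sum A (k : nat) (c : R) : F s A -> 0 < c -> (0 < k)%N ->
  `|Ex (fun w => \1_A w * (dW s (T k) w ^+ 2 - k%:R * dt))| <=
  c / 2 + k%:R * dt ^+ 2 / c.
Proof.
move=> FA c0 k0; have mA := filtration_mf s0 FA.
have bnd1 w : `|\1_A w| <= 1 :> R.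
  by rewrite indicE; case: (w \in _); rewrite ?normr1 ?normr0.
have iS : intg (S k) by apply: intg_sum => i; have [] := moments i.
have iX i : intg (fun w => dW s (T i) w * dW (T i) (T i.+1) w).
  apply: intg_mul; last by have [] := increment_moments (T0 i) (Tlt i).
  - by apply: increment_mf => //; rewrite -{1}[s]addr0 lerD2l mulr_ge0// ltW.
  - exact: increment_mf (ltW (Tlt i)).
  case: i => [|i].
    rewrite /T mul0r addr0 (_ : (fun w => _) = fun=> 0); first exact: intg_cst.
    by apply/funext => w; rewrite /dW subrr expr0n.
  have si : s < T i.+1 by rewrite -{1}[s]addr0 ltrD2l mulr_gt0// ltr0n.
  by have [] := increment_moments s0 si.
have z i : Ex (fun w => \1_A w * (dW s (T i) w * dW (T i) (T i.+1) w)) = 0.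
  have sT : s <= T i by rewrite -{1}[s]addr0 lerD2l mulr_ge0// ltW.
  rewrite (eq_Ex P (Y := fun w => (\1_A w * dW s (T i) w) * dW (T i) (T i.+1) w)); last first.
    by move=> w; rewrite mulrA.
  apply: martingale_mul => //; first exact/ltW/Tlt.
    apply: wrtM => //; last exact: increment_wrt.
    by apply: wrt_indic => //; exact: filtration_le FA.
  under eq_fun do rewrite -mulrA.
  by apply: (@intgMl _ _ _ _ 1).
rewrite (eq_Ex P (Y := fun w => \1_A w * S k w +
    \sum_(i < k) 2 * (\1_A w * (dW s (T i) w * dW (T i) (T i.+1) w)))); last first.
  move=> w; rewrite increment_sum mulrDr; congr (_ + _).
  by rewrite !mulr_sumr; apply: eq_bigr => i _; rewrite mulrCA.
have i1 : intg (fun w => \1_A w * S k w) by exact: (@intgMl _ _ _ _ 1).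
have i2 (i : 'I_k) : intg (fun w => 2 * (\1_A w * (dW s (T i) w * dW (T i) (T i.+1) w))).
  by apply: intgZ; exact: (@intgMl _ _ _ _ 1).
rewrite ExD//; last exact: intg_sum.
rewrite Ex_sum// [X in _ + X]big1 ?addr0; last first.
  by move=> i _; rewrite ExZ ?z ?mulr0//; exact: (@intgMl _ _ _ _ 1).
have [i3 E3] := Smoments k.
(* Young's inequality with parameter [c] reduces the absolute value of [S k] to its square. *)
have i4 : intg (fun w => c / 2 + (2 * c)^-1 * S k w ^+ 2).
  by apply: intgD; [exact: intg_cst|exact: intgZ].
apply: (le_trans (Ex_norm_le i1 i4 _)).
  move=> w; rewrite normrM (le_trans (ler_wpM2r _ (bnd1 w)))// mul1r.
  have q0 : 0 <= (`|S k w| - c) ^+ 2 / (2 * c) by rewrite divr_ge0 ?sqr_ge0// mulr_ge0// ltW.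
  rewrite -[S k w ^+ 2]real_normK ?num_real// -subr_ge0.
  suff -> : c / 2 + (2 * c)^-1 * `|S k w| ^+ 2 - `|S k w| = (`|S k w| - c) ^+ 2 / (2 * c) by [].
  by field; exact: lt0r_neq0.
rewrite ExD ?Ex_cst ?ExZ//; [|exact: intg_cst|exact: intgZ].
rewrite lerD2l (_ : k%:R * dt ^+ 2 / c = (2 * c)^-1 * (k%:R * (2 * dt ^+ 2))).
  by rewrite ler_wpM2l// invr_ge0 mulr_ge0// ltW.
by field; exact: lt0r_neq0.
Qed.

End quadratic_variation.

(* [(W_t - W_s)^2 - (t - s)] is split along a partition into the sum of the
   centred squared increments, small in [L^2], and martingale differences. *)
Lemma quadratic_variation s t A : 0 <= s -> s < t -> F s A ->
  Ex (fun w => \1_A w * (dW s t w ^+ 2 - (t - s))) = 0.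
Proof.
move=> s0 st FA; have ts : 0 < t - s by rewrite subr_gt0.
apply/eqP; rewrite -normr_le0; apply/ler_addgt0Pl => c c0; rewrite addr0.
(* With this many cells the error of [quadratic_variation_sum] is at most [c]. *)
pose n := (Num.truncn ((t - s) ^+ 2 / (c / 2 * c))).+1.
have n0 : (0 : R) < n%:R by rewrite ltr0n.
have := @quadratic_variation_sum s ((t - s) / n%:R) s0 (divr_gt0 ts n0) A n c FA c0 isT.
rewrite (_ : n%:R * ((t - s) / n%:R) = t - s); last by field; exact: lt0r_neq0.
rewrite (addrC s) subrK => /le_trans; apply.
have : n%:R * ((t - s) / n%:R) ^+ 2 / c <= c / 2; last by lra.
have -> : n%:R * ((t - s) / n%:R) ^+ 2 / c = (t - s) ^+ 2 / (c * n%:R).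
  by field; rewrite !lt0r_neq0.
rewrite ler_pdivrMr ?mulr_gt0// mulrA -ler_pdivrMl ?mulr_gt0 ?divr_gt0// mulrC.
by rewrite ltW// truncnS_gt.
Qed.

Lemma quadratic_variation_mul s t G M : 0 <= s -> s < t -> measurable_wrt (F s) G ->
  (forall w, `|G w| <= M) -> Ex (fun w => G w * (dW s t w ^+ 2 - (t - s))) = 0.
Proof.
move=> s0 st mG GM; have [i2 _ _ _] := increment_moments s0 st.
have iY : intg (fun w => dW s t w ^+ 2 - (t - s)) by apply: intgB => //; exact: intg_cst.
apply: (@Ex_mul_eq0 _ _ _ P (F s)) => //; first exact: filtration_mf.
  by apply: (@intgMl _ _ _ _ M) => //; exact: wrt_mf mG.
by move=> A FA; exact: quadratic_variation.
Qed.

(** The third moment is interpolated between the second and the fourth by the inequality of means,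
    weighted with the standard deviation [r]; the constant 2 is [1 / 2 + 3 / 2]. *)
Lemma increment_cube s t : 0 <= s -> s < t ->
  intg (fun w => `|dW s t w| ^+ 3) /\
  Ex (fun w => `|dW s t w| ^+ 3) <= 2 * ((t - s) * Num.sqrt (t - s)).
Proof.
move=> s0 st; have [i2 E2 i4 E4] := increment_moments s0 st.
have ts : 0 < t - s by rewrite subr_gt0.
set r := Num.sqrt (t - s); have r0 : 0 < r by rewrite sqrtr_gt0.
have r2 : r ^+ 2 = t - s by rewrite sqr_sqrtr// ltW.
have i5 : intg (fun w => r / 2 * dW s t w ^+ 2 + (2 * r)^-1 * dW s t w ^+ 4).
  by apply: intgD; exact: intgZ.
have B w : `|dW s t w| ^+ 3 <= r / 2 * dW s t w ^+ 2 + (2 * r)^-1 * dW s t w ^+ 4.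
  have -> : dW s t w ^+ 4 = `|dW s t w| ^+ 4 by rewrite -normrX ger0_norm// exprn_even_ge0.
  rewrite -[dW s t w ^+ 2]real_normK ?num_real//; set x := `|_|.
  rewrite -subr_ge0 (_ : _ - _ = x ^+ 2 * ((x - r) ^+ 2 / (2 * r))).
    by rewrite mulr_ge0 ?sqr_ge0// divr_ge0 ?sqr_ge0// mulr_ge0// ltW.
  by field; exact: lt0r_neq0.
have i3 : intg (fun w => `|dW s t w| ^+ 3).
  apply: (intg_le _ _ i5) => [|w].
    by apply: measurable_funX; apply: measurableT_comp => //; exact: increment_mf (ltW st).
  by rewrite ger0_norm ?exprn_ge0.
split=> //; apply: (le_trans (Ex_le i3 i5 B)).
rewrite ExD ?ExZ//; [|exact: intgZ|exact: intgZ].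
rewrite E2 -r2; move: E4; rewrite -r2 => E4.
have r1 : 0 <= (2 * r)^-1 by rewrite invr_ge0 mulr_ge0// ltW.
have := ler_wpM2l r1 E4.
have -> : (2 * r)^-1 * (3 * (r ^+ 2) ^+ 2) = 3 / 2 * r ^+ 3 by field; exact: lt0r_neq0.
have -> : r / 2 * r ^+ 2 = r ^+ 3 / 2 by field.
have -> : 2 * (r ^+ 2 * r) = 2 * r ^+ 3 by ring.
lra.
Qed.

End brownian.

(** * Dynkin's formula for piecewise constant controls *)

Section taylor.
Context {R : realType}.
Implicit Types (x y z d : R).

Lemma der_norm_le (f df : R -> R) (M d : R) : (forall x, is_derive x 1 f (df x)) ->
  (forall y, `|y| <= `|d| -> `|df y| <= M) -> `|f d - f 0| <= M * `|d|.
Proof.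
move=> dfx dfM; have cf := der_continuous dfx.
have [d0|d0|->] := ltgtP d 0.
- have [z [dz z0 E]] := der_MVT d0 cf (fun z _ _ => dfx z).
  rewrite distrC E normrM sub0r normrN ler_wpM2r// dfM//.
  by rewrite !ltr0_norm// lerN2 ltW.
- have [z [z0 zd E]] := der_MVT d0 cf (fun z _ _ => dfx z).
  rewrite E normrM subr0 ler_wpM2r// dfM//.
  by rewrite !gtr0_norm// ltW.
- by rewrite subrr !normr0 mulr0.
Qed.

(** Two applications of the mean value bound give the remainder with the constant [C] in place of
    the sharp [C / 6]. *)
Lemma taylor2 (f f1 f2 : R -> R) (C : R) : (forall x, is_derive x 1 f (f1 x)) ->
  (forall x, is_derive x 1 f1 (f2 x)) -> lip C f2 -> 0 <= C -> forall z d,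
  `|f (z + d) - f z - f1 z * d - f2 z * d ^+ 2 / 2| <= C * `|d| ^+ 3.
Proof.
move=> df df1 lf2 C0 z d.
have sh (g dg : R -> R) : (forall x, is_derive x 1 g (dg x)) ->
    forall x, is_derive x 1 (fun y => g (y + z)) (dg (x + z)).
  by move=> dgx x; apply: der_shift_comp.
have H1 y : `|f1 (y + z) - f1 z - f2 z * y| <= C * `|y| * `|y|.
  have D x : is_derive x 1 (fun y => f1 (y + z) - f2 z * y) (f2 (x + z) - f2 z).
    by apply: (der_eq (derB (sh _ _ df1 x) (derZ (f2 z) (der_id x)))); rewrite mulr1.
  have := @der_norm_le _ _ (C * `|y|) y D; rewrite add0r mulr0 subr0.
  rewrite [f1 (y + z) - _ - _]addrAC; apply=> x xy.
  by rewrite (le_trans (lf2 _ _))// addrK ler_wpM2l.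
have D x : is_derive x 1 (fun y => f (y + z) - f1 z * y - f2 z / 2 * (y * y)) (f1 (x + z) - f1 z - f2 z * x).
  apply: (der_eq (derB (derB (sh _ _ df x) (derZ (f1 z) (der_id x)))
    (derZ (f2 z / 2) (derM (der_id x) (der_id x))))); by field.
have := @der_norm_le _ _ (C * `|d| * `|d|) d D.
rewrite add0r !mulr0 !subr0 => H.
have -> : f (z + d) - f z - f1 z * d - f2 z * d ^+ 2 / 2 =
  f (d + z) - f1 z * d - f2 z / 2 * (d * d) - f z by rewrite (addrC z); field.
rewrite (_ : C * `|d| ^+ 3 = C * `|d| * `|d| * `|d|); last by ring.
apply: H => y yd.
by rewrite (le_trans (H1 y))// ler_pM// ?mulr_ge0// ler_wpM2l.
Qed.

End taylor.

Section dynkin.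
Context {R : realType} {dsp : measure_display} {Omega : measurableType dsp}.
Variables (P : probability Omega R) (F : R -> set (set Omega)) (W : R -> Omega -> R).
Hypotheses (Ff : filtration F) (bm : standard_brownian P W) (mart : martingale P F W).
Local Notation intg := (intg P).
Local Notation Ex := (Ex P).
Local Notation dW := (@dW R dsp Omega W).
Variables (mu sigma beta : R).
Hypothesis beta0 : 0 < beta.
Variables (f f1 f2 : R -> R) (C : R).
Hypotheses (df : forall x : R, is_derive x 1 f (f1 x)) (df1 : forall x : R, is_derive x 1 f1 (f2 x)).
Hypotheses (C0 : 0 <= C) (f1C : forall x, `|f1 x| <= C) (f2C : forall x, `|f2 x| <= C).
Hypothesis lf2 : lip C f2.
Implicit Types (s t : R).

Definition drift_path s (w : Omega) : R := mu * s + sigma * W s w.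
Local Notation X := drift_path.
Definition generator (x : R) : R := sigma ^+ 2 / 2 * f2 x + mu * f1 x.
(** The first term bounds the drift squared in Taylor's formula. The others come from
    [(x + y) ^+ 3 <= 4 * (x ^+ 3 + y ^+ 3)], the 8 including the factor 2 of the third moment. *)
Definition step_error : R := C * (mu ^+ 2 / 2 + 4 * `|mu| ^+ 3 + 8 * `|sigma| ^+ 3).

Lemma step_error_ge0 : 0 <= step_error.
Proof. apply: mulr_ge0 => //; apply: addr_ge0; [apply: addr_ge0|].
- by rewrite divr_ge0 ?sqr_ge0.
- by rewrite mulr_ge0// exprn_ge0.
- by rewrite mulr_ge0// exprn_ge0. Qed.

Lemma drift_wrt s : 0 <= s -> measurable_wrt (F s) (X s).
Proof.
move=> s0; apply: (@wrt_comp _ _ _ _ _ (W s) (fun x => mu * s + sigma * x)).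
  by apply: measurable_funD => //; exact: measurable_funM.
exact: brownian_adapted mart _ s0.
Qed.

Lemma drift_intg s : 0 <= s -> intg (X s).
Proof.
move=> s0; apply: intgD; first exact: intg_cst.
by apply: intgZ; exact: (brownian_intg mart).
Qed.

Let lipf : lip C f := lip_der df f1C.
Let lipf1 : lip C f1 := lip_der df1 f2C.
Let mf1 : measurable_fun setT f1.
Proof. by apply: continuous_measurable_fun; exact: lip_continuous lipf1. Qed.
Let mf2 : measurable_fun setT f2.
Proof. by apply: continuous_measurable_fun; exact: lip_continuous lf2. Qed.

Lemma intg_lip (g : R -> R) (c : R) (Z : Omega -> R) : lip c g -> intg Z -> intg (fun w => g (Z w)).
Proof.
move=> lg iZ.
have mg : measurable_fun setT g by apply: continuous_measurable_fun; exact: lip_continuous lg.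
apply: (@intg_le _ _ _ _ (fun w => `|g 0| + `|c| * `|Z w|)).
- by apply: (measurableT_comp mg); exact: intg_mf iZ.
- move=> w; rewrite -[g (Z w)](subrK (g 0)) addrC (le_trans (ler_normD _ _))// lerD2l.
  by rewrite (le_trans (lg _ _))// subr0 ler_wpM2r// ler_norm.
- by apply: intgD; [exact: intg_cst|apply: intgZ; exact: intg_abs].
Qed.

(** The control [c] is frozen over the step and known at its start. In the expansion at [Z] the
    terms in [dW] and in [dW ^+ 2 - dt] have mean zero, by the martingale property and the quadratic
    variation; what remains is of order [dt * Num.sqrt dt]. *)
Lemma one_step s t (c : Omega -> R) : 0 <= s -> s < t -> t - s <= 1 ->
  measurable_wrt (F s) c -> intg c ->
  `|Ex (fun w => f (X t w + c w)) - Ex (fun w => f (X s w + c w)) -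
    (t - s) * Ex (fun w => generator (X s w + c w))| <=
  step_error * ((t - s) * Num.sqrt (t - s)).
Proof.
move=> s0 st ts1 mc ic; have t0 : 0 <= t by rewrite (le_trans s0)// ltW.
set dt := t - s; have dt0 : 0 < dt by rewrite subr_gt0.
pose Z w := X s w + c w.
have mZ : measurable_wrt (F s) Z by apply: (wrtD Ff) => //; exact: drift_wrt.
have iZ : intg Z by apply: intgD => //; exact: drift_intg.
have iZt : intg (fun w => X t w + c w) by apply: intgD => //; exact: drift_intg.
have mZm : measurable_fun setT Z := intg_mf iZ.
have i0 := intg_lip lipf iZ; have i1 := intg_lip lipf iZt.
have b1 w : `|f1 (Z w)| <= C by []. have b2 w : `|f2 (Z w)| <= C by [].
have m1 : measurable_wrt (F s) (fun w => f1 (Z w)) by exact: wrt_comp.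
have m2 : measurable_wrt (F s) (fun w => f2 (Z w)) by exact: wrt_comp.
have mm1 := wrt_mf Ff s0 m1; have mm2 := wrt_mf Ff s0 m2.
have idW : intg (dW s t) := increment_intg mart s0 (ltW st).
have [i2 E2 _ _] := increment_moments bm mart s0 st.
have [i3 E3] := increment_cube bm mart s0 st.
have ia : intg (fun w => f1 (Z w) * dW s t w) by exact: intgMl idW.
have ib : intg (fun w => f2 (Z w) * dW s t w) by exact: intgMl idW.
have iq : intg (fun w => f2 (Z w) * (dW s t w ^+ 2 - dt)).
  by apply: (intgMl mm2 b2); apply: intgB => //; exact: intg_cst.
have if1 : intg (fun w => f1 (Z w)) by exact: intg_bnd b1.
have if2 : intg (fun w => f2 (Z w)) by exact: intg_bnd b2.
have ig : intg (fun w => generator (Z w)) by apply: intgD; exact: intgZ.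
have za := martingale_mul Ff mart s0 (ltW st) m1 ia.
have zb := martingale_mul Ff mart s0 (ltW st) m2 ib.
have zq := quadratic_variation_mul Ff bm mart s0 st m2 b2.
pose rem w := f (X t w + c w) - f (Z w) - dt * generator (Z w) -
  (sigma * (f1 (Z w) * dW s t w) + mu * sigma * dt * (f2 (Z w) * dW s t w) +
   sigma ^+ 2 / 2 * (f2 (Z w) * (dW s t w ^+ 2 - dt))).
have im : intg (fun w => sigma * (f1 (Z w) * dW s t w) + mu * sigma * dt * (f2 (Z w) * dW s t w) +
   sigma ^+ 2 / 2 * (f2 (Z w) * (dW s t w ^+ 2 - dt))).
  by apply: intgD; [apply: intgD|]; exact: intgZ.
have il : intg (fun w => f (X t w + c w) - f (Z w) - dt * generator (Z w)).
  by apply: intgB; [exact: intgB|exact: intgZ].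
have irem : intg rem by exact: intgB.
have Erem : Ex (fun w => f (X t w + c w)) - Ex (fun w => f (Z w)) - dt * Ex (fun w => generator (Z w)) = Ex rem.
  rewrite /rem ExB// ExB//; [|exact: intgB|exact: intgZ].
  have ja := intgZ sigma ia; have jb := intgZ (mu * sigma * dt) ib.
  have jq := intgZ (sigma ^+ 2 / 2) iq.
  rewrite ExB// ExZ// (ExD (intgD ja jb) jq) (ExD ja jb) !ExZ// za zb zq.
  by rewrite !mulr0 !addr0 subr0.
rewrite Erem.
have ibnd : intg (fun w => C * mu ^+ 2 / 2 * dt ^+ 2 + C * (4 * `|mu| ^+ 3) * dt ^+ 3 +
    C * (4 * `|sigma| ^+ 3) * `|dW s t w| ^+ 3).
  by apply: intgD; [exact: intg_cst|exact: intgZ].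
apply: (le_trans (Ex_norm_le irem ibnd _)) => [w|].
  pose d := mu * dt + sigma * dW s t w.
  have Zd : X t w + c w = Z w + d.
    by rewrite /Z /d /drift_path /dt /dW; ring.
  have T := taylor2 df df1 lf2 C0 (Z w) d; rewrite -Zd in T.
  (* The drift contributes [mu ^+ 2 / 2 * dt ^+ 2] to the factor of [f2], which the generator does
     not contain. *)
  have -> : rem w = (f (X t w + c w) - f (Z w) - f1 (Z w) * d - f2 (Z w) * d ^+ 2 / 2) +
      mu ^+ 2 / 2 * dt ^+ 2 * f2 (Z w).
    by rewrite /rem /d /generator; field.
  have m0 : 0 <= mu ^+ 2 / 2 * dt ^+ 2 by rewrite mulr_ge0 ?sqr_ge0// divr_ge0 ?sqr_ge0.
  have A1 : `|mu ^+ 2 / 2 * dt ^+ 2 * f2 (Z w)| <= C * mu ^+ 2 / 2 * dt ^+ 2.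
    rewrite normrM ger0_norm//.
    have -> : C * mu ^+ 2 / 2 * dt ^+ 2 = mu ^+ 2 / 2 * dt ^+ 2 * C by ring.
    by rewrite ler_wpM2l.
  suff A2 : C * `|d| ^+ 3 <= C * (4 * `|mu| ^+ 3) * dt ^+ 3 + C * (4 * `|sigma| ^+ 3) * `|dW s t w| ^+ 3.
    by rewrite (le_trans (ler_normD _ _))//; lra.
  rewrite (_ : _ + _ = C * (4 * ((`|mu| * dt) ^+ 3 + (`|sigma| * `|dW s t w|) ^+ 3))); last by ring.
  rewrite ler_wpM2l//.
  have := ler_normD (mu * dt) (sigma * dW s t w); rewrite -/d !normrM (gtr0_norm dt0).
  set x := `|mu| * dt; set y := `|sigma| * _ => dxy.
  have x0 : 0 <= x by rewrite mulr_ge0// ltW. have y0 : 0 <= y by rewrite mulr_ge0.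
  apply: (@le_trans _ _ ((x + y) ^+ 3)); first by rewrite lerXn2r ?nnegrE ?addr_ge0.
  rewrite -subr_ge0 (_ : 4 * (x ^+ 3 + y ^+ 3) - (x + y) ^+ 3 = 3 * (x + y) * (x - y) ^+ 2); last by ring.
  by rewrite mulr_ge0 ?sqr_ge0// mulr_ge0// addr_ge0.
rewrite ExD ?Ex_cst ?ExZ//; [|exact: intg_cst|exact: intgZ].
set r := Num.sqrt dt; have r0 : 0 <= r by exact: sqrtr_ge0.
have r2 : r ^+ 2 = dt by rewrite sqr_sqrtr// ltW.
have r1 : r <= 1 by rewrite -[1]sqrtr1 ler_wsqrtr.
have dr : dt <= r by rewrite -r2 expr2 ler_piMl.
have d2 : dt ^+ 2 <= dt * r by rewrite expr2 ler_wpM2l// ltW.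
have d3 : dt ^+ 3 <= dt * r.
  by rewrite exprS expr2 ler_wpM2l ?(ltW dt0)// (le_trans _ dr)// ler_piMl// ltW.
have q1 := ler_wpM2l (_ : 0 <= C * mu ^+ 2 / 2) d2.
have q2 := ler_wpM2l (_ : 0 <= C * (4 * `|mu| ^+ 3)) d3.
have q3 := ler_wpM2l (_ : 0 <= C * (4 * `|sigma| ^+ 3)) E3.
have h1 : 0 <= C * mu ^+ 2 / 2 by rewrite divr_ge0// mulr_ge0// sqr_ge0.
have h2 : 0 <= C * (4 * `|mu| ^+ 3) by rewrite !mulr_ge0// exprn_ge0.
have h3 : 0 <= C * (4 * `|sigma| ^+ 3) by rewrite !mulr_ge0// exprn_ge0.
by move: (q1 h1) (q2 h2) (q3 h3); rewrite /step_error -/dt -/r; lra.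
Qed.

Section discretisation.
Variables (c : R -> Omega -> R).
Hypotheses (mc : forall s, 0 <= s -> measurable_wrt (F s) (c s)).
Hypothesis (ic : forall s, 0 <= s -> intg (c s)).
Variables (dt : R) (n : nat).
Hypotheses (dt0 : 0 < dt) (dt1 : dt <= 1).

Local Notation D := (fun j : nat => expR (- beta * (j%:R * dt))).
Local Notation T := (fun j : nat => j%:R * dt).
Local Notation Z := (fun s w => X s w + c s w).

(** The integral of the discount factor over one cell, so that only the integrand has to be
    discretised. *)
Definition weight (j : nat) : R := (D j - D j.+1) / beta.

Let T0 j : 0 <= T j. Proof. by rewrite mulr_ge0// ltW. Qed.
Let TS j : T j.+1 - T j = dt. Proof. by rewrite /= -natr1; ring. Qed.

Lemma weight_bounds j : [/\ 0 <= weight j, weight j <= dt &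
  `|D j.+1 * dt - weight j| <= beta * dt ^+ 2].
Proof.
have DS : D j = D j.+1 * expR (beta * dt).
  by rewrite /= -expRD -natr1; congr expR; ring.
have DS' : D j.+1 = D j * expR (- (beta * dt)).
  by rewrite /= -expRD -natr1; congr expR; ring.
have D1 i : D i <= 1 by rewrite -[leRHS]expR0 ler_expR mulNr oppr_le0 mulr_ge0// ltW.
have e1 := expR_ge1Dx (beta * dt); have e2 := expR_ge1Dx (- (beta * dt)).
have bdt : 0 < beta * dt by rewrite mulr_gt0.
have w1 : D j.+1 * dt <= weight j.
  rewrite /weight ler_pdivlMr//; have := expR_ge0 (- beta * T j.+1); rewrite DS; nra.
have w2 : weight j <= D j * dt.
  rewrite /weight ler_pdivrMr//; have := expR_ge0 (- beta * T j); rewrite DS'; nra.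
have d0 := expR_ge0 (- beta * T j.+1); have d0' := expR_ge0 (- beta * T j).
have w0 : 0 <= weight j by rewrite (le_trans _ w1)// mulr_ge0// ltW.
have wd : weight j <= dt by rewrite (le_trans w2)// ler_piMl// ltW.
split=> //; rewrite distrC ger0_norm ?subr_ge0//.
have : D j - D j.+1 <= beta * dt.
  by have -> : D j - D j.+1 = beta * weight j; [rewrite /weight; field; exact: lt0r_neq0|rewrite ler_wpM2l// ltW].
by rewrite expr2; move=> ?; nra.
Qed.

(** All jumps of a cell are delayed to its right end: the free path first moves with [c] frozen,
    then [c] is updated. *)
Definition jump_sum (w : Omega) : R :=
  \sum_(j < n) D j.+1 * (f (Z (T j.+1) w) - f (X (T j.+1) w + c (T j) w)).
Definition running_sum (w : Omega) : R :=
  \sum_(j < n) weight j * (generator (Z (T j) w) - beta * f (Z (T j) w)).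

Definition dynkin_error : R := step_error + beta * C * (sigma ^+ 2 / 2 + `|mu|).

Let iZ j : intg (Z (T j)).
Proof. by apply: intgD; [exact: drift_intg|exact: ic]. Qed.
Let iZ' j : intg (fun w => X (T j.+1) w + c (T j) w).
Proof. by apply: intgD; [exact: drift_intg|exact: ic]. Qed.
Let generatorC x : `|generator x| <= C * (sigma ^+ 2 / 2 + `|mu|).
Proof.
rewrite (le_trans (ler_normD _ _))// mulrDr; apply: lerD.
  by rewrite normrM ger0_norm ?divr_ge0 ?sqr_ge0// mulrC ler_wpM2r// divr_ge0 ?sqr_ge0.
by rewrite normrM mulrC ler_wpM2r.
Qed.
Let ig j : intg (fun w => generator (Z (T j) w)).
Proof.
apply: (@intg_bnd _ _ _ _ (C * (sigma ^+ 2 / 2 + `|mu|))) => //.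
apply: measurable_funD; apply: measurable_funM => //;
  by [apply: (measurableT_comp mf2); exact: intg_mf|apply: (measurableT_comp mf1); exact: intg_mf].
Qed.

Lemma intg_jump_sum : intg jump_sum.
Proof. by apply: intg_sum => j; apply: intgZ; apply: intgB; exact: intg_lip lipf _. Qed.

Lemma intg_running_sum : intg running_sum.
Proof.
by apply: intg_sum => j; apply: intgZ; apply: intgB; [exact: ig|apply: intgZ; exact: intg_lip lipf _].
Qed.

(** Discounted means telescope over the grid, each step costing an error of order
    [dt * Num.sqrt dt]; over a fixed horizon the total is of order [Num.sqrt dt]. *)
Lemma discrete_dynkin :
  `|D n * Ex (fun w => f (Z (T n) w)) - Ex (fun w => f (Z 0 w)) -
    Ex jump_sum - Ex running_sum| <= n%:R * (dynkin_error * (dt * Num.sqrt dt)).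
Proof.
pose a j := Ex (fun w => f (Z (T j) w)); pose b j := Ex (fun w => f (X (T j.+1) w + c (T j) w)).
pose g j := Ex (fun w => generator (Z (T j) w)).
have i1 j : intg (fun w => f (Z (T j) w)) by exact: intg_lip lipf _.
have i2 j : intg (fun w => f (X (T j.+1) w + c (T j) w)) by exact: intg_lip lipf _.
have EJ : Ex jump_sum = \sum_(j < n) D j.+1 * (a j.+1 - b j).
  rewrite Ex_sum => [|j]; last by apply: intgZ; exact: intgB.
  by apply: eq_bigr => j _; rewrite ExZ ?ExB//; exact: intgB.
have ER : Ex running_sum = \sum_(j < n) weight j * (g j - beta * a j).
  rewrite Ex_sum => [|j]; last by apply: intgZ; apply: intgB; [exact: ig|apply: intgZ; exact: i1].
  apply: eq_bigr => j _; rewrite ExZ; last by apply: intgB; [exact: ig|apply: intgZ; exact: i1].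
  by rewrite (ExB (ig j) (intgZ beta (i1 j))) (ExZ beta (i1 j)).
have -> : Ex (fun w => f (Z 0 w)) = a 0%N.
  by apply: eq_Ex => w; rewrite mul0r.
have -> : D n * Ex (fun w => f (Z (T n) w)) - a 0%N = \sum_(j < n) (D j.+1 * a j.+1 - D j * a j).
  rewrite -/(a n); elim: n => [|m IH].
    by rewrite big_ord0 /= mul0r mulr0 expR0 mul1r subrr.
  by rewrite big_ord_recr/= -IH; ring.
rewrite EJ ER -!sumrB.
have r0 : 0 <= Num.sqrt dt by exact: sqrtr_ge0.
have dr : dt <= Num.sqrt dt.
  have r1 : Num.sqrt dt <= 1 by rewrite -[1]sqrtr1 ler_wsqrtr.
  by rewrite -{1}(sqr_sqrtr (ltW dt0)) expr2 ler_piMl.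
rewrite (le_trans (ler_norm_sum _ _ _))// mulr_natl -[X in _ *+ X]card_ord -sumr_const.
apply: ler_sum => j _.
have [w0 wd wD] := weight_bounds j.
have D1 : D j.+1 <= 1 by rewrite -[leRHS]expR0 ler_expR mulNr oppr_le0 mulr_ge0// ltW.
have gC : `|g j| <= C * (sigma ^+ 2 / 2 + `|mu|).
  by rewrite -(Ex_cst P (C * _)); apply: Ex_norm_le => //; exact: intg_cst.
have jj : T j < T j.+1 by rewrite -subr_gt0 TS.
have := @one_step (T j) (T j.+1) (c (T j)) (T0 j) jj.
rewrite TS => /(_ dt1 (mc (T0 j)) (ic (T0 j))); rewrite -/(a j) -/(b j) -/(g j) => one.
have wE : beta * weight j = D j - D j.+1 by rewrite /weight mulrC divfK// lt0r_neq0.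
(* In one summand the jump part cancels; the error of [one_step] remains, and [D j.+1 * dt] is
   exchanged for the exact weight. *)
have -> : D j.+1 * a j.+1 - D j * a j - D j.+1 * (a j.+1 - b j) - weight j * (g j - beta * a j) =
  D j.+1 * (b j - a j - dt * g j) + (D j.+1 * dt - weight j) * g j.
  have -> : D j = beta * weight j + D j.+1 by rewrite wE subrK.
  by ring.
rewrite (le_trans (ler_normD _ _))// /dynkin_error [leRHS]mulrDl; apply: lerD.
  rewrite normrM ger0_norm ?expR_ge0// (le_trans _ one)// ler_piMl//.
rewrite normrM (le_trans (ler_pM _ _ wD gC))//.
rewrite (_ : beta * dt ^+ 2 * _ = beta * C * (sigma ^+ 2 / 2 + `|mu|) * (dt * dt)); last by ring.
rewrite ler_wpM2l//; first by rewrite !mulr_ge0 ?(ltW beta0)// addr_ge0// divr_ge0// sqr_ge0.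
by rewrite ler_wpM2l// ltW.
Qed.

End discretisation.

End dynkin.

(** * Riemann sums along paths *)

Section riemann_sums.
Context {R : realType}.
Local Notation leb := (@lebesgue_measure R).
Implicit Types (f x c vv G : R -> R) (s t p T dt e : R).

(** Only [s] is confined to [[0, T]], so the estimate also reaches past the end points. *)
Lemma uniform_continuity f T e : continuous f -> 0 < e ->
  exists2 dt, 0 < dt & forall s t, 0 <= s -> s <= T -> `|t - s| < dt -> `|f t - f s| <= e.
Proof.
move=> cf e0; have e2 : 0 < e / 2 by rewrite divr_gt0.
have /compact_near_coveringP cov := @segment_compact R 0 T.
pose Q (i s : R) := forall t, `|t - s| < i -> `|f t - f s| <= e.
have := cov R (0 : R)^'+ Q _ => H.
have {H} : \forall i \near (0 : R)^'+, `[0, T]%classic `<=` Q i.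
  apply: H => s _; have := cf s => /cvgrPdist_le /(_ _ e2) [d /= d0 Hd].
  have d2 : 0 < d / 2 by rewrite divr_gt0.
  exists ([set s' | `|s - s'| < d / 2], [set i | i < d / 2]).
    split; first by exists (d / 2).
    by exists (d / 2) => //= i /=; rewrite sub0r normrN => id i0; rewrite -(gtr0_norm i0).
  move=> [s' i] /= [s'd id] t ts'.
  have d1 := Hd s' (lt_trans s'd (_ : d / 2 < d)).
  have d3 := Hd t.
  have E : `|f t - f s'| <= `|f s - f t| + `|f s - f s'|.
    by rewrite -[f t - f s'](subrKA (f s)) (le_trans (ler_normD _ _))// [`|f t - _|]distrC.
  apply: (le_trans E); have dd : d / 2 < d by lra.
  have := d1 dd; have : `|s - t| < d.
    rewrite -[s - t](subrKA s') (le_lt_trans (ler_normD _ _))//.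
    by rewrite [`|s' - t|]distrC; lra.
  by move=> /d3; lra.
move=> [d /= d0 Hd]; exists (d / 2); first by rewrite divr_gt0.
move=> s t s0 sT; apply: (Hd (d / 2)) => /=.
- by rewrite sub0r normrN gtr0_norm ?divr_gt0//; lra.
- by rewrite divr_gt0.
- by rewrite in_itv/= s0.
Qed.

(** Freezing a path at negative times makes it continuous on the whole line, where the calculus
    lemmas are stated. *)
Lemma extended_path_continuous f : {within `[0, +oo[%classic, continuous f} ->
  continuous (fun s => f (Num.max 0 s)).
Proof.
move=> /subspace_continuousP cf s.
have m0 : `[(0:R), +oo[%classic (Num.max 0 s) by rewrite /= in_itv/= andbT le_max lexx.
apply: (cvg_trans _ (cf _ m0)) => A /= [e /= e0 He].
exists e => //= t st; apply: He; last by rewrite /= in_itv/= andbT le_max lexx.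
rewrite /=; apply: le_lt_trans st; have := ler_norm (s - t); have := ler_norm (t - s).
rewrite [`|t - s|]distrC ler_norml; move: (`|s - t|) => N.
by case: (leP 0 s) => ?; case: (leP 0 t) => ? ? ?; lra.
Qed.

Section one_path.
Variables (beta : R) (beta0 : 0 < beta) (G : R -> R) (CG : R).
Hypotheses (CG0 : 0 <= CG) (lG : lip CG G).
Variables (x c vv : R -> R) (T : R).
Hypotheses (T0 : 0 < T) (cx : continuous x) (mc : measurable_fun `[0, T] c).
Hypothesis vvc : forall p s, 0 <= p -> p <= s -> s <= T -> `|c s - c p| <= vv s - vv p.

Local Notation z := (fun s => x s + c s).
Local Notation phi := (fun s => expR (- beta * s) * G (x s + c s)).
Definition riemann_sum dt (n : nat) : R :=
  \sum_(j < n) weight beta dt j * G (x (j%:R * dt) + c (j%:R * dt)).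

Let exp1 s : 0 <= s -> expR (- beta * s) <= 1.
Proof. by move=> s0; rewrite -[leRHS]expR0 ler_expR mulNr oppr_le0 mulr_ge0// ltW. Qed.

Let cexp : continuous (fun s => expR (- beta * s)).
Proof. exact: der_continuous (der_expRM (- beta)). Qed.

Lemma discounted_integrable : leb.-integrable `[0, T] (EFin \o phi).
Proof.
apply: measurable_bounded_integrable => //.
- by have := @lebesgue_measure_itv R `[0, T]; rewrite /= lte_fin T0 => ->; rewrite -EFinD ltry.
- apply: measurable_funM.
    by apply: measurable_funTS; exact: continuous_measurable_fun.
  have mG : measurable_fun setT G by apply: continuous_measurable_fun; exact: lip_continuous lG.
  apply: (measurableT_comp mG); apply: measurable_funD => //.
  by apply: measurable_funTS; exact: continuous_measurable_fun.
have [M [M0 HM]] := continuous_bounded (ltW T0) cx.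
exists (`|G 0| + CG * (M + (`|c 0| + (vv T - vv 0)))); split; first by rewrite num_real.
move=> y yM s; rewrite /= in_itv/= => /andP[s0 sT]; apply: ltW; apply: le_lt_trans yM.
rewrite normrM ger0_norm ?expR_ge0// (le_trans (ler_piMl _ (exp1 s0)))//.
rewrite -[G _](subrK (G 0)) addrC (le_trans (ler_normD _ _))// lerD2l.
rewrite (le_trans (lG _ _))// ler_wpM2l// subr0 (le_trans (ler_normD _ _))// lerD ?HM//.
have := vvc (lexx 0) s0 sT; have := vvc s0 sT (lexx T) => H1 H2.
rewrite -[c s](subrK (c 0)) addrC (le_trans (ler_normD _ _))// lerD2l.
by have := normr_ge0 (c T - c s); lra.
Qed.

Let intS (A : set R) : measurable A -> A `<=` `[0, T]%classic -> leb.-integrable A (EFin \o phi).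
Proof. by move=> mA AT; apply: integrableS discounted_integrable. Qed.

Let piece p q e : 0 <= p -> p < q -> q <= T ->
  (forall s, p <= s -> s <= q -> `|x s - x p| <= e) ->
  `|(expR (- beta * p) - expR (- beta * q)) / beta * G (x p + c p) -
    \int[leb]_(s in `]p, q]) phi s| <= CG * ((q - p) * (e + (vv q - vv p))).
Proof.
move=> p0 pq qT He; have mpq : measurable `]p, q]%classic by exact: measurable_itv.
have iphi : leb.-integrable `]p, q] (EFin \o phi).
  apply: intS => // s /=; rewrite !in_itv/= => /andP[ps sq].
  by rewrite (le_trans p0 (ltW ps)) (le_trans sq).
have iexp : leb.-integrable `]p, q] (EFin \o (fun s => expR (- beta * s))).
  by apply: integrableS (continuous_integrable p q cexp) => //; exact: subset_itv_oc_cc.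
have icst : leb.-integrable `]p, q] (EFin \o (fun s => expR (- beta * s) * G (x p + c p))).
  apply: integrableS (continuous_integrable p q (contM cexp (fun s => cvg_cst (G (x p + c p))))) => //.
  exact: subset_itv_oc_cc.
have Eexp : \int[leb]_(s in `]p, q]) (expR (- beta * s) * G (x p + c p)) =
    (expR (- beta * p) - expR (- beta * q)) / beta * G (x p + c p).
  rewrite Rintegral_itv_obnd_cbnd//.
  have dE s : is_derive s 1 (fun s => - (G (x p + c p) / beta) * expR (- beta * s))
      (expR (- beta * s) * G (x p + c p)).
    by apply: (der_eq (derZ _ (der_expRM (- beta) s))); field; exact: lt0r_neq0.
  rewrite (Rintegral_derive (ltW pq) dE); last by apply: contM => //; move=> s; exact: cvg_cst.
  by field; exact: lt0r_neq0.
rewrite -Eexp -RintegralB//.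
have idiff : leb.-integrable `]p, q] (EFin \o (fun s => expR (- beta * s) * G (x p + c p) - phi s)).
  exact: (integrableB _ icst iphi).
rewrite (le_trans (le_normr_Rintegral _ idiff))//.
have ib : leb.-integrable `]p, q] (EFin \o (fun=> CG * (e + (vv q - vv p)))).
  apply: integrableS (continuous_integrable p q (fun s => cvg_cst (CG * (e + (vv q - vv p))))) => //.
  exact: subset_itv_oc_cc.
apply: (@le_trans _ _ (\int[leb]_(s in `]p, q]) (CG * (e + (vv q - vv p))))); last first.
  rewrite Rintegral_cst//= lebesgue_measure_itv/= lte_fin pq -EFinD /=.
  by rewrite -mulrA [(_ + _) * _]mulrC.
apply: le_Rintegral => //; first exact: integrable_norm.
move=> s /=; rewrite in_itv/= => /andP[ps sq]; rewrite -mulrBr normrM ger0_norm ?expR_ge0//.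
have s0 := le_trans p0 (ltW ps).
rewrite (le_trans (ler_piMl _ (exp1 s0)))// (le_trans (lG _ _))// ler_wpM2l//.
rewrite distrC opprD addrACA (le_trans (ler_normD _ _))// lerD ?(He _ (ltW ps) sq)//.
have := vvc p0 (ltW ps) (le_trans sq qT); have := vvc s0 sq qT.
by have := normr_ge0 (c q - c s); lra.
Qed.

(** On each cell the continuous part oscillates by at most [e], and [c] by at most the increment of
    [vv]. These increments add up to the total variation, so that jumps cost only [dt] times the
    latter. *)
Lemma riemann_bound (n : nat) dt e : 0 < dt -> n%:R * dt = T ->
  (forall s t, 0 <= s -> s <= T -> `|t - s| <= dt -> `|x t - x s| <= e) ->
  `|riemann_sum dt n - \int[leb]_(s in `[0, T]) phi s| <=
  CG * (T * e + dt * (vv T - vv 0)).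
Proof.
move=> dt0 nT He.
suff H k : (k <= n)%N -> `|riemann_sum dt k - \int[leb]_(s in `[0, k%:R * dt]) phi s| <=
    CG * (k%:R * dt * e + dt * (vv (k%:R * dt) - vv 0)).
  by have := H n (leqnn n); rewrite nT.
have dt0' := ltW dt0.
elim: k => [_|k IH kn].
  rewrite /riemann_sum big_ord0 mul0r set_itv1 Rintegral_set1 subrr normr0.
  by rewrite mul0r add0r subrr mulr0 mulr0.
have := IH (ltnW kn); set p := k%:R * dt; set q := k.+1%:R * dt => {}IH.
have p0 : 0 <= p by rewrite mulr_ge0.
have qp : q - p = dt by rewrite /q -natr1 /p; ring.
have pq : p < q by rewrite -subr_gt0 qp.
have qT : q <= T by rewrite -nT ler_pM2r// ler_nat.
have He' s : p <= s -> s <= q -> `|x s - x p| <= e.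
  move=> ps sq; apply: He => //; first exact: le_trans (ltW pq) qT.
  by rewrite ger0_norm ?subr_ge0// -qp lerD2r.
have H := piece p0 pq qT He'; rewrite qp in H.
rewrite /riemann_sum big_ord_recr/= -/(riemann_sum dt k).
have iq : leb.-integrable `[0, q] (EFin \o phi).
  by apply: intS => // s /=; rewrite !in_itv/= => /andP[-> sq]; rewrite (le_trans sq).
have := @Rintegral_itvB _ phi (BLeft 0) (BRight q) p iq.
rewrite !bnd_simp => /(_ p0 (ltW pq)) /(canRL (subrK _)) ->.
rewrite opprD addrACA [X in X + _]addrC addrACA.
rewrite -[X in _ <= CG * X]/(_ + _).
have -> : CG * (q * e + dt * (vv q - vv 0)) =
  CG * (p * e + dt * (vv p - vv 0)) + CG * (dt * (e + (vv q - vv p))).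
  by rewrite -[q](subrK p) qp; ring.
by rewrite addrC (le_trans (ler_normD _ _))// lerD// addrC.
Qed.

Lemma riemann_cvg :
  riemann_sum (T / n.+1%:R) n.+1 @[n --> \oo] --> \int[leb]_(s in `[0, T]) phi s.
Proof.
apply/cvgrPdist_le => e e0; set V := vv T - vv 0.
have V0 : 0 <= V by have := vvc (lexx 0) (ltW T0) (lexx T); have := normr_ge0 (c T - c 0); rewrite /V; lra.
pose e1 := e / (2 * (CG + 1) * (T + 1)).
have CG1 : 0 < CG + 1 by rewrite ltr_wpDl. have T1 : 0 < T + 1 by rewrite addr_gt0.
have e10 : 0 < e1 by rewrite divr_gt0// !mulr_gt0.
have [d d0 Hd] := uniform_continuity T cx e10.
pose d1 := Num.min d (e / (2 * (CG + 1) * (V + 1))).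
have V1 : 0 < V + 1 by rewrite ltr_wpDl.
have d10 : 0 < d1 by rewrite lt_min d0 divr_gt0// !mulr_gt0.
near=> n.
have n0 : (0 : R) < n.+1%:R by rewrite ltr0n.
have dtd : T / n.+1%:R < d1.
  rewrite ltr_pdivrMr// mulrC -ltr_pdivrMr//.
  by rewrite (lt_trans (_ : _ < n%:R)) ?ltr_nat//; near: n; exact: nbhs_infty_gtr.
have := dtd; rewrite lt_min => /andP[dtd0 dtd1].
have nT : n.+1%:R * (T / n.+1%:R) = T by field; exact: lt0r_neq0.
rewrite distrC (le_trans (riemann_bound (divr_gt0 T0 n0) nT (e := e1) _))//.
  by move=> s t s0 sT st; apply: Hd => //; exact: le_lt_trans dtd0.
have q1 : CG * (T * e1) <= e / 2.
  rewrite (_ : e / 2 = (CG + 1) * ((T + 1) * e1)); last by rewrite /e1; field; rewrite !lt0r_neq0.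
  by apply: ler_pM => //; [rewrite mulr_ge0// ltW|rewrite lerDl|rewrite ler_wpM2r ?lerDl// ltW].
have q2 : CG * (T / n.+1%:R * V) <= e / 2.
  rewrite (_ : e / 2 = (CG + 1) * (e / (2 * (CG + 1) * (V + 1)) * (V + 1))); last by field; rewrite !lt0r_neq0.
  apply: ler_pM => //; [by rewrite mulr_ge0// divr_ge0// ltW|by rewrite lerDl|].
  by apply: ler_pM => //; [rewrite divr_ge0// ltW|exact: ltW|rewrite lerDl].
by rewrite -/V mulrDr (le_trans (lerD q1 q2))//; lra.
Unshelve. all: by end_near. Qed.

(** Here the continuous part enters through its increments from the left ends of the coarse cells
    instead of a modulus of continuity: their means can be computed, as an estimate in expectation
    demands. *)
Lemma riemann_refine dt (n r : nat) : 0 < dt -> n%:R * dt <= T -> (0 < r)%N ->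
  `|riemann_sum dt n - riemann_sum (dt / r%:R) (n * r)| <=
  CG * (dt * (vv (n%:R * dt) - vv 0) +
    \sum_(j < n) \sum_(i < r) dt / r%:R * `|x (j%:R * dt + i%:R * (dt / r%:R)) - x (j%:R * dt)|).
Proof.
move=> dt0 nT r0; have r0' : (0 : R) < r%:R by rewrite ltr0n.
set dr := dt / r%:R; have dr0 : 0 < dr by rewrite divr_gt0.
have rdr : r%:R * dr = dt by rewrite /dr; field; exact: lt0r_neq0.
have time j i : (j * r + i)%:R * dr = j%:R * dt + i%:R * dr.
  by rewrite natrD natrM mulrDl -mulrA rdr.
have wsum j : weight beta dt j = \sum_(i < r) weight beta dr (j * r + i).
  have E m : \sum_(i < m) weight beta dr (j * r + i) =
      (expR (- beta * (j%:R * dt)) - expR (- beta * (j%:R * dt + m%:R * dr))) / beta.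
    elim: m => [|m IH]; first by rewrite big_ord0 mul0r addr0 subrr mul0r.
    rewrite big_ord_recr/= IH /weight -addnS !time -mulrDl; congr (_ / _); ring.
  rewrite E rdr /weight (_ : j.+1%:R * dt = j%:R * dt + dt)//.
  by rewrite -natr1 mulrDl mul1r.
have split_sum (a : nat -> R) N : \sum_(m < N * r) a m = \sum_(j < N) \sum_(i < r) a (j * r + i)%N.
  elim: N => [|m IH]; first by rewrite mul0n !big_ord0.
  by rewrite mulSnr big_split_ord/= big_ord_recr/= IH.
rewrite /riemann_sum (split_sum (fun m => weight beta dr m * G (x (m%:R * dr) + c (m%:R * dr)))) -sumrB.
have Z j (jn : (j < n)%N) : `|weight beta dt j * G (x (j%:R * dt) + c (j%:R * dt)) -
    \sum_(i < r) weight beta dr (j * r + i) * G (x ((j * r + i)%:R * dr) + c ((j * r + i)%:R * dr))| <=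
    CG * (dt * (vv (j.+1%:R * dt) - vv (j%:R * dt)) +
      \sum_(i < r) dr * `|x (j%:R * dt + i%:R * dr) - x (j%:R * dt)|).
  rewrite wsum mulr_suml -sumrB (le_trans (ler_norm_sum _ _ _))//.
  have p0 : 0 <= j%:R * dt by rewrite mulr_ge0// ltW.
  have qT : j.+1%:R * dt <= T by rewrite (le_trans _ nT)// ler_pM2r// ler_nat.
  have -> : dt * (vv (j.+1%:R * dt) - vv (j%:R * dt)) =
      \sum_(i < r) dr * (vv (j.+1%:R * dt) - vv (j%:R * dt)).
    by rewrite sumr_const card_ord -[RHS]mulr_natl mulrA rdr.
  rewrite -big_split/= mulr_sumr.
  apply: ler_sum => i _; rewrite time -mulrBr normrM.
  have [w0 wd _] := @weight_bounds R beta beta0 dr dr0 (j * r + i).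
  rewrite (ger0_norm w0) -(mulrDr dr) (mulrCA CG).
  set s := j%:R * dt + i%:R * dr; set p := j%:R * dt.
  have ps : p <= s by rewrite lerDl mulr_ge0// ltW.
  have sq : s <= j.+1%:R * dt.
    by rewrite -natr1 mulrDl mul1r lerD2l -rdr ler_pM2r// ler_nat ltnW.
  apply: ler_pM => //.
  rewrite (le_trans (lG _ _))// ler_wpM2l// distrC opprD addrACA addrC.
  rewrite (le_trans (ler_normD _ _))// lerD//.
  have := vvc p0 ps (le_trans sq qT); have := vvc (le_trans p0 ps) sq qT.
  by have := normr_ge0 (c (j.+1%:R * dt) - c s); lra.
rewrite (le_trans (ler_norm_sum _ _ _))//.
have tele N : dt * (vv (N%:R * dt) - vv 0) = \sum_(j < N) dt * (vv (j.+1%:R * dt) - vv (j%:R * dt)).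
  rewrite -mulr_sumr; congr (_ * _).
  elim: N => [|m IH]; first by rewrite big_ord0 mul0r subrr.
  by rewrite big_ord_recr/= -IH; ring.
rewrite tele -big_split/= mulr_sumr; apply: ler_sum => j _; exact: Z.
Qed.

End one_path.

End riemann_sums.

Section fatou.
Context {R : realType} {dsp : measure_display} {Omega : measurableType dsp}.
Variable P : probability Omega R.

Lemma Ex_fatou (X : nat -> Omega -> R) (X0 : Omega -> R) (M : R) :
  (forall n, intg P (X n)) -> (forall n w, 0 <= X n w) ->
  (forall w, X ^~ w @ \oo --> X0 w) -> (forall n, Ex P (X n) <= M) ->
  intg P X0 /\ Ex P X0 <= M.
Proof.
move=> iX X_ge0 XX0 XM.
have mX n : measurable_fun setT (X n) := intg_mf (iX n).
have mX0 : measurable_fun setT X0.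
  by apply: (@measurable_fun_cvg _ _ _ _ X) => // w _; exact: XX0.
have X0_ge0 w : 0 <= X0 w by apply: (cvgr_to_ge (XX0 w)); exact: nearW.
have mEX n : measurable_fun setT (EFin \o X n) by exact/measurable_EFinP.
have fat := @fatou _ _ _ P setT measurableT (fun n => EFin \o X n) mEX
  (fun n w _ => X_ge0 n w).
have intM : (\int[P]_w (X0 w)%:E <= M%:E)%E.
  apply: (le_trans (le_trans _ fat)).
    rewrite le_eqVlt; apply/orP; left; apply/eqP; apply: eq_integral => w _.
    have H : (fun n => (X n w)%:E) @ \oo --> (X0 w)%:E.
      by apply: cvg_EFin; [exact: nearW|exact: XX0].
    by have [-> _] := cvg_limn_einf_sup H.
  rewrite limn_einf_lim; apply: lime_le; first exact: is_cvg_einfs.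
  apply: nearW => n; apply: (@le_trans _ _ (\int[P]_w (X n w)%:E)%E).
    by apply: ereal_inf_lbound; exists n => //=.
  by rewrite integral_Ex// lee_fin.
have iX0 : intg P X0.
  apply/integrableP; split; first exact/measurable_EFinP.
  under eq_integral do rewrite /= ger0_norm//.
  by rewrite (le_lt_trans intM)// ltry.
by split=> //; rewrite -lee_fin -integral_Ex.
Qed.

End fatou.

(** * Passage to the limit in Dynkin's formula *)

Section dynkin_formula.
Context {R : realType} {dsp : measure_display} {Omega : measurableType dsp}.
Local Notation leb := (@lebesgue_measure R).
Variables (P : probability Omega R) (F : R -> set (set Omega)) (W : R -> Omega -> R).
Hypotheses (Ff : filtration F) (bm : standard_brownian P W) (mart : martingale P F W).
Local Notation intg := (intg P).
Local Notation Ex := (Ex P).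
Variables (mu sigma beta : R).
Hypothesis beta0 : 0 < beta.
Variables (f f1 f2 : R -> R) (C : R).
Hypotheses (df : forall x : R, is_derive x 1 f (f1 x)) (df1 : forall x : R, is_derive x 1 f1 (f2 x)).
Hypotheses (C0 : 0 <= C) (f1C : forall x, `|f1 x| <= C) (f2C : forall x, `|f2 x| <= C).
Hypothesis lf2 : lip C f2.
Implicit Types (s t p : R).
Local Notation X := (drift_path W mu sigma).
Local Notation G := (fun x => generator mu sigma f1 f2 x - beta * f x).

Variables (c : R -> Omega -> R).
Hypotheses (mc : forall s, 0 <= s -> measurable_wrt (F s) (c s)).
Hypothesis (ic : forall s, 0 <= s -> intg (c s)).
Variables (T : R) (vv : Omega -> R -> R) (S : Omega -> R).
Hypotheses (T0 : 0 < T) (mpath : forall w, measurable_fun `[0, T] (c ^~ w)).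
Hypothesis vvc : forall w p s, 0 <= p -> p <= s -> s <= T ->
  `|c s w - c p w| <= vv w s - vv w p.
Hypotheses (vvS : forall w, vv w T - vv w 0 <= S w) (iS : intg S).

Let CG : R := sigma ^+ 2 / 2 * C + `|mu| * C + beta * C.
Let CG0 : 0 <= CG.
Proof.
apply: addr_ge0; [apply: addr_ge0|].
- by rewrite mulr_ge0// divr_ge0// sqr_ge0.
- by rewrite mulr_ge0.
- by rewrite mulr_ge0// ltW.
Qed.

Let lG : lip CG G.
Proof.
have s2 : 0 <= sigma ^+ 2 / 2 by rewrite divr_ge0// sqr_ge0.
have lf : lip C f := lip_der df f1C. have lf1 : lip C f1 := lip_der df1 f2C.
have := lipD (lipD (lipZ (sigma ^+ 2 / 2) lf2) (lipZ mu lf1)) (lipZ (- beta) lf).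
rewrite (ger0_norm s2) normrN (gtr0_norm beta0) => H x y.
by have := H x y; rewrite /generator !mulNr.
Qed.

Let xe (w : Omega) s : R := X (Num.max 0 s) w.
Let cxe w : continuous (xe w).
Proof.
case: bm => _ _ cW _ _.
have := @extended_path_continuous _ _ (cW w) => cWe.
have cm : continuous (fun s => Num.max 0 s : R).
  apply: (@lip_continuous _ 1) => s t; rewrite mul1r.
  have := ler_norm (s - t); have := ler_norm (t - s); rewrite [`|t - s|]distrC ler_norml.
  by move: (`|s - t|) => N; case: (leP 0 s) => ?; case: (leP 0 t) => ? ? ?; lra.
by rewrite /xe /drift_path; apply: contD; exact: contZ.
Qed.

Let xeE w s : 0 <= s -> xe w s = X s w.
Proof. by move=> s0; rewrite /xe max_r. Qed.

Let running_riemann dt n w : 0 < dt ->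
  running_sum W mu sigma beta f f1 f2 c dt n w = riemann_sum beta G (xe w) (c ^~ w) dt n.
Proof.
move=> dt0; apply: eq_bigr => j _; rewrite xeE//.
by rewrite mulr_ge0// ltW.
Qed.

Definition discounted_running (w : Omega) : R :=
  \int[leb]_(s in `[0, T]) (expR (- beta * s) * G (X s w + c s w)).

Lemma discounted_running_integrable w :
  leb.-integrable `[0, T] (EFin \o (fun s => expR (- beta * s) * G (X s w + c s w))).
Proof.
have := discounted_integrable beta0 CG0 lG T0 (@cxe w) (mpath w) (@vvc w).
apply: eq_integrable => // s; rewrite inE/= in_itv/= => /andP[s0 _].
by rewrite xeE.
Qed.

Let running_cvg w : running_sum W mu sigma beta f f1 f2 c (T / n.+1%:R) n.+1 w @[n --> \oo] -->
  discounted_running w.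
Proof.
have := riemann_cvg beta0 CG0 lG T0 (@cxe w) (mpath w) (@vvc w).
rewrite (_ : \int[leb]_(s in `[0, T]) _ = discounted_running w); last first.
  apply: eq_Rintegral => s; rewrite inE/= in_itv/= => /andP[s0 _].
  by rewrite xeE.
rewrite (_ : (fun n : nat => riemann_sum _ _ _ _ _ _) =
  (fun n => running_sum W mu sigma beta f f1 f2 c (T / n.+1%:R) n.+1 w))//.
by apply/funext => n; rewrite running_riemann// divr_gt0.
Qed.

Let vv_le w q : 0 <= q -> q <= T -> vv w q - vv w 0 <= S w.
Proof.
move=> q0 qT; apply: le_trans (vvS w).
have := vvc w q0 qT (lexx T); have := normr_ge0 (c T w - c q w); lra.
Qed.

Let drift_increment s t : 0 <= s -> s <= t ->
  intg (fun w => `|X t w - X s w|) /\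
  Ex (fun w => `|X t w - X s w|) <= `|mu| * (t - s) + `|sigma| * Num.sqrt (t - s).
Proof.
move=> s0; rewrite le_eqVlt => /predU1P[<-|st].
  have E w : `|X s w - X s w| = 0 by rewrite subrr normr0.
  rewrite (eq_Ex P E) Ex_cst subrr sqrtr0 !mulr0 addr0; split=> //.
  by under eq_fun do rewrite E; exact: intg_cst.
have t0 : 0 <= t by rewrite (le_trans s0)// ltW.
have iX : intg (fun w => `|X t w - X s w|).
  by apply: intg_abs; apply: intgB; exact: drift_intg mart _ _ _ _.
split=> //; have [i2 E2 _ _] := increment_moments bm mart s0 st.
have ts : 0 < t - s by rewrite subr_gt0.
set r := Num.sqrt (t - s); have r0 : 0 < r by rewrite sqrtr_gt0.
have r2 : r ^+ 2 = t - s by rewrite sqr_sqrtr// ltW.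
have ib : intg (fun w => `|mu| * (t - s) + `|sigma| * (r / 2) + `|sigma| * (2 * r)^-1 * (W t w - W s w) ^+ 2).
  by apply: intgD; [exact: intg_cst|exact: intgZ].
apply: (le_trans (Ex_le iX ib _)) => [w|].
  have -> : X t w - X s w = mu * (t - s) + sigma * (W t w - W s w).
    by rewrite /drift_path; ring.
  rewrite (le_trans (ler_normD _ _))// !normrM (gtr0_norm ts) -addrA lerD2l -mulrA -mulrDr.
  rewrite ler_wpM2l// -[(_ - _) ^+ 2]real_normK ?num_real//; set y := `|_|.
  rewrite -subr_ge0 (_ : _ - _ = (y - r) ^+ 2 / (2 * r)).
    by rewrite divr_ge0 ?sqr_ge0// mulr_ge0// ltW.
  by field; exact: lt0r_neq0.
rewrite ExD ?Ex_cst ?ExZ//; [|exact: intg_cst|exact: intgZ].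
rewrite E2 -r2 -addrA lerD2l -mulrA -mulrDr.
by rewrite (_ : r / 2 + _ = r)//; field; exact: lt0r_neq0.
Qed.

Let refine_error dt : R := CG * (dt * Ex S + T * (`|mu| * dt + `|sigma| * Num.sqrt dt)).

Let running_refine (n r : nat) dt : dt = T / n.+1%:R ->
  Ex (fun w => `|running_sum W mu sigma beta f f1 f2 c dt n.+1 w -
    running_sum W mu sigma beta f f1 f2 c (dt / r.+1%:R) (n.+1 * r.+1) w|) <= refine_error dt.
Proof.
move=> dtE; have n0 : (0 : R) < n.+1%:R by rewrite ltr0n.
have r0 : (0 : R) < r.+1%:R by rewrite ltr0n.
have dt0 : 0 < dt by rewrite dtE divr_gt0. have dr0 : 0 < dt / r.+1%:R by rewrite divr_gt0.
have nT : n.+1%:R * dt = T by rewrite dtE; field; exact: lt0r_neq0.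
pose I w := \sum_(j < n.+1) \sum_(i < r.+1) dt / r.+1%:R *
  `|X (j%:R * dt + i%:R * (dt / r.+1%:R)) w - X (j%:R * dt) w|.
have time0 (j : nat) : 0 <= j%:R * dt by rewrite mulr_ge0// ltW.
have timej (j i : nat) : j%:R * dt <= j%:R * dt + i%:R * (dt / r.+1%:R).
  by rewrite lerDl mulr_ge0// ltW.
have iI : intg I.
  apply: intg_sum => j; apply: intg_sum => i; apply: intgZ.
  by have [] := drift_increment (time0 j) (timej j i).
have EI : Ex I <= T * (`|mu| * dt + `|sigma| * Num.sqrt dt).
  rewrite Ex_sum => [|j]; last first.
    by apply: intg_sum => i; apply: intgZ; have [] := drift_increment (time0 j) (timej j i).
  have -> : T * (`|mu| * dt + `|sigma| * Num.sqrt dt) =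
      \sum_(j < n.+1) dt * (`|mu| * dt + `|sigma| * Num.sqrt dt).
    by rewrite sumr_const card_ord -[RHS]mulr_natl mulrA nT.
  apply: ler_sum => j _.
  rewrite Ex_sum => [|i]; last by apply: intgZ; have [] := drift_increment (time0 j) (timej j i).
  have -> : dt * (`|mu| * dt + `|sigma| * Num.sqrt dt) =
      \sum_(i < r.+1) dt / r.+1%:R * (`|mu| * dt + `|sigma| * Num.sqrt dt).
    rewrite sumr_const card_ord -[RHS]mulr_natl mulrA; congr (_ * _).
    by field; exact: lt0r_neq0.
  apply: ler_sum => i _; have [iX EX] := drift_increment (time0 j) (timej j i).
  have E3 : j%:R * dt + i%:R * (dt / r.+1%:R) - j%:R * dt = i%:R * (dt / r.+1%:R).
    by rewrite [X in X - _]addrC addrK.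
  rewrite E3 in EX.
  rewrite ExZ// ler_wpM2l ?(ltW dr0)// (le_trans EX)//.
  have id : i%:R * (dt / r.+1%:R) <= dt.
    by rewrite mulrCA ler_piMr ?(ltW dt0)// ler_pdivrMr// mul1r ler_nat ltnW.
  by apply: lerD; rewrite ler_wpM2l// ler_wsqrtr.
have ib : intg (fun w => CG * (dt * S w + I w)).
  by apply: intgZ; apply: intgD => //; exact: intgZ.
have ir d m : 0 < d -> intg (running_sum W mu sigma beta f f1 f2 c d m).
  by move=> d0; exact: (intg_running_sum mart mu sigma beta df df1 f1C f2C lf2 ic m d0).
apply: (le_trans (Ex_le _ ib _)) => [|w|].
- by apply: intg_abs; apply: intgB; exact: ir.
- rewrite !running_riemann//.
  have nT' : n.+1%:R * dt <= T by rewrite nT.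
  apply: (le_trans (@riemann_refine _ _ beta0 _ _ CG0 lG (xe w) (c ^~ w) (vv w) T
    (@vvc w) dt n.+1 r.+1 dt0 nT' isT)).
  rewrite ler_wpM2l//; apply: lerD.
    by rewrite ler_wpM2l ?(ltW dt0)// vv_le ?nT// ltW.
  rewrite le_eqVlt; apply/orP; left; apply/eqP.
  apply: eq_bigr => j _; apply: eq_bigr => i _.
  by rewrite !xeE//; exact: le_trans (timej j i).
rewrite ExZ ?ExD ?ExZ//; [|exact: intgZ|by apply: intgD => //; exact: intgZ].
by rewrite ler_wpM2l// lerD2l.
Qed.

(** Domination would call for an integrable bound on the supremum of the path. Instead the sum is
    compared in mean with its refinements, uniformly in their order, and Fatou's lemma carries the
    bound to the limit. *)
Lemma running_limit (n : nat) : let dt := T / n.+1%:R in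
  intg discounted_running /\
  `|Ex (running_sum W mu sigma beta f f1 f2 c dt n.+1) - Ex discounted_running| <= refine_error dt.
Proof.
move=> dt; have n0 : (0 : R) < n.+1%:R by rewrite ltr0n.
have dt0 : 0 < dt by rewrite divr_gt0.
have ir d m : 0 < d -> intg (running_sum W mu sigma beta f f1 f2 c d m).
  by move=> d0; exact: (intg_running_sum mart mu sigma beta df df1 f1C f2C lf2 ic m d0).
set B := running_sum W mu sigma beta f f1 f2 c dt n.+1.
have iB : intg B by exact: ir.
pose Y r w := `|B w - running_sum W mu sigma beta f f1 f2 c (dt / r.+1%:R) (n.+1 * r.+1) w|.
have mD : measurable_fun setT discounted_running.
  apply: (@measurable_fun_cvg _ _ _ _ (fun n => running_sum W mu sigma beta f f1 f2 c (T / n.+1%:R) n.+1)) => //.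
  by move=> m; apply: intg_mf (ir _ _ _); rewrite divr_gt0.
have [] := @Ex_fatou _ _ _ P Y (fun w => `|B w - discounted_running w|) (refine_error dt).
- by move=> r; apply: intg_abs; apply: intgB => //; apply: ir; rewrite divr_gt0.
- by move=> r w; exact: normr_ge0.
- move=> w; apply: cvg_norm; apply: cvgB; first exact: cvg_cst.
  (* The refined grids form a subsequence of the grids of mesh [T / m.+1%:R], along which the sums
     converge. *)
  pose k (r : nat) := (n.+1 * r.+1).-1.
  rewrite (_ : (fun r => _) = (fun m => running_sum W mu sigma beta f f1 f2 c (T / m.+1%:R) m.+1 w) \o k); last first.
    apply/funext => r; rewrite /= /k prednK//; congr (running_sum _ _ _ _ _ _ _ _ _ _ _).
    by rewrite /dt natrM invfM mulrA.
  apply: (cvg_comp _ _ _ (@running_cvg w)).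
  move=> A [N _ NA]; exists N => // r /= Nr; apply: NA => /=.
  by rewrite /k mulSn addSn/= (leq_trans Nr)// leq_addr.
- by move=> r; exact: running_refine.
move=> iBD EBD; split.
  have iD : intg (fun w => B w - discounted_running w).
    apply: intg_le iBD => //; first by apply: measurable_funB => //; exact: intg_mf iB.
  have := intgB iB iD; rewrite (_ : (fun w => _) = discounted_running)//.
  by apply/funext => w; rewrite subKr.
have iD : intg (fun w => B w - discounted_running w).
  by apply: intg_le iBD => //; apply: measurable_funB => //; exact: intg_mf iB.
have iQ : intg discounted_running.
  have := intgB iB iD; rewrite (_ : (fun w => _) = discounted_running)//.
  by apply/funext => w; rewrite subKr.
by rewrite -ExB// (le_trans (Ex_norm iD)).
Qed.

(** The jump term is left as a limit of grid sums: for the lower bound these sums are estimated path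
    by path, for the band policy their limit is evaluated. *)
Lemma dynkin_formula : intg discounted_running /\
  Ex (jump_sum W mu sigma beta f c (T / n.+1%:R) n.+1) @[n --> \oo] -->
  expR (- beta * T) * Ex (fun w => f (X T w + c T w)) - Ex (fun w => f (X 0 w + c 0 w)) -
  Ex discounted_running.
Proof.
split; first by have [] := running_limit 0.
apply/cvgrPdist_le => e e0.
(* For [dt <= 1] all errors together are at most [M * Num.sqrt dt]. *)
pose M := T * dynkin_error mu sigma beta C + CG * (`|Ex S| + T * (`|mu| + `|sigma|)) + 1.
have M0 : 0 < M.
  rewrite ltr_wpDl//; apply: addr_ge0; apply: mulr_ge0 => //; first exact: ltW.
    apply: addr_ge0; first exact: step_error_ge0.
    by rewrite mulr_ge0 ?addr_ge0// ?divr_ge0 ?sqr_ge0// mulr_ge0// ltW.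
  by rewrite addr_ge0// mulr_ge0 ?addr_ge0// ltW.
near=> n; set dt := T / n.+1%:R.
have n0 : (0 : R) < n.+1%:R by rewrite ltr0n.
have dt0 : 0 < dt by rewrite divr_gt0.
have small y : 0 < y -> T / y < n%:R -> dt <= y.
  move=> y0 yn; rewrite /dt ler_pdivrMr// mulrC -ler_pdivrMr// ltW// (lt_trans yn)//.
  by rewrite ltr_nat.
have dt1 : dt <= 1 by apply: small => //; near: n; exact: nbhs_infty_gtr.
have dte : dt <= (e / M) ^+ 2.
  by apply: small; [rewrite exprn_gt0// divr_gt0|near: n; exact: nbhs_infty_gtr].
have nT : n.+1%:R * dt = T by rewrite /dt; field; exact: lt0r_neq0.
set r := Num.sqrt dt; have r0 : 0 <= r by exact: sqrtr_ge0.
have re : r <= e / M.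
  by rewrite -(ger0_norm (ltW (divr_gt0 e0 M0))) -sqrtr_sqr ler_wsqrtr.
have r1 : r <= 1 by rewrite -[1]sqrtr1 ler_wsqrtr.
have dr : dt <= r by rewrite -{1}(sqr_sqrtr (ltW dt0)) expr2 ler_piMl.
have [_ H1] := running_limit n.
have := discrete_dynkin Ff bm mart mu sigma beta0 df df1 C0 f1C f2C lf2 mc ic n.+1 dt0 dt1.
rewrite nT -/r.
have -> : n.+1%:R * (dynkin_error mu sigma beta C * (dt * r)) = T * dynkin_error mu sigma beta C * r.
  by rewrite -nT; ring.
move=> H2.
set J := Ex (jump_sum _ _ _ _ _ _ _ _) in H2 *.
set a := expR _ * _ in H2 *; set b := Ex (fun w => f (X 0 w + _)) in H2 *.
set q := Ex discounted_running in H1 *; set q' := Ex (running_sum _ _ _ _ _ _ _ _ _ _) in H1 H2.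
have -> : a - b - q - J = (a - b - J - q') + (q' - q) by ring.
rewrite (le_trans (ler_normD _ _))// (le_trans (lerD H2 H1))//.
apply: (@le_trans _ _ (M * r)); last by rewrite mulrC -ler_pdivlMr.
have q1 : dt * Ex S <= r * `|Ex S|.
  by rewrite (le_trans (ler_wpM2l (ltW dt0) (ler_norm _)))// ler_wpM2r.
have q2 : `|mu| * dt <= `|mu| * r by rewrite ler_wpM2l.
have q3 : refine_error dt <= CG * (r * `|Ex S| + T * (`|mu| * r + `|sigma| * r)).
  by rewrite ler_wpM2l// lerD// ler_wpM2l ?(ltW T0)// lerD2r.
have -> : M * r = T * dynkin_error mu sigma beta C * r +
    CG * (r * `|Ex S| + T * (`|mu| * r + `|sigma| * r)) + r by rewrite /M; ring.
by rewrite -addrA lerD2l (le_trans q3)// lerDl.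
Unshelve. all: by end_near. Qed.

End dynkin_formula.

(** * Adjustment times of a policy *)

Section sequences_of_reals.
Context {R : realType}.

Lemma seq_minimum (J : seq R) : J != [::] -> exists2 m, m \in J & forall s, s \in J -> m <= s.
Proof.
elim: J => // a [|b J] IH _.
  by exists a => [|s]; rewrite !inE// => /eqP ->.
have [//|m mJ Hm] := IH; have [am|ma] := leP a m.
  exists a => [|s]; rewrite inE ?eqxx// => /predU1P[->//|/Hm].
  exact: le_trans.
exists m => [|s]; rewrite inE ?mJ ?orbT// => /predU1P[->|/Hm//].
exact: ltW.
Qed.

Lemma sum_sub_le (I : eqType) (s t : seq I) (h : I -> R) : uniq s -> uniq t ->
  {subset s <= t} -> (forall i, 0 <= h i) -> \sum_(i <- s) h i <= \sum_(i <- t) h i.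
Proof.
move=> us ut st h0; rewrite [leRHS](bigID (mem s))/=.
have -> : \sum_(i <- t | i \in s) h i = \sum_(i <- s) h i.
  rewrite -big_filter; apply: perm_big; apply: uniq_perm => //; first exact: filter_uniq.
  by move=> i; rewrite mem_filter; apply/andP/idP => [[]//|is_]; split=> //; exact: st.
by rewrite lerDl sumr_ge0.
Qed.

End sequences_of_reals.

Section jump_paths.
Context {R : realType}.
Variables (y : R -> R) (py : pure_jump_path y).
Implicit Types (s t T : R).

Lemma jump_ge0 t : 0 <= t -> 0 <= jump y t.
Proof.
rewrite le_eqVlt /jump /before => /predU1P[<-|t0].
  by rewrite lexx subr0; exact: path_ge0.
rewrite (lt_geF t0) subr_ge0.
apply: (cvgr_to_le (path_left_limit py t0)); near=> s.
have st : s < t by near: s; exact: nbhs_left_lt.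
apply: (path_nondecreasing py); last exact: ltW.
by apply: ltW; near: s; exact: nbhs_left_gt.
Unshelve. all: by end_near. Qed.

Lemma path_sum T t (J : seq R) : uniq J -> (forall s, s \in J -> 0 <= s) ->
  (forall s, 0 <= s -> s <= T -> jump y s != 0 -> s \in J) -> 0 <= t -> t <= T ->
  y t = \sum_(s <- J | s <= t) jump y s.
Proof.
move=> uJ J0 HJ t0 tT; have := path_sum_jumps py t0.
rewrite (esumID [set` J]); last by move=> s; rewrite /= in_itv/= lee_fin => /andP[/jump_ge0].
rewrite [X in (_ + X)%E]esum1 ?adde0; last first.
  move=> s [/=]; rewrite in_itv/= => /andP[s0 st] sJ; congr EFin; apply/eqP.
  by apply: contra_notT sJ => js; apply: HJ => //; exact: le_trans tT.
rewrite (_ : _ `&` _ = [set` [seq s <- J | s <= t]]); last first.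
  apply/seteqP; split=> s /=; rewrite mem_filter in_itv/=.
    by move=> [/andP[_ ->] ->].
  by move=> /andP[-> sJ]; rewrite J0.
rewrite esum_fset; [|exact: finite_seq|]; last first.
  by move=> s; rewrite inE/= mem_filter lee_fin => /andP[_ /J0]; exact: jump_ge0.
rewrite -fsbig_seq ?filter_uniq// sumEFin big_filter.
by move=> [].
Qed.

End jump_paths.

Section adjustment_times.
Context {R : realType} {dsp : measure_display} {Omega : measurableType dsp}.
Variables (phi : policy R Omega) (w : Omega).
Hypotheses (py1 : pure_jump_path (upward phi ^~ w)) (py2 : pure_jump_path (downward phi ^~ w)).
Implicit Types (s t p T : R) (n N : nat).
Local Notation tau n := (adj_time phi n w).
Local Notation xi n := (adj_amount phi n w).

Definition adjusts t : Prop := dY1 phi t w != 0 \/ dY2 phi t w != 0.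

Lemma adjustments_seq T : exists J : seq R, uniq J /\
  forall s, s \in J <-> [/\ 0 <= s, s <= T & adjusts s].
Proof.
have : finite_set ([set s | 0 <= s /\ s <= T /\ jump (upward phi ^~ w) s != 0] `|`
    [set s | 0 <= s /\ s <= T /\ jump (downward phi ^~ w) s != 0]).
  by rewrite finite_setU; split; exact: path_finite_jumps.
move=> /finite_seqP [s Es]; exists (undup s); split; first exact: undup_uniq.
have Es' r : [set` s] r <-> r \in s by [].
move=> r; rewrite mem_undup -Es' -Es; split.
  by move=> [[? [? ?]]|[? [? ?]]]; split=> //; [left|right].
by move=> [? ? [?|?]]; [left|right].
Qed.

Lemma adj_time_ge0 n : (0 <= tau n)%E.
Proof.
elim: n => //= n IH; apply: le_ereal_inf_tmp => _ [t [nt _] <-].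
exact: le_trans IH (ltW nt).
Qed.

Lemma adj_time_pinfty n : tau n = +oo%E -> tau n.+1 = +oo%E.
Proof.
move=> E; rewrite /= E (_ : [set _ | _ in _] = set0) ?ereal_inf0//.
by apply/seteqP; split=> // z [t [tt _] _]; move: tt; rewrite ltNge leey.
Qed.

Variant next_adjustment r n : Prop :=
| NoAdjustment of tau n.+1 = +oo%E & forall t, r < t -> ~ adjusts t
| NextAdjustment m of tau n.+1 = m%:E & r < m & adjusts m &
    forall t, r < t -> adjusts t -> m <= t.

(** Only finitely many adjustments occur up to any given time, so the infimum that defines the next
    adjustment time is attained unless the set is empty. *)
Lemma adj_time_next r n : tau n = r%:E -> next_adjustment r n.
Proof.
move=> E; have r0 : 0 <= r by rewrite -lee_fin -E adj_time_ge0.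
have [[t0 [rt0 at0]]|none] := pselect (exists t, r < t /\ adjusts t).
  have [J [uJ HJ]] := adjustments_seq t0.
  have t0J : t0 \in [seq s <- J | r < s].
    by rewrite mem_filter rt0; apply/HJ; split=> //; rewrite (le_trans r0)// ltW.
  have [|m + Hm] := @seq_minimum _ [seq s <- J | r < s].
    by apply/eqP => J0; rewrite J0 in t0J.
  rewrite mem_filter => /andP[rm /HJ[m0 mt0 am]].
  have min t : r < t -> adjusts t -> m <= t.
    move=> rt at_; have [tt0|t0t] := leP t t0; last by rewrite (le_trans mt0)// ltW.
    apply: Hm; rewrite mem_filter rt; apply/HJ; split=> //.
    by rewrite (le_trans r0)// ltW.
  apply: (@NextAdjustment _ _ m) => //; apply/eqP; rewrite eq_le /= E; apply/andP; split.
    by apply: ereal_inf_lbound; exists m => //; rewrite lte_fin.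
  by apply: le_ereal_inf_tmp => _ [t [rt at_] <-]; rewrite lee_fin min// -lte_fin.
apply: NoAdjustment => [|t rt at_]; last by apply: none; exists t.
rewrite /= E (_ : [set _ | _ in _] = set0) ?ereal_inf0//.
by apply/seteqP; split=> // z [t [rt at_] _]; apply: none; exists t; rewrite -lte_fin.
Qed.

Lemma adj_time_lt n : (tau n < +oo)%E -> (tau n < tau n.+1)%E.
Proof.
move=> noo; have /fineK E : tau n \is a fin_num by rewrite ge0_fin_numE ?adj_time_ge0.
rewrite -E; case: (adj_time_next (esym E)) => [-> _|m -> rm _ _]; first exact: ltry.
by rewrite lte_fin.
Qed.

Lemma adj_time_le m n : (m <= n)%N -> (tau m <= tau n)%E.
Proof.
elim: n => [|n IH]; first by rewrite leqn0 => /eqP ->.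
rewrite leq_eqVlt => /predU1P[->//|]; rewrite ltnS => /IH /le_trans; apply.
have [noo|] := boolP (tau n < +oo)%E; first exact/ltW/adj_time_lt.
by rewrite ltey negbK => /eqP E; rewrite (adj_time_pinfty E) E.
Qed.

Lemma adj_time_adjusts n t : tau n.+1 = t%:E -> 0 < t /\ adjusts t.
Proof.
move=> E; have noo : (tau n < +oo)%E.
  by rewrite ltey; apply/eqP => /adj_time_pinfty; rewrite E.
have /fineK E' : tau n \is a fin_num by rewrite ge0_fin_numE ?adj_time_ge0.
have r0 : 0 <= fine (tau n) by rewrite fine_ge0 ?adj_time_ge0.
case: (adj_time_next (esym E')) => [|m]; rewrite E// => -[<-] rm am _.
by split=> //; exact: le_lt_trans rm.
Qed.

Lemma adj_time_unbounded T : exists N, forall n, (N <= n)%N -> (T%:E < tau n)%E.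
Proof.
have [J [uJ HJ]] := adjustments_seq T.
suff H n : (tau n <= T%:E)%E -> exists s : seq R,
    [/\ uniq s, size s = n, {subset s <= J} & forall t, t \in s -> (t%:E <= tau n)%E].
  exists (size J).+1 => n nJ; rewrite ltNge; apply/negP => /H [s [us sn sJ _]].
  by have := uniq_leq_size us sJ; rewrite sn leqNgt nJ.
elim: n => [_|n IH nT]; first by exists [::].
have noo : (tau n < +oo)%E by rewrite (le_lt_trans (adj_time_le (leqnSn n)))// (le_lt_trans nT) ?ltry.
have n1 := adj_time_lt noo.
have [s [us sn sJ st]] := IH (le_trans (adj_time_le (leqnSn n)) nT).
have E : tau n.+1 = (fine (tau n.+1))%:E.
  by rewrite fineK// ge0_fin_numE ?adj_time_ge0// (le_lt_trans nT) ?ltry.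
have [m0 am] := adj_time_adjusts E.
exists (fine (tau n.+1) :: s); split=> /=.
- rewrite us andbT; apply/negP => /st; rewrite -E leNgt.
  by rewrite n1.
- by rewrite sn.
- move=> t; rewrite inE => /predU1P[->|/sJ//]; apply/HJ; split=> //; first exact: ltW.
  by rewrite -lee_fin -E.
- by move=> t; rewrite inE => /predU1P[->|/st /le_trans]; [rewrite -E|apply; exact: ltW].
Qed.

Lemma adj_time_exhaust t : 0 < t -> adjusts t -> exists n, tau n = t%:E.
Proof.
move=> t0 at_; have [N HN] := adj_time_unbounded t.
have ex : exists n, (t%:E <= tau n)%E by exists N; exact/ltW/HN.
case: (ex_minnP ex) => -[|n] tn min; first by move: tn; rewrite /= lee_fin leNgt t0.
exists n.+1; apply/eqP; rewrite eq_le tn andbT.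
have nt : (tau n < t%:E)%E by rewrite ltNge; apply/negP => /min; rewrite ltnn.
by apply: ereal_inf_lbound; exists t.
Qed.

Definition adj_part s n : R := if (tau n <= s%:E)%E then `|xi n| else 0.
(** The total size of the adjustments up to [s]. Only finitely many terms differ from zero, so the
    sequence is eventually constant. *)
Definition adj_variation s : R := limn (fun N => \sum_(n < N) adj_part s n).

Lemma adj_part_ge0 s n : 0 <= adj_part s n.
Proof. by rewrite /adj_part; case: ifP. Qed.

Lemma adj_part0 s n : (s%:E < tau n)%E -> adj_part s n = 0.
Proof. by rewrite /adj_part ltNge => /negbTE ->. Qed.

Lemma adj_variation_stable T : exists N, forall s M, s <= T -> (N <= M)%N ->
  \sum_(n < M) adj_part s n = \sum_(n < N) adj_part s n.
Proof.
have [N HN] := adj_time_unbounded T; exists N => s M sT NM.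
rewrite -(subnKC NM) big_split_ord/= [X in _ + X]big1 ?addr0// => i _.
by rewrite adj_part0// (le_lt_trans _ (HN _ (leq_addr _ _)))// lee_fin.
Qed.

Lemma adj_variation_cvg s : \sum_(n < N) adj_part s n @[N --> \oo] --> adj_variation s.
Proof.
have [N HN] := adj_variation_stable s.
have H : \sum_(n < M) adj_part s n @[M --> \oo] --> \sum_(n < N) adj_part s n.
  by apply: cvg_near_cst; exists N => // M /= NM; exact: HN.
by rewrite /adj_variation (cvg_lim _ H).
Qed.

Lemma adj_variationE T : exists N, forall s M, s <= T -> (N <= M)%N ->
  adj_variation s = \sum_(n < M) adj_part s n.
Proof.
have [N HN] := adj_variation_stable T; exists N => s M sT NM; rewrite (HN s M)//.
by apply/cvg_lim => //; apply: cvg_near_cst; exists N => // m /= Nm; exact: HN.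
Qed.

Lemma adj_variation_ge0 s : 0 <= adj_variation s.
Proof.
have [N H] := adj_variationE s; rewrite (H s N)// sumr_ge0// => n _.
exact: adj_part_ge0.
Qed.

Lemma adj_part_le p s n : p <= s -> adj_part p n <= adj_part s n.
Proof.
move=> ps; rewrite /adj_part; case: ifP => [np|_]; last by case: ifP.
by rewrite (le_trans np)// lee_fin.
Qed.

(** Every adjustment in []p, s]] takes place at some [tau n], with a rank depending injectively on
    the time, so these jumps form a subfamily of the terms counted by [adj_variation]. *)
Lemma net_increment p s : 0 <= p -> p <= s ->
  `|(upward phi s w - downward phi s w) - (upward phi p w - downward phi p w)| <=
  adj_variation s - adj_variation p.
Proof.
move=> p0 ps; have s0 := le_trans p0 ps.
have [J [uJ HJ]] := adjustments_seq s.
have J0 r : r \in J -> 0 <= r by case/HJ.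
have J1 r : 0 <= r -> r <= s -> jump (upward phi ^~ w) r != 0 -> r \in J.
  by move=> ? ? ?; apply/HJ; split=> //; left.
have J2 r : 0 <= r -> r <= s -> jump (downward phi ^~ w) r != 0 -> r \in J.
  by move=> ? ? ?; apply/HJ; split=> //; right.
rewrite (path_sum py1 uJ J0 J1 s0 (lexx s)) (path_sum py1 uJ J0 J1 p0 ps).
rewrite (path_sum py2 uJ J0 J2 s0 (lexx s)) (path_sum py2 uJ J0 J2 p0 ps).
have [N0 E0] := adj_variationE s.
have [N1 HN1] := adj_time_unbounded s.
pose xr r := dY1 phi r w - dY2 phi r w.
have -> : \sum_(r <- J | r <= s) jump (upward phi ^~ w) r - \sum_(r <- J | r <= s) jump (downward phi ^~ w) r -
    (\sum_(r <- J | r <= p) jump (upward phi ^~ w) r - \sum_(r <- J | r <= p) jump (downward phi ^~ w) r) =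
    \sum_(r <- J | p < r <= s) xr r.
  have split_sum (g : R -> R) : \sum_(r <- J | r <= s) g r =
      \sum_(r <- J | r <= p) g r + \sum_(r <- J | p < r <= s) g r.
    rewrite (bigID (fun r => r <= p))/=; congr (_ + _); apply: eq_bigl => r.
      by rewrite andb_idl// => /le_trans; apply.
    by rewrite -ltNge andbC.
  have alg (a1 a2 b1 b2 : R) : a1 + a2 - (b1 + b2) - (a1 - b1) = a2 - b2 by ring.
  rewrite (split_sum (jump (upward phi ^~ w))) (split_sum (jump (downward phi ^~ w))).
  by rewrite alg -sumrB.
pose M := maxn N0 N1.
rewrite (E0 s M) ?leq_maxl// (E0 p M) ?leq_maxl// -sumrB.
(* [nf] assigns to an adjustment time its rank, and 0 to any other time. *)
have /choice[nf Hnf] : forall r : R, exists n, r \in [seq r <- J | p < r <= s] -> tau n = r%:E.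
  move=> r; have [rJ|rJ] := boolP (r \in [seq r <- J | p < r <= s]); last by exists 0%N.
  move: rJ; rewrite mem_filter => /andP[/andP[pr _] /HJ[_ _ ar]].
  by have [n En] := adj_time_exhaust (le_lt_trans p0 pr) ar; exists n.
rewrite -big_filter (le_trans (ler_norm_sum _ _ _))//.
pose g n := adj_part s n - adj_part p n.
have -> : \sum_(r <- [seq r <- J | p < r <= s]) `|xr r| =
    \sum_(n <- [seq nf r | r <- [seq r <- J | p < r <= s]]) g n.
  rewrite big_map; apply: eq_big_seq => r rJ; have Er := Hnf r rJ.
  move: rJ; rewrite mem_filter => /andP[/andP[pr rs] _].
  by rewrite /g /adj_part /adj_amount Er !lee_fin rs leNgt pr subr0.
have -> : \sum_(n < M) (adj_part s n - adj_part p n) = \sum_(n <- iota 0 M) g n.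
  by rewrite -(big_mkord xpredT g) /index_iota subn0.
apply: sum_sub_le.
- rewrite map_inj_in_uniq ?filter_uniq// => r r' rJ rJ' Er.
  have := Hnf r rJ; rewrite Er (Hnf r' rJ') => -[].
  by [].
- exact: iota_uniq.
- move=> _ /mapP[r rJ ->]; rewrite mem_iota add0n /= ltnNge; apply/negP => Mn.
  have := HN1 _ (leq_trans (leq_maxr _ _) Mn); rewrite (Hnf r rJ) lte_fin ltNge.
  by move: rJ; rewrite mem_filter => /andP[/andP[_ ->]].
- by move=> n; rewrite subr_ge0 adj_part_le.
Qed.

Lemma adj_part0_ge : `|xi 0| <= adj_part 0 0.
Proof. by rewrite /adj_part /= lexx. Qed.

Lemma net_bound s : 0 <= s -> `|upward phi s w - downward phi s w| <= adj_variation s.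
Proof.
move=> s0; have H := net_increment (lexx 0) s0.
have [N E] := adj_variationE 0.
have v0 : `|upward phi 0 w - downward phi 0 w| <= adj_variation 0.
  rewrite (E 0 N.+1)// big_ord_recl/= (_ : _ - _ = xi 0).
    by rewrite (le_trans adj_part0_ge)// lerDl sumr_ge0// => n _; exact: adj_part_ge0.
  by rewrite /adj_amount /= /dY1 /dY2 /jump /before lexx !subr0.
have := ler_normD (upward phi s w - downward phi s w - (upward phi 0 w - downward phi 0 w))
  (upward phi 0 w - downward phi 0 w).
by rewrite subrK; lra.
Qed.

End adjustment_times.

(** * Costs of lumped adjustments *)

Section adjustment_costs.
Context {R : realType} {dsp : measure_display} {Omega : measurableType dsp}.
Variables (phi : policy R Omega) (w : Omega).
Hypotheses (py1 : pure_jump_path (upward phi ^~ w)) (py2 : pure_jump_path (downward phi ^~ w)).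
Variables (beta K L k ell : R).
Hypotheses (beta0 : 0 < beta) (K0 : 0 <= K) (L0 : 0 <= L) (k0 : 0 <= k) (ell0 : 0 <= ell).
Implicit Types (s t p T : R) (n N : nat) (J : seq R).

Definition jump_cost s : R :=
  (if 0 < dY1 phi s w then K + k * dY1 phi s w else 0) +
  (if 0 < dY2 phi s w then L + ell * dY2 phi s w else 0).

Lemma jump_cost_ge0 s : 0 <= jump_cost s.
Proof. by apply: addr_ge0; case: ifP => // /ltW H; rewrite addr_ge0// mulr_ge0. Qed.

(** Merging adjustments pays the fixed cost at most once, while the proportional cost is
    additive. *)
Lemma lumped_cost (M m : R) J (b : R -> R) : 0 <= M -> 0 <= m -> (forall r, r \in J -> 0 <= b r) ->
  0 <= \sum_(r <- J) b r /\
  (if 0 < \sum_(r <- J) b r then M + m * \sum_(r <- J) b r else 0) <=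
  \sum_(r <- J) (if 0 < b r then M + m * b r else 0).
Proof.
move=> M0 m0; elim: J => [|r J IH] bJ; first by rewrite !big_nil ltxx.
have [|S0 HS] := IH; first by move=> r' r'J; apply: bJ; rewrite inE r'J orbT.
have br : 0 <= b r by apply: bJ; rewrite inE eqxx.
rewrite !big_cons; move: S0 HS; set s := \sum_(_ <- _) b _; set S := \sum_(_ <- _) _ => S0 HS.
split; first exact: addr_ge0.
move: HS; case: (ltP 0 (b r)) => b0; case: (ltP 0 s) => s0; case: (ltP 0 (b r + s)) => bs H; nra.
Qed.

Definition discounted_jump_cost s : R := expR (- beta * s) * jump_cost s.

Lemma discounted_jump_cost_ge0 s : 0 <= discounted_jump_cost s.
Proof. by rewrite mulr_ge0 ?expR_ge0// jump_cost_ge0. Qed.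

Lemma jump_cost_esum J : uniq J -> (forall r, r \in J -> 0 <= r) ->
  ((\sum_(r <- J) discounted_jump_cost r)%:E <=
   \esum_(s in `[0%R, +oo[) (discounted_jump_cost s)%:E)%E.
Proof.
move=> uJ J0; apply: esum_ge; exists [set` J].
  by split; [exact: finite_seq|move=> r /= /J0; rewrite in_itv/= andbT].
by rewrite -fsbig_seq// sumEFin.
Qed.

Section lower_bound.
Variables (f : R -> R).
Hypothesis up : forall x y, x <= y -> f x <= f y + K + k * (y - x).
Hypothesis down : forall x y, x <= y -> f y <= f x + L + ell * (y - x).
Variables (x : R).
Local Notation c := (fun t w => x + upward phi t w - downward phi t w).

Let lump z (d1 d2 : R) : 0 <= d1 -> 0 <= d2 ->
  f z - f (z + d1 - d2) <= (if 0 < d1 then K + k * d1 else 0) + (if 0 < d2 then L + ell * d2 else 0).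
Proof.
move=> d10 d20.
have H1 : f z - f (z + d1) <= if 0 < d1 then K + k * d1 else 0.
  case: ltP => d1p; first by have := @up z (z + d1); rewrite lerDl d10 => /(_ isT); lra.
  by rewrite (_ : d1 = 0) ?addr0 ?subrr//; apply/eqP; rewrite eq_le d1p.
have H2 : f (z + d1) - f (z + d1 - d2) <= if 0 < d2 then L + ell * d2 else 0.
  case: ltP => d2p.
    by have := @down (z + d1 - d2) (z + d1); rewrite gerBl d20 => /(_ isT); lra.
  by rewrite (_ : d2 = 0) ?subr0 ?subrr//; apply/eqP; rewrite eq_le d2p.
by lra.
Qed.

Let sum_split (g : R -> R) J p q : p <= q -> 0 <= p ->
  \sum_(r <- J | 0 < r <= q) g r = \sum_(r <- J | 0 < r <= p) g r + \sum_(r <- J | p < r <= q) g r.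
Proof.
move=> pq p0; rewrite (bigID (fun r => r <= p))/=; congr (_ + _); apply: eq_bigl => r.
  by rewrite -andbA; congr (_ && _); rewrite andb_idl// => rp; rewrite (le_trans rp).
rewrite -ltNge; case: (ltP p r) => pr; rewrite ?andbF// andbT.
by rewrite (le_lt_trans p0 pr).
Qed.

(** The gain from the lumped jump of a cell is at most the cost of its total upward and downward
    amounts, which is at most the sum of the separate costs; and delaying the jump only lowers its
    discount factor. *)
Lemma jump_sum_cost (W : R -> Omega -> R) (mu sigma dt : R) n J : 0 < dt ->
  uniq J -> (forall s, s \in J <-> [/\ 0 <= s, s <= n%:R * dt & adjusts phi w s]) ->
  - jump_sum W mu sigma beta f c dt n w <=
  \sum_(r <- J | 0 < r <= n%:R * dt) discounted_jump_cost r.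
Proof.
move=> dt0 uJ HJ; have J0 r : r \in J -> 0 <= r by case/HJ.
have J1 r : 0 <= r -> r <= n%:R * dt -> jump (upward phi ^~ w) r != 0 -> r \in J.
  by move=> ? ? ?; apply/HJ; split=> //; left.
have J2 r : 0 <= r -> r <= n%:R * dt -> jump (downward phi ^~ w) r != 0 -> r \in J.
  by move=> ? ? ?; apply/HJ; split=> //; right.
have time0 (j : nat) : 0 <= j%:R * dt by rewrite mulr_ge0// ltW.
have timeS (j : nat) : j%:R * dt <= j.+1%:R * dt by rewrite ler_pM2r// ler_nat.
have timen (j : nat) : (j <= n)%N -> j%:R * dt <= n%:R * dt by move=> jn; rewrite ler_pM2r// ler_nat.
have incr y (py : pure_jump_path y) j : (forall r, 0 <= r -> r <= n%:R * dt -> jump y r != 0 -> r \in J) ->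
    (j < n)%N -> y (j.+1%:R * dt) = y (j%:R * dt) + \sum_(r <- [seq r <- J | j%:R * dt < r <= j.+1%:R * dt]) jump y r.
  move=> Jy jn; rewrite big_filter; rewrite (path_sum py uJ J0 Jy (time0 _) (timen _ jn)).
  rewrite (path_sum py uJ J0 Jy (time0 _) (timen _ (ltnW jn))).
  rewrite (bigID (fun r => r <= j%:R * dt))/=; congr (_ + _); apply: eq_bigl => r.
    by rewrite andb_idl// => /le_trans; apply; exact: timeS.
  by rewrite -ltNge andbC.
have -> : \sum_(r <- J | 0 < r <= n%:R * dt) discounted_jump_cost r =
    \sum_(j < n) \sum_(r <- J | j%:R * dt < r <= j.+1%:R * dt) discounted_jump_cost r.
  elim: (n) => [|m IH].
    rewrite big_ord0 big1_seq// => r /andP[/andP[r0]]; rewrite mul0r => r0'.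
    by have := lt_le_trans r0 r0'; rewrite ltxx.
  by rewrite big_ord_recr/= -IH -sum_split.
rewrite /jump_sum -sumrN; apply: ler_sum => j _.
set Jj := [seq r <- J | j%:R * dt < r <= j.+1%:R * dt].
have Jj0 y r : pure_jump_path y -> r \in Jj -> 0 <= jump y r.
  by move=> py; rewrite mem_filter => /andP[_ /J0]; exact: jump_ge0.
have [d1 H1] := @lumped_cost K k Jj (fun r => dY1 phi r w) K0 k0 (fun r => Jj0 _ r py1).
have [d2 H2] := @lumped_cost L ell Jj (fun r => dY2 phi r w) L0 ell0 (fun r => Jj0 _ r py2).
have := lump (drift_path W mu sigma (j.+1%:R * dt) w + (x + upward phi (j%:R * dt) w - downward phi (j%:R * dt) w)) d1 d2.
set z := drift_path _ _ _ _ _ + _; set z' := z + _ - _.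
have -> : z' = drift_path W mu sigma (j.+1%:R * dt) w +
    (x + upward phi (j.+1%:R * dt) w - downward phi (j.+1%:R * dt) w).
  rewrite (incr (upward phi ^~ w) py1 j J1 (ltn_ord j)) (incr (downward phi ^~ w) py2 j J2 (ltn_ord j)).
  have alg (X a b p q : R) : X + (x + a - b) + p - q = X + (x + (a + p) - (b + q)) by ring.
  exact: alg.
move=> H3; rewrite -mulrN opprB.
apply: (@le_trans _ _ (expR (- beta * (j.+1%:R * dt)) * \sum_(r <- Jj) jump_cost r)).
  rewrite ler_wpM2l ?expR_ge0// (le_trans H3)// /jump_cost [leRHS]big_split/=.
  exact: lerD.
rewrite mulr_sumr -[leRHS]big_filter -/Jj big_seq_cond [leRHS]big_seq_cond.
apply: ler_sum => r; rewrite andbT mem_filter => /andP[/andP[_ rj] _].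
by rewrite ler_wpM2r ?jump_cost_ge0// ler_expR !mulNr lerN2 ler_pM2l.
Qed.

Lemma path_cost_lower (W : R -> Omega -> R) (mu sigma dt : R) n : 0 < dt ->
  ((f x - f (c 0 w) - jump_sum W mu sigma beta f c dt n w)%:E <=
   \esum_(s in `[0%R, +oo[) (discounted_jump_cost s)%:E)%E.
Proof.
move=> dt0; have [J [uJ HJ]] := adjustments_seq py1 py2 (n%:R * dt).
have J0 r : r \in J -> 0 <= r by case/HJ.
(* The grid sums see only the jumps after time 0; the one at time 0 is added by hand. *)
set J' := 0 :: [seq r <- J | 0 < r <= n%:R * dt].
have uJ' : uniq J' by rewrite /= mem_filter ltxx/= filter_uniq.
have J'0 r : r \in J' -> 0 <= r.
  by rewrite inE => /predU1P[->//|]; rewrite mem_filter => /andP[_ /J0].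
apply: (le_trans _ (jump_cost_esum uJ' J'0)); rewrite lee_fin big_cons big_filter.
have := jump_sum_cost W mu sigma dt0 uJ HJ.
have y1 : dY1 phi 0 w = upward phi 0 w by rewrite /dY1 /jump /before lexx subr0.
have y2 : dY2 phi 0 w = downward phi 0 w by rewrite /dY2 /jump /before lexx subr0.
have := lump x (path_ge0 py1) (path_ge0 py2).
rewrite /discounted_jump_cost mulr0 expR0 mul1r /jump_cost y1 y2.
by move: (jump_sum _ _ _ _ _ _ _ _ _) => A ? ?; lra.
Qed.

End lower_bound.

End adjustment_costs.

(** * Measurability and integrability of the adjustments *)

Section adjustment_measurability.
Context {R : realType} {dsp : measure_display} {Omega : measurableType dsp}.
Variables (P : probability Omega R) (F : R -> set (set Omega)).
Hypothesis Ff : filtration F.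
Variables (phi : policy R Omega).
Hypothesis adm : admissible F phi.
Variable beta : R.
Hypothesis beta0 : 0 < beta.
Local Notation intg := (intg P).
Local Notation Ex := (Ex P).
Implicit Types (s t T : R) (n N : nat) (w : Omega).

Let pj1 w : pure_jump_path (upward phi ^~ w).
Proof. by have [] := admissible_paths adm w. Qed.
Let pj2 w : pure_jump_path (downward phi ^~ w).
Proof. by have [] := admissible_paths adm w. Qed.

Lemma adj_time_event n t : measurable [set w | (adj_time phi n w <= t%:E)%E].
Proof.
have [t0|t0] := leP 0 t; first exact: (filtration_mf Ff t0 (admissible_time adm n t0)).
rewrite (_ : [set _ | _] = set0)//; apply/seteqP; split=> // w /= H.
have := le_trans (adj_time_ge0 phi w n) H; rewrite lee_fin; by rewrite leNgt t0.
Qed.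

Lemma measurable_adj_time n : measurable_fun setT (adj_time phi n).
Proof.
apply: (measurability (@ErealGenOInfty.G R)); first exact: ErealGenOInfty.measurableE.
move=> _ [_ [r ->] <-]; rewrite setTI (_ : _ @^-1` _ = ~` [set w | (adj_time phi n w <= r%:E)%E]).
  exact/measurableC/adj_time_event.
by apply/seteqP; split=> w /=; rewrite in_itv/= andbT; [move=> H; apply/negP; rewrite -ltNge|move/negP; rewrite -ltNge].
Qed.

Lemma strict_past_measurable n : strict_past F (adj_time phi n) `<=` measurable.
Proof.
apply: smallest_sub; first exact: sigma_algebra_measurable.
move=> E [FE|[t [A [t0 FA ->]]]]; first exact: (filtration_mf Ff (lexx 0)).
apply: measurableI; first exact: (filtration_mf Ff t0).
rewrite (_ : [set _ | _] = ~` [set w | (adj_time phi n w <= t%:E)%E]).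
  exact/measurableC/adj_time_event.
by apply/seteqP; split=> w /=; [move=> H; apply/negP; rewrite -ltNge|move/negP; rewrite -ltNge].
Qed.

Lemma measurable_adj_amount n : measurable_fun setT (adj_amount phi n).
Proof.
apply: (@measurable_wrt_mf _ _ _ (strict_past F (adj_time phi n))).
  exact: strict_past_measurable.
exact: (admissible_amount adm).
Qed.

Lemma measurable_adj_part s n : measurable_fun setT (fun w => adj_part phi w s n).
Proof.
rewrite (_ : (fun w => _) = fun w => `|adj_amount phi n w| * \1_[set w | (adj_time phi n w <= s%:E)%E] w).
  apply: measurable_funM; last by apply: measurable_indic; exact: adj_time_event.
  by apply: measurableT_comp => //; exact: measurable_adj_amount.
apply/funext => w; rewrite /adj_part indicE; case: ifPn => H.
  by rewrite mem_set// mulr1.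
by rewrite memNset ?mulr0//=; exact/negP.
Qed.

(** The summand of the feasibility condition as a real number; the discount factor is 0 at an
    infinite adjustment time. *)
Definition discounted_part n w : R :=
  fine (expeR (- (beta%:E * adj_time phi n w))) * (1 + `|adj_amount phi n w|).

Lemma expeR_adj_time n w : (expeR (- (beta%:E * adj_time phi n w)) =
  (fine (expeR (- (beta%:E * adj_time phi n w))))%:E)%E.
Proof.
have := adj_time_ge0 phi w n; case: (adj_time phi n w) => //= _.
by rewrite gt0_muley ?lte_fin.
Qed.

Lemma measurable_discounted_part n : measurable_fun setT (discounted_part n).
Proof.
apply: measurable_funM; last first.
  apply: measurable_funD => //; apply: measurableT_comp => //; exact: measurable_adj_amount.
rewrite (_ : (fun w => _) = fun w => expR (- beta * fine (adj_time phi n w)) *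
    \1_(setT `&` [set w | adj_time phi n w \is a fin_num]) w).
  apply: measurable_funM.
    apply: (measurableT_comp (@measurable_expR R)); apply: measurable_funM => //.
    by apply: measurableT_comp (measurable_adj_time n).
  by apply: measurable_indic; apply: emeasurable_fin_num => //; exact: measurable_adj_time.
apply/funext => w; rewrite indicE setTI; have := adj_time_ge0 phi w n.
case E : (adj_time phi n w) => [r| |]//= _.
  by rewrite mem_set ?mulr1 ?mulNr//= E.
by rewrite memNset ?mulr0 ?gt0_muley ?lte_fin//= E.
Qed.

Lemma discounted_part_ge0 n w : 0 <= discounted_part n w.
Proof. by rewrite mulr_ge0 ?addr_ge0// fine_ge0// expeR_ge0. Qed.

Lemma adj_part_discounted s n w : adj_part phi w s n <= expR (beta * s) * discounted_part n w.
Proof.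
rewrite /adj_part /discounted_part /=.
have := adj_time_ge0 phi w n; have := expeR_adj_time n w.
case: (adj_time phi n w) => [r| |]//= _ r0.
  rewrite lee_fin; case: ifPn => rs; last by rewrite !mulr_ge0 ?expR_ge0// addr_ge0.
  rewrite mulrA -expRD; have e1 : 1 <= expR (beta * s - beta * r).
    by rewrite -expR0 ler_expR subr_ge0 ler_pM2l.
  by rewrite -[leLHS]mul1r ler_pM// lerDr.
by rewrite !mulr_ge0 ?addr_ge0 ?expR_ge0// fine_ge0// expeR_ge0.
Qed.

Hypothesis feas : feasible P F beta phi.

Lemma discounted_part_series : (forall n, intg (discounted_part n)) /\
  exists M : R, forall N, \sum_(n < N) Ex (discounted_part n) <= M.
Proof.
have [_] := feas; rewrite (_ : (fun w => _) = fun w => (\sum_(0 <= n <oo) (discounted_part n w)%:E)%E); last first.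
  by apply/funext => w; apply: eq_eseriesr => n _; rewrite expeR_adj_time.
have mE n : measurable_fun setT (EFin \o discounted_part n).
  by apply/measurable_EFinP; exact: measurable_discounted_part.
rewrite integral_nneseries//; last by move=> n w _; rewrite lee_fin discounted_part_ge0.
set S := (\sum_(0 <= n <oo) _)%E => Soo.
have i0 n : (0 <= \int[P]_w (discounted_part n w)%:E)%E.
  by apply: integral_ge0 => w _; rewrite lee_fin discounted_part_ge0.
have part N : (\sum_(0 <= n < N) \int[P]_w (discounted_part n w)%:E <= S)%E.
  exact: nneseries_lim_ge.
have S0 : (0 <= S)%E by rewrite (le_trans _ (part 0))// big_geq.
have Sfin : S \is a fin_num by rewrite ge0_fin_numE.
have intd n : intg (discounted_part n).
  apply/integrableP; split; first exact: mE.
  under eq_integral do rewrite /= ger0_norm ?discounted_part_ge0//.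
  apply: le_lt_trans Soo; apply: le_trans (part n.+1).
  by rewrite big_nat_recr//= leeDr// sume_ge0.
split=> //; exists (fine S) => N; rewrite -lee_fin fineK// -sumEFin.
apply: le_trans (part N); rewrite big_mkord; apply: lee_sum => n _.
by rewrite integral_Ex.
Qed.

Let part_le (n N : nat) s : \sum_(n <= i < N) Ex (fun w => adj_part phi w s i) <=
  expR (beta * s) * \sum_(n <= i < N) Ex (discounted_part i).
Proof.
have [intd _] := discounted_part_series.
rewrite mulr_sumr; apply: ler_sum => i _.
rewrite -ExZ//; apply: Ex_le => [||w]; last exact: adj_part_discounted.
  apply: (intg_le _ _ (intgZ (expR (beta * s)) (intd i))); first exact: measurable_adj_part.
  by move=> w; rewrite ger0_norm ?adj_part_ge0// adj_part_discounted.
exact: intgZ.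
Qed.

Let intg_part s i : intg (fun w => adj_part phi w s i).
Proof.
have [intd _] := discounted_part_series.
apply: (intg_le _ _ (intgZ (expR (beta * s)) (intd i))); first exact: measurable_adj_part.
by move=> w; rewrite ger0_norm ?adj_part_ge0// adj_part_discounted.
Qed.

Lemma adj_variation_intg s (M : R) :
  (forall N, \sum_(n < N) Ex (fun w => adj_part phi w s n) <= M) ->
  intg (fun w => adj_variation phi w s) /\ Ex (fun w => adj_variation phi w s) <= M.
Proof.
move=> HM; apply: (@Ex_fatou _ _ _ P (fun N w => \sum_(n < N) adj_part phi w s n)).
- by move=> N; apply: intg_sum => n; exact: intg_part.
- by move=> N w; rewrite sumr_ge0// => n _; exact: adj_part_ge0.
- by move=> w; exact: adj_variation_cvg.
- by move=> N; rewrite Ex_sum// => n; exact: intg_part.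
Qed.

Lemma intg_adj_variation s : intg (fun w => adj_variation phi w s).
Proof.
have [_ [M HM]] := discounted_part_series.
have [] // := @adj_variation_intg s (expR (beta * s) * M) _ => N.
rewrite -(big_mkord xpredT (fun i => Ex (fun w => adj_part phi w s i))).
rewrite (le_trans (part_le 0 N s))// ler_wpM2l ?expR_ge0//.
by rewrite big_mkord.
Qed.

(* Split the adjustments at a fixed rank: for finitely many of them dominated
   convergence applies, and the others contribute little in the mean. *)
Lemma adj_variation_decay e : 0 < e -> exists m0 : nat, forall m, (m0 <= m)%N ->
  expR (- beta * m%:R) * Ex (fun w => adj_variation phi w m%:R) <= e.
Proof.
move=> e0; have [intd [M HM]] := discounted_part_series.
pose a n := Ex (discounted_part n).
have a0 n : 0 <= a n by apply: Ex_ge0 => w; exact: discounted_part_ge0.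
have e2 : 0 < e / 2 by rewrite divr_gt0.
have [N HN] : exists N, forall m, (N <= m)%N -> \sum_(N <= i < m) a i <= e / 2.
  pose u n := \sum_(i < n) a i.
  have uc : cvgn u.
    apply: nondecreasing_is_cvgn.
      by apply/nondecreasing_seqP => n; rewrite /u big_ord_recr/= lerDl.
    by exists M => _ [n _ <-]; exact: HM.
  have /cvgrPdist_le /(_ _ (divr_gt0 e2 (ltr0n R 2 : 0 < 2%:R))) [N _ HN] := uc.
  exists N => m Nm; have := HN m Nm; have := HN N (leqnn N) => /= H1 H2.
  have E : \sum_(N <= i < m) a i = u m - u N.
    rewrite /u -!(big_mkord xpredT a) (big_cat_nat (leq0n N) Nm)/=.
    by rewrite [X in X - _]addrC addrK.
  rewrite E (_ : u m - u N = (limn u - u N) - (limn u - u m)); last by ring.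
  by rewrite (le_trans (ler_norm _))// (le_trans (ler_normB _ _))//; lra.
pose b (m n : nat) := expR (- beta * m%:R) * Ex (fun w => adj_part phi w m%:R n).
have bE m n w : expR (- beta * m%:R) * adj_part phi w m%:R n <= discounted_part n w.
  have := ler_wpM2l (expR_ge0 (- beta * m%:R)) (adj_part_discounted m%:R n w).
  by rewrite mulrA -expRD mulNr addNr expR0 mul1r.
have exp0 : expR (- beta * m%:R) @[m --> \oo] --> (0 : R).
  rewrite (_ : (fun m : nat => expR (- beta * m%:R)) = fun m => expR (- beta) ^+ m).
    apply: cvg_expr; rewrite ger0_norm ?expR_ge0// -[ltRHS]expR0 ltr_expR.
    by rewrite oppr_lt0.
  by apply/funext => m; rewrite mulrC expRM_natl.
have cvb n : b m n @[m --> \oo] --> (0 : R).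
  have [||||_] := @Ex_dominated _ _ _ P (fun m w => expR (- beta * m%:R) * adj_part phi w m%:R n)
    (fun=> 0) (discounted_part n).
  - by move=> m; apply: measurable_funM => //; exact: measurable_adj_part.
  - move=> w.
    have H : expR (- beta * m%:R) * `|adj_amount phi n w| @[m --> \oo] --> 0 * `|adj_amount phi n w|.
      by apply: cvgMr_tmp; exact: exp0.
    rewrite mul0r in H; apply: squeeze_cvgr (cvg_cst 0) H; apply: nearW => m.
    rewrite mulr_ge0 ?expR_ge0 ?adj_part_ge0//= ler_wpM2l ?expR_ge0//.
    by rewrite /adj_part; case: ifP.
  - by move=> m w; rewrite ger0_norm ?mulr_ge0 ?expR_ge0 ?adj_part_ge0.
  - exact: intd.
  rewrite Ex_cst; rewrite (_ : (fun m => Ex _) = b ^~ n)//.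
  by apply/funext => m; rewrite /b -ExZ//; exact: intg_part.
have cv : \sum_(n < N) b m n @[m --> \oo] --> (0 : R).
  elim: (N) => [|n IH].
    rewrite (_ : (fun m => _) = fun=> 0); first exact: cvg_cst.
    by apply/funext => m; rewrite big_ord0.
  rewrite (_ : (fun m => _) = (fun m => \sum_(i < n) b m i + b m n)).
    by rewrite -[X in _ --> X](addr0 (0 : R)); apply: cvgD.
  by apply/funext => m; rewrite big_ord_recr.
have /cvgrPdist_le /(_ _ e2) [m0 _ Hm0] := cv.
exists m0 => m mm0; have := Hm0 m mm0; rewrite /= sub0r normrN => bm.
have HM' N' : \sum_(n < N') Ex (fun w => adj_part phi w m%:R n) <=
    \sum_(n < N) Ex (fun w => adj_part phi w m%:R n) + expR (beta * m%:R) * (e / 2).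
  pose N2 := maxn N N'.
  apply: (@le_trans _ _ (\sum_(n < N2) Ex (fun w => adj_part phi w m%:R n))).
    rewrite /N2 -(subnKC (leq_maxr N N')) big_split_ord/= lerDl sumr_ge0// => i _.
    by apply: Ex_ge0 => w; exact: adj_part_ge0.
  rewrite -!(big_mkord xpredT (fun n => Ex (fun w => adj_part phi w m%:R n))).
  rewrite /N2 (big_cat_nat (leq0n N) (leq_maxl N N'))/= lerD2l (le_trans (part_le _ _ _))//.
  by rewrite ler_wpM2l ?expR_ge0// HN// leq_maxl.
have [_ H] := adj_variation_intg HM'.
have := ler_wpM2l (expR_ge0 (- beta * m%:R)) H.
rewrite mulrDr mulrA -expRD mulNr addNr expR0 mul1r mulr_sumr -mulNr => H'.
by rewrite (le_trans H')//; have := ler_norm (\sum_(n < N) b m n); rewrite /b in bm *; lra.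
Qed.

End adjustment_measurability.

(** * Verification *)

Lemma band_neighbourhood {R : realType} (d u x z r : R) : r <= 1 -> d < x + r -> x - r < u ->
  x - r <= z -> z <= x + r -> [/\ d - 2 <= z, z <= u + 2, d - 2 <= x, x <= u + 2 & `|z - x| <= r].
Proof. by move=> *; split; rewrite ?ler_norml; lra. Qed.

Section smoothing.
Context {R : realType}.
Variables (mu sigma beta K L k ell : R) (h : R -> R) (a : R).
Hypotheses (sigma0 : 0 < sigma) (beta0 : 0 < beta).
Hypotheses (K0 : 0 < K) (L0 : 0 < L) (k0 : 0 < k) (ell0 : 0 < ell).
Hypothesis hh : holding_cost mu sigma beta k ell h a.
Variables (A B d D U u : R).
Hypothesis fb : free_boundary mu sigma beta K L k ell h a A B d D U u.
Local Notation V := (Vfun mu sigma beta h a A B d u).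
Local Notation V' := (Vder mu sigma beta h a A B d u).
Implicit Types (x y z e t : R) (F G g gg : R -> R).

Let ch : continuous h := holding_continuous hh.
Let dV x : is_derive x 1 V (V' x) := der_Vfun hh fb x.

(* The symmetric mean of [g = F'] over [[x - e, x + e]]. *)
Definition symmetric_mean (F : R -> R) e x : R := (F (x + e) - F (x - e)) / (2 * e).

Lemma symmetric_mean_value (F g : R -> R) e x : 0 < e -> (forall z, is_derive z 1 F (g z)) ->
  exists z, [/\ x - e < z, z < x + e & symmetric_mean F e x = g z].
Proof.
move=> e0 dF; have xe : x - e < x + e by lra.
have [z [xz zx E]] := der_MVT xe (der_continuous dF) (fun z _ _ => dF z).
exists z; split=> //; rewrite /symmetric_mean E; field; exact: lt0r_neq0.
Qed.

Lemma der_symmetric_mean (F g : R -> R) e x : (forall z, is_derive z 1 F (g z)) ->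
  is_derive x 1 (symmetric_mean F e) (symmetric_mean g e x).
Proof.
move=> dF.
have sh c y : is_derive y 1 (fun z => F (z + c)) (g (y + c)) by apply: der_shift_comp.
have H := derZ ((2 * e)^-1) (derB (sh e x) (sh (- e) x)).
rewrite (_ : symmetric_mean F e = fun z => (2 * e)^-1 * (F (z + e) - F (z - e))).
  by apply: (der_eq H); rewrite /symmetric_mean mulrC.
by apply/funext => z; rewrite /symmetric_mean mulrC.
Qed.

(** A pointwise inequality is averaged over the common shift [t]. *)
Lemma symmetric_mean_le (F G g gg : R -> R) e x y b : 0 < e ->
  (forall z, is_derive z 1 F (g z)) -> (forall z, is_derive z 1 G (gg z)) ->
  (forall t, g (x + t) <= gg (y + t) + b) -> symmetric_mean F e x <= symmetric_mean G e y + b.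
Proof.
move=> e0 dF dG gb.
have dH t : is_derive t 1 (fun s => G (s + y) - F (s + x) + b * s) (gg (t + y) - g (t + x) + b).
  have d1 : is_derive t 1 (fun s => G (s + y)) (gg (t + y)) by apply: der_shift_comp.
  have d2 : is_derive t 1 (fun s => F (s + x)) (g (t + x)) by apply: der_shift_comp.
  by apply: (der_eq (derD (derB d1 d2) (derZ b (der_id t)))); rewrite mulr1.
have le_e : - e <= e by lra.
have := der_ge0_le le_e (der_continuous dH) (fun t _ _ => dH t) _.
move=> /(_ _)/[!(addrC e)] H.
have {}H : G (- e + y) - F (- e + x) + b * - e <= G (y + e) - F (x + e) + b * e.
  by apply: H => t _ _; have := gb t; rewrite ![t + _]addrC; lra.
rewrite /symmetric_mean ler_pdivrMr ?mulr_gt0// mulrDl divfK ?mulf_neq0 ?lt0r_neq0//.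
by move: H; rewrite ![- e + _]addrC; lra.
Qed.

(** The function is the symmetric mean of [V] over a small radius. The jump inequalities compare [V]
    at points of fixed distance and survive averaging unchanged; in the generator inequality the
    errors are Lipschitz constants times the radius. *)
Lemma smooth_subsolution e : 0 < e -> exists f f1 f2 C,
  [/\ 0 <= C, (forall x, is_derive x 1 f (f1 x)), (forall x, is_derive x 1 f1 (f2 x)),
      (forall x, `|f1 x| <= C) & (forall x, `|f2 x| <= C)] /\
  [/\ lip C f2, (forall x y, x <= y -> f x <= f y + K + k * (y - x)),
      (forall x y, x <= y -> f y <= f x + L + ell * (y - x)),
      (forall x, - e <= generator mu sigma f1 f2 x - beta * f x + h x) &
      (forall x, `|f x - V x| <= e)].
Proof.
move=> e0.
have [c1 [c10 V'c]] := Vder_bounded hh fb.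
have [c2 [c20 V'l]] := Vder_lip hh fb.
have [c3 [c30 hl]] := cost_lipschitz hh (d - 2) (u + 2).
have lV : lip c1 V := lip_der dV V'c.
have cV : continuous V := der_continuous dV.
pose Q := fun x => oriented_integral 0 x V; pose H := fun x => oriented_integral 0 x h.
have dQ x : is_derive x 1 Q (V x) := der_oriented_integral 0 x cV.
have dH x : is_derive x 1 H (h x) := der_oriented_integral 0 x ch.
(* [r <= 1] keeps the arguments within the interval on which [c3] is a Lipschitz constant of [h];
   the quotient makes each error at most [e]. *)
pose r := Num.min 1 (e / (c1 + beta * c1 + c3 + 1)).
have den : 0 < c1 + beta * c1 + c3 + 1 by rewrite ltr_wpDl// !addr_ge0// mulr_ge0// ltW.
have r0 : 0 < r by rewrite lt_min ltr01 divr_gt0.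
have r1 : r <= 1 by rewrite ge_min lexx.
have re : (c1 + beta * c1 + c3 + 1) * r <= e by rewrite mulrC -ler_pdivlMr// ge_min lexx orbT.
have bc1 : 0 <= beta * c1 by rewrite mulr_ge0// ltW.
have [q1 q2 q3 q4] : [/\ c1 * r <= e, beta * (c1 * r) <= e, c3 * r <= e & 0 <= r].
  have t1 : 0 <= c1 * r by rewrite mulr_ge0// ltW.
  have t2 : 0 <= beta * c1 * r by rewrite mulr_ge0// ltW.
  have t3 : 0 <= c3 * r by rewrite mulr_ge0// ltW.
  by rewrite mulrA; split; lra.
have fV x : `|symmetric_mean Q r x - V x| <= c1 * r.
  have [z [xz zx ->]] := symmetric_mean_value x r0 dQ.
  rewrite (le_trans (lV _ _))// ler_wpM2l// ler_norml; lra.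
exists (symmetric_mean Q r), (symmetric_mean V r), (symmetric_mean V' r), (c1 + c2 + c2 / r).
have c2r : 0 <= c2 / r by rewrite divr_ge0.
split; split.
- by rewrite !addr_ge0.
- by move=> x; exact: der_symmetric_mean.
- by move=> x; exact: der_symmetric_mean.
- by move=> x; have [z [_ _ ->]] := symmetric_mean_value x r0 dV; rewrite (le_trans (V'c _))//; lra.
- move=> x; rewrite /symmetric_mean normrM normfV (gtr0_norm (_ : 0 < 2 * r)) ?mulr_gt0//.
  rewrite ler_pdivrMr ?mulr_gt0// (le_trans (V'l _ _))//.
  rewrite (_ : x + r - (x - r) = 2 * r); last by ring.
  by rewrite gtr0_norm ?mulr_gt0// ler_wpM2r ?mulr_ge0//; lra.
- apply: (@lip_le _ (c2 / r)); first by lra.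
  move=> x y; rewrite /symmetric_mean -mulrBl normrM normfV (gtr0_norm (_ : 0 < 2 * r)) ?mulr_gt0//.
  rewrite ler_pdivrMr ?mulr_gt0//.
  have -> : V' (x + r) - V' (x - r) - (V' (y + r) - V' (y - r)) =
    (V' (x + r) - V' (y + r)) - (V' (x - r) - V' (y - r)) by ring.
  rewrite (le_trans (ler_normB _ _))// (le_trans (lerD (V'l _ _) (V'l _ _)))//.
  rewrite (_ : x + r - (y + r) = x - y); last by ring.
  rewrite (_ : x - r - (y - r) = x - y); last by ring.
  rewrite le_eqVlt; apply/orP; left; apply/eqP; field; exact: lt0r_neq0.
- move=> x y xy; rewrite -addrA; apply: (symmetric_mean_le r0 dQ dQ) => t.
  have := Vfun_jump_up sigma0 beta0 K0 k0 ell0 hh fb (_ : x + t <= y + t).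
  by rewrite lerD2r => /(_ xy); lra.
- move=> x y xy; rewrite -addrA; apply: (symmetric_mean_le r0 dQ dQ) => t.
  have := Vfun_jump_down sigma0 beta0 L0 k0 ell0 hh fb (_ : x + t <= y + t).
  by rewrite lerD2r => /(_ xy); lra.
- move=> x; have := fV x; rewrite ler_norml => /andP[f1 f2].
  (* [h] is Lipschitz only locally. Clear of the band [V] is affine and the inequality at [x] itself
     is used; only near the band is [h] replaced by its mean. *)
  have [xd|dx] := leP (x + r) d.
    have xd' : x <= d by lra. have xd2 : x - r <= d by lra.
    have := Vfun_generator_left sigma0 beta0 hh fb xd'.
    have [z [_ zx E]] := symmetric_mean_value x r0 dV.
    rewrite /generator E (Vder_left sigma0 beta0 hh fb); last by lra.
    rewrite {1}/symmetric_mean !(Vder_left sigma0 beta0 hh fb)// subrr mul0r mulr0 add0r.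
    have := ler_wpM2l (ltW beta0) f2; lra.
  have [ux|xu] := leP u (x - r).
    have ux' : u <= x by lra. have ux2 : u <= x + r by lra.
    have := Vfun_generator_right sigma0 beta0 hh fb ux'.
    have [z [xz _ E]] := symmetric_mean_value x r0 dV.
    rewrite /generator E (Vder_right sigma0 beta0 hh fb); last by lra.
    rewrite {1}/symmetric_mean !(Vder_right sigma0 beta0 hh fb)// subrr mul0r mulr0 add0r.
    have := ler_wpM2l (ltW beta0) f2; lra.
  have xx : x - r <= x + r by lra.
  have G := Vfun_generator sigma0 beta0 hh fb dQ dH xx.
  have [z [xz zx E]] := symmetric_mean_value x r0 dH.
  have hz : h z <= h x + c3 * r.
    have : `|h z - h x| <= c3 * r.
      have [z1 z2 z3 z4 z5] := band_neighbourhood r1 dx xu (ltW xz) (ltW zx).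
      by rewrite (le_trans (hl _ _ z1 z2 z3 z4))// ler_wpM2l.
    by rewrite ler_norml => /andP[_]; lra.
  have : 0 <= sigma ^+ 2 / 2 * symmetric_mean V' r x + mu * symmetric_mean V r x -
      beta * symmetric_mean Q r x + symmetric_mean H r x.
    rewrite (_ : _ + _ = (sigma ^+ 2 / 2 * (V' (x + r) - V' (x - r)) + mu * (V (x + r) - V (x - r)) -
      beta * (Q (x + r) - Q (x - r)) + (H (x + r) - H (x - r))) / (2 * r)); last first.
      by rewrite /symmetric_mean; field; exact: lt0r_neq0.
    by rewrite divr_ge0 ?mulr_ge0//; lra.
  by rewrite E /generator; lra.
- by move=> x; rewrite (le_trans (fV x)).
Qed.

End smoothing.

Section nonnegative_integrals.
Context {R : realType} {dsp : measure_display} {T : measurableType dsp}.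
Variable m : {measure set T -> \bar R}.
Local Open Scope ereal_scope.

(** Read off the definition as a supremum over simple functions, so that it applies to the cost of a
    policy as it stands, a sum over uncountably many times included. *)
Lemma integral_monotone (D : set T) (f g : T -> \bar R) : (forall x, D x -> 0 <= f x) ->
  (forall x, D x -> f x <= g x) -> \int[m]_(x in D) f x <= \int[m]_(x in D) g x.
Proof.
move=> f0 fg; have g0 x : D x -> 0 <= g x by move=> Dx; rewrite (le_trans (f0 x Dx))// fg.
rewrite !ge0_integralE//; apply: ereal_sup_le => _ [s sf <-]; exists s => // x.
apply: (le_trans (sf x)); rewrite !patchE; case: ifPn => //.
by rewrite inE => /fg.
Qed.

Lemma integral_monotone_set (D E : set T) (f : T -> \bar R) : D `<=` E ->
  (forall x, E x -> 0 <= f x) -> \int[m]_(x in D) f x <= \int[m]_(x in E) f x.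
Proof.
move=> DE f0; rewrite [leLHS]integral_mkcond [leRHS]integral_mkcond.
apply: integral_monotone => x _; rewrite !patchE; case: ifPn => //.
  by rewrite inE => /DE/f0.
by rewrite inE => /DE Ex; rewrite mem_set.
by case: ifPn => //; rewrite inE => /f0.
Qed.

End nonnegative_integrals.

(** * Lower bound for every feasible policy *)

Section verification.
Context {R : realType} {dsp : measure_display} {Omega : measurableType dsp}.
Local Notation leb := (@lebesgue_measure R).
Variables (P : probability Omega R) (F : R -> set (set Omega)) (W : R -> Omega -> R).
Hypotheses (Ff : filtration F) (bm : standard_brownian P W) (mart : martingale P F W).
Local Notation intg := (intg P).
Local Notation Ex := (Ex P).
Variables (mu sigma beta K L k ell : R) (h : R -> R).
Hypotheses (beta0 : 0 < beta) (K0 : 0 <= K) (L0 : 0 <= L) (k0 : 0 <= k) (ell0 : 0 <= ell).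
Hypothesis h0 : forall x, 0 <= h x.
Variables (x : R) (phi : policy R Omega).
Local Notation X := (drift_path W mu sigma).
Local Notation c := (fun t w => x + upward phi t w - downward phi t w).
Local Notation DC := (discounted_cost P W mu sigma beta K L k ell h x phi).

Lemma net_measurable w : pure_jump_path (upward phi ^~ w) -> pure_jump_path (downward phi ^~ w) ->
  forall T : R, measurable_fun `[0, T] (c ^~ w).
Proof.
move=> p1 p2 T.
have mono y : pure_jump_path y -> measurable_fun `[0, T] y.
  move=> py; have H : measurable_fun `[0, T] (fun s => y (Num.max 0 s)).
    apply: nondecreasing_measurable; first exact: measurable_itv.
    move=> s t st; apply: (path_nondecreasing py); first by rewrite le_max lexx.
    by rewrite ge_max le_max lexx/= le_max st orbT.
  apply: eq_measurable_fun H => s; rewrite inE/= in_itv/= => /andP[s0 _].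
  by rewrite max_r.
by apply: measurable_funB; [apply: measurable_funD|]; [|exact: mono|exact: mono].
Qed.

Lemma inventory_drift t w : inventory mu sigma W x phi t w = X t w + c t w.
Proof. by rewrite /inventory /drift_path; ring. Qed.

Hypothesis adm : admissible F phi.
Let pj1 w : pure_jump_path (upward phi ^~ w).
Proof. by have [] := admissible_paths adm w. Qed.
Let pj2 w : pure_jump_path (downward phi ^~ w).
Proof. by have [] := admissible_paths adm w. Qed.

Lemma net_wrt s : 0 <= s -> measurable_wrt (F s) (c s).
Proof.
move=> s0; apply: (wrtB Ff) => //; last exact: (admissible_downward adm).
apply: (wrtD Ff) => //; first exact: (wrt_cst Ff).
exact: (admissible_upward adm).
Qed.

Definition policy_cost (w : Omega) : \bar R :=
  (\int[leb]_(t in `[0%R, +oo[) (expR (- beta * t) * h (inventory mu sigma W x phi t w))%:E +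
   \esum_(s in `[0%R, +oo[) (discounted_jump_cost phi w beta K L k ell s)%:E)%E.

Lemma discounted_costE : DC = (\int[P]_w policy_cost w)%E.
Proof. by []. Qed.

Lemma policy_cost_ge0 w : (0 <= policy_cost w)%E.
Proof.
apply: adde_ge0.
  by apply: integral_ge0 => t _; rewrite lee_fin mulr_ge0 ?expR_ge0.
apply: esum_ge0 => s; rewrite /= in_itv/= andbT => s0.
by rewrite lee_fin discounted_jump_cost_ge0.
Qed.

Hypothesis feas : feasible P F beta phi.

Lemma intg_net s : 0 <= s -> intg (c s).
Proof.
move=> s0; apply: (@intg_le _ _ _ _ (fun w => `|x| + adj_variation phi w s)).
- by apply: (wrt_mf Ff s0); exact: net_wrt.
- move=> w; rewrite -addrA (le_trans (ler_normD _ _))// lerD2l.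
  exact: net_bound (pj1 w) (pj2 w) _ s0.
- by apply: intgD; [exact: intg_cst|exact: (intg_adj_variation Ff adm beta0 feas)].
Qed.

Section test_function.
Variables (f f1 f2 : R -> R) (C e : R).
Hypotheses (df : forall x : R, is_derive x 1 f (f1 x)) (df1 : forall x : R, is_derive x 1 f1 (f2 x)).
Hypotheses (C0 : 0 <= C) (f1C : forall x, `|f1 x| <= C) (f2C : forall x, `|f2 x| <= C).
Hypothesis lf2 : lip C f2.
Hypothesis up : forall x y, x <= y -> f x <= f y + K + k * (y - x).
Hypothesis down : forall x y, x <= y -> f y <= f x + L + ell * (y - x).
Hypotheses (e0 : 0 < e) (sub : forall x, - e <= generator mu sigma f1 f2 x - beta * f x + h x).
Local Notation Gf := (fun y => generator mu sigma f1 f2 y - beta * f y).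

Let variation_bound w (p s T : R) : 0 <= p -> p <= s -> s <= T ->
  `|c s w - c p w| <= adj_variation phi w s - adj_variation phi w p.
Proof.
move=> p0 ps _; have := net_increment (pj1 w) (pj2 w) p0 ps.
have alg (a b a' b' : R) : x + a - b - (x + a' - b') = a - b - (a' - b') by ring.
by rewrite alg.
Qed.

Let exp_integral (T : R) : 0 < T -> e * \int[leb]_(s in `[0, T]) expR (- beta * s) <= e / beta.
Proof.
move=> T0; have dE (s : R) : is_derive s 1 (fun s => - beta^-1 * expR (- beta * s)) (expR (- beta * s)).
  by apply: (der_eq (derZ _ (der_expRM (- beta) s))); field; exact: lt0r_neq0.
rewrite (Rintegral_derive (ltW T0) dE); last exact: der_continuous (der_expRM (- beta)).
rewrite mulr0 expR0 ler_pM2l//; have := expR_ge0 (- beta * T).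
have : 0 < beta^-1 by rewrite invr_gt0.
by rewrite mulr1 opprK mulNr; nra.
Qed.

Let running_lower (T : R) w : 0 < T ->
  ((- discounted_running W mu sigma beta f f1 f2 c T w - e / beta)%:E <=
   \int[leb]_(t in `[0%R, +oo[) (expR (- beta * t) * h (inventory mu sigma W x phi t w))%:E)%E.
Proof.
move=> T0.
have mc := @net_measurable w (pj1 w) (pj2 w) T.
pose phi0 s := expR (- beta * s) * Gf (X s w + c s w).
have iphi : leb.-integrable `[0, T] (EFin \o phi0).
  exact: (discounted_running_integrable bm mu sigma beta0 df df1 C0 f1C f2C lf2 (c := c) (vv := fun w => adj_variation phi w) T0
    (fun w => @net_measurable w (pj1 w) (pj2 w) T) (fun w p s => @variation_bound w p s T)).
have iexp : leb.-integrable `[0, T] (EFin \o (fun s => expR (- beta * s))).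
  by apply: continuous_integrable; exact: der_continuous (der_expRM (- beta)).
have ieexp : leb.-integrable `[0, T] (EFin \o (fun s => e * expR (- beta * s))).
  by apply: continuous_integrable; apply: contZ; exact: der_continuous (der_expRM (- beta)).
pose u s := - phi0 s - e * expR (- beta * s).
have iu : leb.-integrable `[0, T] (EFin \o u) by exact: (integrableB _ (integrableN iphi) ieexp).
have Eu : - discounted_running W mu sigma beta f f1 f2 c T w - e / beta <= \int[leb]_(s in `[0, T]) u s.
  rewrite RintegralB//; last exact: (integrableN iphi).
  rewrite (_ : \int[leb]_(s in `[0, T]) (- phi0 s) = - discounted_running W mu sigma beta f f1 f2 c T w); last first.
    by rewrite -[RHS]mulN1r -RintegralZl//; apply: eq_Rintegral => s _; rewrite mulN1r.
  by rewrite lerD2l lerN2 RintegralZl//; exact: exp_integral.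
apply: (@le_trans _ _ (\int[leb]_(s in `[0%R, T]) (Num.max (u s) 0)%:E)%E).
  have mu0 : measurable_fun `[0, T]%classic u by apply/measurable_EFinP; exact: (measurable_int leb).
  rewrite -lee_fin in Eu; apply: (le_trans Eu); rewrite /Rintegral fineK; last exact: integrable_fin_num.
  apply: le_integral => //.
    apply: (le_integrable _ _ _ iu) => //; first by apply/measurable_EFinP; exact: measurable_maxr.
    move=> s _ /=; rewrite lee_fin ger0_norm ?le_max ?lexx ?orbT//.
    by rewrite ge_max ler_norm normr_ge0.
  by move=> s _; rewrite lee_fin le_max lexx.
apply: (@le_trans _ _ (\int[leb]_(t in `[0%R, T]) (expR (- beta * t) * h (inventory mu sigma W x phi t w))%:E)%E).
  apply: integral_monotone => s _; first by rewrite lee_fin le_max lexx orbT.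
  rewrite lee_fin ge_max mulr_ge0 ?expR_ge0// andbT /u /phi0 inventory_drift.
  have := sub (X s w + c s w); have := expR_ge0 (- beta * s).
  by move: (expR _) (Gf _) => q g; nra.
apply: integral_monotone_set => [s|s _]; first by rewrite /= !in_itv/= andbT => /andP[].
by rewrite lee_fin mulr_ge0 ?expR_ge0.
Qed.

(** In Dynkin's formula for [f] on [[0, T]] the negative of the running term is below the holding
    cost up to [e], whose discounted integral is at most [e / beta], and the negative of the jump
    sum is below the adjustment cost, both path by path. *)
Lemma verification_lower_horizon (T : R) : 0 < T ->
  ((f x - expR (- beta * T) * Ex (fun w => f (X T w + c T w)) - e / beta)%:E <= DC)%E.
Proof.
move=> T0; rewrite discounted_costE; apply/lee_addgt0Pr => r r0.
have vS w : adj_variation phi w T - adj_variation phi w 0 <= adj_variation phi w T.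
  by rewrite gerBl adj_variation_ge0.
have [iQ cvJ] := dynkin_formula Ff bm mart mu sigma beta0 df df1 C0 f1C f2C lf2 (c := c)
  net_wrt intg_net (vv := fun w => adj_variation phi w) T0
  (fun w => @net_measurable w (pj1 w) (pj2 w) T) (fun w p s => @variation_bound w p s T)
  vS
  (intg_adj_variation Ff adm beta0 feas T).
move/cvgrPdist_le: cvJ => /(_ _ r0) [n _ /(_ n (leqnn n))] /=.
set J := jump_sum _ _ _ _ _ _ _ _; set aT := expR _ * _; set b := Ex (fun w => f (X 0 w + _)).
set q := Ex _; rewrite ler_norml => /andP[HJ _].
have n0 : (0 : R) < n.+1%:R by rewrite ltr0n.
have dt0 : 0 < T / n.+1%:R by rewrite divr_gt0.
pose Y w := f x - f (X 0 w + c 0 w) - J w - discounted_running W mu sigma beta f f1 f2 c T w - e / beta.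
have iJ : intg J := intg_jump_sum mart mu sigma beta df f1C intg_net n.+1 dt0.
have i0 : intg (fun w => f (X 0 w + c 0 w)).
  apply: (intg_lip (lip_der df f1C)); apply: intgD; first exact: (drift_intg mart).
  exact: intg_net.
have ja := intg_cst P (f x); have jb := intgB ja i0; have jc := intgB jb iJ.
have jd := intgB jc iQ; have je := intg_cst P (e / beta).
have iY : intg Y := intgB jd je.
have EY : Ex Y = f x - b - Ex J - q - e / beta.
  by rewrite (ExB jd je) (ExB jc iQ) (ExB jb iJ) (ExB ja i0) !Ex_cst.
have W0 w : X 0 w + c 0 w = c 0 w.
  by case: bm => _ W0 _ _ _; rewrite /drift_path W0 !mulr0 add0r add0r.
have YC w : ((Y w)%:E <= policy_cost w)%E.
  have := path_cost_lower (pj1 w) (pj2 w) beta0 K0 L0 k0 ell0 up down x W mu sigma n.+1 dt0.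
  rewrite -/J => H1; have H2 := running_lower w T0.
  rewrite /policy_cost (_ : (Y w)%:E = (- discounted_running W mu sigma beta f f1 f2 c T w - e / beta)%:E +
    (f x - f (c 0 w) - J w)%:E)%E; first exact: leeD.
  by rewrite -EFinD /Y W0; congr EFin; ring.
apply: (@le_trans _ _ ((Ex Y)%:E + r%:E)%E).
  by rewrite -EFinD lee_fin EY; lra.
rewrite leeD2r// -integral_Ex//.
(* [Y] is integrable but may be negative; its positive part still lies below the cost and is
   nonnegative, as [integral_monotone] demands. *)
apply: (@le_trans _ _ (\int[P]_w (Num.max (Y w) 0)%:E)%E).
  have mY : measurable_fun setT Y := intg_mf iY.
  apply: le_integral => //.
    apply: (le_integrable _ _ _ iY) => //; first by apply/measurable_EFinP; exact: measurable_maxr.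
    move=> w _ /=; rewrite lee_fin ger0_norm ?le_max ?lexx ?orbT//.
    by rewrite ge_max ler_norm normr_ge0.
  by move=> w _; rewrite lee_fin le_max lexx.
apply: integral_monotone => w _; first by rewrite lee_fin le_max lexx orbT.
by rewrite EFin_max ge_max YC policy_cost_ge0.
Qed.

(** [f] is Lipschitz, so the mean of its absolute value grows at most linearly in [T] plus a
    multiple of the mean variation of the adjustments. The exponential beats the first,
    [adj_variation_decay] the second. *)
Lemma terminal_vanishes r : 0 < r -> exists2 T : R, 0 < T &
  expR (- beta * T) * Ex (fun w => f (X T w + c T w)) <= r.
Proof.
move=> r0; have r2 : 0 < r / 2 by rewrite divr_gt0.
have C1 : 0 < C + 1 by rewrite ltr_wpDl.
have [m0 Hm0] := adj_variation_decay Ff adm beta0 feas (divr_gt0 r2 C1).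
pose a := `|f 0| + C * (`|sigma| + `|x|); pose b := C * (`|mu| + `|sigma|).
have a0 : 0 <= a by rewrite addr_ge0// mulr_ge0// addr_ge0.
have b0 : 0 <= b by rewrite mulr_ge0// addr_ge0.
(* From here on [a + b * T] is at most [r / 2 * (beta * T / 2) ^+ 2], and the square is at most
   [expR (beta * T)]. *)
pose m := maxn m0 (Num.truncn (8 * (a + b) / (beta ^+ 2 * r))).+1.
have m1 : (0 < m)%N by rewrite (leq_trans _ (leq_maxr _ _)).
have T0 : (0 : R) < m%:R by rewrite ltr0n.
exists m%:R => //; set T := m%:R.
have [i2 E2 _ _] := increment_moments bm mart (lexx 0) T0.
have iV := intg_adj_variation Ff adm beta0 feas T.
have iZ : intg (fun w => X T w + c T w).
  by apply: intgD; [exact: (drift_intg mart _ _ (ltW T0))|exact: intg_net (ltW T0)].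
have W0 w : W 0 w = 0 by case: bm.
have bound w : `|f (X T w + c T w)| <= a + C * (`|mu| * T) + C * `|sigma| * dW W 0 T w ^+ 2 + C * adj_variation phi w T.
  rewrite -[f _](subrK (f 0)) addrC (le_trans (ler_normD _ _))//.
  have H1 := lip_der df f1C (X T w + c T w) 0; rewrite subr0 in H1.
  have H2 : `|X T w + c T w| <= `|mu| * T + `|sigma| * (1 + dW W 0 T w ^+ 2) + (`|x| + adj_variation phi w T).
    rewrite (le_trans (ler_normD _ _))//; apply: lerD; last first.
      rewrite -addrA (le_trans (ler_normD _ _))// lerD2l.
      exact: net_bound (pj1 w) (pj2 w) _ (ltW T0).
    rewrite (le_trans (ler_normD _ _))// !normrM (gtr0_norm T0) lerD2l ler_wpM2l//.
    rewrite /dW W0 subr0 -[W T w ^+ 2]real_normK ?num_real//.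
    by have := sqr_ge0 (`|W T w| - 1); rewrite sqrrB; have := normr_ge0 (W T w); lra.
  have := ler_wpM2l C0 H2; rewrite /a; move: H1.
  by move: (`|X T w + c T w|) (`|f (X T w + c T w) - f 0|) => z1 z2; lra.
have iB : intg (fun w => a + C * (`|mu| * T) + C * `|sigma| * dW W 0 T w ^+ 2 + C * adj_variation phi w T).
  by apply: intgD; [apply: intgD; [exact: intg_cst|exact: intgZ]|exact: intgZ].
have if_ : intg (fun w => f (X T w + c T w)) := intg_lip (lip_der df f1C) iZ.
have H := le_trans (ler_norm _) (Ex_norm_le if_ iB bound).
have i3 := intgZ (C * `|sigma|) i2; have i4 := intgZ C iV.
have i5 := intgD (intg_cst P (a + C * (`|mu| * T))) i3.
rewrite (ExD i5 i4) (ExD (intg_cst P _) i3) Ex_cst !ExZ// E2 subr0 in H.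
have eT := expR_ge0 (- beta * T).
have := Hm0 m (leq_maxl _ _); rewrite -/T => HV.
have HV' : C * (expR (- beta * T) * Ex (fun w => adj_variation phi w T)) <= r / 2.
  rewrite (le_trans (ler_wpM2l C0 HV))// mulrA ler_pdivrMr// mulrC ler_pM2l//; lra.
have HX : expR (- beta * T) * (a + b * T) <= r / 2.
  have e1 : (beta * T / 2) ^+ 2 <= expR (beta * T).
    rewrite (_ : expR (beta * T) = expR (beta * T / 2) ^+ 2); last by rewrite -expRM_natl; congr expR; field.
    have bT : 0 <= beta * T / 2 by rewrite divr_ge0// mulr_ge0// ltW.
    by rewrite lerXn2r ?nnegrE ?expR_ge0//; have := expR_ge1Dx (beta * T / 2); lra.
  have T1 : 1 <= T by rewrite ler1n.
  have big : 8 * (a + b) / (beta ^+ 2 * r) <= T.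
    rewrite ltW// (lt_le_trans (truncnS_gt _))// ler_nat; exact: leq_maxr.
  rewrite mulNr expRN mulrC ler_pdivrMr ?expR_gt0//.
  rewrite ler_pdivrMr in big; last by rewrite mulr_gt0// exprn_gt0.
  apply: (@le_trans _ _ ((a + b) * T)); first by rewrite mulrDl lerD2r ler_peMr.
  apply: (@le_trans _ _ (r / 2 * (beta * T / 2) ^+ 2)); last by rewrite ler_wpM2l// ltW.
  rewrite (_ : r / 2 * (beta * T / 2) ^+ 2 = T * (beta ^+ 2 * r) / 8 * T); last by field.
  by rewrite ler_wpM2r ?(ltW T0)//; lra.
have := ler_wpM2l eT H; rewrite /b in HX.
by move: HX HV'; move: (expR _) (Ex (fun w => adj_variation _ _ _)) (Ex (fun w => f _)) => q v w; nra.
Qed.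

End test_function.

End verification.

(** * Paths of the control band policy *)

Section step_paths.
Context {R : realType}.
Variable tau : nat -> R.
Hypotheses (tau0 : tau 0 = 0) (tau_lt : forall n, tau n < tau n.+1).
Hypothesis tau_unbounded : forall T : R, exists n, T < tau n.
Implicit Types (s t T : R) (n m i j : nat).

Lemma step_le m n : (m <= n)%N -> tau m <= tau n.
Proof.
elim: n => [|n IH]; first by rewrite leqn0 => /eqP ->.
by rewrite leq_eqVlt => /predU1P[->//|]; rewrite ltnS => /IH /le_trans; apply; exact: ltW.
Qed.

Lemma step_ge0 n : 0 <= tau n.
Proof. by rewrite -tau0; exact: step_le. Qed.

Definition step_index t : nat := xget 0%N [set n | tau n <= t < tau n.+1].

Lemma step_indexP t : 0 <= t -> tau (step_index t) <= t < tau (step_index t).+1.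
Proof.
move=> t0; apply: (@xgetPex _ 0%N [set n | tau n <= t < tau n.+1]).
have ex := tau_unbounded t; case: (ex_minnP ex) => -[|n] tn min.
  by move: tn; rewrite tau0 ltNge t0.
exists n; rewrite /= tn andbT leNgt; apply/negP => /min.
by rewrite ltnn.
Qed.

Lemma step_indexE t n : tau n <= t -> t < tau n.+1 -> step_index t = n.
Proof.
move=> nt tn; have t0 : 0 <= t by rewrite (le_trans _ nt)// step_ge0.
have /andP[it ti] := step_indexP t0; apply/eqP; rewrite eqn_leq; apply/andP; split.
  by rewrite leqNgt; apply/negP => /step_le /(lt_le_trans tn); rewrite ltNge it.
by rewrite leqNgt; apply/negP => /step_le /(lt_le_trans ti); rewrite ltNge nt.
Qed.

Lemma step_index_tau n : step_index (tau n) = n.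
Proof. exact: step_indexE. Qed.

Lemma step_index0 : step_index 0 = 0%N.
Proof. by have := step_index_tau 0; rewrite tau0. Qed.

Lemma step_index_le s t : 0 <= s -> s <= t -> (step_index s <= step_index t)%N.
Proof.
move=> s0 st; have /andP[is_ _] := step_indexP s0.
have /andP[_ ti] := step_indexP (le_trans s0 st).
rewrite leqNgt; apply/negP => /step_le; rewrite leNgt.
by rewrite (le_lt_trans _ ti)// (le_trans is_).
Qed.

Section one_step_path.
Variables (v : nat -> R) (y : R -> R).
Hypothesis yE : forall t, 0 <= t -> y t = v (step_index t).

Lemma step_path_left t n : tau n < t -> t <= tau n.+1 -> y s @[s --> t^'-] --> v n.
Proof.
move=> nt tn; apply: cvg_near_cst; near=> s.
have ns : tau n <= s by apply: ltW; near: s; exact: nbhs_left_gt.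
have st : s < t by near: s; exact: nbhs_left_lt.
rewrite yE ?(le_trans (step_ge0 n))//; congr v; apply: step_indexE => //.
exact: lt_le_trans tn.
Unshelve. all: by end_near. Qed.

Lemma step_path_right t : 0 <= t -> y s @[s --> t^'+] --> y t.
Proof.
move=> t0; have /andP[it ti] := step_indexP t0; rewrite (yE t0).
apply: cvg_near_cst; near=> s.
have ts : t <= s by apply: ltW; near: s; exact: nbhs_right_gt.
have si : s < tau (step_index t).+1 by near: s; exact: nbhs_right_lt.
rewrite yE ?(le_trans t0)//; congr v; apply: step_indexE => //.
exact: le_trans ts.
Unshelve. all: by end_near. Qed.

Lemma step_path_before t n (y0 : R) : tau n < t -> t <= tau n.+1 -> before y0 y t = v n.
Proof.
move=> nt tn; rewrite /before lt_geF ?(le_lt_trans (step_ge0 n))//.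
by apply/cvg_lim => //; exact: step_path_left nt tn.
Qed.

Lemma step_jump0 : jump y 0 = v 0.
Proof. by rewrite /jump /before lexx subr0 yE// step_index0. Qed.

Lemma step_jump_tau n : jump y (tau n.+1) = v n.+1 - v n.
Proof.
rewrite /jump (@step_path_before _ n)// yE ?step_index_tau//; exact: step_ge0.
Qed.

Lemma step_jump_between n t : tau n < t -> t < tau n.+1 -> jump y t = 0.
Proof.
move=> nt tn; rewrite /jump (@step_path_before _ n)//; last exact: ltW.
rewrite yE ?(@step_indexE _ n)// ?subrr// ?(ltW nt)//.
by rewrite (le_trans (step_ge0 n))// ltW.
Qed.

Lemma step_jump_neq0 t : 0 <= t -> jump y t != 0 -> exists n, t = tau n.
Proof.
move=> t0 jt; have /andP[it ti] := step_indexP t0; exists (step_index t).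
apply/eqP; rewrite eq_le it andbT leNgt; apply/negP => it'.
by move: jt; rewrite (step_jump_between it' ti) eqxx.
Qed.

Hypotheses (v0 : 0 <= v 0) (v_le : forall n, v n <= v n.+1).

Lemma step_pure_jump : pure_jump_path y.
Proof.
have vmono m n : (m <= n)%N -> v m <= v n.
  elim: n => [|n IH]; first by rewrite leqn0 => /eqP ->.
  by rewrite leq_eqVlt => /predU1P[->//|]; rewrite ltnS => /IH /le_trans; apply.
have jn n : 0 <= jump y (tau n).
  by case: n => [|n]; [rewrite tau0 step_jump0|rewrite step_jump_tau subr_ge0].
have tau_inj : injective tau.
  move=> m n E; have := step_index_tau m; rewrite E step_index_tau => ->.
  by [].
split.
- by rewrite yE// step_index0.
- by move=> s t s0 st; rewrite !yE ?(le_trans s0)//; apply: vmono; exact: step_index_le.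
- exact: step_path_right.
- move=> t t0; have /andP[it ti] := step_indexP (ltW t0).
  have [E|it'] := eqVneq (tau (step_index t)) t; last first.
    apply/cvg_ex; exists (v (step_index t)); apply: step_path_left; last exact: ltW.
    by rewrite lt_neqAle it'.
  case En : (step_index t) => [|n]; first by move: E t0; rewrite En tau0 => ->; rewrite ltxx.
  rewrite En in E; apply/cvg_ex; exists (v n); apply: step_path_left; rewrite -E//.
- move=> T; have [N TN] := tau_unbounded T.
  apply: (@sub_finite_set _ _ [set` [seq tau n | n <- iota 0 N]]); last exact: finite_seq.
  move=> s [s0 [sT js]]; have [n En] := step_jump_neq0 s0 js.
  apply/mapP; exists n => //; rewrite mem_iota add0n/= ltnNge; apply/negP => /step_le.
  by rewrite -En leNgt (le_lt_trans sT).
move=> t t0; have /andP[it ti] := step_indexP t0; set N := step_index t in it ti.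
pose J := [seq tau n | n <- iota 0 N.+1].
rewrite (esumID [set` J]); last first.
  move=> s; rewrite /= in_itv/= lee_fin => /andP[s0 _].
  have [->//|/(step_jump_neq0 s0) [n ->]] := eqVneq (jump y s) 0; exact: jn.
rewrite [X in (_ + X)%E]esum1 ?adde0; last first.
  move=> s [/=]; rewrite in_itv/= => /andP[s0 st] sJ; congr EFin; apply/eqP.
  apply: contra_notT sJ => js; have [n En] := step_jump_neq0 s0 js.
  apply/mapP; exists n => //; rewrite mem_iota add0n/= ltnS leqNgt; apply/negP => /step_le.
  by rewrite -En leNgt (le_lt_trans st ti).
rewrite (_ : _ `&` _ = [set` J]); last first.
  apply/seteqP; split=> s /=; first by case.
  move=> sJ; split=> //; rewrite in_itv/=; move/mapP: sJ => [n]; rewrite mem_iota add0n/= ltnS => nN ->.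
  by rewrite step_ge0 (le_trans (step_le nN)).
rewrite esum_fset; [|exact: finite_seq|]; last first.
  by move=> s; rewrite inE/= lee_fin => /mapP[n _ ->].
rewrite /J -fsbig_seq ?map_inj_uniq ?iota_uniq// sumEFin big_map; congr EFin.
rewrite (yE t0) -/N; elim: (N) => [|n IH]; first by rewrite big_seq1 tau0 step_jump0.
have -> : iota 0 n.+2 = iota 0 n.+1 ++ [:: n.+1] by rewrite -[n.+2]addn1 iotaD.
by rewrite big_cat -IH big_seq1 step_jump_tau /= addrC subrK.
Qed.

End one_step_path.

Section jump_sums.
Variables (v : nat -> R) (f X : R -> R) (beta : R).
Local Notation D := (fun t => expR (- beta * t)).
Local Notation c := (fun t => v (step_index t)).
Definition step_term i s : R := D s * (f (X s + v i.+1) - f (X s + v i)).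

Let telescope_terms m n s : (m <= n)%N ->
  \sum_(m <= i < n) step_term i s = D s * (f (X s + v n) - f (X s + v m)).
Proof.
elim: n => [|n IH]; first by rewrite leqn0 => /eqP ->; rewrite big_geq// subrr mulr0.
rewrite leq_eqVlt => /predU1P[<-|]; first by rewrite big_geq// subrr mulr0.
by rewrite ltnS => mn; rewrite big_nat_recr//= IH// /step_term; ring.
Qed.

(* The grid point following [tau i.+1] serves all the jumps of one cell. *)
Lemma step_jump_sum dt n : 0 < dt -> exists g : nat -> R,
  (forall i, (i < step_index (n%:R * dt))%N -> tau i.+1 <= g i /\ g i < tau i.+1 + dt) /\
  \sum_(j < n) D (j.+1%:R * dt) * (f (X (j.+1%:R * dt) + c (j.+1%:R * dt)) - f (X (j.+1%:R * dt) + c (j%:R * dt))) =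
  \sum_(i < step_index (n%:R * dt)) step_term i (g i).
Proof.
move=> dt0; elim: n => [|n [g [Hg IH]]].
  exists (fun=> 0); rewrite mul0r step_index0; split=> [//|].
  by rewrite !big_ord0.
have n0 : 0 <= n%:R * dt by rewrite mulr_ge0// ltW.
have nS : n%:R * dt <= n.+1%:R * dt by rewrite ler_pM2r// ler_nat.
have ii := step_index_le n0 nS.
set p := step_index (n%:R * dt) in Hg IH ii *; set q := step_index (n.+1%:R * dt) in ii *.
exists (fun i => if (i < p)%N then g i else n.+1%:R * dt); split=> [i iq|].
  case: ltnP => [/Hg//|pi].
  have /andP[q1 _] := step_indexP (le_trans n0 nS); rewrite -/q in q1.
  have /andP[_ p2] := step_indexP n0; rewrite -/p in p2.
  rewrite (le_trans (step_le iq) q1); split=> //.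
  rewrite -natr1 mulrDl mul1r ltrD2r (lt_le_trans p2)//.
  exact: step_le.
rewrite big_ord_recr/= IH -/p -/q -(telescope_terms _ ii).
pose G i := step_term i (if (i < p)%N then g i else n.+1%:R * dt).
rewrite -[RHS](big_mkord xpredT G) (big_cat_nat (leq0n p) ii)/= (big_mkord xpredT); congr (_ + _).
  by apply: eq_bigr => i _; rewrite /G ltn_ord.
rewrite big_nat_cond [RHS]big_nat_cond; apply: eq_bigr => i; rewrite andbT => /andP[pi _].
by rewrite /G ltnNge pi.
Qed.

Hypotheses (cf : continuous f) (cX : continuous X).

Lemma step_term_continuous i : continuous (step_term i).
Proof.
have cfv w : continuous (fun s => f (X s + w)).
  move=> s; apply: (@continuous_comp _ _ _ (fun s => X s + w) f); last exact: cf.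
  by apply: cvgD; [exact: cX|exact: cvg_cst].
apply: contM; first exact: der_continuous (der_expRM (- beta)).
exact: contB.
Qed.

(** Each jump is delayed by less than the mesh, so all grid sums have the same finitely many terms,
    evaluated at times that converge to the jump times. *)
Lemma step_jump_sum_cvg T : 0 < T ->
  \sum_(j < n.+1) D (j.+1%:R * (T / n.+1%:R)) *
    (f (X (j.+1%:R * (T / n.+1%:R)) + c (j.+1%:R * (T / n.+1%:R))) -
     f (X (j.+1%:R * (T / n.+1%:R)) + c (j%:R * (T / n.+1%:R)))) @[n --> \oo] -->
  \sum_(i < step_index T) step_term i (tau i.+1).
Proof.
move=> T0; set N := step_index T.
have dt0 n : 0 < T / n.+1%:R by rewrite divr_gt0// ltr0n.
have nT n : n.+1%:R * (T / n.+1%:R) = T by rewrite mulrC divfK// pnatr_eq0.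
have /choice[g Hg] := fun n => step_jump_sum n.+1 (dt0 n).
rewrite (_ : (fun n => _) = (fun n => \sum_(i < N) step_term i (g n i))); last first.
  by apply/funext => n; have [_ ->] := Hg n; rewrite nT.
have cvdt : T / n.+1%:R @[n --> \oo] --> (0 : R).
  by rewrite -(mulr0 T); apply: cvgMl_tmp; exact: cvg_harmonic.
have cvg_g i : (i < N)%N -> g n i @[n --> \oo] --> tau i.+1.
  move=> iN; have H2 : tau i.+1 + T / n.+1%:R @[n --> \oo] --> tau i.+1.
    by rewrite -[X in _ --> X]addr0; apply: cvgD => //; exact: cvg_cst.
  apply: squeeze_cvgr (cvg_cst (tau i.+1)) H2; apply: nearW => n.
  have [Hi _] := Hg n; rewrite nT -/N in Hi; have [-> /ltW ->] := Hi i iN.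
  by [].
have : forall M, (M <= N)%N -> \sum_(i < M) step_term i (g n i) @[n --> \oo] --> \sum_(i < M) step_term i (tau i.+1).
  elim=> [_|M IH MN].
    rewrite big_ord0 (_ : (fun n => _) = fun=> 0); first exact: cvg_cst.
    by apply/funext => n; rewrite big_ord0.
  rewrite big_ord_recr/= (_ : (fun n => _) = (fun n => \sum_(i < M) step_term i (g n i) + step_term M (g n M))).
    apply: cvgD; first exact: IH (ltnW MN).
    by apply: (cvg_comp _ _ (cvg_g M MN)); exact: step_term_continuous.
  by apply/funext => n; rewrite big_ord_recr.
exact.
Qed.

End jump_sums.

End step_paths.

(** * Construction of the band paths *)

Section band_paths.
Context {R : realType}.
Implicit Types (s t T : R) (w : seq bool) (n : nat).

Lemma first_zero (g : R -> R) t0 : continuous g -> 0 < g t0 ->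
  (forall t, t0 <= t -> 0 < g t) \/
  exists m, [/\ t0 < m, g m = 0 & forall t, t0 <= t -> t < m -> 0 < g t].
Proof.
move=> cg g0; have [H|/existsNP[e /not_implyP[te /negP]]] := pselect (forall t, t0 <= t -> 0 < g t).
  by left.
rewrite -leNgt => ge; right; pose E := [set t | t0 <= t /\ g t <= 0].
have iE : has_inf E by split; [exists e|exists t0 => t []].
have mlb t : E t -> inf E <= t by move=> Et; apply: ge_inf => //; case: iE.
have t0m : t0 <= inf E by apply: lb_le_inf; [exists e|move=> t []].
have pos t : t0 <= t -> t < inf E -> 0 < g t.
  by move=> tt tm; rewrite ltNge; apply/negP => gt; have := mlb t (conj tt gt); rewrite leNgt tm.
have gm : g (inf E) <= 0.
  rewrite leNgt; apply/negP => gm0; have := cg (inf E) => /cvgr_gt /(_ _ gm0) [r /= r0 Hr].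
  have [t Et tr] := inf_adherent r0 iE; have [_ gt] := Et.
  suff : 0 < g t by rewrite ltNge gt.
  by apply: Hr; rewrite /= distrC ger0_norm ?subr_ge0 ?mlb// ltrBlDl.
have tm : t0 < inf E by rewrite lt_neqAle t0m andbT; apply: contraTneq g0 => ->; rewrite -leNgt.
exists (inf E); split=> //; apply/eqP; rewrite eq_le gm leNgt; apply/negP => gm0.
have := cg (inf E) => /cvgr_lt /(_ _ gm0) [r /= r0 Hr].
pose t := Num.max t0 (inf E - r / 2).
have tl : t < inf E by rewrite gt_max tm; lra.
have : g t < 0.
  apply: Hr => /=; have : inf E - r / 2 <= t by rewrite le_max lexx orbT.
  by rewrite gtr0_norm ?subr_gt0//; lra.
by rewrite ltNge ltW// pos// le_max lexx.
Qed.

Variables (d D U u x : R).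
Hypotheses (dD : d < D) (DU : D < U) (Uu : U < u).
Local Notation b0 := (band_initial d D U u x).

(** A path is encoded by the word of its exits, the latest first: [true] for an exit at [d], [false]
    for one at [u]. Words are countable, which the measurability of the policy will use. *)
Definition word_up w : R := Num.max b0 0 + (D - d) *+ count_mem true w.
Definition word_down w : R := Num.max (- b0) 0 + (u - U) *+ count_mem false w.
Definition word_level w : R := x + word_up w - word_down w.

Lemma word_level_nil : word_level [::] = x + b0.
Proof.
rewrite /word_level /word_up /word_down/= !mulr0n !addr0.
by case/orP: (le_total b0 0) => b; [rewrite (max_r b) max_l ?oppr_ge0//|rewrite (max_l b) max_r ?oppr_le0//]; lra.
Qed.

Lemma word_level_up w : word_level (true :: w) = word_level w + (D - d).
Proof. by rewrite /word_level /word_up /word_down/= add1n add0n mulrS; ring. Qed.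

Lemma word_level_down w : word_level (false :: w) = word_level w - (u - U).
Proof. by rewrite /word_level /word_up /word_down/= add1n add0n mulrS; ring. Qed.

Lemma initial_inside : d < x + b0 < u.
Proof.
have := dD; have := DU; have := Uu; rewrite /band_initial => ? ? ?; case: (leP x d) => xd; first by apply/andP; split; lra.
by case: (leP u x) => xu; apply/andP; split; lra.
Qed.

Section one_path.
Variable X : R -> R.
Hypotheses (cX : continuous X) (X0 : X 0 = 0).

Definition inside w t : bool := d < X t + word_level w < u.

(** In the last case of [band_next] no exit follows and [tau n.+1] is just some later time, so that
    the sequence of times is infinite and unbounded for every path. *)
Record band_path (tau : nat -> R) (word : nat -> seq bool) : Prop := BandPath {
  band_time0 : tau 0 = 0;
  band_time_lt : forall n, tau n < tau n.+1;
  band_time_unbounded : forall T : R, exists n, T < tau n;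
  band_word0 : word 0 = [::];
  band_inside : forall n t, tau n <= t -> t < tau n.+1 -> inside (word n) t;
  band_next : forall n,
    [\/ word n.+1 = true :: word n /\ X (tau n.+1) + word_level (word n) = d,
        word n.+1 = false :: word n /\ X (tau n.+1) + word_level (word n) = u |
        word n.+1 = word n /\ forall t, tau n <= t -> inside (word n) t] }.

Let step (p q : R * seq bool) : Prop :=
  [/\ p.1 < q.1, forall t, p.1 <= t -> t < q.1 -> inside p.2 t &
   [\/ q.2 = true :: p.2 /\ X q.1 + word_level p.2 = d,
       q.2 = false :: p.2 /\ X q.1 + word_level p.2 = u |
       [/\ q.2 = p.2, q.1 = p.1 + 1 & forall t, p.1 <= t -> inside p.2 t]]].

Let step_inside p q : step p q -> inside q.2 q.1.
Proof.
have := dD; have := DU; have := Uu; rewrite /inside => ? ? ? -[pq _ [[-> E]|[-> E]|[-> _ H]]].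
- by rewrite word_level_up addrA E; apply/andP; split; lra.
- by rewrite word_level_down addrA E; apply/andP; split; lra.
- by apply: H; exact: ltW.
Qed.

Let step_total p : exists q, inside p.2 p.1 -> step p q.
Proof.
have [ip|] := boolP (inside p.2 p.1); last by exists p.
(* Since [d < u] the factors cannot both be negative, so [g] is positive exactly inside the band and
   an exit is its first zero. *)
pose g t := (X t + word_level p.2 - d) * (u - (X t + word_level p.2)).
have cXw : continuous (fun t => X t + word_level p.2).
  by apply: contD => //; move=> ?; exact: cvg_cst.
have cg : continuous g.
  by apply: contM; apply: contB => //; move=> ?; exact: cvg_cst.
have gP t : (0 < g t) = inside p.2 t.
  have du := lt_trans dD (lt_trans DU Uu).
  rewrite /g /inside; move: (X t + _) => z; apply/idP/andP => [|[dz zu]]; last by apply: mulr_gt0; lra.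
  case: (ltP d z) => [dz|zd H]; last by exfalso; nra.
  by rewrite pmulr_rgt0 ?subr_gt0// => ->.
have := @first_zero g p.1 cg; rewrite gP => /(_ ip) [H|[m [pm gm H]]].
  exists (p.1 + 1, p.2) => _; split=> /=; first by lra.
    by move=> t pt _; rewrite -gP; exact: H.
  by apply: Or33; split=> // t pt; rewrite -gP; exact: H.
move/eqP: gm; rewrite /g mulf_eq0 !subr_eq0 => /orP[/eqP E|/eqP E].
  exists (m, true :: p.2) => _; split=> //=; last by apply: Or31.
  by move=> t pt tm; rewrite -gP; exact: H.
exists (m, false :: p.2) => _; split=> //=; last by apply: Or32.
by move=> t pt tm; rewrite -gP; exact: H.
Qed.

Lemma band_path_exists : exists tau word, band_path tau word.
Proof.
have /choice[next Hn] := step_total.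
pose st n := iter n next (0, [::]).
have ins n : inside (st n).2 (st n).1.
  elim: n => [|n IH]; last by apply: step_inside (Hn _ IH).
  by rewrite /inside/= X0 add0r word_level_nil initial_inside.
have stP n : step (st n) (st n.+1) by apply: Hn; exact: ins.
exists (fun n => (st n).1), (fun n => (st n).2); split=> //.
- by move=> n; have [] := stP n.
- move=> T; apply: contrapT => /forallNP H.
  have bd n : (st n).1 <= T by rewrite leNgt; apply/negP; exact: H.
  have lt_st n : (st n).1 < (st n.+1).1 by have [] := stP n.
  have st0 n : 0 <= (st n).1 by elim: n => [//|n IH]; exact: le_trans IH (ltW _).
  (* Between two consecutive exits the free path moves by at least [e], so uniform continuity on
     [[0, T]] keeps them apart. The first step is left out, as the initial level may be arbitrarily
     close to a barrier. *)
  pose e := Num.min (D - d) (u - U).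
  have e0 : 0 < e by rewrite lt_min !subr_gt0 dD.
  have e2 : 0 < e / 2 by rewrite divr_gt0.
  have [r r0 Hr] := uniform_continuity T cX e2.
  have r1 : 0 < Num.min r 1 by rewrite lt_min r0 ltr01.
  have gap n : (st n.+1).1 + Num.min r 1 <= (st n.+2).1.
    rewrite leNgt; apply/negP => Hgap.
    have close : `|X (st n.+2).1 - X (st n.+1).1| <= e / 2.
      apply: Hr => //; rewrite gtr0_norm ?subr_gt0// ltrBlDl (lt_le_trans Hgap)//.
      by rewrite lerD2l ge_min lexx.
    have rl : Num.min r 1 <= 1 by rewrite ge_min lexx orbT.
    have eD : e <= D - d by rewrite ge_min lexx.
    have eU : e <= u - U by rewrite ge_min lexx orbT.
    move: close; rewrite ler_norml => /andP[c1 c2].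
    have := dD; have := DU; have := Uu => ? ? ?.
    have [_ _ [[E2 H2]|[E2 H2]|[_ E2 _]]] := stP n.+1; last by move: Hgap; rewrite E2; lra.
      have [_ _ [[E1 H1]|[E1 H1]|[E1 _ /(_ _ (ltW (lt_trans (lt_st n) (lt_st n.+1))))]]] := stP n.
      + by move: H2; rewrite E1 word_level_up; lra.
      + by move: H2; rewrite E1 word_level_down; lra.
      + by rewrite -E1 /inside H2 ltxx.
    have [_ _ [[E1 H1]|[E1 H1]|[E1 _ /(_ _ (ltW (lt_trans (lt_st n) (lt_st n.+1))))]]] := stP n.
    + by move: H2; rewrite E1 word_level_up; lra.
    + by move: H2; rewrite E1 word_level_down; lra.
    + by rewrite -E1 /inside H2 ltxx andbF.
  have low n : n%:R * Num.min r 1 <= (st n.+1).1.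
    elim: n => [|n IH]; first by rewrite mul0r.
    by rewrite -natr1 mulrDl mul1r (le_trans _ (gap n))// lerD2r.
  have [n] : exists n : nat, T / Num.min r 1 < n%:R.
    by exists (Num.truncn (T / Num.min r 1)).+1; exact: truncnS_gt.
  rewrite ltr_pdivrMr// => nT.
  by have := lt_le_trans nT (le_trans (low n) (bd _)); rewrite ltxx.
- by move=> n; have [_ + _] := stP n.
- move=> n; have [_ _ [?|?|[? _ ?]]] := stP n; [exact: Or31|exact: Or32|exact: Or33].
Qed.

End one_path.
End band_paths.

Section path_agreement.
Context {R : realType}.
Implicit Types (s t T : R) (y : R -> R).

Lemma before_eq (f0 t : R) y y' : (forall s, 0 <= s -> s < t -> y s = y' s) ->
  before f0 y t = before f0 y' t.
Proof.
move=> E; rewrite /before; case: (leP t 0) => // t0; congr (lim _).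
have nE : \forall s \near t^'-, y s = y' s.
  near=> s; apply: E; last by near: s; exact: nbhs_left_lt.
  by apply: ltW; near: s; exact: nbhs_left_gt.
apply/seteqP; split; apply: near_eq_cvg => //.
by near=> s; apply/esym; near: s.
Unshelve. all: by end_near. Qed.

Lemma jumps_eq y y' t : pure_jump_path y -> pure_jump_path y' -> 0 <= t ->
  (forall s, 0 <= s -> s <= t -> jump y s = jump y' s) -> y t = y' t.
Proof.
move=> py py' t0 E; apply: EFin_inj; rewrite (path_sum_jumps py t0) (path_sum_jumps py' t0).
by apply: eq_esum => s /=; rewrite in_itv/= => /andP[s0 st]; rewrite E.
Qed.

End path_agreement.

Section control_band_uniqueness.
Context {R : realType} {dsp : measure_display} {Omega : measurableType dsp}.
Variables (mu sigma : R) (W : R -> Omega -> R) (d D U u x : R).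

(** Up to [T] both policies have finitely many adjustments, so there would be a first time at which
    their jumps differ. Before it the paths agree, hence so does the left limit that prescribes the
    jump. *)
Lemma control_band_unique (phi psi : policy R Omega) :
  control_band mu sigma W x d D U u phi -> control_band mu sigma W x d D U u psi ->
  forall w t, 0 <= t -> upward phi t w = upward psi t w /\ downward phi t w = downward psi t w.
Proof.
move=> [p1 c1] [p2 c2] w.
have [pu1 pd1] := p1 w; have [pu2 pd2] := p2 w.
have agree t : 0 <= t -> (forall s, 0 <= s -> s <= t -> dY1 phi s w = dY1 psi s w /\ dY2 phi s w = dY2 psi s w) ->
    upward phi t w = upward psi t w /\ downward phi t w = downward psi t w.
  move=> t0 H; split.
    by apply: (jumps_eq pu1 pu2 t0) => s s0 st; have [] := H s s0 st.
  by apply: (jumps_eq pd1 pd2 t0) => s s0 st; have [] := H s s0 st.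
have step t : 0 <= t -> (forall s, 0 <= s -> s < t -> dY1 phi s w = dY1 psi s w /\ dY2 phi s w = dY2 psi s w) ->
    dY1 phi t w = dY1 psi t w /\ dY2 phi t w = dY2 psi t w.
  move=> t0 H; have [-> ->] := c1 t w t0; have [-> ->] := c2 t w t0.
  have -> : before x (inventory mu sigma W x phi ^~ w) t = before x (inventory mu sigma W x psi ^~ w) t.
    apply: before_eq => s s0 st; rewrite /inventory.
    have [|-> ->//] := agree s s0 => r r0 rs.
    exact: H (le_lt_trans rs st).
  by [].
move=> t t0; apply: agree => // T T0 _ {t t0}.
have [J1 [_ H1]] := adjustments_seq pu1 pd1 T.
have [J2 [_ H2]] := adjustments_seq pu2 pd2 T.
pose bad s := ~~ ((dY1 phi s w == dY1 psi s w) && (dY2 phi s w == dY2 psi s w)).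
have badP s : 0 <= s -> s <= T -> bad s -> s \in [seq s <- J1 ++ J2 | bad s].
  move=> s0 sT bs; rewrite mem_filter bs mem_cat /=; apply/orP.
  have [a1|n1] := pselect (adjusts phi w s); first by left; apply/H1.
  have [a2|n2] := pselect (adjusts psi w s); first by right; apply/H2.
  move: bs; rewrite /bad; move/not_orP: n1 => [/negP + /negP]; rewrite !negbK => /eqP -> /eqP ->.
  by move/not_orP: n2 => [/negP + /negP]; rewrite !negbK => /eqP -> /eqP ->; rewrite eqxx.
have [E|/seq_minimum[m + Hm]] := eqVneq [seq s <- J1 ++ J2 | bad s] [::].
  have [/(badP T T0 (lexx T))|] := boolP (bad T); first by rewrite E.
  by rewrite negbK => /andP[/eqP -> /eqP ->].
rewrite mem_filter mem_cat => /andP[bm mJ].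
have [m0 mT] : 0 <= m /\ m <= T by case/orP: mJ => [/H1[]|/H2[]].
move: (bm); rewrite /bad; have [s s0 sm|-> ->] := step m m0; last by rewrite !eqxx.
have : ~~ bad s.
  by apply/negP => /(badP s s0 (le_trans (ltW sm) mT)) /Hm; rewrite leNgt sm.
by rewrite negbK => /andP[/eqP -> /eqP ->].
Qed.

End control_band_uniqueness.

Section band_path_structure.
Context {R : realType}.
Variables (d D U u x : R).
Hypotheses (dD : d < D) (DU : D < U) (Uu : U < u).
Variable X : R -> R.
Hypotheses (cX : continuous X) (X0 : X 0 = 0).
Variables (tau : nat -> R) (word : nat -> seq bool).
Hypothesis bp : band_path d D U u x X tau word.
Implicit Types (s t T : R) (n m : nat).
Local Notation b0 := (band_initial d D U u x).
Local Notation level := (word_level d D U u x).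
Local Notation up := (word_up d D U u x).
Local Notation down := (word_down d D U u x).
Local Notation inside := (inside d D U u x X).
Let tau0 := band_time0 bp.
Let tau_lt := band_time_lt bp.
Let tau_unb := band_time_unbounded bp.

Definition staying n : Prop := forall t, tau n <= t -> inside (word n) t.

Lemma word_stay n : word n.+1 = word n -> staying n -> staying n.+1.
Proof. by move=> E st t nt; rewrite E; apply: st; rewrite (le_trans _ nt)// ltW. Qed.

(** Each step adds a letter until one does not; from then on the path stays inside forever. *)
Lemma word_size n : size (word n) = n \/ staying n.
Proof.
elim: n => [|n [sn|sn]]; first by left; rewrite (band_word0 bp).
- have [[-> _]|[-> _]|[E st]] := band_next bp n; [by left; rewrite /= sn..|].
  by right; exact: word_stay.
- right; have /andP[a b] := sn (tau n.+1) (ltW (tau_lt n)).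
  have [[_ E]|[_ E]|[E st]] := band_next bp n; last exact: word_stay.
    by move: a; rewrite E ltxx.
  by move: b; rewrite E ltxx.
Qed.

Lemma staying_next n : staying n -> word n.+1 = word n /\ staying n.+1.
Proof.
move=> sn; have /andP[a b] := sn (tau n.+1) (ltW (tau_lt n)).
have [[_ E]|[_ E]|[E st]] := band_next bp n.
- by move: a; rewrite E ltxx.
- by move: b; rewrite E ltxx.
- by split=> //; exact: word_stay.
Qed.

Lemma staying_le n m : (n <= m)%N -> staying n -> word m = word n /\ staying m.
Proof.
move=> nm st; elim: m nm => [|m IH]; first by rewrite leqn0 => /eqP E; rewrite -E.
rewrite leq_eqVlt => /predU1P[<-//|]; rewrite ltnS => /IH [E /staying_next[E' st']].
by rewrite E' E.
Qed.

Lemma word_size_le n : (size (word n) <= n)%N.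
Proof.
elim: n => [|n IH]; first by rewrite (band_word0 bp).
by have [[-> _]|[-> _]|[-> _]] := band_next bp n; rewrite //= (leq_trans IH).
Qed.

Lemma word_size_mono n m : (n <= m)%N -> (size (word n) <= size (word m))%N.
Proof.
elim: m => [|m IH]; first by rewrite leqn0 => /eqP ->.
rewrite leq_eqVlt => /predU1P[->//|]; rewrite ltnS => /IH /leq_trans; apply.
by have [[-> _]|[-> _]|[-> _]] := band_next bp m => //=.
Qed.

Lemma word_size_next n b : word n.+1 = b :: word n -> size (word n) = n.
Proof.
move=> E; have [//|/staying_next[]] := word_size n.
by rewrite E => /(congr1 size)/= /eqP; rewrite eqn_leq ltnn.
Qed.

Lemma word_sizeE n : word n = word (size (word n)).
Proof.
elim: n => [|n IH]; first by rewrite (band_word0 bp)/= (band_word0 bp).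
have [[E _]|[E _]|[-> _]] := band_next bp n; last exact: IH.
- by rewrite [in RHS]E /= (word_size_next E).
- by rewrite [in RHS]E /= (word_size_next E).
Qed.

Lemma word_exit n : size (word n.+1) = n.+1 ->
  (word n.+1 = true :: word n /\ X (tau n.+1) + level (word n) = d) \/
  (word n.+1 = false :: word n /\ X (tau n.+1) + level (word n) = u).
Proof.
have [[-> E]|[-> E]|[-> _]] := band_next bp n; [by left|by right|].
by move=> E; have := word_size_le n; rewrite E ltnn.
Qed.

Section adjustments.
Variables (y1 y2 Z : R -> R).
Hypotheses (y1E : forall t, 0 <= t -> y1 t = up (word (step_index tau t)))
  (y2E : forall t, 0 <= t -> y2 t = down (word (step_index tau t)))
  (ZE : forall t, 0 <= t -> Z t = X t + level (word (step_index tau t))).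

Let up_le n : up (word n) <= up (word n.+1).
Proof.
rewrite /word_up lerD2l; have [[-> _]|[-> _]|[-> _]] := band_next bp n => //=.
by rewrite add1n mulrS lerDr subr_ge0 ltW.
Qed.

Let down_le n : down (word n) <= down (word n.+1).
Proof.
rewrite /word_down lerD2l; have [[-> _]|[-> _]|[-> _]] := band_next bp n => //=.
by rewrite add1n mulrS lerDr subr_ge0 ltW.
Qed.

Lemma band_pure_jump : pure_jump_path y1 /\ pure_jump_path y2.
Proof.
split.
  apply: (@step_pure_jump _ tau tau0 tau_lt tau_unb (fun n => up (word n))) => //.
  by rewrite (band_word0 bp) /word_up/= mulr0n addr0 le_max lexx orbT.
apply: (@step_pure_jump _ tau tau0 tau_lt tau_unb (fun n => down (word n))) => //.
by rewrite (band_word0 bp) /word_down/= mulr0n addr0 le_max lexx orbT.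
Qed.

Lemma band_jump0 : jump y1 0 = Num.max b0 0 /\ jump y2 0 = Num.max (- b0) 0.
Proof.
rewrite (step_jump0 tau0 tau_lt tau_unb (v := fun n => up (word n)) y1E).
rewrite (step_jump0 tau0 tau_lt tau_unb (v := fun n => down (word n)) y2E).
by rewrite (band_word0 bp) /word_up /word_down/= !mulr0n !addr0.
Qed.

Lemma band_jump_between n t : tau n < t -> t < tau n.+1 -> jump y1 t = 0 /\ jump y2 t = 0.
Proof.
move=> nt tn; split.
  exact: (step_jump_between tau0 tau_lt tau_unb (v := fun n => up (word n)) y1E nt tn).
exact: (step_jump_between tau0 tau_lt tau_unb (v := fun n => down (word n)) y2E nt tn).
Qed.

Lemma band_jump_tau n :
  jump y1 (tau n.+1) = up (word n.+1) - up (word n) /\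
  jump y2 (tau n.+1) = down (word n.+1) - down (word n).
Proof.
split.
  exact: (step_jump_tau tau0 tau_lt tau_unb (v := fun n => up (word n)) y1E).
exact: (step_jump_tau tau0 tau_lt tau_unb (v := fun n => down (word n)) y2E).
Qed.

Lemma band_jump_up n : word n.+1 = true :: word n ->
  jump y1 (tau n.+1) = D - d /\ jump y2 (tau n.+1) = 0.
Proof.
move=> E; have [-> ->] := band_jump_tau n.
by rewrite E /word_up /word_down/= add1n add0n mulrS; split; ring.
Qed.

Lemma band_jump_down n : word n.+1 = false :: word n ->
  jump y1 (tau n.+1) = 0 /\ jump y2 (tau n.+1) = u - U.
Proof.
move=> E; have [-> ->] := band_jump_tau n.
by rewrite E /word_up /word_down/= add1n add0n mulrS; split; ring.
Qed.

Lemma band_jump_stay n : word n.+1 = word n ->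
  jump y1 (tau n.+1) = 0 /\ jump y2 (tau n.+1) = 0.
Proof. by move=> E; have [-> ->] := band_jump_tau n; rewrite E !subrr. Qed.

Lemma band_before n t : tau n < t -> t <= tau n.+1 -> before x Z t = X t + level (word n).
Proof.
move=> nt tn; have n0 := step_ge0 tau0 tau_lt n.
rewrite (@before_eq _ _ _ _ (fun s => X s + level (word (step_index tau s)))); last first.
  by move=> s s0 _; exact: ZE.
rewrite /before lt_geF ?(le_lt_trans n0)//; apply/cvg_lim => //.
have cl : X s @[s --> t^'-] --> X t by apply: cvg_at_left_filter; exact: cX.
apply: (cvgD cl).
exact: (step_path_left tau0 tau_lt tau_unb (v := fun n => level (word n)) (y := fun s => level (word (step_index tau s))) _ nt tn).
Qed.

Lemma band_jumps t : 0 < t -> let xi := band_reset d D U u (before x Z t) in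
  jump y1 t = Num.max xi 0 /\ jump y2 t = Num.max (- xi) 0.
Proof.
move=> t0 xi; have /andP[it ti] := step_indexP tau0 tau_unb (ltW t0).
have du := lt_trans dD (lt_trans DU Uu).
have resetI n : tau n < t -> t <= tau n.+1 -> inside (word n) t -> xi = 0.
  move=> nt tn /andP[dz zu]; rewrite /xi (band_before nt tn) /band_reset.
  by rewrite (gt_eqF dz) (lt_eqF zu).
have [E|it'] := eqVneq (tau (step_index tau t)) t; last first.
  have nt : tau (step_index tau t) < t by rewrite lt_neqAle it'.
  rewrite (resetI _ nt (ltW ti)); last exact: (band_inside bp).
  by rewrite oppr0 maxxx; exact: band_jump_between nt ti.
case En : (step_index tau t) => [|n]; first by move: E t0; rewrite En tau0 => ->; rewrite ltxx.
rewrite En in E; have nt : tau n < t by rewrite -E.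
have tn : t <= tau n.+1 by rewrite E.
have [[Ew Ex]|[Ew Ex]|[Ew st]] := band_next bp n.
- have [J1 J2] := band_jump_up Ew; rewrite -E J1 J2.
  have -> : xi = D - d by rewrite /xi (band_before nt tn) -{1}E Ex /band_reset eqxx.
  by rewrite max_l ?subr_ge0 1?ltW// max_r// oppr_le0 subr_ge0 ltW.
- have [J1 J2] := band_jump_down Ew; rewrite -E J1 J2.
  have -> : xi = U - u by rewrite /xi (band_before nt tn) -{1}E Ex /band_reset (gt_eqF du) eqxx.
  by rewrite max_r ?subr_le0 1?ltW// opprB max_l// subr_ge0 ltW.
- have [J1 J2] := band_jump_stay Ew; rewrite -E J1 J2.
  by rewrite (resetI n)// ?oppr0 ?maxxx//; apply: st; exact: ltW.
Qed.

Lemma band_inventory t : 0 <= t -> d < Z t < u.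
Proof.
move=> t0; rewrite (ZE t0); have /andP[it ti] := step_indexP tau0 tau_unb t0.
exact: (band_inside bp).
Qed.

End adjustments.
End band_path_structure.

(** * Adjustments of the control band policy *)

Section band_policy_paths.
Context {R : realType} {dsp : measure_display} {Omega : measurableType dsp}.
Variables (P : probability Omega R) (W : R -> Omega -> R) (bm : standard_brownian P W).
Variables (mu sigma d D U u x : R).
Hypotheses (dD : d < D) (DU : D < U) (Uu : U < u).
Implicit Types (s t T : R) (n m : nat) (w : Omega).

Definition free_path w s : R := drift_path W mu sigma (Num.max 0 s) w.

Lemma free_path_continuous w : continuous (free_path w).
Proof.
case: bm => _ _ cW _ _; rewrite /free_path /drift_path.
have cm : continuous (fun s : R => Num.max 0 s).
  by apply: (@extended_path_continuous _ id); apply: continuous_subspaceT => s; exact: cvg_id.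
apply: contD.
  by move=> s; apply: cvgMl_tmp; exact: cm.
move=> s; apply: cvgMl_tmp; exact: (extended_path_continuous (cW w)).
Qed.

Lemma free_path0 w : free_path w 0 = 0.
Proof. by case: bm => _ W0 _ _ _; rewrite /free_path maxxx /drift_path W0 !mulr0 addr0. Qed.

Lemma free_pathE w s : 0 <= s -> free_path w s = mu * s + sigma * W s w.
Proof. by move=> s0; rewrite /free_path (max_r s0). Qed.

Local Notation level := (word_level d D U u x).
Local Notation up := (word_up d D U u x).
Local Notation down := (word_down d D U u x).

Definition represents (phi : policy R Omega) (tau : Omega -> nat -> R)
    (word : Omega -> nat -> seq bool) : Prop :=
  forall w, [/\ band_path d D U u x (free_path w) (tau w) (word w),
    forall t, 0 <= t -> upward phi t w = up (word w (step_index (tau w) t)) &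
    forall t, 0 <= t -> downward phi t w = down (word w (step_index (tau w) t))].

Lemma represents_inventory phi tau word : represents phi tau word -> forall w t, 0 <= t ->
  inventory mu sigma W x phi t w = free_path w t + level (word w (step_index (tau w) t)).
Proof.
move=> rep w t t0; have [_ E1 E2] := rep w.
by rewrite /inventory E1// E2// free_pathE// /word_level; ring.
Qed.

Lemma control_band_exists : exists phi tau word,
  control_band mu sigma W x d D U u phi /\ represents phi tau word.
Proof.
have /choice[tau /choice[word bp]] := fun w => @band_path_exists _ d D U u x dD DU Uu _ (@free_path_continuous w) (free_path0 w).
pose phi : policy R Omega := Policy (fun t w => up (word w (step_index (tau w) t)))
  (fun t w => down (word w (step_index (tau w) t))).
have rep : represents phi tau word by move=> w; split.
exists phi, tau, word; split=> //; split.
  by move=> w; have [_ E1 E2] := rep w; exact: (band_pure_jump dD Uu (bp w) E1 E2).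
move=> t w t0 xi; have [_ E1 E2] := rep w.
have ZE := represents_inventory rep w.
rewrite /dY1 /dY2 /xi; case: eqVneq => [->|tn].
  exact: (band_jump0 (bp w) E1 E2).
apply: (band_jumps dD DU Uu (@free_path_continuous w) (bp w) E1 E2 ZE).
by rewrite lt_neqAle eq_sym tn.
Qed.

Lemma control_band_represented phi : control_band mu sigma W x d D U u phi ->
  exists tau word, represents phi tau word.
Proof.
have [psi [tau [word [cb rep]]]] := control_band_exists.
move=> cbp; exists tau, word => w; have [bp E1 E2] := rep w; split=> // t t0.
  by have [-> _] := control_band_unique cbp cb w t0; exact: E1.
by have [_ ->] := control_band_unique cbp cb w t0; exact: E2.
Qed.

Section represented_policy.
Variables (phi : policy R Omega) (tau : Omega -> nat -> R) (word : Omega -> nat -> seq bool).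
Hypothesis rep : represents phi tau word.
Let bp w : band_path d D U u x (free_path w) (tau w) (word w).
Proof. by have [] := rep w. Qed.
Let upE w t : 0 <= t -> upward phi t w = up (word w (step_index (tau w) t)).
Proof. by have [_ + _] := rep w; exact. Qed.
Let downE w t : 0 <= t -> downward phi t w = down (word w (step_index (tau w) t)).
Proof. by have [_ _ +] := rep w; exact. Qed.

Lemma represented_pure_jump : pure_jump_policy phi.
Proof. by move=> w; exact: (band_pure_jump dD Uu (bp w) (upE w) (downE w)). Qed.

Let py1 w : pure_jump_path (upward phi ^~ w).
Proof. by have [] := represented_pure_jump w. Qed.
Let py2 w : pure_jump_path (downward phi ^~ w).
Proof. by have [] := represented_pure_jump w. Qed.

Lemma adjusts_up w n : word w n.+1 = true :: word w n ->
  dY1 phi (tau w n.+1) w = D - d /\ dY2 phi (tau w n.+1) w = 0.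
Proof. exact: (band_jump_up (bp w) (upE w) (downE w)). Qed.

Lemma adjusts_down w n : word w n.+1 = false :: word w n ->
  dY1 phi (tau w n.+1) w = 0 /\ dY2 phi (tau w n.+1) w = u - U.
Proof. exact: (band_jump_down (bp w) (upE w) (downE w)). Qed.

Lemma adjusts_tau w n : size (word w n.+1) = n.+1 -> adjusts phi w (tau w n.+1).
Proof.
move=> /(word_exit (bp w)) [[E _]|[E _]].
  by have [E1 _] := adjusts_up E; left; rewrite E1 subr_eq0 gt_eqF.
by have [_ E1] := adjusts_down E; right; rewrite E1 subr_eq0 gt_eqF.
Qed.

Lemma not_adjusts_between w n t : tau w n < t -> t < tau w n.+1 -> ~ adjusts phi w t.
Proof.
move=> nt tn; have [E1 E2] := band_jump_between (bp w) (upE w) (downE w) nt tn.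
by rewrite /adjusts /dY1 /dY2 E1 E2 eqxx => -[].
Qed.

Lemma not_adjusts_staying w n t : staying d D U u x (free_path w) (tau w) (word w) n ->
  tau w n < t -> ~ adjusts phi w t.
Proof.
move=> st nt; have tau0 := band_time0 (bp w); have tl := band_time_lt (bp w).
have t0 : 0 <= t by rewrite (le_trans (step_ge0 tau0 tl n))// ltW.
have /andP[it ti] := step_indexP tau0 (band_time_unbounded (bp w)) t0.
have [E|it'] := eqVneq (tau w (step_index (tau w) t)) t; last first.
  by apply: not_adjusts_between ti; rewrite lt_neqAle it'.
case Ek : (step_index (tau w) t) E => [|k] E; first by move: nt; rewrite -E tau0 ltNge (step_ge0 tau0 tl).
have nk : (n <= k)%N.
  rewrite leqNgt; apply/negP => kn; have := step_le tl kn.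
  by rewrite leNgt E nt.
have [_ /(staying_next (bp w)) [Ew _]] := staying_le (bp w) nk st.
have [E1 E2] := band_jump_stay (bp w) (upE w) (downE w) Ew.
by rewrite -E /adjusts /dY1 /dY2 E1 E2 eqxx => -[].
Qed.

(** The adjustment of rank [n] exists exactly when the word has reached [n] letters. Time 0 has rank
    0 whether or not there is an adjustment, so ranks and step numbers agree. *)
Lemma adj_timeE w n : adj_time phi n w = if size (word w n) == n then (tau w n)%:E else +oo%E.
Proof.
elim: n => [|n IH]; first by rewrite (band_word0 (bp w)) (band_time0 (bp w)).
move: IH; case: eqP => [sn En|sn En]; last first.
  have [//|/(staying_next (bp w)) [E _]] := word_size (bp w) n.
  rewrite (adj_time_pinfty En) E ifF//; apply/eqP => s1.
  by have := word_size_le (bp w) n; rewrite s1 ltnn.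
have [s1|/eqP s1] := eqVneq (size (word w n.+1)) n.+1.
  have an := adjusts_tau s1; have tl := band_time_lt (bp w) n.
  case: (adj_time_next (py1 w) (py2 w) En) => [_ /(_ _ tl an)//|m -> nm am min].
  have mn := min _ tl an; congr EFin; apply/eqP; rewrite eq_le mn leNgt; apply/negP => mn'.
  exact: (not_adjusts_between nm mn' am).
have st : staying d D U u x (free_path w) (tau w) (word w) n.
  have [[E _]|[E _]|[_ //]] := band_next (bp w) n; by case: s1; rewrite E /= sn.
by case: (adj_time_next (py1 w) (py2 w) En) => [->//|m _ nm /(not_adjusts_staying st nm)].
Qed.

Lemma adj_amount0 w : adj_amount phi 0 w = band_initial d D U u x.
Proof.
rewrite /adj_amount/= /dY1 /dY2.
have [-> ->] := band_jump0 (bp w) (upE w) (downE w).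
case/orP: (le_total (band_initial d D U u x) 0) => b.
  by rewrite (max_r b) max_l ?oppr_ge0//; lra.
by rewrite (max_l b) max_r ?oppr_le0//; lra.
Qed.

Lemma adj_amount_up w n : word w n.+1 = true :: word w n -> adj_amount phi n.+1 w = D - d.
Proof.
move=> E; rewrite /adj_amount adj_timeE E /= (word_size_next (bp w) E) eqxx.
by have [-> ->] := adjusts_up E; rewrite subr0.
Qed.

Lemma adj_amount_down w n : word w n.+1 = false :: word w n -> adj_amount phi n.+1 w = U - u.
Proof.
move=> E; rewrite /adj_amount adj_timeE E /= (word_size_next (bp w) E) eqxx.
by have [-> ->] := adjusts_down E; rewrite sub0r opprB.
Qed.

Lemma adj_amount_none w n : adj_time phi n w = +oo%E -> adj_amount phi n w = 0.
Proof. by rewrite /adj_amount => ->. Qed.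

Lemma adj_amount_bound w n :
  `|adj_amount phi n w| <= `|band_initial d D U u x| + (D - d) + (u - U).
Proof.
have a0 : 0 <= `|band_initial d D U u x| by [].
have := dD; have := Uu => ? ?; case: n => [|n]; first by rewrite adj_amount0; lra.
have := adj_timeE w n.+1; case: eqP => [/(word_exit (bp w)) [[E _]|[E _]] _|_ /adj_amount_none ->].
- by rewrite (adj_amount_up E) gtr0_norm ?subr_gt0//; lra.
- by rewrite (adj_amount_down E) ltr0_norm ?subr_lt0//; lra.
- by rewrite normr0; lra.
Qed.

End represented_policy.
End band_policy_paths.

(** * Measurability of the control band policy *)

Section countable_events.
Context {T : Type}.
Variables (G : set (set T)) (sG : sigma_algebra setT G).

Lemma events_setC A : G A -> G (~` A).
Proof. by case: sG => _ H _ /H; rewrite setTD. Qed.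

Lemma events_bigcup (I : countType) (A : I -> set T) : (forall i, G (A i)) -> G (\bigcup_i A i).
Proof.
case: sG => G0 _ H GA.
rewrite (_ : \bigcup_i A i = \bigcup_n (if unpickle n is Some i then A i else set0)).
  by apply: H => n; case: unpickle.
apply/seteqP; split=> w [i _ Ai]; first by exists (pickle i) => //; rewrite pickleK.
by move: Ai; case: unpickle => // j Aj; exists j.
Qed.

Lemma events_bigcap (I : countType) (A : I -> set T) : (forall i, G (A i)) -> G (\bigcap_i A i).
Proof.
move=> GA; rewrite -[\bigcap_i A i]setCK setC_bigcap; apply: events_setC.
by apply: events_bigcup => i; exact: events_setC.
Qed.

Lemma events_setU A B : G A -> G B -> G (A `|` B).
Proof.
move=> GA GB; rewrite (_ : A `|` B = \bigcup_(b : bool) (if b then A else B)).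
  by apply: events_bigcup => -[].
apply/seteqP; split=> w; first by move=> [?|?]; [exists true|exists false].
by move=> [[] _ ?]; [left|right].
Qed.

Lemma events_setI A B : G A -> G B -> G (A `&` B).
Proof.
move=> GA GB; rewrite -[A `&` B]setCK setCI; apply: events_setC.
by apply: events_setU; exact: events_setC.
Qed.

Lemma events_set0 : G set0. Proof. by case: sG. Qed.

Lemma events_setT : G setT.
Proof. by rewrite -setC0; apply: events_setC; exact: events_set0. Qed.

Lemma events_cst (b : Prop) : G [set _ | b].
Proof.
have [Hb|Hb] := pselect b.
  by rewrite (_ : [set _ | b] = setT); [exact: events_setT|apply/seteqP; split].
by rewrite (_ : [set _ | b] = set0); [exact: events_set0|apply/seteqP; split].
Qed.

End countable_events.

(** By continuity the value at [m] announces itself at rational times before [m]; this is how exits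
    become observable by countably many events. *)
Lemma rational_before {R : realType} (f : R -> R) (m a c : R) : continuous f -> f m < c -> a < m ->
  exists q : rat, [/\ a < ratr q, ratr q < m & forall s, ratr q <= s -> s < m -> f s < c].
Proof.
move=> cf fm am; have /cvgr_lt /(_ _ fm) [r /= r0 Hr] := cf m.
have : Num.max a (m - r) < m by rewrite gt_max am /=; lra.
move=> /rat_in_itvoo [q]; rewrite in_itv/= gt_max => /andP[/andP[aq rq] qm].
exists q; split=> // s qs sm; apply: Hr => /=.
by rewrite gtr0_norm ?subr_gt0//; lra.
Qed.

Section band_policy_measurability.
Context {R : realType} {dsp : measure_display} {Omega : measurableType dsp}.
Variables (P : probability Omega R) (F : R -> set (set Omega)) (W : R -> Omega -> R).
Hypotheses (Ff : filtration F) (bm : standard_brownian P W) (mart : martingale P F W).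
Variables (mu sigma d D U u x : R).
Hypotheses (dD : d < D) (DU : D < U) (Uu : U < u).
Local Notation ratR := (@ratr R).
Local Notation X := (free_path W mu sigma).
Local Notation level := (word_level d D U u x).
Variables (phi : policy R Omega) (tau : Omega -> nat -> R) (word : Omega -> nat -> seq bool).
Hypothesis rep : represents W mu sigma d D U u x phi tau word.
Implicit Types (s t T : R) (n m : nat) (w : Omega) (v : seq bool) (q r : rat).

Let bp w : band_path d D U u x (X w) (tau w) (word w).
Proof. by have [] := rep w. Qed.
Let tau0 w := band_time0 (bp w).
Let tau_lt w := band_time_lt (bp w).
Let tau_unb w := band_time_unbounded (bp w).
Let sF t : 0 <= t -> sigma_algebra setT (F t).
Proof. by case: Ff => H _ _; exact: H. Qed.
Let cX w : continuous (X w) := free_path_continuous bm (w := w).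
Let cXl w v : continuous (fun s => X w s + level v).
Proof. by apply: contD => //; move=> ?; exact: cvg_cst. Qed.

(** Both events concern the history coded by [v]: its last exit, and the exit that follows it, has
    taken place by time [t]. *)
Definition visited v t : set Omega := [set w | word w (size v) = v /\ tau w (size v) <= t].
Definition exited v t : set Omega :=
  [set w | [/\ word w (size v) = v, size (word w (size v).+1) = (size v).+1 & tau w (size v).+1 <= t]].

Let path_event (B : set R) r t : measurable B -> 0 <= ratR r -> ratR r <= t ->
  F t [set w | B (X w (ratR r))].
Proof.
move=> mB r0 rt; apply: (filtration_le Ff r0 rt).
have := drift_wrt mart mu sigma r0 mB; rewrite (_ : _ @^-1` B = [set w | B (X w (ratR r))])//.
by apply/seteqP; split=> w; rewrite /= /free_path max_r.
Qed.

Let gap v y : R := Num.min (y + level v - d) (u - (y + level v)).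

Let mgap v c : measurable [set y | gap v y < c].
Proof.
have -> : [set y | gap v y < c] = `]-oo, c + d - level v[ `|` `]u - c - level v, +oo[.
  apply/seteqP; split=> y /=; rewrite /gap gt_min !in_itv/= andbT.
    by move=> /orP[H|H]; [left|right]; lra.
  by move=> [H|H]; apply/orP; [left|right]; lra.
by apply: measurableU.
Qed.

Let gap_exit w v : continuous (fun s => gap v (X w s)).
Proof.
move=> s; apply: (@continuous_min _ _ (fun s => X w s + level v - d) (fun s => u - (X w s + level v))).
  by apply: cvgB; [exact: cXl|exact: cvg_cst].
by apply: cvgB; [exact: cvg_cst|exact: cXl].
Qed.

Let gap_inside w v s : inside d D U u x (X w) v s -> 0 < gap v (X w s).
Proof. by rewrite /inside /gap lt_min => /andP[a b]; rewrite !subr_gt0 a. Qed.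

(** The exit happens by [t] exactly when the distance to the barriers falls below every [j.+1%:R^-1]
    at rational times up to [t]: otherwise it would have a positive minimum on the compact interval.
    Inspecting only times up to [t] keeps the event in [F t]. *)
Lemma exited_event v : (forall s, 0 <= s -> F s (visited v s)) ->
  forall t, 0 <= t -> F t (exited v t).
Proof.
move=> Hv t t0.
have -> : exited v t = \bigcap_(j : nat) \bigcup_(r : rat)
    ([set _ | 0 <= ratR r <= t] `&` (visited v (ratR r) `&` [set w | gap v (X w (ratR r)) < j.+1%:R^-1])).
  apply/seteqP; split=> w.
    move=> [wv sv mt] j _; have j0 : (0 : R) < j.+1%:R^-1 by rewrite invr_gt0.
    have gm : gap v (X w (tau w (size v).+1)) < j.+1%:R^-1.
      apply: le_lt_trans j0; rewrite /gap ge_min.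
      by have [[_]|[_]] := word_exit (bp w) sv; rewrite wv => ->; rewrite subrr lexx ?orbT.
    have [r [ar rm Hr]] := rational_before (@gap_exit w v) gm (tau_lt w (size v)).
    exists r => //; split=> /=.
      by rewrite (le_trans (ltW rm) mt) andbT (le_trans _ (ltW ar))// (step_ge0 (tau0 w) (tau_lt w)).
    by split; [split=> //; exact: ltW|exact: Hr].
  move=> H; have [r0 _ [/= /andP[r00 r0t] [[wv vr] _]]] := H 0%N I.
  apply: contrapT => nex.
  have ins s : tau w (size v) <= s -> s <= t -> inside d D U u x (X w) v s.
    move=> vs st; have [[E _]|[E _]|[_ st']] := band_next (bp w) (size v).
    - rewrite -[v in inside _ _ _ _ _ _ v]wv; apply: (band_inside (bp w)) => //.
      rewrite (le_lt_trans st)// ltNge; apply/negP => mt; apply: nex; split=> //.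
      by rewrite E /= wv.
    - rewrite -[v in inside _ _ _ _ _ _ v]wv; apply: (band_inside (bp w)) => //.
      rewrite (le_lt_trans st)// ltNge; apply/negP => mt; apply: nex; split=> //.
      by rewrite E /= wv.
    - by have := st' s vs; rewrite wv.
  have vt : tau w (size v) <= t by exact: le_trans r0t.
  have [c ct cmin] := EVT_min vt (continuous_subspaceT (@gap_exit w v)).
  have gc : 0 < gap v (X w c).
    by apply: gap_inside; move: ct; rewrite in_itv/= => /andP[a b]; exact: ins.
  pose j := Num.truncn (gap v (X w c))^-1.
  have Hj : j.+1%:R^-1 < gap v (X w c) by rewrite invf_plt ?posrE// truncnS_gt.
  have [r _ [/= /andP[r10 rt] [[_ vr'] /=]]] := H j I.
  rewrite ltNge => /negP; apply; apply: le_trans (cmin (ratR r) _); last by rewrite in_itv/= vr' rt.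
  exact: ltW.
apply: (events_bigcap (sF t0)) => j; apply: (events_bigcup (sF t0)) => r.
have [/andP[r0 rt]|nr] := boolP (0 <= ratR r <= t); last first.
  rewrite (_ : _ `&` _ = set0); first exact: events_set0 (sF t0).
  by apply/seteqP; split=> // w [].
apply: (events_setI (sF t0)); first exact: (events_cst (sF t0)).
apply: (events_setI (sF t0)).
  exact: (filtration_le Ff r0 rt) (Hv _ r0).
exact: (path_event (mgap v _) r0 rt).
Qed.

Let mid := (d + u) / 2.
Let dmid : d < mid. Proof. by have := dD; have := DU; have := Uu; rewrite /mid; lra. Qed.
Let midu : mid < u. Proof. by have := dD; have := DU; have := Uu; rewrite /mid; lra. Qed.

(** Induction on the word. Which barrier was reached is told by the path just before: the exit is at
    [d] exactly when from some rational time on the level stays below the middle [mid] until the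
    exit. An exit at [u] is the complement among the exits. *)
Lemma visited_event v t : 0 <= t -> F t (visited v t).
Proof.
elim: v t => [|b v IH] t t0.
  rewrite (_ : visited [::] t = setT); first exact: events_setT (sF t0).
  by apply/seteqP; split=> // w _; split=> /=; [exact: (band_word0 (bp w))|rewrite tau0].
have Fex := exited_event IH.
have prev b' w : word w (size v).+1 = b' :: v ->
    word w (size v) = v /\ word w (size v).+1 = b' :: word w (size v).
  move=> E; have s1 : size (word w (size v).+1) = (size v).+1 by rewrite E.
  by have [[]|[]] := word_exit (bp w) s1; rewrite E => -[-> <-].
suff up_event : F t (visited (true :: v) t).
  case: b => //.
  rewrite (_ : visited _ t = exited v t `&` ~` visited (true :: v) t).
    by apply: (events_setI (sF t0)); [exact: Fex|exact: (events_setC (sF t0))].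
  apply/seteqP; split=> w.
    move=> [/= E mt]; have [wv _] := prev _ _ E; split; first by split=> //; rewrite E.
    by move=> [/=]; rewrite E.
  move=> [[wv s1 mt] nup]; have [[E _]|[E _]] := word_exit (bp w) s1.
    by exfalso; apply: nup; split=> //=; rewrite E wv.
  by split=> //=; rewrite E wv.
rewrite (_ : visited (true :: v) t = exited v t `&` \bigcup_(q : rat)
    ([set _ | 0 <= ratR q <= t] `&` (visited v (ratR q) `&` (~` exited v (ratR q) `&`
     \bigcap_(r : rat) ([set _ | ~~ (ratR q <= ratR r <= t)] `|`
        (exited v (ratR r) `|` [set w | X w (ratR r) < mid - level v])))))).
  apply: (events_setI (sF t0)); first exact: Fex.
  apply: (events_bigcup (sF t0)) => q.
  have [/andP[q0 qt]|nq] := boolP (0 <= ratR q <= t); last first.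
    rewrite (_ : _ `&` _ = set0); first exact: events_set0 (sF t0).
    by apply/seteqP; split=> // w [].
  apply: (events_setI (sF t0)); first exact: (events_cst (sF t0)).
  apply: (events_setI (sF t0)); first exact: (filtration_le Ff q0 qt) (IH _ q0).
  apply: (events_setI (sF t0)).
    by apply: (events_setC (sF t0)); exact: (filtration_le Ff q0 qt) (Fex _ q0).
  apply: (events_bigcap (sF t0)) => r.
  have [/andP[qr rt]|nr] := boolP (ratR q <= ratR r <= t); last first.
    rewrite (_ : _ `|` _ = setT); first exact: events_setT (sF t0).
    by apply/seteqP; split=> // w _; left.
  have r0 := le_trans q0 qr.
  apply: (events_setU (sF t0)); first exact: (events_cst (sF t0)).
  apply: (events_setU (sF t0)); first exact: (filtration_le Ff r0 rt) (Fex _ r0).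
  have := path_event (measurable_itv `]-oo, mid - level v[) r0 rt.
  by rewrite (_ : [set w | `]-oo, mid - level v[%classic (X w (ratR r))] = [set w | X w (ratR r) < mid - level v])//; apply/seteqP; split=> w; rewrite /= in_itv.
apply/seteqP; split=> w.
  move=> [/= E mt]; have [wv E'] := prev _ _ E.
  have s1 : size (word w (size v).+1) = (size v).+1 by rewrite E.
  split; first by [].
  have Em : X w (tau w (size v).+1) + level v < mid.
    have [[_]|[]] := word_exit (bp w) s1; first by rewrite wv => ->.
    by rewrite E.
  have [q [aq qm Hq]] := rational_before (@cXl w v) Em (tau_lt w (size v)).
  exists q => //; split=> /=.
    by rewrite (le_trans (ltW qm) mt) andbT (le_trans _ (ltW aq))// (step_ge0 (tau0 w) (tau_lt w)).
  split; first by split=> //; exact: ltW.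
  split; first by move=> [_ _]; rewrite leNgt qm.
  move=> r _; have [/andP[qr rt]|nr] := boolP (ratR q <= ratR r <= t); [right|by left].
  have [mr|rm] := leP (tau w (size v).+1) (ratR r); [by left|right].
  by have := Hq _ qr rm; rewrite /= ltrBrDr.
move=> [[wv s1 mt] [q _ [/= /andP[q0 qt] [[_ vq] [nex H]]]]].
have [[E _]|[E Eu]] := word_exit (bp w) s1; first by split=> //=; rewrite E wv.
exfalso; rewrite wv in Eu.
have qm : ratR q < tau w (size v).+1 by rewrite ltNge; apply/negP => mq; apply: nex.
have cN : continuous (fun s => - (X w s + level v)) by move=> s; apply: cvgN; exact: cXl.
have Em : - (X w (tau w (size v).+1) + level v) < - mid by rewrite Eu ltrN2.
have [r [qr rm Hr]] := rational_before cN Em qm.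
have [|[[_ _]|]] := H r I; first by rewrite /= (ltW qr) (le_trans (ltW rm) mt).
- by rewrite leNgt rm.
- by have := Hr _ (lexx _) rm; rewrite /= ltrN2 => ? ?; lra.
Qed.

Lemma current_word w t : 0 <= t -> forall v,
  word w (step_index (tau w) t) = v <-> visited v t w /\ ~ exited v t w.
Proof.
move=> t0 v; have /andP[kt tk] := step_indexP (tau0 w) (tau_unb w) t0.
set k := step_index (tau w) t in kt tk *; split.
  move=> E; have sk : (size v <= k)%N by rewrite -E (word_size_le (bp w)).
  have Ev : word w (size v) = v by rewrite -E -(word_sizeE (bp w)).
  split; first by split=> //; exact: le_trans (step_le (tau_lt w) sk) kt.
  move=> [_ s1 mt]; have [sk'|ks] := ltnP (size v) k.
    by have := word_size_mono (bp w) sk'; rewrite s1 E ltnn.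
  have ek : k = size v by apply/eqP; rewrite eqn_leq ks.
  by move: tk; rewrite ek ltNge mt.
move=> [[wv vt] nex]; have vk : (size v <= k)%N.
  rewrite leqNgt; apply/negP => /(step_le (tau_lt w)); rewrite leNgt.
  by rewrite (le_lt_trans vt tk).
have [s1|s1] := eqVneq (size (word w (size v).+1)) (size v).+1; last first.
  have st : staying d D U u x (X w) (tau w) (word w) (size v).
    have [[E _]|[E _]|[_ //]] := band_next (bp w) (size v); by move: s1; rewrite E /= wv eqxx.
  by have [-> _] := staying_le (bp w) vk st.
rewrite -[RHS]wv; congr (word w _); apply/eqP; rewrite eqn_leq vk andbT leqNgt; apply/negP => vk'.
by apply: nex; split=> //; exact: le_trans (step_le (tau_lt w) vk') kt.
Qed.

Lemma word_function_adapted (y : R -> Omega -> R) (f : seq bool -> R) :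
  (forall w t, 0 <= t -> y t w = f (word w (step_index (tau w) t))) -> adapted F y.
Proof.
move=> yE t t0 B mB.
rewrite (_ : y t @^-1` B = \bigcup_(v : seq bool)
    ([set _ | B (f v)] `&` (visited v t `&` ~` exited v t))).
  apply: (events_bigcup (sF t0)) => v; apply: (events_setI (sF t0)); first exact: (events_cst (sF t0)).
  apply: (events_setI (sF t0)); first exact: visited_event.
  by apply: (events_setC (sF t0)); apply: exited_event => // s; exact: visited_event.
apply/seteqP; split=> w /=; rewrite yE//.
  by move=> Bf; exists (word w (step_index (tau w) t)) => //; split=> //; apply/(current_word w t0).
by move=> [v _ [Bf /(current_word w t0) ->]].
Qed.

Lemma represented_adapted : adapted F (upward phi) /\ adapted F (downward phi).
Proof.
split; [apply: (@word_function_adapted _ (word_up d D U u x))|apply: (@word_function_adapted _ (word_down d D U u x))].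
  by move=> w t t0; have [_ -> ] := rep w.
by move=> w t t0; have [_ _ ->] := rep w.
Qed.

Lemma inventory_adapted : adapted F (inventory mu sigma W x phi).
Proof.
have [au ad] := represented_adapted; move=> t t0.
apply: (wrtB Ff t0); last exact: ad.
apply: (wrtD Ff t0); last exact: au.
apply: (wrtD Ff t0); first exact: (wrt_cst Ff).
apply: (wrtM Ff t0); first exact: (wrt_cst Ff).
exact: (brownian_adapted mart t0).
Qed.

Lemma represented_stopping n : stopping_time F (adj_time phi n).
Proof.
move=> t t0; rewrite (_ : [set w | _] = \bigcup_(v : seq bool) ([set _ | size v = n] `&` visited v t)).
  apply: (events_bigcup (sF t0)) => v.
  by apply: (events_setI (sF t0)); [exact: (events_cst (sF t0))|exact: visited_event].
apply/seteqP; split=> w /=; rewrite (adj_timeE dD Uu rep).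
  by case: eqP => // sn; rewrite lee_fin => nt; exists (word w n) => //; split=> //; split; rewrite sn.
by move=> [v _ [sv [wv vt]]]; rewrite -sv wv eqxx lee_fin.
Qed.

(** The amount has to be read off before the adjustment. The barrier is identified by the inventory
    at rational times shortly before [T], and each such observation is intersected with the event
    that the time precedes [T], as in the generators of [strict_past]. *)
Lemma represented_amount n : measurable_wrt (strict_past F (adj_time phi n)) (adj_amount phi n).
Proof.
have sP : sigma_algebra setT (strict_past F (adj_time phi n)) by exact: smallest_sigma_algebra.
have gen t A : 0 <= t -> F t A -> strict_past F (adj_time phi n) (A `&` [set w | (t%:E < adj_time phi n w)%E]).
  by move=> t0 FA; apply: sub_gen_smallest; right; exists t, A.
case: n sP gen => [|n] sP gen B mB.
  rewrite (_ : _ @^-1` B = [set _ | B (band_initial d D U u x)]); first exact: (events_cst sP).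
  by apply/seteqP; split=> w /=; rewrite (adj_amount0 rep).
set T := adj_time phi n.+1 in sP gen *.
have TE w : T w = if size (word w n.+1) == n.+1 then (tau w n.+1)%:E else +oo%E by exact: (adj_timeE dD Uu rep).
have late t : 0 <= t -> strict_past F T [set w | (t%:E < T w)%E].
  by move=> t0; rewrite -[X in strict_past _ _ X]setTI; apply: gen => //; exact: events_setT (sF t0).
have fin : strict_past F T [set w | (T w < +oo)%E].
  rewrite (_ : [set w | _] = \bigcup_(m : nat) ~` [set w | (m%:R%:E < T w)%E]).
    by apply: (events_bigcup sP) => m; apply: (events_setC sP); exact: late.
  apply/seteqP; split=> w /=.
    have := TE w; case: eqP => [_ Tw _|_ ->]; last by rewrite ltxx.
    exists (Num.truncn (tau w n.+1)).+1 => //=.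
    by rewrite Tw; apply/negP; rewrite -leNgt lee_fin ltW// truncnS_gt.
  by move=> [m _ /negP]; rewrite -leNgt => /le_lt_trans; apply; exact: ltry.
pose Up := [set w | word w n.+1 = true :: word w n].
have FUp : strict_past F T Up.
  rewrite (_ : Up = [set w | (T w < +oo)%E] `&` \bigcup_(q : rat) ([set _ | 0 <= ratR q :> R] `&`
      ([set w | ((ratR q)%:E < T w)%E] `&` \bigcap_(r : rat) ([set _ | ~~ (ratR q <= ratR r :> R)] `|`
       (~` [set w | ((ratR r)%:E < T w)%E] `|`
        ([set w | inventory mu sigma W x phi (ratR r) w < mid] `&` [set w | ((ratR r)%:E < T w)%E])))))).
    apply: (events_setI sP) => //; apply: (events_bigcup sP) => q.
    have [q0|nq] := boolP (0 <= ratR q :> R); last first.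
      rewrite (_ : _ `&` _ = set0); first exact: events_set0 sP.
      by apply/seteqP; split=> // w [].
    apply: (events_setI sP); first exact: (events_cst sP).
    apply: (events_setI sP); first exact: late.
    apply: (events_bigcap sP) => r.
    have [qr|nr] := boolP (ratR q <= ratR r :> R); last first.
      rewrite (_ : _ `|` _ = setT); first exact: events_setT sP.
      by apply/seteqP; split=> // w _; left.
    have r0 := le_trans q0 qr.
    apply: (events_setU sP); first exact: (events_cst sP).
    apply: (events_setU sP); first by apply: (events_setC sP); exact: late.
    apply: gen => //; have := inventory_adapted r0 (measurable_itv `]-oo, mid[).
    by rewrite (_ : _ @^-1` _ = [set w | inventory mu sigma W x phi (ratR r) w < mid])//; apply/seteqP; split=> w; rewrite /= in_itv.
  have Zn w s : tau w n <= s -> s < tau w n.+1 ->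
      inventory mu sigma W x phi s w = X w s + level (word w n).
    move=> ns sn; have s0 : 0 <= s by rewrite (le_trans _ ns)// (step_ge0 (tau0 w) (tau_lt w)).
    by rewrite (represents_inventory rep w s0) (step_indexE (tau0 w) (tau_lt w) (tau_unb w) ns sn).
  apply/seteqP; split=> w.
    move=> E; have s1 : size (word w n.+1) = n.+1 by rewrite E /= (word_size_next (bp w) E).
    have Tw : T w = (tau w n.+1)%:E by rewrite TE s1 eqxx.
    split; first by rewrite /= Tw ltry.
    have Em : X w (tau w n.+1) + level (word w n) < mid.
      have [[_ ->//]|[]] := word_exit (bp w) s1.
      by rewrite E.
    have [q [aq qm Hq]] := rational_before (@cXl w (word w n)) Em (tau_lt w n).
    exists q => //; split=> /=.
      by rewrite (le_trans _ (ltW aq))// (step_ge0 (tau0 w) (tau_lt w)).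
    split; first by rewrite /= Tw lte_fin.
    move=> r _; have [qr|nr] := boolP (ratR q <= ratR r :> R); [right|by left].
    have [mr|rm] := leP (tau w n.+1) (ratR r); [left|right]; rewrite /= Tw lte_fin.
      by apply/negP; rewrite -leNgt.
    by split=> //; rewrite /= Zn ?Hq// (le_trans (ltW aq)).
  move=> [/=]; rewrite TE; case: eqP => // s1 _ [q _ [/= q0 [qm H]]].
  have [[//]|[E Eu]] := word_exit (bp w) s1; exfalso.
  have Tw : T w = (tau w n.+1)%:E by rewrite TE s1 eqxx.
  rewrite Tw lte_fin in qm.
  have cN : continuous (fun s => - (X w s + level (word w n))) by move=> s; apply: cvgN; exact: cXl.
  have Em : - (X w (tau w n.+1) + level (word w n)) < - mid by rewrite Eu ltrN2.
  have qm' : Num.max (ratR q) (tau w n) < tau w n.+1 by rewrite gt_max qm tau_lt.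
  have [r [+ rm Hr]] := rational_before cN Em qm'; rewrite gt_max => /andP[qr nr].
  have [|[|[/=]]] := H r I; first by rewrite /= (ltW qr).
  - by rewrite /= Tw lte_fin rm.
  - by rewrite Zn ?(ltW nr)// => H1 _; have := Hr _ (lexx _) rm; rewrite /= ltrN2 ltNge (ltW H1).
rewrite (_ : _ @^-1` B = ([set _ | B (D - d)] `&` Up) `|` (([set _ | B (U - u)] `&` ([set w | (T w < +oo)%E] `&` ~` Up)) `|`
    ([set _ | B 0] `&` ~` [set w | (T w < +oo)%E]))).
  apply: (events_setU sP).
    by apply: (events_setI sP) => //; exact: (events_cst sP).
  apply: (events_setU sP).
    apply: (events_setI sP); first exact: (events_cst sP).
    by apply: (events_setI sP) => //; exact: (events_setC sP).
  by apply: (events_setI sP); [exact: (events_cst sP)|exact: (events_setC sP)].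
apply/seteqP; split=> w /=.
  have := TE w; case: eqP => [s1 Tw|s1 Tw]; last first.
    by rewrite (adj_amount_none Tw) => B0; right; right; split=> //; rewrite Tw ltxx.
  have [[E _]|[E _]] := word_exit (bp w) s1.
    by rewrite (adj_amount_up dD Uu rep E); left.
  rewrite (adj_amount_down dD Uu rep E) => BU; right; left; split=> //; split; first by rewrite Tw ltry.
  by rewrite /Up/= E.
move=> [[BD E]|[[BU [Tw nup]]|[B0 Tw]]].
- by rewrite (adj_amount_up dD Uu rep E).
- move: Tw; rewrite TE; case: eqP => // s1 _; have [[E _]|[E _]] := word_exit (bp w) s1.
    by exfalso; exact: nup.
  by rewrite (adj_amount_down dD Uu rep E).
- by rewrite adj_amount_none//; move/negP: Tw; rewrite -leNgt leye_eq => /eqP.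
Qed.

Lemma represented_admissible : admissible F phi.
Proof.
have [au ad] := represented_adapted.
split=> //; [exact: (represented_pure_jump dD Uu rep)|exact: represented_stopping|exact: represented_amount].
Qed.

End band_policy_measurability.

(** * Feasibility of the control band policy *)

Section step_dynkin.
Context {R : realType} {dsp : measure_display} {Omega : measurableType dsp}.
Local Notation leb := (@lebesgue_measure R).
Variables (P : probability Omega R) (F : R -> set (set Omega)) (W : R -> Omega -> R).
Hypotheses (Ff : filtration F) (bm : standard_brownian P W) (mart : martingale P F W).
Local Notation intg := (intg P).
Local Notation Ex := (Ex P).
Variables (mu sigma beta : R) (beta0 : 0 < beta).
Variables (f f1 f2 : R -> R) (C : R).
Hypotheses (df : forall x : R, is_derive x 1 f (f1 x)) (df1 : forall x : R, is_derive x 1 f1 (f2 x)).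
Hypotheses (C0 : 0 <= C) (f1C : forall x, `|f1 x| <= C) (f2C : forall x, `|f2 x| <= C).
Hypothesis lf2 : lip C f2.
Variables (tau : Omega -> nat -> R).
Hypotheses (tau0 : forall w, tau w 0 = 0) (tau_lt : forall w n, tau w n < tau w n.+1)
  (tau_unb : forall w (T : R), exists n, T < tau w n).
Variables (v q : Omega -> nat -> R).
Hypothesis vq : forall w i, `|v w i.+1 - v w i| <= q w i.+1 - q w i.
Local Notation idx w t := (step_index (tau w) t).
Local Notation c := (fun t w => v w (idx w t)).
Hypotheses (mc : forall s, 0 <= s -> measurable_wrt (F s) (c s)) (ic : forall s, 0 <= s -> intg (c s)).
Variables (T : R) (S : Omega -> R).
Hypotheses (T0 : 0 < T) (qS : forall w, q w (idx w T) - q w 0 <= S w) (iS : intg S).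
Local Notation X := (drift_path W mu sigma).

Lemma step_path_measurable w : measurable_fun `[0, T] (c ^~ w).
Proof.
move=> _ B mB.
rewrite (_ : _ `&` _ = \bigcup_n ([set _ : R | B (v w n)] `&` (`[0, T] `&` `[tau w n, tau w n.+1[))).
  apply: bigcupT_measurable => n; apply: measurableI; last exact: measurableI.
  have [Bn|Bn] := pselect (B (v w n)).
    by rewrite (_ : [set _ | _] = setT); [exact: measurableT|apply/seteqP; split].
  by rewrite (_ : [set _ | _] = set0); [exact: measurable0|apply/seteqP; split].
apply/seteqP; split=> t /=.
  rewrite in_itv/= => -[/andP[t0 tT] Bt]; exists (idx w t) => //; split=> //.
  by rewrite /= !in_itv/= t0 tT; have := step_indexP (tau0 w) (tau_unb w) t0.
rewrite !in_itv/= => -[n _ [/= Bn]]; rewrite !in_itv/= => -[/andP[t0 tT] /andP[nt tn]].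
rewrite t0 tT; split=> //.
by rewrite (step_indexE (tau0 w) (tau_lt w) (tau_unb w) nt tn).
Qed.

Let variation_index w i j : (i <= j)%N -> `|v w j - v w i| <= q w j - q w i.
Proof.
elim: j => [|j IH]; first by rewrite leqn0 => /eqP ->; rewrite !subrr normr0.
rewrite leq_eqVlt => /predU1P[->|]; first by rewrite !subrr normr0.
rewrite ltnS => /IH H; rewrite -(subrKA (v w j)) (le_trans (ler_normD _ _))//.
by rewrite -[q w j.+1 - _](subrKA (q w j)) lerD.
Qed.

Let q_le w i j : (i <= j)%N -> q w i <= q w j.
Proof. by move=> ij; rewrite -subr_ge0 (le_trans _ (variation_index w ij)). Qed.

Let variation w (p s : R) : 0 <= p -> p <= s -> s <= T ->
  `|c s w - c p w| <= q w (idx w s) - q w (idx w p).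
Proof.
move=> p0 ps _; apply: variation_index.
exact: (step_index_le (tau0 w) (tau_lt w) (tau_unb w)).
Qed.

Definition step_gain w : R :=
  \sum_(i < idx w T) step_term (v w) f (free_path W mu sigma w) beta i (tau w i.+1).

Let free_drift s w : 0 <= s -> X s w = free_path W mu sigma w s.
Proof. by move=> s0; rewrite /free_path (max_r s0). Qed.

Let jump_sum_free n w : jump_sum W mu sigma beta f c (T / n.+1%:R) n.+1 w =
  \sum_(j < n.+1) expR (- beta * (j.+1%:R * (T / n.+1%:R))) *
    (f (free_path W mu sigma w (j.+1%:R * (T / n.+1%:R)) + c (j.+1%:R * (T / n.+1%:R)) w) -
     f (free_path W mu sigma w (j.+1%:R * (T / n.+1%:R)) + c (j%:R * (T / n.+1%:R)) w)).
Proof.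
by apply: eq_bigr => j _; rewrite free_drift// mulr_ge0// divr_ge0// ltW.
Qed.

Let jump_sum_bound n w : `|jump_sum W mu sigma beta f c (T / n.+1%:R) n.+1 w| <= C * S w.
Proof.
have dt0 : 0 < T / n.+1%:R by rewrite divr_gt0// ltr0n.
set dt := T / n.+1%:R in dt0 *; pose g (j : nat) := q w (idx w (j%:R * dt)).
have time0 (j : nat) : 0 <= j%:R * dt by rewrite mulr_ge0// ltW.
apply: (@le_trans _ _ (\sum_(j < n.+1) C * (g j.+1 - g j))).
  rewrite (le_trans (ler_norm_sum _ _ _))//; apply: ler_sum => j _.
  rewrite normrM ger0_norm ?expR_ge0//.
  have e1 : expR (- beta * (j.+1%:R * dt)) <= 1.
    by rewrite -[leRHS]expR0 ler_expR mulNr oppr_le0 mulr_ge0 ?time0// ltW.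
  apply: (le_trans (ler_piMl _ e1)) => //.
  apply: (le_trans (lip_der df f1C _ _)); rewrite ler_wpM2l//.
  rewrite [X in `|X|](_ : _ = c (j.+1%:R * dt) w - c (j%:R * dt) w); last by ring.
  apply: variation_index; apply: (step_index_le (tau0 w) (tau_lt w) (tau_unb w)) => //.
  by rewrite ler_pM2r// ler_nat.
rewrite -mulr_sumr ler_wpM2l// -(big_mkord xpredT (fun j => g j.+1 - g j)) telescope_sumr//.
rewrite (le_trans _ (qS w))// /g mul0r (step_index0 (tau0 w) (tau_lt w) (tau_unb w)).
by rewrite /dt mulrC divfK// pnatr_eq0.
Qed.

(** The grid sums of the jumps converge path by path to the sum over the actual jump times and are
    dominated by [C * S], so the limit in [dynkin_formula] is the mean of [step_gain]. *)
Lemma step_dynkin : [/\ intg step_gain, intg (discounted_running W mu sigma beta f f1 f2 c T) &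
  Ex step_gain = expR (- beta * T) * Ex (fun w => f (X T w + c T w)) -
    Ex (fun w => f (X 0 w + c 0 w)) - Ex (discounted_running W mu sigma beta f f1 f2 c T)].
Proof.
have qS' w : q w (idx w T) - q w (idx w 0) <= S w.
  by rewrite (step_index0 (tau0 w) (tau_lt w) (tau_unb w)).
have [iQ cvJ] := dynkin_formula Ff bm mart mu sigma beta0 df df1 C0 f1C f2C lf2 (c := c)
  mc ic (vv := fun w t => q w (idx w t)) T0 (@step_path_measurable) variation qS' iS.
have cvw w : jump_sum W mu sigma beta f c (T / n.+1%:R) n.+1 w @[n --> \oo] --> step_gain w.
  rewrite (_ : (fun n => _) = (fun n => \sum_(j < n.+1) expR (- beta * (j.+1%:R * (T / n.+1%:R))) *
    (f (free_path W mu sigma w (j.+1%:R * (T / n.+1%:R)) + c (j.+1%:R * (T / n.+1%:R)) w) -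
     f (free_path W mu sigma w (j.+1%:R * (T / n.+1%:R)) + c (j%:R * (T / n.+1%:R)) w)))).
    have cX := free_path_continuous bm (mu := mu) (sigma := sigma) (w := w).
    exact: (@step_jump_sum_cvg _ _ (tau0 w) (tau_lt w) (tau_unb w) (v w) f _ beta (der_continuous df) cX T T0).
  by apply/funext => n; exact: jump_sum_free.
have mJ n : measurable_fun setT (jump_sum W mu sigma beta f c (T / n.+1%:R) n.+1).
  apply: intg_mf (intg_jump_sum mart mu sigma beta df f1C ic n.+1 _).
  by rewrite divr_gt0// ltr0n.
have [iL cvL] := Ex_dominated mJ cvw jump_sum_bound (intgZ C iS).
split=> //; exact: (cvg_unique _ cvL cvJ).
Qed.

Lemma step_running_integrable w : leb.-integrable `[0, T]
  (EFin \o (fun s => expR (- beta * s) * (generator mu sigma f1 f2 (X s w + c s w) - beta * f (X s w + c s w)))).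
Proof.
exact: (discounted_running_integrable bm mu sigma beta0 df df1 C0 f1C f2C lf2 (c := c)
  (vv := fun w t => q w (idx w t)) T0 (@step_path_measurable) variation w).
Qed.

Lemma discounted_running_bound M w : 0 <= M ->
  (forall y, `|generator mu sigma f1 f2 y - beta * f y| <= M) ->
  `|discounted_running W mu sigma beta f f1 f2 c T w| <= M / beta.
Proof.
move=> M0 HM.
have iphi := step_running_integrable w.
have dE (s : R) : is_derive s 1 (fun s => - beta^-1 * expR (- beta * s)) (expR (- beta * s)).
  by apply: (der_eq (derZ _ (der_expRM (- beta) s))); field; exact: lt0r_neq0.
have iexp : leb.-integrable `[0, T] (EFin \o (fun s => M * expR (- beta * s))).
  by apply: continuous_integrable; apply: contZ; exact: der_continuous (der_expRM (- beta)).
have iexp' : leb.-integrable `[0, T] (EFin \o (fun s => expR (- beta * s))).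
  by apply: continuous_integrable; exact: der_continuous (der_expRM (- beta)).
apply: (le_trans (le_normr_Rintegral _ iphi)) => //.
apply: (@le_trans _ _ (\int[leb]_(s in `[0, T]) (M * expR (- beta * s)))).
  apply: le_Rintegral => //.
    have := integrable_abse iphi; exact.
  by move=> s _; rewrite normrM ger0_norm ?expR_ge0// mulrC ler_wpM2r ?expR_ge0.
rewrite RintegralZl// (Rintegral_derive (ltW T0) dE); last exact: der_continuous (der_expRM (- beta)).
rewrite mulr0 expR0 mulr1 opprK mulNr ler_wpM2l//.
by rewrite gerDr oppr_le0 mulr_ge0 ?expR_ge0// invr_ge0 ltW.
Qed.

End step_dynkin.

Section feasibility.
Context {R : realType} {dsp : measure_display} {Omega : measurableType dsp}.
Variables (P : probability Omega R) (F : R -> set (set Omega)) (W : R -> Omega -> R).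
Hypotheses (Ff : filtration F) (bm : standard_brownian P W) (mart : martingale P F W).
Local Notation intg := (intg P).
Local Notation Ex := (Ex P).
Variables (mu sigma beta d D U u x : R).
Hypotheses (beta0 : 0 < beta) (dD : d < D) (DU : D < U) (Uu : U < u).
Variables (phi : policy R Omega) (tau : Omega -> nat -> R) (word : Omega -> nat -> seq bool).
Hypothesis rep : represents W mu sigma d D U u x phi tau word.
Local Notation level := (word_level d D U u x).
Local Notation X := (free_path W mu sigma).
Implicit Types (n N i : nat) (w : Omega).

Let bp w : band_path d D U u x (X w) (tau w) (word w).
Proof. by have [] := rep w. Qed.
Let tau0 w := band_time0 (bp w).
Let tau_lt w := band_time_lt (bp w).
Let tau_unb w := band_time_unbounded (bp w).
Let adm : admissible F phi := represented_admissible Ff bm mart dD DU Uu rep.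

Let m : R := (D + U) / 2.
Let th : R := (u - d)^-1.
(** Bounded, even about the middle [m] of [[D, U]] and increasing away from it on the band, so that
    each adjustment at a barrier lowers it by at least [kappa]. The scale [th] keeps the argument of
    the cosine within [[- 1, 1]] on the band. *)
Let f y : R := - cos (th * (y - m)).
Let f1 y : R := th * sin (th * (y - m)).
Let f2 y : R := th ^+ 2 * cos (th * (y - m)).

Let th0 : 0 < th.
Proof. by rewrite /th invr_gt0 subr_gt0 (lt_trans dD)// (lt_trans DU). Qed.

Let dlin y : is_derive (y : R) 1 (fun y => th * (y - m)) th.
Proof.
have H := derZ th (derB (der_id y) (der_cst m y)).
by apply: (der_eq H); rewrite subr0 mulr1.
Qed.

Let df y : is_derive (y : R) 1 f (f1 y).
Proof.
have H := derN (@der_comp _ (@cos R) (fun y => th * (y - m)) y _ _ (is_derive_cos _) (dlin y)).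
by apply: (der_eq H); rewrite /f1; ring.
Qed.

Let df1 y : is_derive (y : R) 1 f1 (f2 y).
Proof.
have H := derZ th (@der_comp _ (@sin R) (fun y => th * (y - m)) y _ _ (is_derive_sin _) (dlin y)).
by apply: (der_eq H); rewrite /f2; ring.
Qed.

Let df2 y : is_derive (y : R) 1 f2 (- (th ^+ 3 * sin (th * (y - m)))).
Proof.
have H := derZ (th ^+ 2) (@der_comp _ (@cos R) (fun y => th * (y - m)) y _ _ (is_derive_cos _) (dlin y)).
by apply: (der_eq H); ring.
Qed.

Let C : R := th + th ^+ 2 + th ^+ 3.
Let C0 : 0 <= C.
Proof. by rewrite /C !addr_ge0// ?exprn_ge0// ltW. Qed.
Let Cth i : (0 < i)%N -> (i <= 3)%N -> th ^+ i <= C.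
Proof.
have H1 : 0 <= th by exact: ltW. have H2 : 0 <= th ^+ 2 by exact: exprn_ge0.
have H3 : 0 <= th ^+ 3 by exact: exprn_ge0.
by case: i => [|[|[|[|]]]]// _ _; rewrite /C ?expr1; lra.
Qed.
Let trig_bound i (z : R) : (0 < i)%N -> (i <= 3)%N -> `|z| <= 1 -> `|th ^+ i * z| <= C.
Proof.
move=> i0 i3 z1; rewrite normrM ger0_norm ?exprn_ge0 ?(ltW th0)//.
by rewrite (le_trans (ler_piMr _ z1)) ?exprn_ge0 ?(ltW th0)//; exact: Cth.
Qed.
Let f1C y : `|f1 y| <= C.
Proof. by rewrite /f1 -[th in th * sin _]expr1; apply: trig_bound => //; exact: sin_max. Qed.
Let f2C y : `|f2 y| <= C.
Proof. by apply: trig_bound => //; exact: cos_max. Qed.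
Let lf2 : lip C f2.
Proof. by apply: (lip_der df2) => y; rewrite normrN; apply: trig_bound => //; exact: sin_max. Qed.

Let M : R := sigma ^+ 2 / 2 * C + `|mu| * C + beta.
Let M0 : 0 <= M.
Proof.
have s2 : 0 <= sigma ^+ 2 / 2 by rewrite divr_ge0// sqr_ge0.
by apply: addr_ge0; [apply: addr_ge0; exact: mulr_ge0|exact: ltW].
Qed.
Let GM y : `|generator mu sigma f1 f2 y - beta * f y| <= M.
Proof.
have s2 : 0 <= sigma ^+ 2 / 2 by rewrite divr_ge0// sqr_ge0.
rewrite (le_trans (ler_normB _ _))// /M; apply: lerD.
  rewrite (le_trans (ler_normD _ _))//; apply: lerD.
    by rewrite normrM (ger0_norm s2) ler_wpM2l.
  by rewrite normrM ler_wpM2l.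
by rewrite normrM (gtr0_norm beta0) /f normrN ler_piMr ?(ltW beta0)//; exact: cos_max.
Qed.

Let th1 y : `|y| < u - d -> `|th * y| < 1.
Proof.
by move=> yu; rewrite normrM (gtr0_norm th0) /th mulrC ltr_pdivrMr ?mul1r// subr_gt0 (lt_trans dD)// (lt_trans DU).
Qed.

Let cos_far y z : `|y| < `|z| -> `|z| < u - d -> cos (th * z) < cos (th * y).
Proof.
move=> yz zu; rewrite -(cos_norm (th * z)) -(cos_norm (th * y)).
have pi1 : (1 : R) < pi by rewrite (lt_le_trans _ (pi_ge2 R))// ltr1n.
rewrite ltr_cos ?in_itv/= ?normr_ge0/=.
- by rewrite !normrM ltr_pM2l// normr_gt0 lt0r_neq0.
- by apply: le_trans (ltW pi1); apply/ltW/th1; rewrite ?(lt_trans yz).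
- by apply: le_trans (ltW pi1); apply/ltW/th1; rewrite ?(lt_trans yz).
Qed.

Let kappa : R := Num.min (f d - f D) (f u - f U).
Let kappa0 : 0 < kappa.
Proof.
have := dD; have := DU; have := Uu => ? ? ?.
have k1 : cos (th * (d - m)) < cos (th * (D - m)).
  have Dm : D - m < 0 by rewrite /m; lra.
  have dm : d - m < 0 by rewrite /m; lra.
  by apply: cos_far; rewrite (ltr0_norm dm) ?(ltr0_norm Dm) /m; lra.
have k2 : cos (th * (u - m)) < cos (th * (U - m)).
  have Um : 0 < U - m by rewrite /m; lra.
  have um : 0 < u - m by rewrite /m; lra.
  by apply: cos_far; rewrite (gtr0_norm um) ?(gtr0_norm Um) /m; lra.
by rewrite lt_min !subr_gt0 /f !ltrN2 k1.
Qed.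

Let gap : R := (D - d) + (u - U).
Let gap0 : 0 <= gap.
Proof. by have := dD; have := Uu; rewrite /gap => ? ?; lra. Qed.

Section truncation.
Variables (N : nat) (T : R).
Hypothesis T0 : 0 < T.
(** The latest letters are at the head, so this keeps the [N] oldest exits. The level thus frozen is
    bounded, which gives the integrability that Dynkin's formula asks for while nothing is known yet
    about the number of adjustments. *)
Let cut (wd : seq bool) : R := level (drop (size wd - N) wd).
Let v w i : R := cut (word w i).
Let q w i : R := gap * (minn N (size (word w i)))%:R.

Let exit_step w i : size (word w i) = i -> forall b, word w i.+1 = b :: word w i ->
  v w i.+1 = if (i < N)%N then level (b :: word w i) else v w i.
Proof.
move=> si b E; rewrite /v /cut E /= si; case: ltnP => iN.
  by rewrite (eqP iN).
by rewrite subSn.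
Qed.

Let vlow w i : size (word w i) = i -> (i < N)%N -> v w i = level (word w i).
Proof. by move=> si iN; rewrite /v /cut si (eqP (ltnW iN)) drop0. Qed.

Let vq w i : `|v w i.+1 - v w i| <= q w i.+1 - q w i.
Proof.
have := dD; have := Uu => ? ?.
have [[E _]|[E _]|[E _]] := band_next (bp w) i; last by rewrite /v /q E !subrr normr0.
- have si := word_size_next (bp w) E; rewrite (exit_step si E) /q E /= si; case: ltnP => iN.
    rewrite (vlow si iN) word_level_up (minn_idPr iN) ?(minn_idPr (ltnW iN)) -mulrBr -natr1.
    by rewrite [_ + 1 - _]addrAC subrr add0r mulr1 addrAC subrr add0r gtr0_norm ?subr_gt0// /gap; lra.
  by rewrite ?(minn_idPl iN) (minn_idPl (leqW iN)) !subrr normr0.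
- have si := word_size_next (bp w) E; rewrite (exit_step si E) /q E /= si; case: ltnP => iN.
    rewrite (vlow si iN) word_level_down (minn_idPr iN) ?(minn_idPr (ltnW iN)) -mulrBr -natr1.
    rewrite [_ + 1 - _]addrAC subrr add0r mulr1 addrAC subrr add0r normrN.
    by rewrite gtr0_norm ?subr_gt0// /gap; lra.
  by rewrite ?(minn_idPl iN) (minn_idPl (leqW iN)) !subrr normr0.
Qed.

Let c t w : R := v w (step_index (tau w) t).

Let mc s : 0 <= s -> measurable_wrt (F s) (c s).
Proof.
by move=> s0; apply: (word_function_adapted Ff bm mart dD DU Uu rep (f := cut)).
Qed.

Let q_bound w i j : q w i - q w j <= gap * N%:R.
Proof.
rewrite (@le_trans _ _ (q w i))//; first by rewrite gerBl mulr_ge0.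
by rewrite ler_wpM2l// ler_nat geq_minl.
Qed.

Let ic s : 0 <= s -> intg (c s).
Proof.
move=> s0; apply: (@intg_le _ _ _ _ (fun=> `|level [::]| + gap * N%:R)); [|move=> w|exact: intg_cst].
  exact: (wrt_mf Ff s0 (mc s0)).
have -> : level [::] = v w 0 by rewrite /v /cut (band_word0 (bp w)).
have E i : `|v w i - v w 0| <= q w i - q w 0.
  elim: i => [|i IH]; first by rewrite !subrr normr0.
  rewrite -(subrKA (v w i)) (le_trans (ler_normD _ _))//.
  by rewrite -[q w i.+1 - _](subrKA (q w i)); apply: lerD; [exact: vq|exact: IH].
rewrite -[c s w](subrK (v w 0)) addrC (le_trans (ler_normD _ _))// lerD2l.
exact: le_trans (E _) (q_bound w _ _).
Qed.

Let L w : R := \sum_(i < step_index (tau w) T) step_term (v w) f (X w) beta i (tau w i.+1).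

Let gain : [/\ intg L, - (2 + M / beta) <= Ex L & True].
Proof.
have [iL iQ EL] := step_dynkin Ff bm mart mu sigma beta0 df df1 C0 f1C f2C lf2
  tau0 tau_lt tau_unb vq mc ic T0 (fun w => q_bound w _ _) (intg_cst P _).
have HQ w : `|discounted_running W mu sigma beta f f1 f2 c T w| <= M / beta.
  have H := discounted_running_bound bm beta0 df df1 C0 f1C f2C lf2 (tau := tau) tau0 tau_lt tau_unb (v := v) (q := q) vq T0 w M0 GM.
  exact: H.
split=> //; rewrite [Ex L]EL.
have fb (Y : Omega -> R) : intg Y -> `|Ex (fun w => f (Y w))| <= 1.
  move=> iY; have ify : intg (fun w => f (Y w)) := intg_lip (lip_der df f1C) iY.
  have := Ex_norm_le ify (intg_cst P 1); rewrite Ex_cst; apply=> w.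
  by rewrite /f normrN; exact: cos_max.
have iX s : 0 <= s -> intg (fun w => drift_path W mu sigma s w + c s w).
  by move=> s0; apply: intgD; [exact: (drift_intg mart)|exact: ic].
have H1 := fb _ (iX T (ltW T0)); have H2 := fb _ (iX 0 (lexx 0)).
have H3 := Ex_norm_le iQ (intg_cst P (M / beta)) HQ; rewrite Ex_cst in H3.
have e1 : expR (- beta * T) <= 1 by rewrite -expR0 ler_expR mulNr oppr_le0 mulr_ge0 ?ltW.
have e0 := expR_ge0 (- beta * T).
move: H1 H2 H3; rewrite !ler_norml => /andP[a1 a2] /andP[b1 b2] /andP[c1 c2].
have H4 : -1 <= expR (- beta * T) * Ex (fun w => f (drift_path W mu sigma T w + c T w)).
  by move: a1 a2 e0 e1; move: (expR _) (Ex _) => e y; nra.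
by move: H4 b2 c2; lra.
Qed.

Let term_le w i : kappa * (if (i < N)%N && (size (word w i.+1) == i.+1) then expR (- beta * tau w i.+1) else 0) <=
  - step_term (v w) f (X w) beta i (tau w i.+1).
Proof.
have e0 := expR_ge0 (- beta * tau w i.+1).
have kd : kappa <= f d - f D by rewrite ge_min lexx.
have ku : kappa <= f u - f U by rewrite ge_min lexx orbT.
rewrite /step_term -mulrN opprB.
have [[E Ex]|[E Ex]|[E _]] := band_next (bp w) i.
- have si := word_size_next (bp w) E; rewrite (exit_step si E) E /= si eqxx andbT.
  case: ltnP => iN; last by rewrite subrr !mulr0.
  rewrite (vlow si iN) Ex word_level_up addrA Ex (_ : d + (D - d) = D); last by ring.
  by rewrite mulrC ler_wpM2l.
- have si := word_size_next (bp w) E; rewrite (exit_step si E) E /= si eqxx andbT.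
  case: ltnP => iN; last by rewrite subrr !mulr0.
  rewrite (vlow si iN) Ex word_level_down addrA Ex (_ : u - (u - U) = U); last by ring.
  by rewrite mulrC ler_wpM2l.
- rewrite /v E subrr mulr0 ifF ?mulr0//; apply/negbTE/nandP; right.
  by apply/eqP => s1; have := word_size_le (bp w) i; rewrite s1 ltnn.
Qed.

Let bound : R := `|band_initial d D U u x| + (D - d) + (u - U).

Let part_le w i : discounted_part phi beta i.+1 w * \1_[set w | (adj_time phi i.+1 w <= T%:E)%E] w <=
  (1 + bound) * (if (size (word w i.+1) == i.+1) && (tau w i.+1 <= T) then expR (- beta * tau w i.+1) else 0).
Proof.
have b0 : 0 <= 1 + bound by have := dD; have := Uu; have := normr_ge0 (band_initial d D U u x); rewrite /bound; lra.
rewrite indicE; have TE := adj_timeE dD Uu rep w i.+1.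
case: (boolP (w \in _)) => [/set_mem wT|_]; last first.
  by rewrite mulr0 mulr_ge0//; case: ifP => // _; exact: expR_ge0.
rewrite mulr1; have : (adj_time phi i.+1 w <= T%:E)%E by [].
rewrite TE; case: eqP => //= s1; rewrite lee_fin => ->.
rewrite /discounted_part TE s1 eqxx /= mulNr mulrC ler_wpM2r ?expR_ge0// lerD2l.
have := adj_amount_bound dD Uu rep w i.+1; exact.
Qed.

Let Y w : R := \sum_(i < N) discounted_part phi beta i.+1 w * \1_[set w | (adj_time phi i.+1 w <= T%:E)%E] w.

Let Y_le w : Y w <= (1 + bound) / kappa * - L w.
Proof.
have b0 : 0 <= 1 + bound by have := dD; have := Uu; have := normr_ge0 (band_initial d D U u x); rewrite /bound; lra.
pose e i : R := if (i < N)%N && (size (word w i.+1) == i.+1) then expR (- beta * tau w i.+1) else 0.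
have e0 i : 0 <= e i by rewrite /e; case: ifP => // _; exact: expR_ge0.
have H1 : kappa * \sum_(i < step_index (tau w) T) e i <= - L w.
  by rewrite mulr_sumr -sumrN; apply: ler_sum => i _; exact: term_le.
have H2 : Y w <= (1 + bound) * \sum_(i < step_index (tau w) T) e i.
  rewrite mulr_sumr; set K := step_index _ _.
  have /andP[_ TK] := step_indexP (tau0 w) (tau_unb w) (ltW T0); rewrite -/K in TK.
  rewrite (@le_trans _ _ (\sum_(i < N | (i < K)%N) (1 + bound) * e i))//.
    rewrite [leRHS]big_mkcond; apply: ler_sum => i _; apply: (le_trans (part_le w i)).
    rewrite /e ltn_ord/=; case: ltnP => iK; last first.
      rewrite ifF ?mulr0//; apply/negbTE/nandP; right; rewrite -ltNge (lt_le_trans TK)//.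
      exact: (step_le (tau_lt w)).
    rewrite ler_wpM2l//; case: eqP => //= _; case: ifP => // _; exact: expR_ge0.
  rewrite -(big_mkord (fun i => (i < K)%N) (fun i => (1 + bound) * e i)).
  rewrite -[leRHS](big_mkord xpredT (fun i => (1 + bound) * e i)) -big_filter.
  apply: sum_sub_le; rewrite ?filter_uniq ?iota_uniq//.
    by move=> i; rewrite mem_filter !mem_index_iota => /andP[].
  by move=> i; rewrite mulr_ge0.
apply: (le_trans H2); rewrite -mulrA ler_wpM2l//.
by rewrite ler_pdivlMl.
Qed.

(** Each counted adjustment lowers [f] by at least [kappa], whereas by Dynkin's formula the
    discounted drops have a mean of at most [2 + M / beta], since [f] and the running integrand are
    bounded. The estimate depends neither on [N] nor on [T]. *)
Lemma truncated_adjustments : intg Y /\ Ex Y <= (1 + bound) / kappa * (2 + M / beta).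
Proof.
have b0 : 0 <= 1 + bound by have := dD; have := Uu; have := normr_ge0 (band_initial d D U u x); rewrite /bound; lra.
have [iL EL _] := gain.
have iR : intg (fun w => (1 + bound) / kappa * - L w) by apply: intgZ; exact: intgN.
have iY : intg Y.
  apply: (intg_le _ _ iR).
    apply: measurable_sum => i; apply: measurable_funM; first exact: (measurable_discounted_part Ff adm).
    by apply: measurable_indic; exact: (adj_time_event Ff adm).
  move=> w; rewrite ger0_norm ?Y_le//; apply: sumr_ge0 => i _.
  by rewrite mulr_ge0 ?discounted_part_ge0.
split=> //; apply: (le_trans (Ex_le iY iR Y_le)).
rewrite ExZ ?ExN//; last exact: intgN.
rewrite ler_wpM2l//; first by rewrite divr_ge0// ltW.
by rewrite lerNl.
Qed.

End truncation.

Let bound : R := `|band_initial d D U u x| + (D - d) + (u - U).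

Lemma represented_feasible : feasible P F beta phi.
Proof.
split=> //; set B := (1 + bound) / kappa * (2 + M / beta).
have mp n := measurable_discounted_part Ff adm beta0 n.
have partE n w : (expeR (- (beta%:E * adj_time phi n w)) * (1 + `|adj_amount phi n w|)%:E)%E =
    (discounted_part phi beta n w)%:E.
  by rewrite (expeR_adj_time phi beta0 n w) -EFinM.
(* Fatou's lemma along horizons tending to infinity removes the truncation in time; the number [N]
   is released afterwards, in the series. *)
have tail N : intg (fun w => \sum_(i < N) discounted_part phi beta i.+1 w) /\
    Ex (fun w => \sum_(i < N) discounted_part phi beta i.+1 w) <= B.
  apply: (@Ex_fatou _ _ _ P (fun n w => \sum_(i < N) discounted_part phi beta i.+1 w *
      \1_[set w | (adj_time phi i.+1 w <= n.+1%:R%:E)%E] w)).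
  - by move=> n; have [] := truncated_adjustments N (ltr0Sn R n).
  - by move=> n w; apply: sumr_ge0 => i _; rewrite mulr_ge0 ?discounted_part_ge0.
  - move=> w; apply: cvg_near_cst.
    have H i : \forall n \near \oo, discounted_part phi beta i.+1 w *
        \1_[set w | (adj_time phi i.+1 w <= n.+1%:R%:E)%E] w = discounted_part phi beta i.+1 w.
      have [E|] := eqVneq (adj_time phi i.+1 w) +oo%E.
        by apply: nearW => n; rewrite /discounted_part E gt0_muley ?lte_fin//= !mul0r.
      rewrite -ltey => noo; have /fineK E : adj_time phi i.+1 w \is a fin_num by rewrite ge0_fin_numE ?adj_time_ge0.
      exists (Num.truncn (fine (adj_time phi i.+1 w))).+1 => // n nn.
      suff nT : (adj_time phi i.+1 w <= n.+1%:R%:E)%E by rewrite indicE mem_set ?mulr1.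
      rewrite -E lee_fin ltW// (lt_le_trans (truncnS_gt _))// ler_nat.
      exact: ltnW.
    elim: N => [|N IH]; first by apply: nearW => n; rewrite !big_ord0.
    near=> n; rewrite !big_ord_recr/=; congr (_ + _); last by near: n; exact: H.
    by near: n; exact: IH.
  - by move=> n; have [] := truncated_adjustments N (ltr0Sn R n).
have i0 : intg (discounted_part phi beta 0).
  rewrite (_ : discounted_part phi beta 0 = fun=> 1 + `|band_initial d D U u x|); first exact: intg_cst.
  by apply/funext => w; rewrite /discounted_part (adj_amount0 rep) [adj_time _ _ _]/= mule0 oppe0 expeR0 mul1r.
under eq_integral => w _ do under eq_eseriesr => n _ do rewrite partE.
rewrite integral_nneseries//; last 2 first.
- by move=> n; apply/measurable_EFinP; exact: mp.
- by move=> n w _; rewrite lee_fin discounted_part_ge0.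
apply: (@le_lt_trans _ _ (Ex (discounted_part phi beta 0) + B)%:E); last exact: ltry.
apply: lime_le; first by apply: is_cvg_nneseries => n _ _; apply: integral_ge0 => w _; rewrite lee_fin discounted_part_ge0.
apply: nearW => N; have [iN EN] := tail N.
apply: (@le_trans _ _ (\sum_(0 <= n < N.+1) \int[P]_w (discounted_part phi beta n w)%:E)%E).
  rewrite big_nat_recr//= leeDl// integral_ge0// => w _.
  by rewrite lee_fin discounted_part_ge0.
rewrite -ge0_integral_sum//; last 2 first.
- by move=> n; apply/measurable_EFinP; exact: mp.
- by move=> n w _; rewrite lee_fin discounted_part_ge0.
rewrite (_ : (fun w => _) = fun w => (discounted_part phi beta 0 w + \sum_(i < N) discounted_part phi beta i.+1 w)%:E); last first.
  by apply/funext => w; rewrite sumEFin big_mkord big_ord_recl.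
rewrite integral_Ex; last exact: intgD.
by rewrite lee_fin ExD// lerD2l.
Unshelve. all: by end_near. Qed.

End feasibility.

(** * Cost of the control band policy *)

Lemma der_agree {R : realType} (F G p q : R -> R) x y : x <= y ->
  (forall z : R, is_derive z 1 F (p z)) -> (forall z : R, is_derive z 1 G (q z)) ->
  (forall z, x < z -> z < y -> p z = q z) -> F y - G y = F x - G x.
Proof.
move=> xy dF dG E; apply/eqP; rewrite eq_le.
have dFG z : is_derive (z : R) 1 (fun z => F z - G z) (p z - q z) by exact: derB.
apply/andP; split.
  apply: (der_le0_ge xy (der_continuous dFG) (fun z _ _ => dFG z)) => z xz zy.
  by rewrite E// subrr.
apply: (der_ge0_le xy (der_continuous dFG) (fun z _ _ => dFG z)) => z xz zy.
by rewrite E// subrr.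
Qed.

Section bounded_extension.
Context {R : realType}.
Variables (v g g' : R -> R) (d u c : R).
Hypotheses (du : d <= u) (c0 : 0 <= c).
Hypotheses (dv : forall x : R, is_derive x 1 v (g x)) (dg : forall x : R, is_derive x 1 g (g' x)).
Hypothesis lg : forall x y, d <= x -> x <= u -> d <= y -> y <= u -> `|g' x - g' y| <= c * `|x - y|.

(* The cosine keeps the first derivative of the extension bounded. *)
Definition ext2 x : R := g' (clamp d u x) * cos (x - clamp d u x).
Definition ext1 x : R := g d + oriented_integral d x ext2.
Definition ext0 x : R := v d + oriented_integral d x ext1.

Let bound : exists M, 0 <= M /\ forall x, `|g' (clamp d u x)| <= M.
Proof.
exists (`|g' d| + c * (u - d)); split; first by rewrite addr_ge0// mulr_ge0// subr_ge0.
move=> x; have [dx xu] := clamp_in x du.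
rewrite -[g' (clamp d u x)](subrK (g' d)) addrC (le_trans (ler_normD _ _))// lerD2l.
rewrite (le_trans (lg dx xu (lexx d) du))// ler_wpM2l// ger0_norm ?subr_ge0//.
by rewrite lerD2r.
Qed.

Lemma ext2_lip : exists C, 0 <= C /\ lip C ext2 /\ forall x, `|ext2 x| <= C.
Proof.
have [M [M0 HM]] := bound.
have l1 : lip c (fun x => g' (clamp d u x)) := lip_comp_clamp du c0 lg.
have lcos : lip 1 (@cos R).
  by apply: (lip_der (fun x => is_derive_cos x)) => x; rewrite normrN; exact: sin_max.
have l2 : lip 2 (fun x => cos (x - clamp d u x)).
  move=> x y; apply: (le_trans (lcos _ _)); rewrite mul1r.
  rewrite (_ : x - clamp d u x - (y - clamp d u y) = (x - y) - (clamp d u x - clamp d u y)); last by ring.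
  rewrite (le_trans (ler_normB _ _))//; have := lip_clamp d u x y; rewrite mul1r.
  by move: (`|clamp _ _ _ - _|) (`|x - y|) => p q; lra.
pose M1 := M + 1.
have H1 x : `|g' (clamp d u x)| <= M1 by rewrite (le_trans (HM x))// /M1 lerDl.
have H2 x : `|cos (x - clamp d u x)| <= M1 by rewrite (le_trans (cos_max _))// /M1 lerDr.
have M10 : 0 <= M1 by rewrite /M1 addr_ge0.
have c2 : 0 <= c + 2 by rewrite addr_ge0.
exists (M1 * (c + 2) + M); split; first by rewrite addr_ge0// mulr_ge0.
split; first by apply: lip_le (lipM l1 l2 H1 H2); rewrite lerDl.
move=> x; rewrite /ext2 normrM (le_trans (ler_piMr _ (cos_max _)))//.
by rewrite (le_trans (HM x))// lerDr mulr_ge0.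
Qed.

Let cont2 : continuous ext2.
Proof. by have [C [_ [/lip_continuous]]] := ext2_lip. Qed.

Lemma der_ext1 (x : R) : is_derive x 1 ext1 (ext2 x).
Proof.
apply: (der_eq (derD (der_cst (g d) x) (der_oriented_integral d x cont2))).
by rewrite add0r.
Qed.

Lemma der_ext0 (x : R) : is_derive x 1 ext0 (ext1 x).
Proof.
apply: (der_eq (derD (der_cst (v d) x) (der_oriented_integral d x (der_continuous der_ext1)))).
by rewrite add0r.
Qed.

Lemma ext2_in x : d <= x -> x <= u -> ext2 x = g' x.
Proof. by move=> dx xu; rewrite /ext2 clamp_id// subrr cos0 mulr1. Qed.

Lemma ext1_in x : d <= x -> x <= u -> ext1 x = g x.
Proof.
move=> dx xu; have := der_agree dx der_ext1 dg.
rewrite {2}/ext1 oriented_integral_refl addr0 subrr => /(_ _)/eqP; rewrite subr_eq0 => H.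
by apply/eqP/H => z dz zx; apply: ext2_in; [exact: ltW|exact: le_trans (ltW zx) xu].
Qed.

Lemma ext0_in x : d <= x -> x <= u -> ext0 x = v x.
Proof.
move=> dx xu; have := der_agree dx der_ext0 dv.
rewrite {2}/ext0 oriented_integral_refl addr0 subrr => /(_ _)/eqP; rewrite subr_eq0 => H.
by apply/eqP/H => z dz zx; apply: ext1_in; [exact: ltW|exact: le_trans (ltW zx) xu].
Qed.

(** Outside the band the factor of the cosine in [ext2] is constant, so [ext1] is there the explicit
    function [S p], a constant plus a multiple of a sine. *)
Lemma ext1_bounded : exists C, 0 <= C /\ forall x, `|ext1 x| <= C.
Proof.
have [C1 [C10 H1]] := continuous_bounded du (der_continuous dg).
pose S p (y : R) : R := g p + g' p * sin (y - p).
have dS p (y : R) : is_derive y 1 (S p) (g' p * cos (y - p)).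
  have H := derB (der_id y) (der_cst p y).
  apply: (der_eq (derD (der_cst (g p) y) (derZ (g' p) (@der_comp _ (@sin R) (fun y => y - p) y _ _ (is_derive_sin _) H)))).
  by rewrite subr0 mulr1 add0r.
have Sb p y : `|S p y| <= `|g p| + `|g' p|.
  rewrite (le_trans (ler_normD _ _))// lerD2l normrM ler_piMr//; exact: sin_max.
exists (C1 + (`|g d| + `|g' d|) + (`|g u| + `|g' u|)); split; first by rewrite !addr_ge0.
move=> x.
have [dx|xd] := leP d x; last first.
  have E : ext1 x = S d x.
    have H := der_agree (ltW xd) (dS d) der_ext1.
    have : S d d - ext1 d = S d x - ext1 x.
      by apply: H => z _ zd; rewrite /ext2 (clamp_l du (ltW zd)).
    rewrite {1}/S subrr sin0 mulr0 addr0 (ext1_in (lexx d) du) subrr => /esym/eqP.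
    by rewrite subr_eq0 => /eqP.
  have := Sb d x; have := normr_ge0 (g u); have := normr_ge0 (g' u).
  by rewrite E; have := C10; lra.
have [xu|ux] := leP x u.
  have := H1 x dx xu; have := normr_ge0 (g u); have := normr_ge0 (g' u).
  by have := normr_ge0 (g d); have := normr_ge0 (g' d); rewrite (ext1_in dx xu); lra.
have E : ext1 x = S u x.
  have H := der_agree (ltW ux) der_ext1 (dS u).
  have : ext1 x - S u x = ext1 u - S u u.
    by apply: H => z uz _; rewrite /ext2 (clamp_r du (ltW uz)).
  rewrite {2}/S subrr sin0 mulr0 addr0 (ext1_in du (lexx u)) subrr => /eqP.
  by rewrite subr_eq0 => /eqP.
have := Sb u x; have := normr_ge0 (g d); have := normr_ge0 (g' d).
by rewrite E; have := C10; lra.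
Qed.

End bounded_extension.

(** * The cost of the band policy is at most the value function *)

Section upper_bound.
Context {R : realType} {dsp : measure_display} {Omega : measurableType dsp}.
Local Notation leb := (@lebesgue_measure R).
Variables (P : probability Omega R) (F : R -> set (set Omega)) (W : R -> Omega -> R).
Hypotheses (Ff : filtration F) (bm : standard_brownian P W) (mart : martingale P F W).
Local Notation intg := (intg P).
Local Notation Ex := (Ex P).
Variables (mu sigma beta K L k ell : R) (h : R -> R) (a : R).
Hypotheses (sigma0 : 0 < sigma) (beta0 : 0 < beta).
Hypotheses (K0 : 0 < K) (L0 : 0 < L) (k0 : 0 < k) (ell0 : 0 < ell).
Hypothesis hh : holding_cost mu sigma beta k ell h a.
Variables (A B d D U u : R).
Hypothesis fb : free_boundary mu sigma beta K L k ell h a A B d D U u.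
Local Notation V := (Vfun mu sigma beta h a A B d u).
Local Notation v := (vfun mu sigma beta h a A B).
Local Notation g := (gfun mu sigma beta h a A B).
Local Notation g' := (gder mu sigma beta h a A B).
Variable x : R.
Variables (phi : policy R Omega) (tau : Omega -> nat -> R) (word : Omega -> nat -> seq bool).
Hypothesis rep : represents W mu sigma d D U u x phi tau word.
Local Notation level := (word_level d D U u x).
Local Notation X := (free_path W mu sigma).
Local Notation Z := (inventory mu sigma W x phi).
Local Notation b0 := (band_initial d D U u x).
Implicit Types (n N i m : nat) (w : Omega) (s t T : R).

Let dD : d < D. Proof. by have [] := fb_order fb. Qed.
Let DU : D < U. Proof. by have [] := fb_order fb. Qed.
Let Uu : U < u. Proof. by have [] := fb_order fb. Qed.
Let du : d <= u. Proof. by rewrite ltW// (lt_trans dD)// (lt_trans DU). Qed.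
Let bp w : band_path d D U u x (X w) (tau w) (word w).
Proof. by have [] := rep w. Qed.
Let tau0 w := band_time0 (bp w).
Let tau_lt w := band_time_lt (bp w).
Let tau_unb w := band_time_unbounded (bp w).
Let adm : admissible F phi := represented_admissible Ff bm mart dD DU Uu rep.
Let feas : feasible P F beta phi := represented_feasible Ff bm mart beta0 dD DU Uu rep.
Let upE w t : 0 <= t -> upward phi t w = word_up d D U u x (word w (step_index (tau w) t)).
Proof. by have [_ + _] := rep w; exact. Qed.
Let downE w t : 0 <= t -> downward phi t w = word_down d D U u x (word w (step_index (tau w) t)).
Proof. by have [_ _ +] := rep w; exact. Qed.
Let pj1 w : pure_jump_path (upward phi ^~ w).
Proof. by have [] := admissible_paths adm w. Qed.
Let pj2 w : pure_jump_path (downward phi ^~ w).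
Proof. by have [] := admissible_paths adm w. Qed.

Let dv y : is_derive (y : R) 1 v (g y) .
Proof. exact: (der_vfun sigma0 beta0 hh). Qed.
Let dg y : is_derive (y : R) 1 g (g' y).
Proof. exact: (der_gfun hh). Qed.

(** In the band the equation expresses [g'] through [v], [g] and [h], all Lipschitz there;
    differentiating [g'] instead would meet the kink of [h]. *)
Let lg : exists c, 0 <= c /\ forall y z, d <= y -> y <= u -> d <= z -> z <= u -> `|g' y - g' z| <= c * `|y - z|.
Proof.
have [cv [cv0 lv]] := lip_der_on du dv (der_continuous dg).
have [cg [cg0 lg]] := lip_der_on du dg (@gder_continuous _ _ _ _ _ _ _ _ hh A B).
have [ch [ch0 lh]] := cost_lipschitz hh d u.
have s2 : 0 < sigma ^+ 2 / 2 by rewrite divr_gt0// exprn_gt0.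
exists ((beta * cv + `|mu| * cg + ch) / (sigma ^+ 2 / 2)); split.
  by rewrite divr_ge0 ?(ltW s2)// !addr_ge0 ?mulr_ge0 ?(ltW beta0).
move=> y z dy yu dz zu; rewrite mulrAC ler_pdivlMr// -[X in _ * X <= _](gtr0_norm s2) -normrM.
have Oy := vfun_ode mu h a sigma0 beta0 A B y; have Oz := vfun_ode mu h a sigma0 beta0 A B z.
rewrite (_ : (g' y - g' z) * _ = beta * (v y - v z) - mu * (g y - g z) - (h y - h z)); last by lra.
have Hv := lv y z; have Hg := lg y z; have Hh := lh y z dy yu dz zu.
rewrite !clamp_id// in Hv Hg.
rewrite (le_trans (ler_normB _ _))// !mulrDl; apply: lerD => //.
rewrite (le_trans (ler_normB _ _))//; apply: lerD; rewrite normrM -mulrA.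
  by rewrite (gtr0_norm beta0) ler_wpM2l// ltW.
by rewrite ler_wpM2l.
Qed.

Let f2 := ext2 g' d u.
Let f1 := ext1 g g' d u.
Let f := ext0 v g g' d u.

Let consts : exists C, [/\ 0 <= C, forall y, `|f1 y| <= C, forall y, `|f2 y| <= C & lip C f2].
Proof.
have [c [c0 lgc]] := lg; have [C1 [C10 H1]] := ext1_bounded du c0 dg lgc.
have [C2 [C20 [H2 H3]]] := ext2_lip du c0 lgc.
exists (C1 + C2); split.
- exact: addr_ge0.
- by move=> y; rewrite (le_trans (H1 y))// lerDl.
- by move=> y; rewrite (le_trans (H3 y))// lerDr.
- by apply: lip_le H2; rewrite lerDr.
Qed.

Let df (y : R) : is_derive y 1 f (f1 y).
Proof. by have [c [c0 lgc]] := lg; exact: (der_ext0 v g du c0 lgc). Qed.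
Let df1 (y : R) : is_derive y 1 f1 (f2 y).
Proof. by have [c [c0 lgc]] := lg; exact: (der_ext1 g du c0 lgc). Qed.
Let fE y : d <= y -> y <= u -> f y = v y.
Proof. by have [c [c0 lgc]] := lg; exact: (ext0_in du c0 dv dg lgc). Qed.
Let f1E y : d <= y -> y <= u -> f1 y = g y.
Proof. by have [c [c0 lgc]] := lg; exact: (ext1_in du c0 dg lgc). Qed.

Let GE y : d <= y -> y <= u -> generator mu sigma f1 f2 y - beta * f y = - h y.
Proof.
move=> dy yu; have := vfun_ode mu h a sigma0 beta0 A B y.
rewrite /generator fE// f1E// /f2 ext2_in//.
by move=> H; apply/eqP; rewrite -subr_eq0 opprK H.
Qed.

Let c t w : R := level (word w (step_index (tau w) t)).
Let lv w i : R := level (word w i).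
Let q w i : R := \sum_(j < i) `|lv w j.+1 - lv w j|.

Let vq w i : `|lv w i.+1 - lv w i| <= q w i.+1 - q w i.
Proof. by rewrite /q big_ord_recr/= [leRHS]addrAC subrr add0r. Qed.

Let Zc s w : 0 <= s -> Z s w = drift_path W mu sigma s w + c s w.
Proof. by move=> s0; rewrite (represents_inventory rep w s0) /free_path max_r. Qed.

Let Zin s w : 0 <= s -> d < Z s w < u.
Proof.
by move=> s0; exact: (band_inventory (bp w) (represents_inventory rep w) s0).
Qed.

Let mc s : 0 <= s -> measurable_wrt (F s) (c s).
Proof.
by move=> s0; apply: (word_function_adapted Ff bm mart dD DU Uu rep (f := level)).
Qed.

(** The inventory is confined to the band, so the level differs from the negative of the free path
    by a bounded amount. *)
Let ic s : 0 <= s -> intg (c s).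
Proof.
move=> s0; have iX := drift_intg mart mu sigma s0.
apply: (@intg_le _ _ _ _ (fun w => `|d| + `|u| + `|drift_path W mu sigma s w|)).
- exact: (wrt_mf Ff s0 (mc s0)).
- move=> w; have /andP[dZ Zu] := Zin w s0; rewrite (Zc w s0) in dZ Zu.
  rewrite -[c s w](addKr (drift_path W mu sigma s w)) (le_trans (ler_normD _ _))// normrN addrC lerD2r.
  have := ler_norm u; have := ler_norm (- d); rewrite normrN ler_norml => ? ?.
  have := normr_ge0 d; have := normr_ge0 u; lra.
- by apply: intgD; [exact: intg_cst|exact: intg_abs].
Qed.

Let q_variation w T : 0 < T -> q w (step_index (tau w) T) - q w 0 <= adj_variation phi w T.
Proof.
move=> T0; have [N HN] := adj_variationE (pj1 w) (pj2 w) T.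
set j := step_index (tau w) T; have /andP[jT _] := step_indexP (tau0 w) (tau_unb w) (ltW T0).
rewrite (HN T (maxn N j.+1))// ?leq_maxl// /q big_ord0 subr0.
apply: (@le_trans _ _ (\sum_(i < j.+1) adj_part phi w T i)).
  rewrite big_ord_recl/= -[leLHS]add0r lerD ?adj_part_ge0//; apply: ler_sum => i _.
  have iT : tau w i.+1 <= T by rewrite (le_trans _ jT)// (step_le (tau_lt w)).
  have tE := adj_timeE dD Uu rep w i.+1.
  have [[E _]|[E _]|[E _]] := band_next (bp w) i; last by rewrite /lv E subrr normr0 adj_part_ge0.
  - rewrite /adj_part /bump/= add1n; move: tE; rewrite E /= (word_size_next (bp w) E) eqxx => ->.
    rewrite lee_fin iT (adj_amount_up dD Uu rep E) /lv E word_level_up.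
    by rewrite addrAC subrr add0r.
  - rewrite /adj_part /bump/= add1n; move: tE; rewrite E /= (word_size_next (bp w) E) eqxx => ->.
    rewrite lee_fin iT (adj_amount_down dD Uu rep E) /lv E word_level_down.
    by rewrite addrAC subrr add0r opprB.
rewrite -(big_mkord xpredT (adj_part phi w T)) -(big_mkord xpredT (adj_part phi w T)).
rewrite (@big_cat_nat _ _ _ j.+1 0 (maxn N j.+1))//= ?leq_maxr// lerDl sumr_ge0// => i _.
exact: adj_part_ge0.
Qed.

Let cost s w : R := discounted_jump_cost phi w beta K L k ell s.

(** The integral conditions of the free boundary say exactly that an adjustment from [d] to [D], or
    from [u] to [U], costs what it saves in [v]. *)
Let cost_tau w i : cost (tau w i.+1) w = - step_term (lv w) f (X w) beta i (tau w i.+1).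
Proof.
have [E1 E2] := fb_integrals sigma0 beta0 hh fb.
have [dDl DUl Uul] : [/\ d <= D, D <= U & U <= u] by split; exact: ltW.
have dU := le_trans dDl DUl; have Du := le_trans DUl Uul.
rewrite /cost /discounted_jump_cost /jump_cost /step_term -mulrN opprB; congr (_ * _).
have [[E Ex]|[E Ex]|[E _]] := band_next (bp w) i.
- have [-> ->] := adjusts_up rep E; rewrite [X in f X - _]Ex.
  rewrite (_ : X w _ + lv w i.+1 = D); last by rewrite /lv E word_level_up addrA Ex; ring.
  by rewrite subr_gt0 dD ltxx addr0 !fE.
- have [-> ->] := adjusts_down rep E; rewrite [X in f X - _]Ex.
  rewrite (_ : X w _ + lv w i.+1 = U); last by rewrite /lv E word_level_down addrA Ex; ring.
  by rewrite subr_gt0 Uu ltxx add0r !fE// (le_trans dU).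
- have [J1 J2] := band_jump_stay (bp w) (upE w) (downE w) E.
  by rewrite /dY1 /dY2 J1 J2 ltxx /lv E subrr addr0.
Qed.

Let cost0 w : cost 0 w + v (x + b0) = V x.
Proof.
have [E1 E2] := fb_integrals sigma0 beta0 hh fb.
rewrite /cost /discounted_jump_cost /jump_cost mulr0 expR0 mul1r /dY1 /dY2.
have [-> ->] := band_jump0 (bp w) (upE w) (downE w).
have := dD; have := DU; have := Uu => u1 u2 u3.
have [dx|xd] := ltP d x; last first.
  rewrite /band_initial xd (Vfun_left sigma0 beta0 hh fb xd).
  have xD : 0 < D - x by lra.
  by rewrite max_l ?(ltW xD)// max_r ?oppr_le0 ?(ltW xD)// xD ltxx (_ : x + (D - x) = D); [lra|ring].
have nd : (x <= d) = false by rewrite leNgt dx.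
have [xu|ux] := ltP x u.
  rewrite /band_initial nd leNgt xu /= oppr0 maxxx ltxx !add0r addr0.
  by rewrite (Vfun_in sigma0 beta0 hh fb (ltW dx) (ltW xu)).
rewrite /band_initial nd ux (Vfun_right sigma0 beta0 hh fb ux).
have xU : U - x < 0 by lra.
rewrite max_r ?(ltW xU)// max_l ?oppr_ge0 ?(ltW xU)// ltxx oppr_gt0 xU (_ : x + (U - x) = U); [lra|ring].
Qed.

Let run T w : R := \int[leb]_(s in `[0, T]) (expR (- beta * s) * h (Z s w)).
Let lump T w : R := \sum_(i < (step_index (tau w) T).+1) cost (tau w i) w.

Let lumpE T w : lump T w = cost 0 w - step_gain W mu sigma beta f tau lv T w.
Proof.
rewrite /lump big_ord_recl/= tau0; congr (_ + _); rewrite -sumrN; apply: eq_bigr => i _.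
by rewrite /bump/= add1n cost_tau.
Qed.

Let irun T : 0 < T -> forall w, leb.-integrable `[0, T] (EFin \o (fun s => expR (- beta * s) * h (Z s w))).
Proof.
move=> T0 w; have [C [C0 f1C f2C lf2]] := consts.
have := integrableN (step_running_integrable bm mu sigma beta0 df df1 C0 f1C f2C lf2 tau0 tau_lt tau_unb vq T0 w).
apply: eq_integrable => // s; rewrite inE/= in_itv/= => /andP[s0 _].
have /andP[dZ Zu] := Zin w s0; rewrite (Zc w s0) in dZ Zu *.
by congr EFin; rewrite (GE (ltW dZ) (ltW Zu)) mulrN opprK.
Qed.

Let runE T w : 0 < T -> discounted_running W mu sigma beta f f1 f2 c T w = - run T w.
Proof.
move=> T0; rewrite /run -mulN1r -RintegralZl//; last exact: irun.
apply: eq_Rintegral => s; rewrite inE/= in_itv/= => /andP[s0 _].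
have /andP[dZ Zu] := Zin w s0; rewrite (Zc w s0) in dZ Zu *.
by rewrite (GE (ltW dZ) (ltW Zu)) mulrN mulN1r.
Qed.

(** Equality holds throughout: in the band the running integrand is [- h], later adjustments cost
    the drop of [f], and the initial one costs [V x - v (x + b0)]. *)
Let horizon T : 0 < T -> [/\ intg (run T), intg (lump T) &
  Ex (fun w => run T w + lump T w) = V x - expR (- beta * T) * Ex (fun w => f (Z T w))].
Proof.
move=> T0; have [C [C0 f1C f2C lf2]] := consts.
have [iL iQ EL] := step_dynkin Ff bm mart mu sigma beta0 df df1 C0 f1C f2C lf2
  tau0 tau_lt tau_unb vq mc ic T0 (fun w => q_variation w T0) (intg_adj_variation Ff adm beta0 feas T).
have cE w : cost 0 w = V x - v (x + b0) by rewrite -(cost0 w) addrK.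
have rE : run T = fun w => - discounted_running W mu sigma beta f f1 f2 c T w.
  by apply/funext => w; rewrite runE// opprK.
have lE : lump T = fun w => V x - v (x + b0) - step_gain W mu sigma beta f tau lv T w.
  by apply/funext => w; rewrite lumpE cE.
have iR : intg (run T) by rewrite rE; exact: intgN.
have iS : intg (lump T) by rewrite lE; apply: intgB => //; exact: intg_cst.
split=> //; rewrite ExD// rE lE (ExB (intg_cst P _) iL) Ex_cst ExN// EL.
have -> : Ex (fun w => f (drift_path W mu sigma 0 w + lv w (step_index (tau w) 0))) = v (x + b0).
  rewrite -[RHS](Ex_cst P); apply: eq_Ex => w.
  have /andP[i1 i2] := initial_inside x dD DU Uu.
  rewrite (step_index0 (tau0 w) (tau_lt w) (tau_unb w)) /lv (band_word0 (bp w)) word_level_nil.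
  rewrite (_ : drift_path W mu sigma 0 w = 0) ?add0r ?fE ?ltW//.
  by have := free_path0 bm mu sigma w; rewrite /free_path maxxx.
have -> : Ex (fun w => f (Z T w)) = Ex (fun w => f (drift_path W mu sigma T w + lv w (step_index (tau w) T))).
  by apply: eq_Ex => w; rewrite (Zc w (ltW T0)).
by move: (Ex _) (Ex _) => p1 p2; ring.
Qed.

Let cost_ge0 s w : 0 <= cost s w.
Proof. by apply: discounted_jump_cost_ge0; exact: ltW. Qed.

Let cost_between s w : 0 <= s -> ~ range (tau w) s -> cost s w = 0.
Proof.
move=> s0 ns; have /andP[it ti] := step_indexP (tau0 w) (tau_unb w) s0.
have nt : tau w (step_index (tau w) s) < s.
  by rewrite lt_neqAle it andbT; apply/eqP => E; apply: ns; exists (step_index (tau w) s).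
have [J1 J2] := band_jump_between (bp w) (upE w) (downE w) nt ti.
by rewrite /cost /discounted_jump_cost /jump_cost /dY1 /dY2 J1 J2 ltxx addr0 mulr0.
Qed.

Let tau_inj w : injective (tau w).
Proof.
move=> i j E; have := step_index_tau (tau0 w) (tau_lt w) (tau_unb w) i.
by rewrite E (step_index_tau (tau0 w) (tau_lt w) (tau_unb w)).
Qed.

Let esum_cost w : (\esum_(s in `[0%R, +oo[) (cost s w)%:E = \sum_(0 <= n <oo) (cost (tau w n) w)%:E)%E.
Proof.
rewrite (esumID (range (tau w))); last by move=> s _; rewrite lee_fin cost_ge0.
rewrite [X in (_ + X)%E]esum1 ?adde0; last first.
  by move=> s [/=]; rewrite in_itv/= andbT => s0 ns; rewrite cost_between.
rewrite (_ : _ `&` _ = range (tau w)); last first.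
  apply/seteqP; split=> s; first by case.
  by move=> [n _ <-]; split; [rewrite /= in_itv/= andbT (step_ge0 (tau0 w) (tau_lt w))|exists n].
rewrite (@reindex_esum _ _ _ setT (range (tau w)) (tau w)); last first.
  split; first by move=> n _; exists n.
    by move=> i j _ _; exact: tau_inj.
  by move=> s [n _ <-]; exists n.
by rewrite nneseries_esumT// => n; rewrite lee_fin cost_ge0.
Qed.

Let stage m w : R := run m.+1%:R w + lump m.+1%:R w.

Let run_ereal m w : (run m.+1%:R w)%:E =
  (\int[leb]_(s in `[0%R, m.+1%:R]) (expR (- beta * s) * h (Z s w))%:E)%E.
Proof.
by rewrite /run /Rintegral fineK//; apply: integrable_fin_num => //; apply: irun; rewrite ltr0n.
Qed.

Let term_ge0 s w : 0 <= expR (- beta * s) * h (Z s w).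
Proof. by rewrite mulr_ge0 ?expR_ge0// (holding_ge0 hh). Qed.

Let run_le w m n : (m <= n)%N -> ((run m.+1%:R w)%:E <= (run n.+1%:R w)%:E)%E.
Proof.
move=> mn; rewrite !run_ereal; apply: integral_monotone_set.
  move=> s /=; rewrite !in_itv/= => /andP[-> sm]/=; rewrite (le_trans sm)//.
  by rewrite ler_nat ltnS.
by move=> s _; rewrite lee_fin term_ge0.
Qed.

Let lump_le w (s t : R) : 0 <= s -> s <= t -> lump s w <= lump t w.
Proof.
move=> s0 st; have ij := step_index_le (tau0 w) (tau_lt w) (tau_unb w) s0 st.
rewrite /lump -(big_mkord xpredT (fun i => cost (tau w i) w)) -(big_mkord xpredT (fun i => cost (tau w i) w)).
have ij' : ((step_index (tau w) s).+1 <= (step_index (tau w) t).+1)%N by [].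
rewrite (big_cat_nat (leq0n _) ij')/= lerDl sumr_ge0// => i _; exact: cost_ge0.
Qed.

Let stage_ge0 m w : 0 <= stage m w.
Proof.
by apply: addr_ge0; [apply: Rintegral_ge0 => s _; exact: term_ge0|apply: sumr_ge0 => i _; exact: cost_ge0].
Qed.

Let stage_le w m n : (m <= n)%N -> ((stage m w)%:E <= (stage n w)%:E)%E.
Proof.
move=> mn; rewrite /stage !EFinD leeD ?run_le// lee_fin lump_le//.
by rewrite ler_nat ltnS.
Qed.

Let cost_limit w : (policy_cost W mu sigma beta K L k ell h x phi w <= limn (fun m => (stage m w)%:E))%E.
Proof.
pose b m := (lump m.+1%:R w)%:E.
have bmono : {homo b : m n / (m <= n)%N >-> (m <= n)%E}.
  by move=> m n mn; rewrite lee_fin lump_le// ler_nat ltnS.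
have cb := ereal_nondecreasing_cvgn bmono.
have ca := @ge0_nondecreasing_set_cvg_integral _ (measurableTypeR R) R (fun m => `[0, m.+1%:R]%classic)
  (fun s => (expR (- beta * s) * h (Z s w))%:E) leb.
have {}ca : (run m.+1%:R w)%:E @[m --> \oo] --> (\int[leb]_(s in `[0%R, +oo[) (expR (- beta * s) * h (Z s w))%:E)%E.
  rewrite (_ : (fun m => _) = fun m => (\int[leb]_(s in `[0%R, m.+1%:R]) (expR (- beta * s) * h (Z s w))%:E)%E); last first.
    by apply/funext => m; exact: run_ereal.
  rewrite (_ : `[0%R, +oo[%classic = \bigcup_m `[0, m.+1%:R]%classic).
    apply: ca.
    - move=> m n mn; apply/subsetPset => s /=; rewrite !in_itv/= => /andP[-> sm]/=.
      by rewrite (le_trans sm)// ler_nat ltnS.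
    - by move=> m; exact: measurable_itv.
    - by move=> m; apply: (measurable_int leb); apply: irun; rewrite ltr0n.
    - by move=> m s _; rewrite lee_fin term_ge0.
  apply/seteqP; split=> s /=; rewrite in_itv/= ?andbT.
    by move=> s0; exists (Num.truncn s) => //=; rewrite in_itv/= s0 ltW// truncnS_gt.
  by move=> [m _ /=]; rewrite in_itv/= => /andP[].
have sb : (\esum_(s in `[0%R, +oo[) (cost s w)%:E <= ereal_sup (range b))%E.
  rewrite esum_cost; apply: lime_le.
    by apply: is_cvg_nneseries => n _ _; rewrite lee_fin cost_ge0.
  apply: nearW => N; apply: (@le_trans _ _ (b (Num.truncn (tau w N)))); last first.
    by apply: ereal_sup_ubound; exists (Num.truncn (tau w N)).
  rewrite sumEFin lee_fin /lump -(big_mkord xpredT (fun i => cost (tau w i) w)).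
  have NT : (N <= (step_index (tau w) (Num.truncn (tau w N)).+1%:R).+1)%N.
    rewrite (leq_trans _ (leqnSn _))// -{1}(step_index_tau (tau0 w) (tau_lt w) (tau_unb w) N).
    apply: (step_index_le (tau0 w) (tau_lt w) (tau_unb w)); first exact: (step_ge0 (tau0 w) (tau_lt w)).
    by rewrite ltW// truncnS_gt.
  by rewrite (big_cat_nat (leq0n N) NT)/= lerDl sumr_ge0// => i _; exact: cost_ge0.
apply: (@le_trans _ _ (\int[leb]_(s in `[0%R, +oo[) (expR (- beta * s) * h (Z s w))%:E + ereal_sup (range b))%E).
  by rewrite /policy_cost leeD2l.
have sup0 : (0 <= ereal_sup (range b))%E.
  apply: (@le_trans _ _ (b 0%N)); last by apply: ereal_sup_ubound; exists 0%N.
  by rewrite lee_fin sumr_ge0// => i _; exact: cost_ge0.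
have int0 : (0 <= \int[leb]_(s in `[0%R, +oo[) (expR (- beta * s) * h (Z s w))%:E)%E.
  by apply: integral_ge0 => s _; rewrite lee_fin term_ge0.
rewrite (_ : (fun m => (stage m w)%:E) = fun m => ((run m.+1%:R w)%:E + b m)%E); last by apply/funext.
rewrite (cvg_lim _ (cvgeD (ge0_adde_def _ _) ca cb))//; by rewrite inE.
Qed.

Lemma band_cost_le : (discounted_cost P W mu sigma beta K L k ell h x phi <= (V x)%:E)%E.
Proof.
rewrite discounted_costE.
apply: (@le_trans _ _ (\int[P]_w limn (fun m => (stage m w)%:E))%E).
  apply: integral_monotone => w _; last exact: cost_limit.
  by apply: policy_cost_ge0 => //; try exact: ltW; exact: (holding_ge0 hh).
have T0 m : (0 : R) < m.+1%:R by rewrite ltr0n.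
have istage m : intg (stage m) by have [i1 i2 _] := horizon (T0 m); exact: intgD.
rewrite monotone_convergence//; last 3 first.
- by move=> m; apply/measurable_EFinP; exact: intg_mf (istage m).
- by move=> m w _; rewrite lee_fin stage_ge0.
- by move=> w _ m n; exact: stage_le.
(* In the band [v] is bounded by [M], so the terminal term is at most [M] times the discount factor,
   which is below the reciprocal of [beta] times the horizon. *)
have [M [M0 HM]] := continuous_bounded du (der_continuous dv).
have EM m : (\int[P]_w (stage m w)%:E <= (V x + M / (beta * m.+1%:R))%:E)%E.
  have [i1 i2 E] := horizon (T0 m); rewrite (integral_Ex (istage m)) lee_fin [Ex _]E lerD2l -mulrN.
  have iZ : intg (fun w => f (Z m.+1%:R w)).
    have [C [_ f1C _ _]] := consts; apply: (intg_lip (lip_der df f1C)).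
    rewrite (_ : Z m.+1%:R = fun w => drift_path W mu sigma m.+1%:R w + c m.+1%:R w).
      by apply: intgD; [apply: (drift_intg mart)|apply: ic].
    by apply/funext => w; rewrite Zc.
  have := Ex_norm_le iZ (intg_cst P M) => /(_ _)/wrap[w|].
    by have /andP[dZ Zu] := Zin w (ltW (T0 m)); rewrite (fE (ltW dZ) (ltW Zu)) HM// ltW.
  rewrite Ex_cst ler_norml => /andP[H _].
  have e0 := expR_ge0 (- beta * m.+1%:R).
  have bT : 0 < beta * m.+1%:R by rewrite mulr_gt0.
  have e1 : expR (- beta * m.+1%:R) <= (beta * m.+1%:R)^-1.
    rewrite mulNr expRN lef_pV2 ?posrE ?expR_gt0//.
    by have := expR_ge1Dx (beta * m.+1%:R); lra.
  apply: (@le_trans _ _ (expR (- beta * m.+1%:R) * M)); first by rewrite ler_wpM2l// lerNl.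
  by rewrite mulrC ler_wpM2l.
have mono : {homo (fun m => \int[P]_w (stage m w)%:E)%E : m n / (m <= n)%N >-> (m <= n)%E}.
  move=> m n mn; apply: integral_monotone => w _; first by rewrite lee_fin stage_ge0.
  exact: stage_le.
apply/lee_addgt0Pr => r r0; apply: lime_le; first exact: ereal_nondecreasing_is_cvgn.
exists (Num.truncn (M / (beta * r))).+1 => // m /= mm.
apply: (le_trans (EM m)); rewrite -EFinD lee_fin lerD2l ler_pdivrMr ?mulr_gt0//.
have : M / (beta * r) <= m.+1%:R.
  by rewrite ltW// (lt_le_trans (truncnS_gt _))// ler_nat ltnW// ltnW.
by rewrite ler_pdivrMr ?mulr_gt0//; lra.
Qed.

End upper_bound.

(** * Optimality and uniqueness *)

Section optimality.
Context {R : realType} {dsp : measure_display} {Omega : measurableType dsp}.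
Variables (P : probability Omega R) (F : R -> set (set Omega)) (W : R -> Omega -> R).
Hypotheses (Ff : filtration F) (bm : standard_brownian P W) (mart : martingale P F W).
Variables (mu sigma beta K L k ell : R) (h : R -> R) (a : R).
Hypotheses (sigma0 : 0 < sigma) (beta0 : 0 < beta).
Hypotheses (K0 : 0 < K) (L0 : 0 < L) (k0 : 0 < k) (ell0 : 0 < ell).
Hypothesis hh : holding_cost mu sigma beta k ell h a.
Local Notation is_fb := (free_boundary mu sigma beta K L k ell h a).
Local Notation V A B d u := (Vfun mu sigma beta h a A B d u).
Local Notation g := (gfun mu sigma beta h a).
Local Notation v := (vfun mu sigma beta h a).
Local Notation DC := (discounted_cost P W mu sigma beta K L k ell h).

Lemma policy_cost_lower A B d D U u x psi : is_fb A B d D U u -> feasible P F beta psi ->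
  ((V A B d u x)%:E <= DC x psi)%E.
Proof.
move=> fb feas; apply/lee_addgt0Pr => r r0; have adm : admissible F psi by case: feas.
have b1 : 0 < 1 + beta^-1 by rewrite addr_gt0// invr_gt0.
have r2 : 0 < r / 2 by rewrite divr_gt0.
(* Smoothing costs [e] at [x] and [e / beta] along the path, together [r / 2]; the other half of [r]
   pays for the terminal term. *)
pose e := r / 2 / (1 + beta^-1); have e0 : 0 < e by rewrite divr_gt0.
have [f [f1 [f2 [C [[C0 df df1 f1C f2C] [lf2 up down sub close]]]]]] :=
  smooth_subsolution sigma0 beta0 K0 L0 k0 ell0 hh fb e0.
have [T T0 HT] := terminal_vanishes Ff bm mart mu sigma beta0 x adm feas df C0 f1C r2.
have := verification_lower_horizon Ff bm mart beta0 (ltW K0) (ltW L0) (ltW k0) (ltW ell0)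
  (holding_ge0 hh) x adm feas df df1 C0 f1C f2C lf2 up down e0 sub T0.
move=> H; rewrite -leeBlDr//; apply: le_trans H; rewrite -EFinB lee_fin.
have := close x; rewrite ler_norml => /andP[H1 _].
have E : e + e / beta = r / 2 by rewrite /e; field; rewrite !lt0r_neq0// addr_gt0.
by move: HT H1 E; move: (expR _ * _) (e / beta) => p q; lra.
Qed.

Lemma control_band_optimal A B d D U u x phi : is_fb A B d D U u ->
  control_band mu sigma W x d D U u phi ->
  optimal P F W mu sigma beta K L k ell h x phi /\ (DC x phi <= (V A B d u x)%:E)%E.
Proof.
move=> fb cb; have [dD DU Uu] := fb_order fb.
have [tau [word rep]] := control_band_represented bm dD DU Uu cb.
have le := band_cost_le Ff bm mart sigma0 beta0 K0 L0 k0 ell0 hh fb rep.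
split; last exact: le.
split; first exact: (represented_feasible Ff bm mart beta0 dD DU Uu rep).
by move=> psi fpsi; exact: le_trans le (policy_cost_lower x fb fpsi).
Qed.

(** The first function is a lower bound for every feasible cost; the band policy of the second free
    boundary is feasible and costs at most the second function. *)
Lemma value_le A B d D U u A' B' d' D' U' u' : is_fb A B d D U u -> is_fb A' B' d' D' U' u' ->
  forall x, V A B d u x <= V A' B' d' u' x.
Proof.
move=> fb fb' x; have [dD DU Uu] := fb_order fb'.
have [phi [_ [_ [cb _]]]] := control_band_exists bm mu sigma x dD DU Uu.
have [[feas _] le] := control_band_optimal fb' cb.
by rewrite -lee_fin; exact: le_trans (policy_cost_lower x fb feas) le.
Qed.

Section two_solutions.
Variables (A B d D U u A' B' d' D' U' u' : R).
Hypotheses (fb : is_fb A B d D U u) (fb' : is_fb A' B' d' D' U' u').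

Lemma value_unique x : V A B d u x = V A' B' d' u' x.
Proof. by apply/eqP; rewrite eq_le !(value_le fb fb', value_le fb' fb). Qed.

Lemma value_slope_unique x : Vder mu sigma beta h a A B d u x = Vder mu sigma beta h a A' B' d' u' x.
Proof.
have H1 := der_Vfun hh fb x; have H2 := der_Vfun hh fb' x.
have E : V A B d u = V A' B' d' u' by apply/funext; exact: value_unique.
by rewrite E in H1; rewrite -(@derive_val _ _ _ _ _ _ _ H1) -(@derive_val _ _ _ _ _ _ _ H2).
Qed.

(** Otherwise the common slope of the value functions would be [- k] between [d] and [d'], and [g]
    would be constant on an interval to the right of [d]. *)
Lemma left_barrier_le : d' <= d.
Proof.
rewrite leNgt; apply/negP => dd'; have [dD DU Uu] := fb_order fb.
have du : d < u by exact: lt_trans (lt_trans dD DU) Uu.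
have [gd _ _ _] := fb_values sigma0 beta0 hh fb.
have m0 : d < Num.min d' u by rewrite lt_min dd'.
apply: (fb_nonconstant sigma0 beta0 k0 ell0 hh fb m0) => z dz; rewrite le_min => /andP[zd' zu].
rewrite gd -(Vder_in _ _ _ _ _ _ _ dz zu) value_slope_unique.
exact: (Vder_left sigma0 beta0 hh fb').
Qed.

Lemma right_barrier_le : u <= u'.
Proof.
rewrite leNgt; apply/negP => uu'; have [dD DU Uu] := fb_order fb.
have du : d < u by exact: lt_trans (lt_trans dD DU) Uu.
have [_ _ _ gu] := fb_values sigma0 beta0 hh fb.
have m0 : Num.max u' d < u by rewrite gt_max uu'.
have E z : Num.max u' d <= z -> z <= u -> g A B z = ell.
  rewrite ge_max => /andP[uz dz] zu; rewrite -(Vder_in _ _ _ _ _ _ _ dz zu) value_slope_unique.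
  exact: (Vder_right sigma0 beta0 hh fb').
by apply: (fb_nonconstant sigma0 beta0 k0 ell0 hh fb m0) => z mz zu; rewrite !E// ltW.
Qed.

End two_solutions.

(** The outer barriers are read off the slope of the common value function. Value and slope at [d]
    are then two linear equations for [A] and [B], and [D] and [U] are determined because [g] has no
    flat piece. *)
Lemma free_boundary_unique A B d D U u A' B' d' D' U' u' :
  is_fb A B d D U u -> is_fb A' B' d' D' U' u' ->
  [/\ A' = A, B' = B & [/\ d' = d, D' = D, U' = U & u' = u]].
Proof.
move=> fb fb'; have [dD DU Uu] := fb_order fb; have [dD' DU' Uu'] := fb_order fb'.
have Ed : d' = d by apply/eqP; rewrite eq_le (left_barrier_le fb fb') (left_barrier_le fb' fb).
have Eu : u' = u by apply/eqP; rewrite eq_le (right_barrier_le fb fb') (right_barrier_le fb' fb).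
subst d' u'.
have du : d <= u by rewrite ltW// (lt_trans dD)// (lt_trans DU).
have Eg : g A' B' d = g A B d.
  have := value_slope_unique fb fb' d; rewrite !(Vder_in _ _ _ _ _ _ _ (lexx d) du).
  by [].
have Ev : v A' B' d = v A B d.
  have := value_unique fb fb' d.
  by rewrite (Vfun_in sigma0 beta0 hh fb (lexx d) du) (Vfun_in sigma0 beta0 hh fb' (lexx d) du).
have l10 := lambda1_gt0 mu sigma0 beta0; have l20 := lambda2_gt0 mu sigma0 beta0.
have c0 := cc_gt0 mu sigma0 beta0.
have e1 := E1_gt0 mu sigma beta a d; have e2 := E2_gt0 mu sigma beta a d.
have [EA EB] : A' = A /\ B' = B.
  move: Eg Ev; rewrite /gfun /vfun /K1 /K2.
  move: (E1 mu sigma beta a d) (E2 mu sigma beta a d) e1 e2 => p q p0 q0.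
  move: (cc mu sigma beta) c0 => c c0 /(mulfI (lt0r_neq0 c0)) Eg /(mulfI (lt0r_neq0 c0)) Ev.
  set l1 := lambda1 mu sigma beta in l10 Eg Ev; set l2 := lambda2 mu sigma beta in l20 Eg Ev.
  move: (N1 mu sigma beta h a d) (N2 mu sigma beta h a d) Eg Ev => m1 m2 Eg Ev.
  (* A linear system for the contributions [s] and [t] of the two differences; its determinant is
     [l1^-1 + l2^-1] up to sign. *)
  have E1 : (A' - A) / l1 * p + (B' - B) / l2 * q = 0.
    rewrite (_ : _ + _ = (A' / l1 - l1 * m1) * p + (B' / l2 - l2 * m2) * q -
      ((A / l1 - l1 * m1) * p + (B / l2 - l2 * m2) * q)); last by ring.
    by rewrite Eg subrr.
  have E2 : (A' - A) / l1 * p / l1 - (B' - B) / l2 * q / l2 = 0.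
    rewrite (_ : _ - _ = (A' / l1 - l1 * m1) * p / l1 - (B' / l2 - l2 * m2) * q / l2 -
      ((A / l1 - l1 * m1) * p / l1 - (B / l2 - l2 * m2) * q / l2)); last by ring.
    by rewrite Ev subrr.
  move: E1 E2; set s := (A' - A) / l1 * p; set t := (B' - B) / l2 * q => E1 E2.
  clear Eg Ev.
  have i1 : 0 < l1^-1 by rewrite invr_gt0.
  have i2 : 0 < l2^-1 by rewrite invr_gt0.
  have t0 : t = 0.
    have st : s = - t by move/eqP: E1; rewrite addr_eq0 => /eqP.
    have : t * (l1^-1 + l2^-1) = 0.
      rewrite st in E2; rewrite (_ : t * _ = - (- t / l1 - t / l2)); last by ring.
      by rewrite E2 oppr0.
    by move/eqP; rewrite mulf_eq0 (gt_eqF (addr_gt0 i1 i2)) orbF => /eqP.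
  have s0 : s = 0 by rewrite -E1 t0 addr0.
  move: s0 t0; rewrite /s /t => /eqP + /eqP.
  rewrite !mulf_eq0 !invr_eq0 !(gt_eqF p0) !(gt_eqF q0) !(gt_eqF l10) !(gt_eqF l20) !orbF !subr_eq0.
  by move=> /eqP -> /eqP ->.
subst A' B'.
have [q1 q2 q3 q4] := fb_bands sigma0 beta0 k0 ell0 hh fb.
have [q1' q2' q3' q4'] := fb_bands sigma0 beta0 k0 ell0 hh fb'.
have Du := lt_trans DU Uu; have Du' := lt_trans DU' Uu'.
have dU := lt_trans dD DU; have dU' := lt_trans dD' DU'.
(* Between two different values of [D], or of [U], the bounds of [fb_bands] for the two solutions
   would force [g] to be constant. *)
have flat x y c : x < y -> (forall z, x <= z -> z <= y -> g A B z = c) -> False.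
  move=> xy E; apply: (fb_nonconstant sigma0 beta0 k0 ell0 hh fb xy) => z xz zy.
  by rewrite !E// ltW.
split=> //; split=> //.
- have [lt|lt|//] := ltgtP D' D.
  + exfalso; apply: (flat D' D (- k) lt) => z z1 z2; apply/eqP; rewrite eq_le.
    by rewrite q1 ?q2'// ?(le_trans (ltW dD') z1)// (le_trans z2 (ltW Du)).
  + exfalso; apply: (flat D D' (- k) lt) => z z1 z2; apply/eqP; rewrite eq_le.
    by rewrite q1' ?q2// ?(le_trans (ltW dD) z1)// (le_trans z2 (ltW Du')).
- have [lt|lt|//] := ltgtP U' U.
  + exfalso; apply: (flat U' U ell lt) => z z1 z2; apply/eqP; rewrite eq_le.
    by rewrite q3 ?q4'// ?(le_trans (ltW dU') z1)// (le_trans z2 (ltW Uu)).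
  + exfalso; apply: (flat U U' ell lt) => z z1 z2; apply/eqP; rewrite eq_le.
    by rewrite q3' ?q4// ?(le_trans (ltW dU) z1)// (le_trans z2 (ltW Uu')).
Qed.

End optimality.

Theorem theorem6p2 (R : realType) (mu sigma beta K L k ell : R)
    (sigma_gt0 : 0 < sigma) (beta_gt0 : 0 < beta) (K_gt0 : 0 < K) (L_gt0 : 0 < L)
    (k_gt0 : 0 < k) (ell_gt0 : 0 < ell)
    (h : R -> R) (a : R) (h_cost : holding_cost mu sigma beta k ell h a)
    (dsp : measure_display) (Omega : measurableType dsp)
    (P : probability Omega R) (F : R -> set (set Omega)) (W : R -> Omega -> R)
    (F_filtration : filtration F) (W_brownian : standard_brownian P W)
    (W_martingale : martingale P F W) :
  exists A B d D U u : R,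
    [/\ free_boundary mu sigma beta K L k ell h a A B d D U u,
        forall A' B' d' D' U' u' : R,
          free_boundary mu sigma beta K L k ell h a A' B' d' D' U' u' ->
          [/\ A' = A, B' = B & [/\ d' = d, D' = D, U' = U & u' = u]] &
        forall x : R,
          (exists phi : policy R Omega,
             control_band mu sigma W x d D U u phi) /\
          (forall phi : policy R Omega,
             control_band mu sigma W x d D U u phi ->
             optimal P F W mu sigma beta K L k ell h x phi)].
Proof.
have [A [B [d [D [U [u fb]]]]]] := free_boundary_exists sigma_gt0 beta_gt0 K_gt0 L_gt0 k_gt0 ell_gt0 h_cost.
exists A, B, d, D, U, u; split; first exact: fb.
  move=> A' B' d' D' U' u' fb'.
  exact: (free_boundary_unique F_filtration W_brownian W_martingale sigma_gt0 beta_gt0 K_gt0 L_gt0 k_gt0 ell_gt0 h_cost fb fb').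
move=> x; have [dD DU Uu] := fb_order fb; split.
  have [phi [_ [_ [cb _]]]] := control_band_exists W_brownian mu sigma x dD DU Uu.
  by exists phi.
move=> phi cb.
by have [] := control_band_optimal F_filtration W_brownian W_martingale sigma_gt0 beta_gt0 K_gt0 L_gt0 k_gt0 ell_gt0 h_cost fb cb.
Qed.
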